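(* Let $A$ be a $C^*$-algebra. Then the following conditions are equivalent: (1) $A$ is scattered. (2) Every $C^*$-subalgebra of $A$ is AF. (3) Every separable abelian $C^*$-subalgebra of $A$ is AF. (4) Every $C^*$-subalgebra of $A$ has real rank zero. (5) Every separable abelian $C^*$-subalgebra of $A$ has real rank zero.
   Context: $C^*$-algebras are not assumed to be separable or unital. A $C^*$-algebra $A$ is scattered if every positive linear functional on $A$ is a countable sum of pure positive linear functionals on $A$. Equivalently, $A$ is of type I and its spectrum $\widehat A$ (the set of equivalence classes of nonzero irreducible representations of $A$, with the Jacobson topology) is a scattered topological space, where a topological space is called scattered if every non-empty subset contains a point that is isolated in that subset. A $C^*$-algebra $A$ is AF (approximately finite-dimensional) if for any elements $x_1,\dots,x_n\in A$ and any $\varepsilon>0$ there exist a finite-dimensional $C^*$-subalgebra $B$ of $A$ and elements $y_1,\dots,y_n\in B$ such that $\Vert x_k-y_k\Vert<\varepsilon$ for all $k=1,\dots,n$. (No separability and no identity are assumed.) For a $C^*$-algebra $A$, $A_1$ denotes the $C^*$-algebra obtained from $A$ by adjunction of an identity. $A$ has real rank zero if every self-adjoint element of $A_1$ can be approximated in norm by invertible self-adjoint elements of $A_1$; equivalently, the set of self-adjoint elements of $A$ with finite spectrum is dense in the set of all self-adjoint elements of $A$. *)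

(* Defs.v *)
From HB Require Import structures.
From mathcomp Require Import all_boot all_order all_algebra.
From mathcomp Require Import complex.
From mathcomp Require Import all_classical all_reals all_analysis.
Import Order.TTheory GRing.Theory Num.Theory.
Import numFieldNormedType.Exports.

Set Implicit Arguments.
Unset Strict Implicit.
Unset Printing Implicit Defensive.

Local Open Scope classical_set_scope.
Local Open Scope ring_scope.
Local Open Scope complex_scope.

(* C*-algebras have complex scalars [R[i]], with [R] the real numbers.  The
   norm of the library takes its values in the scalar field, so [`|x|] is an
   element of [R[i]]; in [R[i]] the relation [0 <= z] means that [z] is real
   and nonnegative.  The product is a separate operation because the ring
   structures of the library are unital. *)
HB.mixin Record isCStarAlgebra (R : realType) A
    of CompleteNormedModule R[i] A := {
  cmul : A -> A -> A ;
  star : A -> A ;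
  cmulA : associative cmul ;
  cmulDl : left_distributive cmul +%R ;
  cmulDr : right_distributive cmul +%R ;
  cmulZl : forall (a : R[i]) (x y : A), cmul (a *: x) y = a *: cmul x y ;
  cmulZr : forall (a : R[i]) (x y : A), cmul x (a *: y) = a *: cmul x y ;
  starD : {morph star : x y / x + y} ;
  starZ : forall (a : R[i]) (x : A), star (a *: x) = a^* *: star x ;
  starM : forall x y : A, star (cmul x y) = cmul (star y) (star x) ;
  starK : involutive star ;
  norm_cmul : forall x y : A, `|cmul x y| <= `|x| * `|y| ;
  norm_cstar : forall x : A, `|cmul (star x) x| = `|x| ^+ 2
}.

#[short(type="cstarAlgType")]
HB.structure Definition CStarAlgebra (R : realType) :=
  {A of isCStarAlgebra R A & CompleteNormedModule R[i] A}.

Section Scattered.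
Context (R : realType) (A : cstarAlgType R).
Implicit Types f g : {scalar A}.

Definition positive_functional f : Prop :=
  forall x : A, 0 <= f (cmul (star x) x).

Definition functional_le g f : Prop :=
  forall x : A, g (cmul (star x) x) <= f (cmul (star x) x).

Definition pure_functional f : Prop :=
  [/\ positive_functional f,
      exists x : A, f x != 0 &
      forall g, positive_functional g -> functional_le g f ->
        exists t : R, 0 <= t <= 1 /\ forall x : A, g x = t%:C * f x].

(* The set [D] of indices makes finite (possibly empty) sums available. *)
Definition countable_sum_of_pure f : Prop :=
  exists (D : set nat) (g : nat -> {scalar A}),
    (forall n, D n -> pure_functional (g n)) /\
    (forall x : A,
      (fun N : nat => \sum_(0 <= n < N | n \in D) g n x : R[i]^o) @ \oo
        --> (f x : R[i]^o)).

Definition scattered : Prop :=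
  forall f, positive_functional f -> countable_sum_of_pure f.

End Scattered.

(* A C*-subalgebra [B] of [A] is given by its carrier, and the properties of
   the C*-algebra [B] are relativized to that carrier. *)
Section Subalgebras.
Context (R : realType) (A : cstarAlgType R).
Implicit Types B D : set A.

Definition cstar_subalgebra B : Prop :=
  [/\ closed B, B 0,
      forall (a : R[i]) (x y : A), B x -> B y -> B (a *: x + y),
      forall x y : A, B x -> B y -> B (cmul x y) &
      forall x : A, B x -> B (star x)].

Definition abelian_subalgebra B : Prop :=
  forall x y : A, B x -> B y -> cmul x y = cmul y x.

Definition separable_subalgebra B : Prop :=
  exists S : set A, [/\ countable S, S `<=` B & B `<=` closure S].

Definition finite_dimensional D : Prop :=
  exists (m : nat) (v : 'I_m -> A), (forall i, D (v i)) /\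
    forall x, D x -> exists c : 'I_m -> R[i], x = \sum_(i < m) c i *: v i.

Definition approximately_finite B : Prop :=
  forall (n : nat) (x : 'I_n -> A) (e : R), (forall k, B (x k)) -> 0 < e ->
    exists D : set A,
      [/\ cstar_subalgebra D, D `<=` B, finite_dimensional D &
          exists y : 'I_n -> A, forall k, D (y k) /\ `|x k - y k| < e%:C].

(* The algebra obtained from [B] by adjunction of an identity consists of the
   pairs [(b, a)] with [b] in [B], where [(b, a)] stands for [b + a 1]. *)
Definition unitization : Type := (A * R[i])%type.
Implicit Types u v w : unitization.

Definition in_unitization B u : Prop := B u.1.

Definition unitization_one : unitization := (0, 1).

Definition unitization_sub u v : unitization := (u.1 - v.1, u.2 - v.2).

Definition unitization_mul u v : unitization :=
  (cmul u.1 v.1 + u.2 *: v.1 + v.2 *: u.1, u.2 * v.2).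

Definition unitization_star u : unitization := (star u.1, u.2^*).

(* The C*-norm: if [B] has no identity, this is the norm of left multiplication
   on [B], which dominates [`|u.2|]; if [B] has an identity [p], the adjoined
   algebra is the direct sum of [B] and the scalars by [u |-> (u.1 + u.2 p, u.2)],
   which is normed by the maximum. *)
Definition unitization_norm B u : R :=
  Num.max (complex.Re `|u.2|)
    (sup [set complex.Re `|cmul u.1 x + u.2 *: x| | x in
            [set x | B x /\ `|x| <= 1]]).

Definition unitization_selfadjoint u : Prop := unitization_star u = u.

Definition unitization_invertible B u : Prop :=
  exists w, [/\ in_unitization B w, unitization_mul u w = unitization_one &
                unitization_mul w u = unitization_one].

Definition real_rank_zero B : Prop :=
  forall u (e : R),
    in_unitization B u -> unitization_selfadjoint u -> 0 < e ->
    exists v, [/\ in_unitization B v, unitization_selfadjoint v,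
                  unitization_invertible B v &
                  unitization_norm B (unitization_sub u v) < e].

End Subalgebras.

(* Main.v *)
(* All five conditions are equivalent to a sixth one, [scat]: no self-adjoint
   element h of the unitization of A has an interval in its spectrum.

   If the spectrum of h contains [al, be], let c run through bumps along the
   n-th dyadic subdivision of [al, be].  The averages of |c(h) x c(h)| over the
   subdivision decrease with n, and by Hahn-Banach their limit dominates a
   state F, with F (u(h) x) = F (x u(h)), which is diffuse along [al, be].  Let
   G <= F be pure.  Riesz representation gives a_n with F (a_n^* x) -> G x, and
   x |-> lim F (a_n^* x a_n e) is dominated by G, hence a multiple s_e G, for
   every e = u(h) with 0 <= u <= 1; here the s_e add up over a partition of
   unity, while F is small on each cell.  This forces G = 0, so F is no sum of
   pure functionals.

   Conversely assume [scat].  Gaps in spectra yield spectral projections.  For a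
   proper closed ideal J of a C*-subalgebra B, the quotient B/J has a minimal
   projection p: otherwise halving projections again and again produces an
   element whose spectrum is an interval.  Then p x p is a scalar modulo J.
   Matrix units over p lift to B, so a maximal ideal with locally approximately
   finite corners is all of B, and B is AF.  If J is maximal among the closed
   ideals on which a positive functional F <> 0 vanishes, then x |-> p x p
   modulo J is pure, and Riesz representation moves it to a pure functional
   below F; removing from F pure minorants that are maximal up to a factor 2
   exhausts F.  For real rank zero, shift b + l by a small scalar into a gap of
   the spectrum of b.

   Finally let [al, be] be in the spectrum of h, and let b be self-adjoint in
   C*(h), close to h.  Polynomials in h approximate b, and the intermediate
   value theorem for them shows that the spectrum of b contains every t0 well
   inside [al, be].  So b is in no finite-dimensional subalgebra and h - t0 is
   not a limit of invertible elements: (3) and (5) both imply [scat]. *)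

From HB Require Import structures.
Require Import Defs.
From mathcomp Require Import all_boot all_order all_algebra.
From mathcomp Require Import ssrAC complex zify ring lra.
From mathcomp Require Import all_classical all_reals all_analysis.
Import Order.TTheory GRing.Theory Num.Theory.
Import numFieldNormedType.Exports.
Import Normc.

Set Implicit Arguments.
Unset Strict Implicit.
Unset Printing Implicit Defensive.

Local Open Scope classical_set_scope.
Local Open Scope ring_scope.
Local Open Scope complex_scope.

(** * Unital C*-algebras *)

(** No representation, quotient algebra or Hilbert space is built. B/J is replaced by congruences
    modulo J inside the unitization, and GNS vectors by sequences that are Cauchy for the seminorm
    given by F (st x * x). All spectra are computed in the unitization. A continuous function of h
    that vanishes at 0 lies in every closed subalgebra containing h, so one spectral gap serves all
    subalgebras. The same condition at 0 explains why intervals are taken on one side of 0: there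
    some element of A is equal to 1 along the interval, acts as a unit for F, and F does not vanish
    on A. The bumps have a wide plateau, so that a bump is absorbed by the one above it in the
    previous subdivision; this is what makes the averages decrease. Averaging spreads the mass over
    the interval, whereas a state concentrated at one spectral point could be pure. A projection at
    distance less than 1 from an ideal belongs to it. Properties formulated through projections
    therefore pass from an ideal to its closure, and maximal ideals come out closed. *)

(* Unlike the norm of the library, [nm] is real valued. *)
HB.mixin Record isUnitalCStar (R : realType) U of GRing.Algebra R[i] U := {
  nm : U -> R ;
  st : U -> U ;
  nm_eq0 : forall x, nm x = 0 -> x = 0 ;
  nmD : forall x y, nm (x + y) <= nm x + nm y ;
  nmZ : forall (a : R[i]) x, nm (a *: x) = normc a * nm x ;
  nmM : forall x y, nm (x * y) <= nm x * nm y ;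
  nm_cstar : forall x, nm (st x * x) = nm x ^+ 2 ;
  stD : {morph st : x y / x + y} ;
  stZ : forall (a : R[i]) x, st (a *: x) = a^* *: st x ;
  stM : forall x y, st (x * y) = st y * st x ;
  stK : involutive st ;
  nm_complete : forall u : nat -> U,
    (forall e : R, 0 < e -> exists N : nat, forall m n : nat,
      (N <= m)%N -> (N <= n)%N -> nm (u m - u n) < e) ->
    exists l : U, forall e : R, 0 < e -> exists N : nat, forall n : nat,
      (N <= n)%N -> nm (u n - l) < e
}.

#[short(type="ucstarType")]
HB.structure Definition UnitalCStar (R : realType) :=
  {U of isUnitalCStar R U & GRing.Algebra R[i] U}.

(** * Noncommutative ring identities by reflection *)

Section NoncommutativeRing.
Context (T : pzRingType).

(* [nring] proves identities of noncommutative rings by normalization in the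
   free ring. *)
Inductive nexp : Type :=
  | NVar of nat | NZero | NOne | NAdd of nexp & nexp | NOpp of nexp
  | NMul of nexp & nexp.

Fixpoint neval (env : seq T) (e : nexp) : T :=
  match e with
  | NVar i => nth 0 env i
  | NZero => 0
  | NOne => 1
  | NAdd a b => neval env a + neval env b
  | NOpp a => - neval env a
  | NMul a b => neval env a * neval env b
  end.

Fixpoint nins (m : seq nat) (c : int) (p : seq (seq nat * int)) :=
  if p is (m', c') :: p' then
    if m == m' then (m', c + c') :: p' else (m', c') :: nins m c p'
  else [:: (m, c)].

Fixpoint nnorm (e : nexp) : seq (seq nat * int) :=
  match e with
  | NVar i => [:: ([:: i], 1)]
  | NZero => [::]
  | NOne => [:: ([::], 1)]
  | NAdd a b => foldr (fun t p => nins t.1 t.2 p) (nnorm b) (nnorm a)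
  | NOpp a => [seq (t.1, - t.2) | t <- nnorm a]
  | NMul a b => foldr (fun t p =>
      foldr (fun u q => nins (t.1 ++ u.1) (t.2 * u.2) q) p (nnorm b))
      [::] (nnorm a)
  end.

Definition nterm (env : seq T) (t : seq nat * int) : T :=
  (\prod_(i <- t.1) nth 0 env i) *~ t.2.
Definition nsum env (p : seq (seq nat * int)) : T := \sum_(t <- p) nterm env t.

Lemma nsum_ins env m c p : nsum env (nins m c p) = nterm env (m, c) + nsum env p.
Proof.
elim: p => [|[m' c'] p IHp] /=; first by rewrite /nsum big_seq1 big_nil addr0.
case: eqP => [->|_]; rewrite /nsum !big_cons; first by rewrite /nterm /= mulrzDr addrA.
by rewrite -!/(nsum _ _) IHp addrCA.
Qed.

Lemma nnormP env e : nsum env (nnorm e) = neval env e.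
Proof.
elim: e => [i|||a IHa b IHb|a IHa|a IHa b IHb] /=.
- by rewrite /nsum big_seq1 /nterm big_seq1.
- by rewrite /nsum big_nil.
- by rewrite /nsum big_seq1 /nterm big_nil.
- rewrite -IHa -IHb; elim: (nnorm a) => [|t p IHp] /=.
    by rewrite {2}/nsum big_nil add0r.
  by rewrite nsum_ins IHp addrA {3}/nsum big_cons; case: t.
- rewrite -IHa /nsum big_map -sumrN; apply: eq_bigr => t _.
  by rewrite /nterm mulrNz.
- rewrite -IHa; elim: (nnorm a) => [|t p IHp] /=.
    by rewrite /nsum !big_nil mul0r.
  rewrite {2}/nsum big_cons mulrDl -/(nsum _ _) -IHp -IHb.
  set q0 := foldr _ _ p; elim: (nnorm b) => [|u q IHq] /=.
    by rewrite {2}/nsum big_nil mulr0 add0r.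
  rewrite nsum_ins IHq {3}/nsum big_cons mulrDr addrA; congr (_ + _ + _).
  by rewrite /nterm /= big_cat /= mulrzAl mulrzAr -mulrzA mulrC.
Qed.

Lemma nring_correct env a b :
  all (fun t => t.2 == 0) (nnorm (NAdd a (NOpp b))) -> neval env a = neval env b.
Proof.
move=> /allP h; apply/eqP; rewrite -subr_eq0 -[_ - _]/(neval env (NAdd a (NOpp b))).
rewrite -nnormP /nsum big_seq big1 // => t /h /eqP t0.
by rewrite /nterm t0.
Qed.

End NoncommutativeRing.

Ltac nr_in x env :=
  lazymatch env with
  | nil => constr:(false)
  | cons x _ => constr:(true)
  | cons _ ?t => nr_in x t
  end.

Ltac nr_env e env :=
  lazymatch e with
  | GRing.add ?a ?b => let env := nr_env a env in nr_env b env
  | GRing.opp ?a => nr_env a env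
  | GRing.mul ?a ?b => let env := nr_env a env in nr_env b env
  | @GRing.zero _ => env
  | @GRing.one _ => env
  | _ => let r := nr_in e env in
         lazymatch r with
         | true => env
         | false => constr:(cons e env)
         end
  end.

Ltac nr_idx x env :=
  lazymatch env with
  | cons x _ => constr:(0%N)
  | cons _ ?t => let n := nr_idx x t in constr:(S n)
  end.

Ltac nr_reify e env :=
  lazymatch e with
  | GRing.add ?a ?b =>
      let a := nr_reify a env in let b := nr_reify b env in constr:(NAdd a b)
  | GRing.opp ?a => let a := nr_reify a env in constr:(NOpp a)
  | GRing.mul ?a ?b =>
      let a := nr_reify a env in let b := nr_reify b env in constr:(NMul a b)
  | @GRing.zero _ => constr:(NZero)
  | @GRing.one _ => constr:(NOne)
  | _ => let n := nr_idx e env in constr:(NVar n)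
  end.

Ltac nring :=
  try rewrite !expr2;
  lazymatch goal with
  | |- @eq ?T ?a ?b =>
      let env := nr_env a (@nil T) in let env := nr_env b env in
      let ea := nr_reify a env in let eb := nr_reify b env in
      apply: (@nring_correct _ env ea eb); vm_compute; reflexivity
  end.

(** * Norms, square roots and real spectra *)

Section Basics.
Context (R : realType) (U : ucstarType R).
Implicit Types (x y z h : U) (K : set U).

Lemma normc_real (a : R) : normc a%:C = `|a|.
Proof. by rewrite /= expr0n /= addr0 sqrtr_sqr. Qed.

Lemma conjc_realE (t : R) : (t%:C)^* = t%:C.
Proof. by rewrite /= oppr0. Qed.

Lemma nm0 : nm (0 : U) = 0.
Proof. by rewrite -(scale0r (0 : U)) nmZ normc0 mul0r. Qed.

Lemma nmN x : nm (- x) = nm x.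
Proof. by rewrite -scaleN1r nmZ -(rmorphN1 (real_complex R)) normc_real normrN1 mul1r. Qed.

Lemma nm_ge0 x : 0 <= nm x.
Proof. by have := nmD x (- x); rewrite subrr nm0 nmN; lra. Qed.

Lemma nmB x y : nm (x - y) <= nm x + nm y.
Proof. by rewrite -(nmN y) nmD. Qed.

Lemma nmBC x y : nm (x - y) = nm (y - x).
Proof. by rewrite -nmN opprB. Qed.

Lemma nm_tri z x y : nm (x - y) <= nm (x - z) + nm (z - y).
Proof. by have := nmD (x - z) (z - y); rewrite addrA subrK. Qed.

Lemma st0 : st (0 : U) = 0.
Proof. by apply: (addrI (st 0)); rewrite -stD !addr0. Qed.

Lemma st1 : st (1 : U) = 1.
Proof. by rewrite -[RHS]stK -{2}(mulr1 (st 1)) stM stK mulr1. Qed.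

Lemma stN x : st (- x) = - st x.
Proof. by apply: (addrI (st x)); rewrite -stD !subrr st0. Qed.

Lemma stB x y : st (x - y) = st x - st y.
Proof. by rewrite stD stN. Qed.

Lemma st_sum I (r : seq I) (P : pred I) (F : I -> U) :
  st (\sum_(i <- r | P i) F i) = \sum_(i <- r | P i) st (F i).
Proof. exact: (big_morph _ stD st0). Qed.

(** Cancel [nm y] in [nm y ^+ 2 = nm (st y * y) <= nm (st y) * nm y]. *)
Lemma nm_st x : nm (st x) = nm x.
Proof.
suff le_st y : nm y <= nm (st y).
  by apply/eqP; rewrite eq_le le_st andbT -{2}(stK x) le_st.
have [->|y0] := eqVneq (nm y) 0; first exact: nm_ge0.
have {}y0 : 0 < nm y by rewrite lt_def y0 nm_ge0.
by rewrite -(ler_pM2r y0) -expr2 -nm_cstar nmM.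
Qed.

Lemma nm1 : nm (1 : U) = 1.
Proof.
have /eqP := nm_cstar (1 : U); rewrite st1 mulr1 expr2 -{1}(mulr1 (nm 1)).
have n0 : nm (1 : U) != 0.
  by apply/eqP => /nm_eq0/eqP; rewrite oner_eq0.
by rewrite (inj_eq (mulfI n0)) => /eqP.
Qed.

Definition sc (t : R) : U := t%:C%:A.

Lemma sc0 : sc 0 = 0. Proof. by rewrite /sc rmorph0 scale0r. Qed.
Lemma sc1 : sc 1 = 1. Proof. by rewrite /sc rmorph1 scale1r. Qed.
Lemma scD s t : sc (s + t) = sc s + sc t.
Proof. by rewrite /sc rmorphD scalerDl. Qed.
Lemma scN t : sc (- t) = - sc t.
Proof. by rewrite /sc rmorphN scaleNr. Qed.
Lemma scB s t : sc (s - t) = sc s - sc t.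
Proof. by rewrite scD scN. Qed.
Lemma scE t x : sc t * x = t%:C *: x.
Proof. by rewrite /sc -scalerAl mul1r. Qed.
Lemma scEr t x : x * sc t = t%:C *: x.
Proof. by rewrite /sc -scalerAr mulr1. Qed.
Lemma scC t x : x * sc t = sc t * x.
Proof. by rewrite scE scEr. Qed.
Lemma scM s t : sc (s * t) = sc s * sc t.
Proof. by rewrite scE /sc rmorphM scalerA. Qed.
Lemma stZr (t : R) x : st (t%:C *: x) = t%:C *: st x.
Proof. by rewrite stZ; congr (_ *: _); exact: conjc_realE. Qed.
Lemma st_sc t : st (sc t) = sc t.
Proof. by rewrite /sc stZr st1. Qed.
Lemma nm_sc t : nm (sc t) = `|t|.
Proof. by rewrite /sc nmZ nm1 mulr1 normc_real. Qed.
Lemma nmZr (t : R) x : nm (t%:C *: x) = `|t| * nm x.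
Proof. by rewrite nmZ normc_real. Qed.

Definition sa x := st x = x.

Lemma sa0 : sa 0. Proof. exact: st0. Qed.
Lemma sa1 : sa 1. Proof. exact: st1. Qed.
Lemma sa_sc t : sa (sc t). Proof. exact: st_sc. Qed.
Lemma saD x y : sa x -> sa y -> sa (x + y).
Proof. by rewrite /sa stD => -> ->. Qed.
Lemma saN x : sa x -> sa (- x).
Proof. by rewrite /sa stN => ->. Qed.
Lemma saB x y : sa x -> sa y -> sa (x - y).
Proof. by rewrite /sa stB => -> ->. Qed.
Lemma saM x y : x * y = y * x -> sa x -> sa y -> sa (x * y).
Proof. by rewrite /sa stM => xy -> ->. Qed.
Lemma saZ (t : R) x : sa x -> sa (t%:C *: x).
Proof. by rewrite /sa stZr => ->. Qed.
Lemma saX x n : sa x -> sa (x ^+ n).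
Proof.
move=> sx; elim: n => [|n IHn]; first by rewrite expr0; exact: sa1.
by rewrite exprS; apply: saM => //; rewrite -exprS exprSr.
Qed.
Lemma sa_cstar x : sa (st x * x).
Proof. by rewrite /sa stM stK. Qed.

Lemma nm_sqr x : sa x -> nm (x ^+ 2) = nm x ^+ 2.
Proof. by move=> sx; rewrite -nm_cstar sx. Qed.

Definition clo K := forall x,
  (forall e : R, 0 < e -> exists2 y, K y & nm (x - y) < e) -> K x.

(** Neither a unit nor stability under [st] is asked for, so that commutants and the sets of
    elements fixed or killed by multiplication with a given element qualify. Functional calculus
    without constant term stays in each of them. *)
Definition csub K := [/\ clo K, K 0,
  forall (a : R[i]) x y, K x -> K y -> K (a *: x + y) &
  forall x y, K x -> K y -> K (x * y)].

Section Csub.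
Variables (K : set U) (cK : csub K).
Lemma csub_clo : clo K. Proof. by case: cK. Qed.
Lemma csub0 : K 0. Proof. by case: cK. Qed.
Lemma csubZ (a : R[i]) x : K x -> K (a *: x).
Proof. by case: cK => _ k0 kl _ kx; rewrite -(addr0 (_ *: _)); apply: kl. Qed.
Lemma csubD x y : K x -> K y -> K (x + y).
Proof. by case: cK => _ k0 kl _ kx ky; rewrite -(scale1r x); apply: kl. Qed.
Lemma csubN x : K x -> K (- x).
Proof. by move=> kx; rewrite -scaleN1r; apply: csubZ. Qed.
Lemma csubB x y : K x -> K y -> K (x - y).
Proof. by move=> kx ky; apply/csubD/csubN. Qed.
Lemma csubM x y : K x -> K y -> K (x * y).
Proof. by case: cK => _ _ _; apply. Qed.
Lemma csub_sum I (r : seq I) (P : pred I) (F : I -> U) :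
  (forall i, P i -> K (F i)) -> K (\sum_(i <- r | P i) F i).
Proof. by move=> KF; apply: big_ind; [exact: csub0|exact: csubD|]. Qed.
End Csub.

Lemma csubT : csub setT. Proof. by []. Qed.

Lemma nm_eps x : (forall e : R, 0 < e -> nm x <= e) -> x = 0.
Proof.
move=> xe; apply/nm_eq0/eqP; rewrite eq_le nm_ge0 andbT.
by apply/ler_addgt0Pr => e e0; rewrite add0r xe.
Qed.

Lemma clo_cst (f : U -> U) (c : U) (M : R) :
  (forall x y, f (x - y) = f x - f y) -> (forall x, nm (f x) <= M * nm x) ->
  clo [set x | f x = c].
Proof.
move=> fB fM x xK; apply/eqP; rewrite -subr_eq0; apply/eqP/nm_eps => e e0.
have M0 : 0 < `|M| + 1 by rewrite ltr_pwDr.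
have [y /= <- yx] := xK (e / (`|M| + 1)) (divr_gt0 e0 M0).
rewrite -fB; apply: le_trans (fM _) _.
apply: (@le_trans _ _ ((`|M| + 1) * nm (x - y))).
  by rewrite ler_wpM2r ?nm_ge0//; have := ler_norm M; lra.
by rewrite mulrC -ler_pdivlMr // ltW.
Qed.

Lemma csub_comm z : csub [set x | x * z = z * x].
Proof.
split=> [||a x y /= xz yz|x y /= xz yz].
- have -> : [set x | x * z = z * x] = [set x | x * z - z * x = 0].
    by apply/seteqP; split=> x /= xz; [rewrite xz subrr|apply/eqP; rewrite -subr_eq0 xz].
  apply: (@clo_cst _ _ (2 * nm z)) => [x y|x].
    by nring.
  have := nmB (x * z) (z * x); have := nmM x z; have := nmM z x; lra.
- by rewrite /= mul0r mulr0.
- by rewrite mulrDl mulrDr -scalerAl -scalerAr xz yz.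
- by rewrite -mulrA yz mulrA xz mulrA.
Qed.

(** The form in which completeness of the algebra is used; the explicit rate replaces later epsilon
    arguments about the limit. *)
Lemma geom_limit (u : nat -> U) (C r : R) : 0 <= C -> 0 <= r < 1 ->
  (forall n, nm (u n.+1 - u n) <= C * r ^+ n) ->
  exists l, forall n, nm (u n - l) <= C / (1 - r) * r ^+ n.
Proof.
move=> C0 /andP[r0 r1] ur.
have r1' : 0 < 1 - r by lra.
have step n k : nm (u (n + k)%N - u n) <= C / (1 - r) * r ^+ n.
  suff : nm (u (n + k)%N - u n) <= C / (1 - r) * (r ^+ n - r ^+ (n + k)).
    move=> /le_trans; apply; rewrite ler_wpM2l ?divr_ge0 ?(ltW r1')//.
    by rewrite gerBl exprn_ge0.
  elim: k => [|k IHk]; first by rewrite addn0 !subrr nm0 mulr0.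
  have := nm_tri (u (n + k)%N) (u (n + k.+1)%N) (u n).
  have := ur (n + k)%N; rewrite addnS => h1 h2.
  apply: le_trans h2 _; apply: le_trans (lerD h1 IHk) _.
  rewrite le_eqVlt; apply/orP; left; apply/eqP; rewrite exprS; field.
  by rewrite gt_eqF.
have D0 : 0 <= C / (1 - r) by rewrite divr_ge0 // ltW.
have small e : 0 < e -> exists N, forall n, (N <= n)%N -> C / (1 - r) * r ^+ n < e.
  move=> e0.
  have /cvgrPdist_lt/(_ e e0)[N _ Nn] : (fun n => C / (1 - r) * r ^+ n : R) @ \oo --> (0 : R).
    rewrite -[X in _ --> X](mulr0 (C / (1 - r))).
    by apply: cvgM; [exact: cvg_cst|apply: cvg_expr; rewrite ger0_norm].
  exists N => n /Nn; rewrite /= sub0r normrN ger0_norm // mulr_ge0 ?exprn_ge0 //.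
have [|l ul] := @nm_complete _ _ u.
  move=> e e0; have [N Ne] := small (e / 2) ltac:(lra); exists N => m n Nm Nn.
  have := nm_tri (u N) (u m) (u n); rewrite (nmBC (u N)) => h.
  have := step N (m - N)%N; have := step N (n - N)%N; rewrite !subnKC //.
  have := Ne N (leqnn N); lra.
exists l => n; apply/ler_addgt0Pr => e e0.
have [N Ne] := ul e e0.
have := nm_tri (u (n + N)%N) (u n) l; rewrite (nmBC (u n) (u _)).
have := step n N; have := Ne (n + N)%N (leq_addl _ _); lra.
Qed.

Definition invt x := exists y, x * y = 1 /\ y * x = 1.

Lemma invt_mul x y : invt x -> invt y -> invt (x * y).
Proof.
move=> [x' [xx' x'x]] [y' [yy' y'y]]; exists (y' * x'); split.
  by rewrite mulrA -(mulrA x) yy' mulr1.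
by rewrite mulrA -(mulrA y') x'x mulr1.
Qed.

(** If z inverts x y, then y z is a right and z y a left inverse of x, so they agree. *)
Lemma invt_mulC x y : x * y = y * x -> invt (x * y) -> invt x.
Proof.
move=> xy [z [xyz zxy]].
have xyz' : x * (y * z) = 1 by rewrite mulrA.
have zyx' : (z * y) * x = 1 by rewrite -mulrA -xy.
exists (y * z); split => //.
suff -> : y * z = z * y by [].
by rewrite -[LHS]mul1r -{1}zyx' -mulrA xyz' mulr1.
Qed.

Lemma invt_scale (a : R[i]) x : a != 0 -> invt x -> invt (a *: x).
Proof.
move=> a0 [y [xy yx]]; exists (a^-1 *: y).
by rewrite -!scalerAl -!scalerAr !scalerA xy yx mulfV// mulVf// scale1r.
Qed.

Lemma neumann x : nm x < 1 -> invt (1 - x).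
Proof.
move=> x1; have x0 := nm_ge0 x.
pose u n := \sum_(i < n) x ^+ i.
have xn n : nm (x ^+ n) <= nm x ^+ n.
  elim: n => [|n IHn]; first by rewrite !expr0 nm1.
  by rewrite !exprS; apply: le_trans (nmM _ _) _; rewrite ler_wpM2l.
have [|n|l ul] := @geom_limit u 1 (nm x) ler01; first by rewrite x0.
  by rewrite /u big_ord_recr /= addrAC subrr add0r mul1r.
have u1 n : (1 - x) * u n = 1 - x ^+ n.
  rewrite /u; elim: n => [|n IHn]; first by rewrite big_ord0 mulr0 expr0 subrr.
  by rewrite big_ord_recr /= mulrDr IHn mulrBl mul1r -exprS addrA subrK.
have u2 n : u n * (1 - x) = 1 - x ^+ n.
  rewrite /u; elim: n => [|n IHn]; first by rewrite big_ord0 mul0r expr0 subrr.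
  by rewrite big_ord_recr /= mulrDl IHn mulrBr mulr1 -exprSr addrA subrK.
(* The fraction accounts for the tail of the geometric series, the summand 1 for the remainder
   [x ^+ n]. *)
pose C := nm (1 - x) / (1 - nm x) + 1.
have C0 : 0 < C by rewrite ltr_wpDl // divr_ge0 ?nm_ge0// subr_ge0 ltW.
have small e : 0 < e -> exists n, C * nm x ^+ n <= e.
  move=> e0.
  have /cvgrPdist_lt/(_ e e0)[N _ Nn] : (fun n => C * nm x ^+ n : R) @ \oo --> (0 : R).
    rewrite -[X in _ --> X](mulr0 C).
    by apply: cvgM; [exact: cvg_cst|apply: cvg_expr; rewrite ger0_norm].
  exists N; have := Nn N (leqnn N).
  by rewrite /= sub0r normrN ger0_norm ?mulr_ge0 ?exprn_ge0 ?(ltW C0)// => /ltW.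
exists l; split; apply/eqP; rewrite -subr_eq0; apply/eqP/nm_eps => e e0;
  have [n /(le_trans _)] := small e e0; apply.
- rewrite (_ : _ - 1 = - ((1 - x) * (u n - l) + x ^+ n)); last first.
    by rewrite mulrBr u1; nring.
  rewrite nmN; apply: le_trans (nmD _ _) _; rewrite /C [leRHS]mulrDl (mul1r (_ ^+ n : R)); apply: lerD => //.
  apply: le_trans (nmM _ _) _; rewrite -mulrA ler_wpM2l ?nm_ge0//.
  by have := ul n; rewrite mul1r.
- rewrite (_ : _ - 1 = - ((u n - l) * (1 - x) + x ^+ n)); last first.
    by rewrite mulrBl u2; nring.
  rewrite nmN; apply: le_trans (nmD _ _) _; rewrite /C [leRHS]mulrDl (mul1r (_ ^+ n : R)); apply: lerD => //.
  apply: le_trans (nmM _ _) _; rewrite mulrC -mulrA ler_wpM2l ?nm_ge0//.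
  by have := ul n; rewrite mul1r.
Qed.

(** The equation for y reads y = (x + y^2) / 2, a fixed point problem for [T]. The radius r = 1 -
    sqrt (1 - nm x) solves its scalar version nm x + r^2 = 2 r, and [T] contracts the ball of radius
    r by the factor r < 1. The iterates start at 0 and involve no constants, hence stay in every
    [csub] containing x. *)
Lemma sqrt_1B x : sa x -> nm x < 1 ->
  exists y, [/\ sa y, (1 - y) ^+ 2 = 1 - x & forall K, csub K -> K x -> K y].
Proof.
move=> sx x1; have x0 := nm_ge0 x.
pose r := 1 - Num.sqrt (1 - nm x).
have s0 : 0 < Num.sqrt (1 - nm x) by rewrite sqrtr_gt0 subr_gt0.
have s2 : Num.sqrt (1 - nm x) ^+ 2 = 1 - nm x by rewrite sqr_sqrtr // subr_ge0 ltW.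
have r1 : r < 1 by rewrite /r; lra.
have r0 : 0 <= r.
  rewrite /r subr_ge0 -[X in _ <= X]sqrtr1 ler_wsqrtr //; lra.
have rE : nm x + r ^+ 2 = 2 * r by rewrite /r; nra.
pose T z := (2^-1 : R)%:C *: (x + z ^+ 2).
pose u n := iter n T 0.
have half : `|2^-1 : R| = 2^-1 by rewrite ger0_norm ?invr_ge0.
have ur n : nm (u n) <= r.
  elim: n => [|n IHn]; first by rewrite nm0.
  rewrite /u iterS -/(u n) nmZr half -ler_pdivlMl ?invr_gt0// invrK.
  apply: le_trans (nmD _ _) _; rewrite -rE lerD2l; apply: le_trans (nmM _ _) _.
  by rewrite expr2 ler_pM ?nm_ge0.
have us n : sa (u n).
  elim: n => [|n IHn]; first exact: sa0.
  by rewrite /u iterS; apply: saZ; apply: saD => //; apply: saX.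
have uK n K : csub K -> K x -> K (u n).
  move=> cK Kx; elim: n => [|n IHn]; first exact: (csub0 cK).
  rewrite /u iterS; apply: (csubZ cK); apply: (csubD cK) => //.
  by rewrite expr2; apply: (csubM cK).
have Tlip a b : nm a <= r -> nm b <= r -> nm (T a - T b) <= r * nm (a - b).
  move=> ar br; rewrite /T -scalerBr nmZr half addrAC opprD addrA subrr sub0r addrC.
  have -> : a ^+ 2 - b ^+ 2 = a * (a - b) + (a - b) * b.
    by rewrite mulrBr mulrBl addrA subrK.
  have h1 := nmD (a * (a - b)) ((a - b) * b).
  have h2 := nmM a (a - b); have h3 := nmM (a - b) b; have h4 := nm_ge0 (a - b).
  nra.
have [|n|l ul] := @geom_limit u r r r0; first by rewrite r0.
  elim: n => [|n IHn].
    by rewrite expr0 mulr1 subr0.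
  apply: le_trans (Tlip _ _ (ur n.+1) (ur n)) _.
  by rewrite exprS ler_wpM2l.
have small e : 0 < e -> exists n, r / (1 - r) * r ^+ n < e.
  move=> e0.
  have /cvgrPdist_lt/(_ e e0)[N _ Nn] : (fun n => r / (1 - r) * r ^+ n : R) @ \oo --> (0 : R).
    rewrite -[X in _ --> X](mulr0 (r / (1 - r))).
    by apply: cvgM; [exact: cvg_cst|apply: cvg_expr; rewrite ger0_norm].
  exists N; have := Nn N (leqnn N).
  rewrite /= sub0r normrN ger0_norm // mulr_ge0 ?exprn_ge0//.
  by rewrite divr_ge0 // subr_ge0 ltW.
have lK K : clo K -> (forall n, K (u n)) -> K l.
  move=> cK Ku; apply: cK => e e0; have [n ne] := small e e0.
  by exists (u n) => //; rewrite nmBC; apply: le_lt_trans (ul n) ne.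
have ls : sa l.
  apply: (lK [set z | st z = z]) => //.
  move=> z zK; apply/eqP; rewrite -subr_eq0; apply/eqP/nm_eps => e e0.
  have [y /= sy zy] := zK (e / 2) ltac:(lra).
  have := nm_tri y (st z) z; rewrite -{1}sy -stB nm_st (nmBC y); lra.
have lr : nm l <= r.
  apply/ler_addgt0Pr => e e0; have [n ne] := small e e0.
  have := nmD (u n) (l - u n); rewrite addrC subrK nmBC.
  have := ul n; have := ur n; lra.
exists l; split => // [|K cK Kx]; last first.
  by apply: lK => [|n]; [exact: csub_clo|exact: uK].
have Tl : T l = l.
  apply/eqP; rewrite -subr_eq0; apply/eqP/nm_eps => e e0.
  have [n ne] := small (e / 2) ltac:(lra).
  have := nm_tri (u n.+1) (T l) l; rewrite {1}/u iterS -/(u n).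
  have := Tlip _ _ lr (ur n); rewrite (nmBC l).
  have := ul n; have := ul n.+1; rewrite exprS.
  have r1' : 0 <= r / (1 - r) * r ^+ n.
    by rewrite mulr_ge0 ?exprn_ge0// divr_ge0 // subr_ge0 ltW.
  have := nm_ge0 (u n - l); nra.
have : T l + T l = l + l by rewrite Tl.
rewrite /T -scalerDl -rmorphD /= (_ : 2^-1 + 2^-1 = 1 :> R) ?rmorph1 ?scale1r; last by field.
move => xl.
have -> : (1 - l) ^+ 2 = 1 - (l + l) + l ^+ 2 by nring.
by rewrite -xl; nring.
Qed.

Lemma sqrt_sc k M : sa k -> nm k < M ->
  exists s, [/\ sa s, s * s = sc M - k & forall z, k * z = z * k -> s * z = z * s].
Proof.
move=> sk kM; have M0 : 0 < M by apply: le_lt_trans kM; exact: nm_ge0.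
have [||y [sy y2 yK]] := @sqrt_1B ((M^-1)%:C *: k).
- exact: saZ.
- by rewrite nmZr ger0_norm ?invr_ge0 ?(ltW M0)// mulrC ltr_pdivrMr // mul1r.
exists ((Num.sqrt M)%:C *: (1 - y)); split.
- by apply/saZ/saB => //; exact: sa1.
- rewrite -scalerAl -scalerAr scalerA -rmorphM /= -expr2 sqr_sqrtr ?(ltW M0)//.
  by rewrite -expr2 y2 scalerBr scalerA -rmorphM /= mulfV ?gt_eqF// rmorph1 scale1r.
- move=> z kz; rewrite -scalerAl -scalerAr; congr (_ *: _).
  suff yz : y * z = z * y by rewrite mulrBl mulrBr mul1r mulr1 yz.
  apply: (yK _ (csub_comm z)); rewrite /= -scalerAl -scalerAr kz //.
Qed.

(** Put z = x + i y. As x and y commute, st z * z = x x + y y; and x is the real part of z, so nm x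
    <= nm z. This stands in for monotonicity of the norm as long as no order is available. *)
Lemma nm_sqr_le x y : sa x -> sa y -> x * y = y * x ->
  nm (x * x) <= nm (x * x + y * y).
Proof.
move=> sx sy xy; pose z := x + 'i *: y.
have stz : st z = x - 'i *: y.
  rewrite /z stD stZ sx sy -scaleNr; congr (_ + _ *: _).
  by apply/eqP; rewrite eq_complex /= oppr0 !eqxx.
have -> : x * x + y * y = st z * z.
  rewrite stz /z; set w := 'i *: y.
  have xw : x * w = w * x by rewrite /w -scalerAl -scalerAr xy.
  have ww : y * y = - (w * w).
    rewrite /w -scalerAl -scalerAr scalerA -scaleNr.
    rewrite (_ : - _ = 1) ?scale1r //.
    by apply/eqP; rewrite eq_complex /= !mulr0 !mul0r !mulr1 sub0r addr0 oppr0 opprK !eqxx.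
  rewrite ww (_ : _ * (x + w) = x * x + x * w - w * x - w * w); last by nring.
  by rewrite xw; nring.
rewrite nm_cstar -expr2 nm_sqr // ler_pXn2r ?nnegrE ?nm_ge0//.
have -> : x = (2^-1)%:C *: (z + st z).
  rewrite stz /z addrACA subrr addr0 scalerDr -scalerDl -rmorphD /=.
  by rewrite (_ : 2^-1 + 2^-1 = 1 :> R) ?rmorph1 ?scale1r //; field.
rewrite nmZr ger0_norm ?invr_ge0//.
have := nmD z (st z); rewrite nm_st; lra.
Qed.

(** M + e/2 - k k is a square s s with s commuting with k, and [nm_sqr_le] bounds its norm by that
    of s s + k k = M + e/2. *)
Lemma nm_scB_sqr k M : sa k -> nm k ^+ 2 <= M -> nm (sc M - k * k) <= M.
Proof.
move=> sk kM; apply/ler_addgt0Pr => e e0.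
have [||s [ss s2 sC]] := @sqrt_sc (k * k) (M + e / 2).
- exact: saM.
- by rewrite -expr2 nm_sqr //; lra.
have skk : s * k = k * s by apply: sC; rewrite mulrA.
have := nm_sqr_le ss sk skk; have := sqr_ge0 (nm k).
rewrite s2 subrK nm_sc => k0 h.
have -> : sc M - k * k = sc (M + e / 2) - k * k - sc (e / 2) by rewrite scD; nring.
apply: le_trans (nmB _ _) _; move: h; rewrite nm_sc !ger0_norm; lra.
Qed.

Definition ev h (p : {poly R}) : U := horner_alg h (map_poly (real_complex R) p).

Lemma evD h p q : ev h (p + q) = ev h p + ev h q.
Proof. by rewrite /ev !rmorphD. Qed.
Lemma evB h p q : ev h (p - q) = ev h p - ev h q.
Proof. by rewrite /ev !rmorphB. Qed.
Lemma evM h p q : ev h (p * q) = ev h p * ev h q.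
Proof. by rewrite /ev !rmorphM. Qed.
Lemma evC h c : ev h c%:P = sc c.
Proof. by rewrite /ev map_polyC /= horner_algC. Qed.
Lemma evX h : ev h 'X = h.
Proof. by rewrite /ev map_polyX horner_algX. Qed.

Lemma ev_comm h p z : h * z = z * h -> ev h p * z = z * ev h p.
Proof.
move=> hz; elim/poly_ind: p => [|p c IHp].
  by rewrite -polyC0 evC sc0 mul0r mulr0.
by rewrite evD evM evX evC mulrDl mulrDr -mulrA hz !mulrA IHp scC.
Qed.

Lemma ev_sa h p : sa h -> sa (ev h p).
Proof.
move=> sh; elim/poly_ind: p => [|p c IHp].
  by rewrite -polyC0 evC; exact: sa_sc.
rewrite evD evM evX evC; apply: saD; last exact: sa_sc.
by apply: saM => //; exact: ev_comm.
Qed.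

Lemma ev_csub K h p : csub K -> K h -> p.[0] = 0 -> K (ev h p).
Proof.
move=> cK Kh; have Kp q : K (ev h q * h).
  elim/poly_ind: q => [|q c IHq].
    by rewrite -polyC0 evC sc0 mul0r; exact: csub0 cK.
  rewrite evD evM evX evC mulrDl scE.
  by apply: (csubD cK); [apply: (csubM cK)|apply: (csubZ cK)].
elim/poly_ind: p => [|p c _]; first by rewrite -polyC0 evC sc0 => _; exact: csub0 cK.
rewrite hornerMXaddC mulr0 add0r => ->; rewrite evD evM evX evC sc0 addr0.
exact: Kp.
Qed.

(** Only the real part of the spectrum; for self-adjoint h this is all of it, by [invt_nonreal]. *)
Definition spec h : set R := [set t | ~ invt (h - sc t)].

(** With k = h - a, the product (k - i b)(k + i b) is k^2 + b^2 = (m + b^2) - (m - k^2) for m = nm k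
    ^ 2. Since nm (m - k^2) <= m < m + b^2, the Neumann series inverts it, and a factor of it that
    commutes with the cofactor is invertible too. *)
Lemma invt_nonreal h (a b : R) : sa h -> b != 0 -> invt (h - (a +i* b)%:A).
Proof.
move=> sh b0; set w : U := (0 +i* b)%:A; set k := h - sc a.
have sk : sa k by apply: saB => //; exact: sa_sc.
have -> : h - (a +i* b)%:A = k - w.
  rewrite /k /w -addrA -opprD /sc -scalerDl; congr (_ - _ *: _).
  by apply/eqP; rewrite eq_complex /= addr0 add0r !eqxx.
have kw : k * w = w * k by rewrite /w -scalerAl -scalerAr mul1r mulr1.
have ww : w * w = - sc (b ^+ 2).
  rewrite /w -scalerAl -scalerAr mulr1 scalerA -scN; congr (_ *: _).
  by apply/eqP; rewrite eq_complex /= !mul0r !mulr0 sub0r addr0 !eqxx.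
apply: (@invt_mulC _ (k + w)).
  have -> : (k - w) * (k + w) = k * k + (k * w - w * k) - w * w by nring.
  have -> : (k + w) * (k - w) = k * k - (k * w - w * k) - w * w by nring.
  by rewrite kw subrr oppr0.
have -> : (k - w) * (k + w) = k * k + sc (b ^+ 2).
  have -> : (k - w) * (k + w) = k * k + (k * w - w * k) - w * w by nring.
  by rewrite kw ww subrr addr0 opprK.
pose m := nm k ^+ 2; have m0 : 0 <= m by rewrite exprn_ge0 // nm_ge0.
have b20 : 0 < b ^+ 2 by rewrite lt_def sqr_ge0 sqrf_eq0 b0.
have M0 : 0 < m + b ^+ 2 by lra.
have -> : k * k + sc (b ^+ 2) =
    (m + b ^+ 2)%:C *: (1 - ((m + b ^+ 2)^-1)%:C *: (sc m - k * k)).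
  rewrite scalerBr scalerA -rmorphM /= mulfV ?gt_eqF// rmorph1 scale1r.
  by rewrite -/(sc _) scD; nring.
apply: invt_scale; first by rewrite -(rmorph0 (real_complex R)) eq_complex /= negb_and gt_eqF.
apply: neumann; rewrite nmZr ger0_norm ?invr_ge0 ?(ltW M0)//.
rewrite mulrC ltr_pdivrMr // mul1r.
have := nm_scB_sqr sk (lexx m); lra.
Qed.

(** An inverse w of d = m - h^2 would separate h^2 from m. The square of s r is (d + dl/4)(1 - dl
    w), so that h^2 + (s r)^2 = m - 3 dl/4 - (dl^2/4) w has norm less than m = nm (h^2), against
    [nm_sqr_le]. *)
Lemma norm_spec h : sa h -> ~ invt (sc (nm h ^+ 2) - h * h).
Proof.
move=> sh [w [w1 w2]]; set m := nm h ^+ 2 in w1 w2.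
have m0 : 0 < m.
  rewrite lt_def exprn_ge0 ?nm_ge0// andbT; apply/eqP => m0.
  have /eqP := m0; rewrite /m sqrf_eq0 => /eqP /nm_eq0 h0.
  move: w1; rewrite m0 h0 sc0 mul0r subrr mul0r => /esym/eqP.
  by rewrite oner_eq0.
have shh : sa (h * h) by exact: saM.
set d := sc m - h * h in w1 w2.
have sd : sa d by apply: saB => //; exact: sa_sc.
have sw : sa w.
  have : st w * d = 1 by rewrite -sd -stM w1 st1.
  by move=> wd; rewrite /sa -[LHS]mulr1 -w1 mulrA wd mul1r.
have dC z : h * z = z * h -> d * z = z * d.
  by move=> hz; rewrite /d mulrBl mulrBr scC -mulrA hz !mulrA hz.
have wC z : h * z = z * h -> w * z = z * w.
  move=> /dC dz; rewrite -[LHS]mulr1 -w1 !mulrA; congr (_ * w).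
  by rewrite -mulrA -dz mulrA w2 mul1r.
pose n := 1 + nm w; have n0 : 0 < n by rewrite /n; have := nm_ge0 w; lra.
(* The bound m/2 keeps m - 3 dl/4 nonnegative. The other one gives dl * nm w < 1/2, which provides
   the square root of 1 - dl w and bounds the last term by dl/8. *)
pose dl := Num.min (m / 2) (2^-1 / n).
have dl0 : 0 < dl by rewrite lt_min !divr_gt0 // invr_gt0.
have dlm : dl <= m / 2 by rewrite ge_min lexx.
have dln : dl * nm w < 2^-1.
  apply: (@lt_le_trans _ _ (dl * n)); first by rewrite ltr_pM2l // /n; lra.
  by rewrite -ler_pdivlMr // ge_min lexx orbT.
have [||r [sr r2 rC]] := @sqrt_sc (dl%:C *: w) 1; first exact: saZ.
  by rewrite nmZr ger0_norm ?(ltW dl0)//; lra.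
have e0 : 0 < dl / 4 by lra.
have [|s [ss s2 sC]] := @sqrt_sc (h * h) (m + dl / 4) shh.
  by rewrite -expr2 nm_sqr //; rewrite -/m; lra.
have hs : h * s = s * h by symmetry; apply: sC; rewrite mulrA.
have wh : w * h = h * w by apply: wC.
have rs : r * s = s * r.
  by apply: rC; rewrite -scalerAl -scalerAr wC.
have hr : h * r = r * h by symmetry; apply: rC; rewrite -scalerAl -scalerAr wh.
have srs : sa (s * r) by apply: saM.
have srh : h * (s * r) = s * r * h by rewrite mulrA hs -mulrA hr mulrA.
have := nm_sqr_le sh srs srh.
have -> : s * r * (s * r) = s * s * (r * r) by rewrite !mulrA -(mulrA s r s) rs !mulrA.
have dE : sc (m + dl / 4) - h * h = d + sc (dl / 4) by rewrite scD /d; nring.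
have -> : h * h + s * s * (r * r) = sc (m + dl / 4 - dl) - (dl / 4 * dl)%:C *: w.
  have wd : d * (dl%:C *: w) = sc dl by rewrite -scalerAr w1.
  have -> : (dl / 4 * dl)%:C *: w = sc (dl / 4) * (dl%:C *: w).
    by rewrite scE scalerA -rmorphM.
  rewrite s2 r2 dE sc1 mulrBr mulr1 mulrDl wd /d.
  by rewrite !scD scN; nring.
rewrite -expr2 nm_sqr // -/m => h1.
have := nmB (sc (m + dl / 4 - dl)) ((dl / 4 * dl)%:C *: w).
rewrite nm_sc nmZr !ger0_norm; [|by rewrite mulr_ge0 // ltW|by lra].
have : dl / 4 * dl * nm w <= dl / 4 / 2.
  by rewrite -mulrA ler_wpM2l ?(ltW e0)// ltW.
move: h1; set X := nm (_ - _); set Y := dl / 4 * dl * nm w; lra.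
Qed.

(** Factor q over [R[i]]: if q(h) is not invertible, neither is some factor h - z, and such a z is
    real. *)
Lemma spec_poly h q : sa h -> q != 0 -> ~ invt (ev h q) ->
  exists2 t, spec h t & q.[t] = 0.
Proof.
move=> sh q0 nq; pose qc := map_poly (real_complex R) q.
have [r qcE] := closed_field_poly_normal qc.
have qc0 : qc != 0 by rewrite map_poly_eq0.
have [z zr nz] : exists2 z, z \in r & ~ invt (h - z%:A).
  apply: contrapT => nz; apply: nq; rewrite /ev -/qc qcE linearZ /=.
  rewrite -scalerAl mul1r; apply: invt_scale; first by rewrite lead_coef_eq0.
  have {}nz (z : R[i]) : z \in r -> invt (h - z%:A).
    by move=> zr; apply: contrapT => iz; apply: nz; exists z.
  elim: r nz {qcE} => [_|z r IHr nz]; first by rewrite big_nil rmorph1; exists 1; rewrite mulr1.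
  rewrite big_cons rmorphM /= rmorphB /= horner_algX horner_algC.
  apply: invt_mul; first by apply: nz; rewrite inE eqxx.
  by apply: IHr => y yr; apply: nz; rewrite inE yr orbT.
case: z zr nz => a b zr nz.
have b0 : b = 0 by apply: contrapT => /eqP b0; apply: nz; apply: invt_nonreal.
rewrite b0 in zr nz; exists a; first exact: nz.
have : root qc a%:C.
  by rewrite qcE rootZ ?lead_coef_eq0// root_prod_XsubC.
by rewrite /root /qc horner_map /= eq_complex /= eqxx andbT => /eqP.
Qed.

Lemma spec_nonempty h : sa h -> exists t, spec h t.
Proof.
move=> sh; have q0 : (nm h ^+ 2)%:P - 'X * 'X != 0 :> {poly R}.
  apply/eqP => /(congr1 (fun p : {poly R} => p`_2)).
  by rewrite coefB coefC -expr2 coefXn /= coef0 sub0r => /eqP; rewrite oppr_eq0 oner_eq0.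
have [|t ht _] := spec_poly sh q0; last by exists t.
by rewrite evB evM evX evC; exact: norm_spec.
Qed.

(** For m = nm (p(h)), [norm_spec] says that m^2 - p^2 is not invertible at h, so it has a root t in
    the spectrum, where |p(t)| = m. If m^2 - p^2 is the zero polynomial, any spectral point will
    do. *)
Lemma nm_ev_le h p C : sa h -> (forall t, spec h t -> `|p.[t]| <= C) ->
  nm (ev h p) <= C.
Proof.
move=> sh pC; set m := nm (ev h p).
have [q0|q0] := eqVneq ((m ^+ 2)%:P - p * p) 0.
  have [t /pC] := spec_nonempty sh.
  have /(congr1 (fun q => q.[t])) := q0; rewrite !hornerE => /eqP.
  rewrite subr_eq0 -expr2 eqf_sqr => /orP[]/eqP me; apply: le_trans; rewrite ?normrN.
    by rewrite -me ler_norm.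
  by rewrite -[p.[t]]opprK -me normrN ler_norm.
have [|t /pC] := spec_poly sh q0.
  by rewrite evB evM evC; apply/norm_spec/ev_sa.
rewrite !hornerE => tC /eqP.
rewrite subr_eq0 -expr2 eqf_sqr => /orP[]/eqP me; apply: le_trans tC.
  by rewrite -me ler_norm.
by rewrite -[p.[t]]opprK -me normrN ler_norm.
Qed.

(** If |p(t)| exceeded the norm of p(h), the Neumann series would invert p(h) - p(t), of which h - t
    is a commuting factor. *)
Lemma spec_ev_le h p t : sa h -> spec h t -> `|p.[t]| <= nm (ev h p).
Proof.
move=> sh ht; rewrite leNgt; apply/negP => lt; apply: ht.
have pt0 : p.[t] != 0 by apply/eqP => pt; move: lt; rewrite pt normr0 ltNge nm_ge0.
have /factor_theorem[q qE] : root (p - (p.[t])%:P) t by rewrite /root !hornerE subrr.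
apply: (@invt_mulC _ (ev h q)).
  by symmetry; apply: ev_comm; rewrite mulrBl mulrBr scC.
have -> : (h - sc t) * ev h q = - (p.[t])%:C *: (1 - (p.[t]^-1)%:C *: ev h p).
  have -> : (h - sc t) * ev h q = ev h q * ev h ('X - t%:P).
    by rewrite evB evX evC; symmetry; apply: ev_comm; rewrite mulrBl mulrBr scC.
  rewrite -evM -qE evB evC scalerBr scalerA mulNr -rmorphM /= mulfV // rmorph1.
  by rewrite scaleN1r opprK scaleNr addrC.
apply: invt_scale; first by rewrite oppr_eq0 eq_complex /= negb_and pt0.
apply: neumann; rewrite nmZr normfV mulrC ltr_pdivrMr ?normr_gt0// mul1r.
exact: lt.
Qed.

Lemma spec_le h t : sa h -> spec h t -> `|t| <= nm h.
Proof. by move=> sh /(spec_ev_le 'X sh); rewrite hornerX evX. Qed.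

End Basics.

(** * Continuous functional calculus *)

Section Weierstrass.
Context (R : realType).
Implicit Types (f g : R -> R) (x y t : R).

(** The value at x is the mean of g at the number of successes in n trials of probability x. The
    recursion conditions on one trial, so that positivity and moments follow by induction without
    binomial sums. *)
Fixpoint bernstein (n : nat) (g : nat -> R) : {poly R} :=
  if n is m.+1 then
    'X * bernstein m (fun k => g k.+1) + (1 - 'X) * bernstein m g
  else (g 0%N)%:P.

Lemma bernsteinS n (g : nat -> R) x : (bernstein n.+1 g).[x] =
  x * (bernstein n (fun k => g k.+1)).[x] + (1 - x) * (bernstein n g).[x].
Proof. by rewrite /= !hornerE. Qed.

Lemma bernstein_le n (g g' : nat -> R) x : 0 <= x <= 1 ->
  (forall k, (k <= n)%N -> g k <= g' k) ->
  (bernstein n g).[x] <= (bernstein n g').[x].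
Proof.
move=> /andP[x0 x1]; elim: n g g' => [|n IHn] g g' gg'.
  by rewrite /= !hornerC gg'.
rewrite !bernsteinS lerD // ler_wpM2l ?subr_ge0 // IHn // => k kn; apply: gg' => //.
exact: leqW.
Qed.

Lemma bernstein_lin n (a b : R) (g g' : nat -> R) x :
  (bernstein n (fun k => a * g k + b * g' k)).[x] =
  a * (bernstein n g).[x] + b * (bernstein n g').[x].
Proof.
elim: n g g' => [|n IHn] g g'; first by rewrite /= !hornerC.
by rewrite !bernsteinS !IHn; ring.
Qed.

Lemma bernstein_cst n (a : R) x : (bernstein n (fun=> a)).[x] = a.
Proof.
by elim: n => [|n IHn]; [rewrite /= hornerC|rewrite bernsteinS IHn; ring].
Qed.

Lemma bernstein_var n (a x : R) : (bernstein n (fun k => (k%:R - a) ^+ 2)).[x] =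
  n%:R * (x * (1 - x)) + (n%:R * x - a) ^+ 2.
Proof.
elim: n a => [|n IHn] a; first by rewrite /= hornerC; ring.
rewrite bernsteinS IHn.
have -> : (fun k => (k.+1%:R - a) ^+ 2) = (fun k => (k%:R - (a - 1)) ^+ 2) :> (nat -> R).
  by apply/funext => k; rewrite -natr1; ring.
by rewrite IHn -natr1; ring.
Qed.

(** Uniform continuity in a form adapted to Bernstein polynomials: the mean of the quadratic term is
    given exactly by [bernstein_var]. *)
Lemma uniform_modulus f (M e : R) : continuous f -> 0 < e ->
  exists2 K, 0 <= K & forall x y, `|x| <= M -> `|y| <= M ->
    `|f x - f y| <= e + K * (x - y) ^+ 2.
Proof.
move=> cf e0.
(* Uniform continuity by contradiction: the offending pairs come ever closer, and
   Bolzano-Weierstrass makes a subsequence converge to a point where f would be discontinuous. *)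
have [d d0 fd] : exists2 d, 0 < d & forall x y, `|x| <= M -> `|y| <= M ->
    `|x - y| < d -> `|f x - f y| <= e.
  apply: contrapT => nd.
  have /choice[u uP] n : exists xy : R * R, [/\ `|xy.1| <= M, `|xy.2| <= M,
      `|xy.1 - xy.2| < n.+1%:R^-1 & ~ (`|f xy.1 - f xy.2| <= e)].
    apply: contrapT => nxy; apply: nd; exists n.+1%:R^-1; first by rewrite invr_gt0.
    move=> x y xM yM xyn; apply: contrapT => fxy; apply: nxy.
    by exists (x, y).
  have [|s si sc] := @bolzano_weierstrass R (fun n => (u n).1).
    exists M; split; first exact: num_real.
    by move=> N MN n _ /=; case: (uP n) => h _ _ _; apply: le_trans h (ltW MN).
  set c := lim _ in sc.
  have sn n : (n <= s n)%N.
    elim: n => // n IHn; apply: leq_ltn_trans IHn _.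
    by move/increasing_seqP: si; apply.
  have e2 : 0 < e / 2 by rewrite divr_gt0.
  have /cvgrPdist_lt/(_ _ e2)/nbhs_ballP[d /= d0 fd] := cf c.
  have d2 : 0 < d / 2 by rewrite divr_gt0.
  have /cvgrPdist_lt/(_ _ d2)[N _ Nc] := sc.
  have [N' N'd] : exists N' : nat, N'.+1%:R^-1 < d / 2.
    exists (Num.truncn (d / 2)^-1); rewrite -ltf_pV2 ?posrE ?invr_gt0// invrK.
    exact: truncnS_gt.
  pose n := maxn N N'.
  have [_ _ xy nfxy] := uP (s n).
  have xc := Nc n (leq_maxl _ _); rewrite /= in xc.
  have yx : `|(u (s n)).1 - (u (s n)).2| < d / 2.
    apply: lt_trans xy _; apply: le_lt_trans N'd.
    by rewrite lef_pV2 ?posrE // ler_nat ltnS (leq_trans (leq_maxr _ _) (sn n)).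
  apply: nfxy; have := fd (u (s n)).1; have := fd (u (s n)).2; rewrite /ball /=.
  have := ler_normD (c - (u (s n)).1) ((u (s n)).1 - (u (s n)).2).
  rewrite addrA subrK => cy fy fx.
  have h1 := fx ltac:(lra); have h2 := fy ltac:(lra).
  have := ler_normD (f (u (s n)).1 - f c) (f c - f (u (s n)).2).
  by rewrite addrA subrK (distrC _ (f c)); lra.
have [M0|M0] := ltP M 0.
  by exists 0 => // x y xM; have := normr_ge0 x; lra.
have [||c cM fc] := @EVT_max R (fun x => `|f x|) (- M) M; first by lra.
  apply: continuous_subspaceT => x.
  by apply: (@continuous_comp _ _ _ f); [exact: cf|exact: norm_continuous].
have B0 : 0 <= 2 * `|f c| / d ^+ 2.
  by rewrite divr_ge0 ?exprn_ge0 ?(ltW d0)// mulr_ge0.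
(* At distance at least d the quadratic term exceeds twice the maximum of |f|, hence the
   oscillation. *)
exists (2 * `|f c| / d ^+ 2) => // x y xM yM.
have [xyd|xyd] := ltP `|x - y| d.
  by apply: le_trans (fd _ _ xM yM xyd) _; rewrite lerDl mulr_ge0 // sqr_ge0.
have fb z : `|z| <= M -> `|f z| <= `|f c|.
  by move=> zM; apply: fc; rewrite in_itv /= -ler_norml.
apply: le_trans (ler_normB _ _) _.
have -> : 2 * `|f c| / d ^+ 2 * (x - y) ^+ 2 = 2 * `|f c| * ((x - y) ^+ 2 / d ^+ 2).
  by field; rewrite gt_eqF.
have h1 : 1 <= (x - y) ^+ 2 / d ^+ 2.
  rewrite ler_pdivlMr ?exprn_gt0// mul1r -(real_normK (num_real (x - y))).
  by rewrite ler_pXn2r ?nnegrE ?(ltW d0).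
have := fb _ xM; have := fb _ yM; have := normr_ge0 (f c); nra.
Qed.

Lemma continuous_bounded f (M : R) : continuous f ->
  exists2 A, 0 < A & forall t, `|t| <= M -> `|f t| <= A.
Proof.
move=> cf; have [K K0 fK] := uniform_modulus `|M| cf ltr01.
exists (`|f 0| + 1 + K * M ^+ 2).
  by have := normr_ge0 (f 0); have := mulr_ge0 K0 (sqr_ge0 M); lra.
move=> t tM; have := fK t 0 (le_trans tM (ler_norm _)); rewrite normr0 => /(_ (normr_ge0 _)).
have M0 : 0 <= M by apply: le_trans tM.
have : K * (t - 0) ^+ 2 <= K * M ^+ 2.
  by rewrite ler_wpM2l // subr0 -(real_normK (num_real t)) ler_pXn2r ?nnegrE.
by have := ler_normD (f t - f 0) (f 0); rewrite subrK; lra.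
Qed.

(** The argument of Chebyshev: the operator is positive, so the quadratic bound [fk] on f(t) -
    f(node) turns into a bound by the variance, which is of lower order than the square of the
    number of nodes. *)
Theorem weierstrass f (M e : R) : continuous f -> 0 < e ->
  exists p : {poly R}, forall t, `|t| <= M -> `|f t - p.[t]| <= e.
Proof.
move=> cf e0; have [M0|M0] := leP M 0.
  exists (f 0)%:P => t tM; have /eqP : `|t| = 0 by have := normr_ge0 t; lra.
  by rewrite normr_eq0 hornerC => /eqP ->; rewrite subrr normr0 ltW.
have [|K K0 fK] := @uniform_modulus f M (e / 2) cf; first by rewrite divr_gt0.
(* With n+1 trials the variance term is at most K M^2 / (n+1), because 4 x (1 - x) <= 1; this must
   not exceed e/2. *)
have [n Kn] : exists n : nat, 2 * K * M ^+ 2 / e < n.+1%:R.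
  by exists (Num.truncn (2 * K * M ^+ 2 / e)); exact: truncnS_gt.
have n0 : 0 < n.+1%:R :> R by [].
pose node (k : nat) : R := 2 * M * (k%:R / n.+1%:R) - M.
pose p := bernstein n.+1 (f \o node).
exists (p \Po ((2 * M)^-1 *: ('X + M%:P))) => t tM.
rewrite horner_comp hornerZ (hornerD 'X) hornerX hornerC; set x := (2 * M)^-1 * (t + M).
have tE : t = 2 * M * x - M by rewrite /x; field; lra.
have x01 : 0 <= x <= 1.
  move: tM; rewrite ler_norml => /andP[t1 t2].
  rewrite /x mulrC divr_ge0 ?ler_pdivrMr; lra.
have nodeM k : (k <= n.+1)%N -> `|node k| <= M.
  move=> kn; have k0 : 0 <= k%:R / n.+1%:R :> R by rewrite divr_ge0.
  have k1 : k%:R / n.+1%:R <= 1 :> R by rewrite ler_pdivrMr // mul1r ler_nat.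
  rewrite /node; move: k0 k1; set r := _ / _ => k0 k1.
  have := ler_wpM2l (ltW M0) k1; have := mulr_ge0 (ltW M0) k0.
  by rewrite ler_norml; lra.
(* The constant with K (t - node k)^2 = c (k - (n+1) x)^2. *)
pose c := (n.+1%:R ^+ 2)^-1 * (K * (2 * M) ^+ 2).
have c0 : 0 <= c.
  by rewrite mulr_ge0 ?invr_ge0 ?exprn_ge0 ?mulr_ge0 ?(ltW M0).
have fk k : (k <= n.+1)%N ->
    `|f t - f (node k)| <= e / 2 + c * (k%:R - n.+1%:R * x) ^+ 2.
  move=> kn; apply: le_trans (fK _ _ tM (nodeM _ kn)) _.
  rewrite le_eqVlt; apply/orP; left; apply/eqP; congr (_ + _).
  by rewrite /c tE /node; field; rewrite gt_eqF.
pose V k : R := (k%:R - n.+1%:R * x) ^+ 2.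
have up : p.[x] <= f t + (e / 2 + c * (n.+1%:R * (x * (1 - x)))).
  have -> : f t + (e / 2 + c * (n.+1%:R * (x * (1 - x)))) =
     (bernstein n.+1 (fun k => 1 * (f t + e / 2) + c * V k)).[x].
    by rewrite (bernstein_lin _ 1 c (fun=> f t + e / 2)) bernstein_cst bernstein_var; ring.
  apply: bernstein_le => // k /fk; rewrite ler_norml /V /= => /andP[]; lra.
have lo : f t - (e / 2 + c * (n.+1%:R * (x * (1 - x)))) <= p.[x].
  have -> : f t - (e / 2 + c * (n.+1%:R * (x * (1 - x)))) =
     (bernstein n.+1 (fun k => 1 * (f t - e / 2) + (- c) * V k)).[x].
    by rewrite (bernstein_lin _ 1 (- c) (fun=> f t - e / 2)) bernstein_cst bernstein_var; ring.
  apply: bernstein_le => // k /fk; rewrite ler_norml /V /= => /andP[]; lra.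
have ce : c * (n.+1%:R * (x * (1 - x))) <= e / 2.
  have -> : c * (n.+1%:R * (x * (1 - x))) = (4 * (x * (1 - x))) * (K * M ^+ 2 / n.+1%:R).
    by rewrite /c; field; rewrite gt_eqF.
  have x4 (y : R) : 4 * (y * (1 - y)) <= 1.
    by have := sqr_ge0 (1 - 2 * y); rewrite expr2; lra.
  have KM : 0 <= K * M ^+ 2 / n.+1%:R by rewrite divr_ge0 // mulr_ge0 // sqr_ge0.
  apply: (@le_trans _ _ (K * M ^+ 2 / n.+1%:R)); first by rewrite ler_piMl.
  by move: Kn; rewrite ltr_pdivrMr // ler_pdivrMr // => Kn; lra.
by rewrite ler_norml; lra.
Qed.

End Weierstrass.

Section Continuity.
Context (R : realType).
Implicit Types f g : R -> R.

Lemma cont_cst (c : R) : continuous (fun _ : R => c).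
Proof. by move=> t; exact: cvg_cst. Qed.
Lemma cont_id : continuous (fun t : R => t).
Proof. by move=> t; exact: cvg_id. Qed.
Lemma contD f g : continuous f -> continuous g -> continuous (fun t => f t + g t).
Proof. by move=> cf cg t; apply: cvgD; [exact: cf|exact: cg]. Qed.
Lemma contN f : continuous f -> continuous (fun t => - f t).
Proof. by move=> cf t; apply: cvgN; exact: cf. Qed.
Lemma contM f g : continuous f -> continuous g -> continuous (fun t => f t * g t).
Proof. by move=> cf cg t; apply: cvgM; [exact: cf|exact: cg]. Qed.
Lemma cont_max f g : continuous f -> continuous g -> continuous (fun t => Num.max (f t) (g t)).
Proof. by move=> cf cg t; apply: continuous_max; [exact: cf|exact: cg]. Qed.
Lemma cont_min f g : continuous f -> continuous g -> continuous (fun t => Num.min (f t) (g t)).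
Proof. by move=> cf cg t; apply: continuous_min; [exact: cf|exact: cg]. Qed.
Lemma cont_abs f : continuous f -> continuous (fun t => `|f t|).
Proof. by move=> cf t; apply: (@continuous_comp _ _ _ f); [exact: cf|exact: norm_continuous]. Qed.
Lemma cont_sqrt f : continuous f -> continuous (fun t => Num.sqrt (f t)).
Proof. by move=> cf t; apply: (@continuous_comp _ _ _ f); [exact: cf|exact: sqrt_continuous]. Qed.
Lemma contV f : (forall t, f t != 0) -> continuous f -> continuous (fun t => (f t)^-1).
Proof. by move=> f0 cf t; apply: cvgV; [exact: f0|exact: cf]. Qed.

End Continuity.

Ltac cont := repeat
  first [ assumption
        | lazymatch goal with
          | |- forall x, continuous_at x ?h =>
            lazymatch h with
            | (fun t => @GRing.mul _ (@?f t) (@?g t)) => apply: (@contM _ f g)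
            | (fun t => @GRing.add _ (@?f t) (@?g t)) => apply: (@contD _ f g)
            | (fun t => @GRing.opp _ (@?f t)) => apply: (@contN _ f)
            | (fun t => Num.max (@?f t) (@?g t)) => apply: (@cont_max _ f g)
            | (fun t => Num.min (@?f t) (@?g t)) => apply: (@cont_min _ f g)
            | (fun t => `|@?f t|) => apply: (@cont_abs _ f)
            | (fun t => Num.sqrt (@?f t)) => apply: (@cont_sqrt _ f)
            | (fun t => t) => exact: cont_id
            | (fun t => ?c) => exact: (@cont_cst _ c)
            end
          end ].

(** * Continuous functions of a self-adjoint element *)

Section FunctionalCalculus.
Context (R : realType) (U : ucstarType R).
Implicit Types (x y z h : U) (f g : R -> R) (K : set U).

(** Polynomials approximate f on the whole interval [- nm h, nm h], which contains the spectrum;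
    that only the values on the spectrum matter is recovered in [fc_ext]. *)
Definition fc_rep h f x := forall e : R, 0 < e ->
  exists p, nm (x - ev h p) <= e /\ forall t, `|t| <= nm h -> `|f t - p.[t]| <= e.

Definition fc h f : U := xget 0 [set x | fc_rep h f x].

Lemma fc_rep_exists h f : sa h -> continuous f -> exists x, fc_rep h f x.
Proof.
move=> sh cf.
have rn (n : nat) : 0 < 2^-1 ^+ n :> R by rewrite exprn_gt0 // invr_gt0.
have /choice[p pP] (n : nat) := weierstrass (nm h) cf (rn n).
(* Consecutive polynomials differ by at most 2^-n + 2^-(n+1) <= 2 * 2^-n on the spectrum. *)
have [||n|l pl] := @geom_limit _ _ (fun n => ev h (p n)) 2 2^-1.
- by [].
- by rewrite invr_ge0 ler0n /=; lra.
- rewrite -evB; apply: nm_ev_le => // t /(spec_le sh) th.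
  have := pP n _ th; have := pP n.+1 _ th; have := rn n.
  rewrite exprS !hornerE; set a := _ ^+ n => a0 h1 h2.
  have := ler_normD ((p n.+1).[t] - f t) (f t - (p n).[t]).
  by rewrite addrA subrK (distrC _ (f t)); lra.
exists l => e e0.
have [N Ne] : exists N, 4 * 2^-1 ^+ N < e.
  have /cvgrPdist_lt/(_ e e0)[N _ Nn] : (fun n => 4 * 2^-1 ^+ n : R) @ \oo --> (0 : R).
    rewrite -[X in _ --> X](mulr0 4).
    by apply: cvgM; [exact: cvg_cst|apply: cvg_expr; rewrite ger0_norm ?invr_ge0 //; lra].
  exists N; have := Nn N (leqnn N); by rewrite /= sub0r normrN ger0_norm.
exists (p N); split.
  rewrite nmBC; apply: le_trans (pl N) _; apply: le_trans (ltW Ne).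
  rewrite (_ : 1 - 2^-1 = 2^-1 :> R) ?invrK; last by field.
  by have := rn N; lra.
by move=> t /(pP N) h1; apply: le_trans h1 _; have := rn N; lra.
Qed.

Lemma fcP h f : sa h -> continuous f -> fc_rep h f (fc h f).
Proof.
move=> sh cf; have [x xP] := fc_rep_exists sh cf.
by rewrite /fc; case: xgetP => [y _ yP|/(_ x)].
Qed.

Lemma fc_norm h f C : sa h -> continuous f ->
  (forall t, spec h t -> `|f t| <= C) -> nm (fc h f) <= C.
Proof.
move=> sh cf fC; apply/ler_addgt0Pr => e e0.
have [|p [p1 p2]] := fcP sh cf (e := e / 2); first by rewrite divr_gt0.
have := nmD (fc h f - ev h p) (ev h p); rewrite subrK => h1.
have : nm (ev h p) <= C + e / 2.
  apply: nm_ev_le => // t ht; have := fC t ht; have := p2 _ (spec_le sh ht).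
  have := ler_normB (f t) (f t - p.[t]); rewrite opprB addrC subrK; lra.
lra.
Qed.

Lemma fc_ge h f t : sa h -> continuous f -> spec h t -> `|f t| <= nm (fc h f).
Proof.
move=> sh cf ht; apply/ler_addgt0Pr => e e0.
have [|p [p1 p2]] := fcP sh cf (e := e / 2); first by rewrite divr_gt0.
have := spec_ev_le p sh ht; have := p2 _ (spec_le sh ht).
have := ler_normD (f t - p.[t]) p.[t]; rewrite subrK.
have := nmB (fc h f) (fc h f - ev h p); rewrite opprB addrC subrK; lra.
Qed.

Lemma fc_rep_uniq h f x y : sa h -> fc_rep h f x -> fc_rep h f y -> x = y.
Proof.
move=> sh fx fy; apply/eqP; rewrite -subr_eq0; apply/eqP/nm_eps => e e0.
have e4 : 0 < e / 4 by rewrite divr_gt0.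
have [p [p1 p2]] := fx _ e4; have [q [q1 q2]] := fy _ e4.
have : nm (ev h p - ev h q) <= e / 2.
  rewrite -evB; apply: nm_ev_le => // t /(spec_le sh) th; rewrite !hornerE.
  have := p2 _ th; have := q2 _ th.
  have := ler_normD (p.[t] - f t) (f t - q.[t]).
  rewrite addrA subrK (distrC _ (f t)); lra.
have := nm_tri (ev h p) x y; have := nm_tri (ev h q) (ev h p) y.
rewrite (nmBC (ev h q) y); lra.
Qed.

Lemma fc_eq h f x : sa h -> continuous f -> fc_rep h f x -> fc h f = x.
Proof. by move=> sh cf; apply: fc_rep_uniq => //; exact: fcP. Qed.

Lemma fc_poly h p : sa h -> fc h (horner p) = ev h p.
Proof.
move=> sh; apply: fc_eq => //; first exact: continuous_horner.
by move=> e e0; exists p; rewrite subrr nm0 (ltW e0); split=> // t _; rewrite subrr normr0 ltW.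
Qed.

Lemma fc_cst h c : sa h -> fc h (fun=> c) = sc U c.
Proof.
move=> sh; rewrite -(evC h) -fc_poly //; congr (fc _ _).
by apply/funext => t; rewrite hornerC.
Qed.

Lemma fc_id h : sa h -> fc h id = h.
Proof.
move=> sh; rewrite -[RHS]evX -fc_poly //; congr (fc _ _).
by apply/funext => t; rewrite hornerX.
Qed.

Lemma fcD h f g : sa h -> continuous f -> continuous g ->
  fc h (fun t => f t + g t) = fc h f + fc h g.
Proof.
move=> sh cf cg; apply: fc_eq => //; first by move=> t; apply: cvgD; [exact: cf|exact: cg].
move=> e e0; have e2 : 0 < e / 2 by rewrite divr_gt0.
have [p [p1 p2]] := fcP sh cf e2; have [q [q1 q2]] := fcP sh cg e2.
exists (p + q); rewrite evD; split=> [|t th].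
  by have := nmD (fc h f - ev h p) (fc h g - ev h q); rewrite addrACA -opprD; lra.
have := p2 _ th; have := q2 _ th; have := ler_normD (f t - p.[t]) (g t - q.[t]).
by rewrite hornerD addrACA -opprD; lra.
Qed.

Lemma fcM h f g : sa h -> continuous f -> continuous g ->
  fc h (fun t => f t * g t) = fc h f * fc h g.
Proof.
move=> sh cf cg.
have [A A0 fA] := continuous_bounded (nm h) cf.
have [A' A'0 gA] := continuous_bounded (nm h) cg.
(* B bounds the functions, their values at h and, since e' <= 1, the approximating polynomials as
   well; each of the two error terms is then at most e' B <= e/2. *)
pose B := nm (fc h f) + nm (fc h g) + A + A' + 2.
have B2 : 2 <= B by have := nm_ge0 (fc h f); have := nm_ge0 (fc h g); rewrite /B; lra.
apply: fc_eq => //; first by move=> t; apply: cvgM; [exact: cf|exact: cg].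
move=> e e0; pose e' := Num.min 1 (e / (2 * B)).
have e'0 : 0 < e' by rewrite lt_min ltr01 divr_gt0 // mulr_gt0 //; lra.
have e'1 : e' <= 1 by rewrite ge_min lexx.
have e'B : e' * B <= e / 2.
  rewrite -ler_pdivlMr; last by lra.
  by rewrite ge_min; apply/orP; right; rewrite le_eqVlt; apply/orP; left; apply/eqP; field; lra.
have [p [p1 p2]] := fcP sh cf e'0; have [q [q1 q2]] := fcP sh cg e'0.
exists (p * q); rewrite evM; split=> [|t th].
  have -> : fc h f * fc h g - ev h p * ev h q =
    (fc h f - ev h p) * fc h g + ev h p * (fc h g - ev h q) by nring.
  have := nmD ((fc h f - ev h p) * fc h g) (ev h p * (fc h g - ev h q)).
  have h1 := nmM (fc h f - ev h p) (fc h g); have h2 := nmM (ev h p) (fc h g - ev h q).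
  have := nmB (fc h f) (fc h f - ev h p); rewrite opprB addrC subrK => h3.
  have h4 := nm_ge0 (fc h g); have h5 := nm_ge0 (ev h p).
  have h6 : nm (fc h f - ev h p) * nm (fc h g) <= e' * B.
    by apply: ler_pM => //; [exact: nm_ge0|have := nm_ge0 (fc h f); rewrite /B; lra].
  have h7 : nm (ev h p) * nm (fc h g - ev h q) <= B * e'.
    by apply: ler_pM => //; [exact: nm_ge0|rewrite /B; lra].
  lra.
rewrite hornerM.
have -> : f t * g t - p.[t] * q.[t] = f t * (g t - q.[t]) + (f t - p.[t]) * q.[t] by ring.
have := ler_normD (f t * (g t - q.[t])) ((f t - p.[t]) * q.[t]); rewrite !normrM.
have h1 := p2 _ th; have h2 := q2 _ th; have h3 := fA _ th; have h4 := gA _ th.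
have h5 : `|q.[t]| <= B.
  have := ler_normB (g t) (g t - q.[t]); rewrite opprB addrC subrK.
  by have := nm_ge0 (fc h f); have := nm_ge0 (fc h g); rewrite /B; lra.
have h6 : `|f t| * `|g t - q.[t]| <= B * e'.
  apply: ler_pM => //.
  by have := nm_ge0 (fc h f); have := nm_ge0 (fc h g); rewrite /B; lra.
have h7 : `|f t - p.[t]| * `|q.[t]| <= e' * B by apply: ler_pM.
lra.
Qed.

Lemma fcZ h f c : sa h -> continuous f ->
  fc h (fun t => c * f t) = c%:C *: fc h f.
Proof.
move=> sh cf; rewrite (@fcM h (fun=> c)) // ?fc_cst ?scE //.
by move=> t; exact: cvg_cst.
Qed.

Lemma fcB h f g : sa h -> continuous f -> continuous g ->
  fc h (fun t => f t - g t) = fc h f - fc h g.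
Proof.
move=> sh cf cg.
have cNg : continuous (fun t => -1 * g t).
  by move=> t; apply: cvgM; [exact: cvg_cst|exact: cg].
have -> : (fun t => f t - g t) = (fun t => f t + -1 * g t).
  by apply/funext => t; rewrite mulN1r.
by rewrite fcD // fcZ // rmorphN1 scaleN1r.
Qed.

Lemma fc_ext h f g : sa h -> continuous f -> continuous g ->
  (forall t, spec h t -> f t = g t) -> fc h f = fc h g.
Proof.
move=> sh cf cg fg; apply/eqP; rewrite -subr_eq0 -fcB //; apply/eqP/nm_eps => e e0.
apply: fc_norm => // [t|t /fg ->]; first by apply: cvgB; [exact: cf|exact: cg].
by rewrite subrr normr0 ltW.
Qed.

Lemma fc_sa h f : sa h -> continuous f -> sa (fc h f).
Proof.
move=> sh cf; apply/eqP; rewrite -subr_eq0; apply/eqP/nm_eps => e e0.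
have [|p [p1 _]] := fcP sh cf (e := e / 2); first by rewrite divr_gt0.
have := nm_tri (ev h p) (st (fc h f)) (fc h f).
rewrite -{1}(ev_sa p sh) -stB nm_st (nmBC (ev h p)); lra.
Qed.

(** As f 0 = 0, the approximating polynomials can be freed of their constant terms at the price of
    doubling the error. *)
Lemma fc_csub K h f : sa h -> continuous f -> csub K -> K h -> f 0 = 0 ->
  K (fc h f).
Proof.
move=> sh cf cK Kh f0; apply: (csub_clo cK) => e e0.
have [|p [p1 p2]] := fcP sh cf (e := e / 4); first by rewrite divr_gt0.
have p0 : `|p.[0]| <= e / 4.
  by have := p2 0; rewrite normr0 f0 sub0r normrN; apply; exact: nm_ge0.
exists (ev h (p - (p.[0])%:P)).
  by apply: ev_csub => //; rewrite !hornerE subrr.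
rewrite evB evC opprB addrA addrAC.
have := nmD (fc h f - ev h p) (sc U p.[0]); rewrite nm_sc; lra.
Qed.

Lemma fc_comm h f z : sa h -> continuous f -> h * z = z * h ->
  fc h f * z = z * fc h f.
Proof.
move=> sh cf hz; have c1 : continuous (fun t => f t - f 0).
  by move=> t; apply: cvgB; [exact: cf|exact: cvg_cst].
have -> : fc h f = fc h (fun t => f t - f 0) + sc U (f 0).
  by rewrite fcB ?fc_cst ?subrK // => t; exact: cvg_cst.
rewrite mulrDl mulrDr scC; congr (_ + _).
by apply: (fc_csub (K := [set y | y * z = z * y])) => //; [exact: csub_comm|rewrite subrr].
Qed.

End FunctionalCalculus.

(** * Positive elements and positive functionals *)

Section Positivity.
Context (R : realType) (U : ucstarType R).
Implicit Types (x y z h : U) (f g : R -> R) (K : set U).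

Definition psd x := sa x /\ forall t, spec x t -> 0 <= t.

(** Together with [psd_bound] this expresses positivity as a norm inequality, from which stability
    under sums and limits follows by the triangle inequality. *)
Lemma psd_crit x M : sa x -> 0 <= M -> nm (sc U M - x) <= M -> psd x.
Proof.
move=> sx M0 xM; split => // t xt.
have := spec_ev_le (M%:P - 'X) sx xt; rewrite evB evC evX !hornerE => h.
by have := le_trans h xM; rewrite ler_norml; lra.
Qed.

Lemma psd_bound x M : psd x -> nm x <= M -> nm (sc U M - x) <= M.
Proof.
move=> [sx px] xM; rewrite -(evC x) -{2}(evX x) -evB; apply: nm_ev_le => // t xt.
rewrite !hornerE ler_norml; have := px t xt; have := spec_le sx xt.
by have := ler_norm t; lra.
Qed.

Lemma psd_add x y : psd x -> psd y -> psd (x + y).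
Proof.
move=> px py; have sx := px.1; have sy := py.1.
apply: (@psd_crit _ (nm x + nm y)); [exact: saD|by rewrite addr_ge0 // nm_ge0|].
rewrite scD opprD addrACA; apply: le_trans (nmD _ _) _.
by rewrite lerD // psd_bound.
Qed.

Lemma psd_sqr y : sa y -> psd (y * y).
Proof.
move=> sy; apply: (@psd_crit _ (nm y ^+ 2)); first exact: saM.
  by rewrite exprn_ge0 // nm_ge0.
exact: nm_scB_sqr.
Qed.

Lemma psd_fc h f : sa h -> continuous f -> (forall t, spec h t -> 0 <= f t) ->
  psd (fc h f).
Proof.
move=> sh cf f0; apply: (@psd_crit _ (nm (fc h f))); [exact: fc_sa|exact: nm_ge0|].
rewrite -(fc_cst _ sh) -fcB //; [|by cont]; apply: fc_norm => // [|t ht].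
  by cont.
have := fc_ge sh cf ht; have := f0 t ht => ft0; rewrite ger0_norm // => fn.
by rewrite ler_norml; lra.
Qed.

Lemma psd_sqrt x : psd x ->
  exists y, [/\ sa y, x = y * y, nm y ^+ 2 = nm x & forall K, csub K -> K x -> K y].
Proof.
move=> [sx px]; exists (fc x Num.sqrt).
have cs : continuous (Num.sqrt : R -> R) by exact: sqrt_continuous.
have sy : sa (fc x Num.sqrt) by exact: fc_sa.
have xE : x = fc x Num.sqrt * fc x Num.sqrt.
  rewrite -fcM // -{1}(fc_id sx); apply: fc_ext => // [||t /px t0].
  - by cont.
  - by cont.
  - by rewrite -expr2 sqr_sqrtr.
split => // [|K cK Kx]; first by rewrite -nm_sqr // expr2 -xE.
by apply: fc_csub => //; rewrite sqrtr0.
Qed.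

(** If v inverts x y - t, then t^-1 (y v x - 1) inverts y x - t. *)
Lemma invt_swap x y t : t != 0 -> invt (x * y - sc U t) -> invt (y * x - sc U t).
Proof.
move=> t0 [v [v1 v2]].
have tt : sc U t * sc U t^-1 = 1 by rewrite -scM mulfV // sc1.
have tt' : sc U t^-1 * sc U t = 1 by rewrite -scM mulVf // sc1.
set s := sc U t in v1 v2 tt tt' *; set s' := sc U t^-1 in tt tt' *.
have ys : y * s = s * y by exact: scC.
exists (s' * (y * v * x - 1)); split.
  have -> : (y * x - s) * (s' * (y * v * x - 1)) = s' * ((y * x - s) * (y * v * x - 1)).
    by rewrite !mulrA; congr (_ * _); rewrite /s' scC.
  have -> : (y * x - s) * (y * v * x - 1) =
     y * ((x * y) * v) * x - s * y * v * x - y * x + s by nring.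
  have -> : (x * y) * v = 1 + s * v by rewrite -v1; nring.
  have -> : y * (1 + s * v) * x - s * y * v * x - y * x + s =
     y * s * v * x - s * y * v * x + s by nring.
  by rewrite ys subrr add0r.
have xs : x * s = s * x by exact: scC.
rewrite -mulrA.
have -> : (y * v * x - 1) * (y * x - s) =
   y * (v * (x * y)) * x - y * v * (x * s) - y * x + s by nring.
have -> : v * (x * y) = 1 + v * s by rewrite -v2; nring.
have -> : y * (1 + v * s) * x - y * v * (x * s) - y * x + s =
   y * v * (s * x) - y * v * (x * s) + s by nring.
by rewrite xs subrr add0r.
Qed.

Lemma psdN_spec x t : psd (- x) -> spec x t -> t <= 0.
Proof.
move=> pN xt; have sx : sa x by have := pN.1 => /saN; rewrite opprK.
have := psd_bound pN (lexx _); have := spec_ev_le ((nm (- x))%:P + 'X) sx xt.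
rewrite evD evC evX opprK !hornerE => h1 h2.
by have := le_trans h1 h2; rewrite ler_norml; lra.
Qed.

Lemma nm_spec0 x : sa x -> (forall t, spec x t -> t = 0) -> x = 0.
Proof.
move=> sx x0; apply/nm_eq0/eqP; rewrite eq_le nm_ge0 andbT.
rewrite -(evX x); apply: nm_ev_le => // t /x0 ->.
by rewrite hornerX normr0.
Qed.

Lemma complex_half : (2^-1)%:C + (2^-1)%:C = 1 :> R[i].
Proof. by rewrite -rmorphD /= (_ : 2^-1 + 2^-1 = 1 :> R) ?rmorph1 //; field. Qed.

Definition rpart x := (2^-1)%:C *: (x + st x).
Definition ipart x := (2^-1)%:C *: ((- 'i) *: (x - st x)).

Lemma ri_partE x : x = rpart x + 'i *: ipart x.
Proof.
rewrite /rpart /ipart !scalerA [X in _ + X *: _](_ : _ = (2^-1)%:C); last first.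
  by apply/eqP; rewrite eq_complex /=; apply/andP; split; apply/eqP; ring.
by rewrite -scalerDr addrACA subrr addr0 scalerDr -scalerDl complex_half scale1r.
Qed.

Lemma rpart_sa x : sa (rpart x).
Proof. by rewrite /rpart; apply: saZ; rewrite /sa stD stK addrC. Qed.

Lemma ipart_sa x : sa (ipart x).
Proof.
rewrite /ipart; apply: saZ; rewrite /sa stZ [X in X *: _](_ : _ = 'i); last first.
  by apply/eqP; rewrite eq_complex /= oppr0 opprK !eqxx.
rewrite stB stK.
by rewrite scaleNr -scalerN opprB.
Qed.

Lemma normc_i : normc ('i : R[i]) = 1.
Proof. by rewrite /= expr0n /= add0r expr1n sqrtr1. Qed.

Lemma normcNi : normc (- 'i : R[i]) = 1.
Proof. by rewrite /= oppr0 expr0n /= add0r sqrrN expr1n sqrtr1. Qed.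

Lemma nm_rpart x : nm (rpart x) <= nm x.
Proof.
rewrite /rpart nmZr ger0_norm ?invr_ge0 //; have := nmD x (st x).
by rewrite nm_st; lra.
Qed.

Lemma nm_ipart x : nm (ipart x) <= nm x.
Proof.
rewrite /ipart nmZr nmZ normcNi mul1r ger0_norm ?invr_ge0 //.
by have := nmB x (st x); rewrite nm_st; lra.
Qed.

Lemma sqr_i x : ('i *: x) * ('i *: x) = - (x * x).
Proof.
rewrite -scalerAl -scalerAr scalerA (_ : 'i * 'i = -1) ?scaleN1r //.
by apply/eqP; rewrite eq_complex /= !mulr0 !mul0r !mulr1 sub0r addr0 oppr0 !eqxx.
Qed.

Lemma cstar_ri x : st x * x + x * st x =
  2%:C *: (rpart x * rpart x + ipart x * ipart x).
Proof.
set c := rpart x; set d := ipart x; set w := 'i *: d.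
have xE : x = c + w by exact: ri_partE.
have sxE : st x = c - w.
  rewrite xE stD (rpart_sa x) /w stZ (ipart_sa x) -scaleNr; congr (_ + _ *: _).
  by apply/eqP; rewrite eq_complex /= oppr0 !eqxx.
have ww : d * d = - (w * w) by rewrite /w sqr_i opprK.
rewrite sxE {1 2}xE ww (_ : 2%:C = 1 + 1) ?scalerDl ?scale1r; last first.
  by rewrite -[2]/(1 + 1) rmorphD /= rmorph1.
by nring.
Qed.

Lemma psd_scale (c : R) x : 0 <= c -> psd x -> psd (c%:C *: x).
Proof.
move=> c0 /psd_sqrt[y [sy -> _ _]].
have -> : c%:C *: (y * y) = ((Num.sqrt c)%:C *: y) * ((Num.sqrt c)%:C *: y).
  by rewrite -scalerAl -scalerAr scalerA -rmorphM /= -(expr2 (Num.sqrt c)) sqr_sqrtr.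
by apply/psd_sqr/saZ.
Qed.

(* Kelley-Vaught: if b is the negative part of x^*x, then (xb)^*(xb) = - b^3,
   while (xb)^*(xb) and (xb)(xb)^* have the same nonzero spectrum and a
   nonnegative sum; so b = 0. *)
Theorem psd_cstar x : psd (st x * x).
Proof.
set h := st x * x; have sh : sa h by exact: sa_cstar.
split=> // t0 ht0; rewrite leNgt; apply/negP => t0N.
pose n (t : R) := Num.max (- t) 0.
have cn : continuous n.
  by rewrite /n; cont.
have n0 t : 0 <= n t by rewrite le_max lexx orbT.
set b := fc h n; have sb : sa b by exact: fc_sa.
pose y := x * b.
pose n3 (t : R) := n t * t * n t.
have cnt : continuous (fun t => n t * t) by cont.
have cn3 : continuous n3 by rewrite /n3; cont.
have yE : st y * y = fc h n3.
  by rewrite fcM // fcM ?fc_id //; [rewrite -/b /y stM sb /h !mulrA|cont].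
have n3E t : n3 t <= 0 /\ (t < 0 -> n3 t < 0).
  rewrite /n3 /n; case: (ltP (- t) 0) => [tn|tp]; first by rewrite !mulr0; split=> //; lra.
  by split=> [|t0']; [nra|rewrite mulrAC -expr2 pmulr_rlt0 // exprn_gt0 //; lra].
have pN : psd (- (st y * y)).
  have -> : - (st y * y) = fc h (fun t => 0 - n3 t).
    by rewrite fcB ?fc_cst ?sc0 ?sub0r ?yE //; cont.
  apply: psd_fc => // [|t _]; first by cont.
  by have := (n3E t).1; lra.
have pyy : psd (y * st y).
  have -> : y * st y = 2%:C *: (rpart y * rpart y + ipart y * ipart y) + - (st y * y).
    by rewrite -cstar_ri addrAC subrr add0r.
  apply: psd_add => //; apply: psd_scale => //.
  by apply: psd_add; apply: psd_sqr; [exact: rpart_sa|exact: ipart_sa].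
have y0 : st y * y = 0.
  apply: nm_spec0 => [|t yt]; first exact: sa_cstar.
  apply/eqP; apply: contrapT => /negP t1.
  have tle := psdN_spec pN yt.
  have : 0 <= t by apply: pyy.2 => inv; apply: yt; apply: invt_swap.
  by move=> tge; move: t1; rewrite eq_le tle tge.
have := fc_ge sh cn3 ht0; rewrite -yE y0 nm0 normr_le0 => /eqP.
by have := (n3E t0).2 t0N; lra.
Qed.

Lemma psd_nm_sub x : psd (sc U (nm x ^+ 2) - st x * x).
Proof.
have px := psd_cstar x; have sx := px.1.
have x2 : 0 <= nm x ^+ 2 by rewrite exprn_ge0 // nm_ge0.
apply: (@psd_crit _ (nm x ^+ 2)) => //; first by apply: saB => //; exact: sa_sc.
by rewrite opprB addrC subrK nm_cstar.
Qed.

Lemma psd_lim x : sa x -> (forall e : R, 0 < e -> exists2 y, psd y & nm (x - y) < e) ->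
  psd x.
Proof.
move=> sx xl; apply: (@psd_crit _ (nm x + 1)) => //.
  by have := nm_ge0 x; lra.
apply/ler_addgt0Pr => e e0.
have [|y py xy] := xl (Num.min e 1); first by rewrite lt_min e0 ltr01.
move: xy; rewrite lt_min => /andP[xe x1].
have := nmB x (x - y); rewrite opprB addrC subrK => h.
have := psd_bound py (M := nm x + 1) ltac:(lra).
by have := nm_tri y (sc U (nm x + 1)) x; rewrite (nmBC y x); lra.
Qed.

(** Take a = g (x * st x) with g(t) = min (1, |t| / e^2): then (1 - g(t))^2 t <= e^2 for t >= 0, and
    this function of x * st x is the one whose norm is nm (x - a x)^2. As g 0 = 0, a lies in every
    [csub] containing x * st x. *)
Lemma approx_unit1 x (e : R) : 0 < e ->
  exists a, [/\ sa a, nm a <= 1, nm (x - a * x) <= e &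
    forall K, csub K -> K (x * st x) -> K a].
Proof.
move=> e0; set h := x * st x.
have ph : psd h by have := psd_cstar (st x); rewrite stK.
have sh := ph.1; have e2 : 0 < e ^+ 2 by rewrite exprn_gt0.
pose g (t : R) := Num.min 1 (`|t| / e ^+ 2).
have cg : continuous g.
  by rewrite /g; cont.
have g0 t : 0 <= g t <= 1.
  by rewrite /g le_min ler01 divr_ge0 ?(ltW e2)//= ge_min lexx.
exists (fc h g); have sg : sa (fc h g) by exact: fc_sa.
split => // [||K cK Kh].
- by apply: fc_norm => // t _; have /andP[g1 g2] := g0 t; rewrite ger0_norm.
- rewrite -(@ler_pXn2r _ 2) ?nnegrE ?nm_ge0 ?(ltW e0)// -nm_st -nm_cstar stK.
  have -> : (x - fc h g * x) * st (x - fc h g * x) =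
      h - fc h g * h - h * fc h g + fc h g * h * fc h g.
    by rewrite stB stM sg /h; nring.
  have -> : h - fc h g * h - h * fc h g + fc h g * h * fc h g =
      fc h (fun t => t - g t * t - t * g t + g t * t * g t).
    by rewrite fcD; [rewrite fcB; [rewrite fcB; [rewrite !fcM|..]|..]|..]; rewrite ?fc_id //; cont.
  apply: fc_norm => // [|t /(ph.2) t0]; first by cont.
  have -> : t - g t * t - t * g t + g t * t * g t = (1 - g t) ^+ 2 * t by ring.
  rewrite ger0_norm; last exact: (mulr_ge0 (sqr_ge0 _) t0).
  rewrite /g ger0_norm //; case: (leP 1 (t / e ^+ 2)) => [_|].
    by rewrite subrr expr0n mul0r ltW.
  rewrite ltr_pdivrMr // mul1r => te; apply: le_trans (ltW te).
  rewrite ler_piMl // exprn_ile1 //.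
    by rewrite subr_ge0 ler_pdivrMr // mul1r ltW.
  by rewrite gerBl divr_ge0 // ltW.
- apply: fc_csub => //; rewrite /g normr0 mul0r.
  by apply/eqP; rewrite eq_le ge_min lexx orbT le_min ler01 lexx.
Qed.

End Positivity.

(** * Positive functionals: Cauchy-Schwarz and automatic continuity *)

Section PositiveFunctionals.
Context (R : realType) (U : ucstarType R) (K : set U).
Hypotheses (cK : csub K) (stK' : forall x, K x -> K (st x)).
Implicit Types (x y z h : U) (F : {scalar U}).

Definition pos_on (F : {scalar U}) := forall x, K x -> 0 <= F (st x * x).

(** The square of the GNS seminorm of F, as a real number. *)
Definition qf (F : {scalar U}) x : R := complex.Re (F (st x * x)).

Lemma ge0_complex (z : R[i]) : 0 <= z -> z = (complex.Re z)%:C /\ 0 <= complex.Re z.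
Proof. by case: z => a b; rewrite lecE /= => /andP[/eqP -> ->]. Qed.

Lemma qf_ge0 F x : pos_on F -> K x -> 0 <= qf F x.
Proof. by move=> pF Kx; case/ge0_complex: (pF x Kx). Qed.

Lemma qfE F x : pos_on F -> K x -> F (st x * x) = (qf F x)%:C.
Proof. by move=> pF Kx; case/ge0_complex: (pF x Kx). Qed.

Lemma qf_polar F (a : R[i]) x y : F (st (x + a *: y) * (x + a *: y)) =
  F (st x * x) + a * F (st x * y) + a^* * F (st y * x) + (a^* * a) * F (st y * y).
Proof.
rewrite stD stZ mulrDl !mulrDr !linearD /= -!scalerAl -!scalerAr !scalarZ !addrA.
by [].
Qed.

Lemma F_herm F x y : pos_on F -> K x -> K y -> F (st y * x) = (F (st x * y))^*.
Proof.
move=> pF Kx Ky.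
have K1 : K (x + 1 *: y) by apply: (csubD cK) => //; apply: (csubZ cK).
have K2 : K (x + 'i *: y) by apply: (csubD cK) => //; apply: (csubZ cK).
have := pF _ K1; have := pF _ K2; rewrite !qf_polar !qfE // !lecE.
case: (F (st x * y)) => a b; case: (F (st y * x)) => c d /=.
move=> /andP[/eqP h1 _] /andP[/eqP h2 _].
by apply/eqP; rewrite eq_complex /=; apply/andP; split; apply/eqP; lra.
Qed.

(** Discriminant argument with B = |b|^2: the quadratic polynomial in s is the form at x - s b y.
    Take s = 1/C, or a large s if C = 0. *)
Lemma disc_le (A B C : R) : 0 <= A -> 0 <= B -> 0 <= C ->
  (forall s : R, 0 <= A - 2 * s * B + s ^+ 2 * B * C) -> B <= A * C.
Proof.
move=> A0 B0 C0 h; have [C1|C1] := eqVneq C 0.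
  rewrite C1 mulr0; have [B1|B1] := eqVneq B 0; first by rewrite B1.
  have Bp : 0 < B by rewrite lt_def B1.
  have := h ((A + 1) / B); rewrite C1 mulr0 addr0.
  have -> : 2 * ((A + 1) / B) * B = 2 * (A + 1) by field.
  lra.
have Cp : 0 < C by rewrite lt_def C1.
have := h C^-1.
have -> : A - 2 * C^-1 * B + C^-1 ^+ 2 * B * C = A - B / C by field.
by rewrite subr_ge0 ler_pdivrMr.
Qed.

Lemma normc2E (z : R[i]) : (normc z ^+ 2)%:C = z^* * z.
Proof.
case: z => a b; rewrite /= sqr_sqrtr ?addr_ge0 ?sqr_ge0 //.
by apply/eqP; rewrite eq_complex /=; apply/andP; split; apply/eqP; ring.
Qed.

Lemma cauchy_schwarz F x y : pos_on F -> K x -> K y ->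
  normc (F (st y * x)) ^+ 2 <= qf F x * qf F y.
Proof.
move=> pF Kx Ky; apply: disc_le; rewrite ?qf_ge0 ?sqr_ge0 // => s.
set b := F (st y * x).
have Kz : K (x + (- s%:C * b) *: y) by apply: (csubD cK) => //; apply: (csubZ cK).
have := pF _ Kz; rewrite qf_polar !qfE // (F_herm pF Ky Kx) -/b.
clear Kz; case: b => a b; rewrite lecE /= sqr_sqrtr; last by rewrite addr_ge0 // sqr_ge0.
move=> /andP[_]; congr (_ <= _); ring.
Qed.

Lemma qf_null F x y : pos_on F -> K x -> K y -> qf F y = 0 -> F (st y * x) = 0.
Proof.
move=> pF Kx Ky y0; apply: eq0_normc; apply/eqP; rewrite -sqrf_eq0 eq_le sqr_ge0 andbT.
by have := cauchy_schwarz pF Kx Ky; rewrite y0 mulr0.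
Qed.

Lemma psd_pos F x : pos_on F -> K x -> psd x -> 0 <= F x.
Proof.
by move=> pF Kx /psd_sqrt[y [sy xE _ yK]]; have := pF y (yK _ cK Kx); rewrite sy -xE.
Qed.

Lemma ReD (a b : R[i]) : complex.Re (a + b) = complex.Re a + complex.Re b.
Proof. by case: a; case: b. Qed.
Lemma ReN (a : R[i]) : complex.Re (- a) = - complex.Re a.
Proof. by case: a. Qed.
Lemma Re_scale (t : R) (a : R[i]) : complex.Re (t%:C * a) = t * complex.Re a.
Proof. by case: a => a b /=; rewrite mul0r subr0. Qed.

(** Otherwise there are x_n in the unit ball of K with F (st x_n * x_n) >= 4^n. The sum b of the
    2^-n st x_n * x_n converges in K and dominates each of its terms, so F b >= 2^n for all n. *)
Theorem pos_bounded F : pos_on F ->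
  exists2 M, 0 <= M & forall x, K x -> qf F x <= M * nm x ^+ 2.
Proof.
move=> pF; apply: contrapT => nM.
have /choice[x xP] (n : nat) : exists x, [/\ K x, nm x <= 1 & 4 ^+ n <= qf F x].
  apply: contrapT => nx; apply: nM; exists (4 ^+ n); first by rewrite exprn_ge0.
  move=> x Kx; have [x0|x0] := eqVneq (nm x) 0.
    by rewrite (nm_eq0 _ x0) /qf mulr0 linear0 nm0 expr0n mulr0.
  have xp : 0 < nm x by rewrite lt_def x0 nm_ge0.
  rewrite leNgt; apply/negP => lt; apply: nx.
  exists ((nm x)^-1%:C *: x); split; first exact: (csubZ cK).
    by rewrite nmZr ger0_norm ?invr_ge0 ?(ltW xp)// mulVf.
  rewrite /qf stZr -scalerAl -scalerAr scalerA -rmorphM /= scalarZ Re_scale.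
  rewrite -/(qf F x) -expr2 exprVn mulrC ler_pdivlMr ?exprn_gt0 //.
  exact: ltW.
pose a n := st (x n) * x n.
pose u (n : nat) : U := \sum_(k < n) (2^-1 ^+ k)%:C *: a k.
have r0 n : 0 < 2^-1 ^+ n :> R by rewrite exprn_gt0 // invr_gt0.
have Ka n : K (a n) by have [Kx _ _] := xP n; apply: (csubM cK) => //; exact: stK'.
have [||n|b ub] := @geom_limit _ _ u 1 2^-1.
- by [].
- by rewrite invr_ge0 ler0n /=; lra.
- rewrite /u big_ord_recr /= addrAC subrr add0r nmZr ger0_norm ?(ltW (r0 n))//.
  rewrite mul1r ler_piMr ?(ltW (r0 n))// /a nm_cstar.
  have [_ x1 _] := xP n.
  by rewrite -[leRHS](expr1n _ 2) ler_pXn2r ?nnegrE ?nm_ge0.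
have small e : 0 < e -> exists N, forall n, (N <= n)%N -> nm (u n - b) < e.
  move=> e0.
  have /cvgrPdist_lt/(_ e e0)[N _ Nn] : (fun n => 2 * 2^-1 ^+ n : R) @ \oo --> (0 : R).
    rewrite -[X in _ --> X](mulr0 2).
    by apply: cvgM; [exact: cvg_cst|apply: cvg_expr; rewrite ger0_norm ?invr_ge0 //; lra].
  exists N => n /Nn; rewrite /= sub0r normrN ger0_norm //; apply: le_lt_trans.
  apply: le_trans (ub n) _; rewrite (_ : 1 / (1 - 2^-1) = 2 :> R) //.
  by rewrite (_ : 1 - 2^-1 = 2^-1 :> R); [rewrite invrK mul1r|field].
have Ku n : K (u n) by apply: (csub_sum cK) => k _; apply: (csubZ cK).
have Kb : K b.
  apply: (csub_clo cK) => e /small[N Ne]; exists (u N) => //.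
  by rewrite nmBC; exact: Ne.
have pa n : psd ((2^-1 ^+ n)%:C *: a n).
  by apply: psd_scale; [exact: ltW (r0 n)|exact: psd_cstar].
have p0 : psd (0 : U) by rewrite -(mulr0 0); apply: psd_sqr; exact: sa0.
have psum n m : (n < m)%N -> psd (u m - (2^-1 ^+ n)%:C *: a n).
  move=> nm'; rewrite /u (bigD1 (Ordinal nm')) //= addrAC subrr add0r.
  by apply: big_ind => // y z; exact: psd_add.
have sb : sa b.
  apply/eqP; rewrite -subr_eq0; apply/eqP/nm_eps => e e0.
  have [|N Ne] := small (e / 2); first by rewrite divr_gt0.
  have su : sa (u N).
    by rewrite /u /sa st_sum; apply: eq_bigr => k _; exact: (pa k).1.
  have := Ne N (leqnn N); have := nm_tri (u N) (st b) b.
  by rewrite -{1}su -stB nm_st (nmBC b); lra.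
have pb n : psd (b - (2^-1 ^+ n)%:C *: a n).
  apply: psd_lim; first by apply: saB => //; exact: (pa n).1.
  move=> e /small[N Ne]; exists (u (maxn N n.+1) - (2^-1 ^+ n)%:C *: a n).
    by apply: psum; exact: leq_maxr.
  rewrite opprB addrA subrK nmBC; apply: Ne; exact: leq_maxl.
have Fb n : 2 ^+ n <= complex.Re (F b).
  have : 0 <= F (b - (2^-1 ^+ n)%:C *: a n).
    by apply: psd_pos => //; apply: (csubB cK) => //; exact: (csubZ cK).
  move=> /ge0_complex[_]; rewrite linearB scalarZ ReD ReN Re_scale -/(qf F (x n)).
  rewrite subr_ge0; apply: le_trans; have [_ _ x4] := xP n.
  rewrite -(ler_wpM2l (ltW (r0 n))) in x4 || idtac.
  apply: (@le_trans _ _ (2^-1 ^+ n * 4 ^+ n)); last by rewrite ler_wpM2l // ltW.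
  by rewrite -exprMn (_ : 2^-1 * 4 = 2 :> R) //; field.
have [n nb] : exists n : nat, complex.Re (F b) < n%:R.
  by exists (Num.truncn (complex.Re (F b))).+1; exact: truncnS_gt.
have := Fb n; rewrite leNgt => /negP; apply; apply: lt_trans nb _.
by rewrite -natrX ltr_nat ltn_expl.
Qed.

(** A self-adjoint x is y y - z z with y and z the square roots of its positive and negative parts,
    and real and imaginary parts reduce to this case. For the second bound an approximate unit a
    takes the place of 1: F x is close to F (a x), and Cauchy-Schwarz applies with qf F a <= M. *)
Lemma pos_cont_bound F M : pos_on F -> 0 <= M ->
  (forall x, K x -> qf F x <= M * nm x ^+ 2) -> forall x, K x ->
  normc (F x) <= 4 * M * nm x /\ normc (F x) ^+ 2 <= M * qf F x.
Proof.
move=> pF M0 FM; have Fsa x : K x -> sa x -> normc (F x) <= 2 * M * nm x.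
  move=> Kx sx.
  have cp : continuous (fun t : R => Num.sqrt (Num.max t 0)) by cont.
  have cn : continuous (fun t : R => Num.sqrt (Num.max (- t) 0)) by cont.
  set y := fc x (fun t : R => Num.sqrt (Num.max t 0)).
  set z := fc x (fun t : R => Num.sqrt (Num.max (- t) 0)).
  have sy : sa y by exact: fc_sa.
  have sz : sa z by exact: fc_sa.
  have Ky : K y by apply: fc_csub => //; rewrite maxxx sqrtr0.
  have Kz : K z by apply: fc_csub => //; rewrite oppr0 maxxx sqrtr0.
  have xE : x = st y * y - st z * z.
    rewrite sy sz -!fcM // -fcB; [|by cont..]; rewrite // -{1}(fc_id sx).
    apply: fc_ext => //; [by cont..|move=> t _].
    rewrite -!expr2 !sqr_sqrtr ?le_max ?lexx ?orbT //.
    by case: (leP t 0); case: (leP (- t) 0); lra.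
  have yn : nm y ^+ 2 <= nm x.
    rewrite -nm_cstar sy -fcM //; apply: fc_norm => //; first by cont.
    move=> t /(spec_le sx); rewrite -expr2 sqr_sqrtr ?le_max ?lexx ?orbT //.
    by case: (leP t 0) => // _ _; rewrite normr0 nm_ge0.
  have zn : nm z ^+ 2 <= nm x.
    rewrite -nm_cstar sz -fcM //; apply: fc_norm => //; first by cont.
    move=> t /(spec_le sx); rewrite -expr2 sqr_sqrtr ?le_max ?lexx ?orbT //.
    by rewrite -normrN; case: (leP (- t) 0) => // _ _; rewrite normr0 nm_ge0.
  rewrite xE linearB; apply: le_trans (le_normcD _ _) _.
  rewrite normcN !qfE // !normc_real !ger0_norm ?qf_ge0 //.
  have := FM _ Ky; have := FM _ Kz; have := ler_wpM2l M0 yn; have := ler_wpM2l M0 zn.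
  rewrite -xE; lra.
have FK x : K x -> normc (F x) <= 4 * M * nm x.
  move=> Kx.
  have -> : F x = F (rpart x) + 'i * F (ipart x).
    by rewrite {1}(ri_partE x); move: (rpart x) (ipart x) => c d; rewrite linearD scalarZ.
  apply: le_trans (le_normcD _ _) _; rewrite normcM normc_i mul1r.
  have Kr : K (rpart x) by apply/(csubZ cK)/(csubD cK) => //; exact: stK'.
  have Ki : K (ipart x) by apply/(csubZ cK)/(csubZ cK)/(csubB cK) => //; exact: stK'.
  have := Fsa _ Kr (rpart_sa x); have := Fsa _ Ki (ipart_sa x).
  have := ler_wpM2l M0 (nm_rpart x); have := ler_wpM2l M0 (nm_ipart x); lra.
move=> x Kx; split; first exact: FK.
rewrite -[leRHS]sqr_sqrtr ?mulr_ge0 ?qf_ge0 // ler_pXn2r ?nnegrE ?sqrtr_ge0 //; last first.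
  by case: (F x) => a b; exact: sqrtr_ge0.
apply/ler_addgt0Pr => e e0; have M4 : 0 < 4 * M + 1 by lra.
have [a [sa_a a1 ax aK]] := approx_unit1 x (divr_gt0 e0 M4).
have Ka : K a by apply: aK => //; apply: (csubM cK) => //; exact: stK'.
have Kax : K (a * x) by exact: (csubM cK).
have -> : F x = F (x - a * x) + F (st a * x) by rewrite sa_a -linearD subrK.
apply: le_trans (le_normcD _ _) _; rewrite addrC lerD //.
  rewrite -(@ler_pXn2r _ 2) ?nnegrE ?sqrtr_ge0 //; last first.
    by case: (F (st a * x)) => b c; exact: sqrtr_ge0.
  rewrite sqr_sqrtr ?mulr_ge0 ?qf_ge0 //; apply: le_trans (cauchy_schwarz pF Kx Ka) _.
  rewrite mulrC ler_wpM2r ?qf_ge0 //; apply: le_trans (FM _ Ka) _.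
  by rewrite ler_piMr // -[leRHS](expr1n _ 2) ler_pXn2r ?nnegrE ?nm_ge0.
apply: le_trans (FK _ (csubB cK Kx Kax)) _.
apply: (@le_trans _ _ ((4 * M + 1) * nm (x - a * x))).
  by rewrite ler_wpM2r ?nm_ge0 //; lra.
by rewrite mulrC -ler_pdivlMr.
Qed.

Lemma pos_cont F : pos_on F -> exists2 M, 0 <= M &
  forall x, K x -> [/\ qf F x <= M * nm x ^+ 2, normc (F x) <= M * nm x
    & normc (F x) ^+ 2 <= M * qf F x].
Proof.
move=> pF; have [M M0 FM] := pos_bounded pF.
exists (4 * M); first by lra.
move=> x Kx; have [h1 h2] := pos_cont_bound pF M0 FM Kx; split=> //.
  by apply: le_trans (FM _ Kx) _; rewrite ler_wpM2r ?exprn_ge0 ?nm_ge0 //; lra.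
by apply: le_trans h2 _; rewrite ler_wpM2r ?qf_ge0 //; lra.
Qed.

End PositiveFunctionals.

(** * The unitization *)

Section RealNorm.
Context (R : realType) (A : cstarAlgType R).
Implicit Types (x y : A) (a : R[i]).

Definition na x : R := complex.Re `|x|.

Lemma naE x : `|x| = (na x)%:C.
Proof.
by have := normr_ge0 x; rewrite /na; case: `|x| => r s; rewrite lecE /= => /andP[/eqP -> _].
Qed.

Lemma na_ge0 x : 0 <= na x.
Proof. by have := normr_ge0 x; rewrite naE lecE /= => /andP[]. Qed.

Lemma na_eq0 x : na x = 0 -> x = 0.
Proof. by move=> x0; apply/eqP; rewrite -normr_eq0 naE x0. Qed.

Lemma na0 : na 0 = 0. Proof. by rewrite /na normr0. Qed.

Lemma naD x y : na (x + y) <= na x + na y.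
Proof. by have := ler_normD x y; rewrite !naE -rmorphD lecR. Qed.

Lemma naZ a x : na (a *: x) = normc a * na x.
Proof.
have := normrZ a x; rewrite !naE -[`|a|]/((normc a)%:C) -rmorphM /=.
by case.
Qed.

Lemma naN x : na (- x) = na x.
Proof. by rewrite /na normrN. Qed.

Lemma naM x y : na (cmul x y) <= na x * na y.
Proof. by have := norm_cmul x y; rewrite !naE -rmorphM lecR. Qed.

Lemma na_cstar x : na (cmul (star x) x) = na x ^+ 2.
Proof. by have := norm_cstar x; rewrite !naE -rmorphXn /=; case. Qed.

Lemma star0 : star (0 : A) = 0.
Proof. by apply: (addrI (star 0)); rewrite -starD !addr0. Qed.

Lemma cmul0l x : cmul 0 x = 0.
Proof. by apply: (addrI (cmul 0 x)); rewrite -cmulDl !addr0. Qed.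

Lemma cmul0r x : cmul x 0 = 0.
Proof. by apply: (addrI (cmul x 0)); rewrite -cmulDr !addr0. Qed.

Lemma na_star x : na (star x) = na x.
Proof.
suff le y : na y <= na (star y).
  by apply/eqP; rewrite eq_le le andbT -{2}(starK x) le.
have [->|y0] := eqVneq (na y) 0; first exact: na_ge0.
have {}y0 : 0 < na y by rewrite lt_def y0 na_ge0.
by rewrite -(ler_pM2r y0) -expr2 -na_cstar naM.
Qed.

Lemma na_complete (u : nat -> A) :
  (forall e : R, 0 < e -> exists N : nat, forall m n : nat,
     (N <= m)%N -> (N <= n)%N -> na (u m - u n) < e) ->
  exists l : A, forall e : R, 0 < e -> exists N : nat, forall n : nat,
    (N <= n)%N -> na (u n - l) < e.
Proof.
move=> uC.
have cu : cauchy (u @ \oo).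
  apply/cauchy_ballP => e e0.
  have [eE e0'] : e = (complex.Re e)%:C /\ 0 < complex.Re e.
    by move: e0; case: (e) => r s; rewrite ltcE /= => /andP[/eqP -> ->].
  have [N Nu] := uC _ e0'.
  exists (u @` [set n | (N <= n)%N], u @` [set n | (N <= n)%N]) => /=.
    by split; exists N => // n Nn; exists n.
  by move=> [_ _] [[m Nm <-] [n Nn <-]]; rewrite -ball_normE /= naE eE ltcR; exact: Nu.
have /cvg_ex[l ul] : cvgn u by exact: cauchy_cvg.
exists l => e e0.
have e0C : 0 < e%:C by rewrite ltcR.
have /cvgrPdist_lt/(_ _ e0C)[N _ Nl] := ul.
by exists N => n /Nl /=; rewrite naE ltcR -naN opprB.
Qed.

End RealNorm.

Section ComplexComplete.
Context (R : realType).

Lemma normc_Re (z : R[i]) : `|complex.Re z| <= normc z.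
Proof.
by case: z => a b /=; rewrite -sqrtr_sqr ler_wsqrtr // lerDl sqr_ge0.
Qed.

Lemma normc_Im (z : R[i]) : `|complex.Im z| <= normc z.
Proof.
by case: z => a b /=; rewrite -sqrtr_sqr ler_wsqrtr // lerDr sqr_ge0.
Qed.

Lemma normc_le_ReIm (z : R[i]) : normc z <= `|complex.Re z| + `|complex.Im z|.
Proof.
case: z => a b /=; rewrite -[leRHS]ger0_norm ?addr_ge0 // -[leRHS]sqrtr_sqr ler_wsqrtr //.
rewrite sqrrD !real_normK ?num_real // lerD2r lerDl.
by rewrite mulrn_wge0 // mulr_ge0.
Qed.

Lemma normc_ge0 (z : R[i]) : 0 <= normc z.
Proof. by case: z => a b; exact: sqrtr_ge0. Qed.

Lemma real_complete (u : nat -> R) :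
  (forall e : R, 0 < e -> exists N : nat, forall m n : nat,
     (N <= m)%N -> (N <= n)%N -> `|u m - u n| < e) ->
  exists l : R, forall e : R, 0 < e -> exists N : nat, forall n : nat,
    (N <= n)%N -> `|u n - l| < e.
Proof.
move=> uC.
have cu : cauchy (u @ \oo).
  apply/cauchy_ballP => e e0.
  have [N Nu] := uC _ e0.
  exists (u @` [set n | (N <= n)%N], u @` [set n | (N <= n)%N]) => /=.
    by split; exists N => // n Nn; exists n.
  by move=> [_ _] [[m Nm <-] [n Nn <-]]; rewrite /ball /=; exact: Nu.
have /cvg_ex[l ul] : cvgn u by exact: cauchy_cvg.
exists l => e e0; have /cvgrPdist_lt/(_ _ e0)[N _ Nl] := ul.
by exists N => n /Nl /=; rewrite distrC.
Qed.

Lemma complex_complete (u : nat -> R[i]) :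
  (forall e : R, 0 < e -> exists N : nat, forall m n : nat,
     (N <= m)%N -> (N <= n)%N -> normc (u m - u n) < e) ->
  exists l : R[i], forall e : R, 0 < e -> exists N : nat, forall n : nat,
    (N <= n)%N -> normc (u n - l) < e.
Proof.
move=> uC.
have ReB (a b : R[i]) : complex.Re (a - b) = complex.Re a - complex.Re b by case: a; case: b.
have ImB (a b : R[i]) : complex.Im (a - b) = complex.Im a - complex.Im b by case: a; case: b.
have [|a ua] := @real_complete (fun n => complex.Re (u n)).
  move=> e /uC[N Nu]; exists N => m n Nm Nn; rewrite -ReB.
  by apply: le_lt_trans (normc_Re _) _; exact: Nu.
have [|b ub] := @real_complete (fun n => complex.Im (u n)).
  move=> e /uC[N Nu]; exists N => m n Nm Nn; rewrite -ImB.
  by apply: le_lt_trans (normc_Im _) _; exact: Nu.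
exists (a +i* b) => e e0; have e2 : 0 < e / 2 by rewrite divr_gt0.
have [N Na] := ua _ e2; have [M Mb] := ub _ e2.
exists (maxn N M) => n; rewrite geq_max => /andP[Nn Mn].
apply: le_lt_trans (normc_le_ReIm _) _; rewrite ReB ImB /=.
by have := Na n Nn; have := Mb n Mn; lra.
Qed.

End ComplexComplete.

Section Unitization.
Context (R : realType) (A : cstarAlgType R).

Definition unitz : Type := (A * R[i])%type.

HB.instance Definition _ := GRing.Lmodule.copy unitz (A * R[i])%type.

Implicit Types u v w : unitz.

Lemma unitization_mulA : associative (@unitization_mul R A).
Proof.
move=> [a x] [b y] [c z]; rewrite /unitization_mul /=; congr (_, _); last exact: mulrA.
rewrite !cmulDl !cmulDr !cmulZl !cmulZr cmulA !scalerDr !scalerA.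
rewrite (mulrC y z) !(mulrC z) !addrA; congr (_ + _).
by rewrite [LHS](ACl (1*4*2*5*3*6)).
Qed.

Lemma unitization_mul1l : left_id (unitization_one A) (@unitization_mul R A).
Proof.
by move=> [a x]; rewrite /unitization_mul /= cmul0l scale1r scaler0 add0r addr0 mul1r.
Qed.

Lemma unitization_mul1r : right_id (unitization_one A) (@unitization_mul R A).
Proof.
by move=> [a x]; rewrite /unitization_mul /= cmul0r scale1r scaler0 !add0r mulr1.
Qed.

Lemma unitization_mulDl : left_distributive (@unitization_mul R A) (@GRing.add unitz).
Proof.
move=> [a x] [b y] [c z]; rewrite /unitization_mul /=; congr (_, _); last exact: mulrDl.
rewrite /= cmulDl !scalerDl scalerDr !addrA.
by rewrite [LHS](ACl (1*3*5*2*4*6)).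
Qed.

Lemma unitization_mulDr : right_distributive (@unitization_mul R A) (@GRing.add unitz).
Proof.
move=> [a x] [b y] [c z]; rewrite /unitization_mul /=; congr (_, _); last exact: mulrDr.
rewrite /= cmulDr !scalerDl scalerDr !addrA.
by rewrite [LHS](ACl (1*3*5*2*4*6)).
Qed.

Lemma unitization_one_neq0 : unitization_one A != 0 :> unitz.
Proof. by apply/eqP => -[] /eqP; rewrite oner_eq0. Qed.

HB.instance Definition _ := GRing.Zmodule_isNzRing.Build unitz
  unitization_mulA unitization_mul1l unitization_mul1r
  unitization_mulDl unitization_mulDr unitization_one_neq0.

Lemma unitization_scalerAl (a : R[i]) u v : a *: (u * v) = (a *: u) * v.
Proof.
case: u v => [b x] [c y]; congr (_, _); last exact: mulrA.
by rewrite /= cmulZl !scalerDr !scalerA (mulrC y).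
Qed.

HB.instance Definition _ := GRing.Lmodule_isLalgebra.Build R[i] unitz unitization_scalerAl.

Lemma unitization_scalerAr (a : R[i]) u v : a *: (u * v) = u * (a *: v).
Proof.
case: u v => [b x] [c y]; congr (_, _); last by rewrite /= [LHS]mulrCA.
by rewrite /= cmulZr !scalerDr !scalerA (mulrC x).
Qed.

HB.instance Definition _ := GRing.Lalgebra_isAlgebra.Build R[i] unitz unitization_scalerAr.

Definition act (u : unitz) (x : A) : A := cmul u.1 x + u.2 *: x.

Lemma actM u v x : act (u * v) x = act u (act v x).
Proof.
rewrite /act /= !cmulDl !cmulDr !cmulZl !cmulZr cmulA !scalerDr !scalerA !addrA.
by rewrite [LHS](ACl (1*3*2*4)).
Qed.

Lemma actZ u (a : R[i]) x : act u (a *: x) = a *: act u x.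
Proof. by rewrite /act cmulZr scalerDr !scalerA mulrC. Qed.

Lemma act_star u x y : cmul (star (act u x)) y = cmul (star x) (act (unitization_star u) y).
Proof.
by rewrite /act /= starD starM starZ cmulDl cmulDr cmulZl cmulZr cmulA.
Qed.

Definition opn (u : unitz) : R :=
  sup [set complex.Re `|cmul u.1 x + u.2 *: x| | x in [set x | setT x /\ `|x| <= 1]].

Lemma opn_le u x : na x <= 1 -> na (act u x) <= opn u.
Proof.
move=> x1; apply: ub_le_sup; last by exists x => //; split; rewrite // naE lecR.
exists (na u.1 + normc u.2) => _ [y [_ y1] <-]; move: y1; rewrite naE lecR => y1.
apply: le_trans (naD _ _) _; rewrite naZ lerD //.
  by apply: le_trans (naM _ _) _; rewrite ler_piMr ?na_ge0.
by rewrite ler_piMr ?normc_ge0.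
Qed.

Lemma opn_ub u C : 0 <= C -> (forall x, na x <= 1 -> na (act u x) <= C) -> opn u <= C.
Proof.
move=> C0 uC; apply: ge_sup.
  exists (na (act u 0)); exists 0 => //; split=> //; by rewrite normr0 ler01.
by move=> _ [x [_ x1] <-]; apply: uC; move: x1; rewrite naE lecR.
Qed.

Lemma opn_ge0 u : 0 <= opn u.
Proof. by apply: le_trans (opn_le u (x := 0) _); rewrite ?na_ge0 ?na0. Qed.

Lemma opn_act u x : na (act u x) <= opn u * na x.
Proof.
have [x0|x0] := eqVneq (na x) 0.
  by rewrite (na_eq0 x0) /act cmul0r scaler0 addr0 na0 mulr0.
have xp : 0 < na x by rewrite lt_def x0 na_ge0.
rewrite -ler_pdivrMr // mulrC -[(na x)^-1]ger0_norm ?invr_ge0 ?na_ge0 // -normc_real -naZ -actZ.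
by apply: opn_le; rewrite naZ normc_real ger0_norm ?invr_ge0 ?na_ge0 // mulVf.
Qed.

Definition unm (u : unitz) : R := Num.max (normc u.2) (opn u).

Lemma unm_normc u : normc u.2 <= unm u. Proof. by rewrite le_max lexx. Qed.
Lemma unm_opn u : opn u <= unm u. Proof. by rewrite le_max lexx orbT. Qed.

Lemma unm_eq0 u : unm u = 0 -> u = 0.
Proof.
move=> u0; have := unm_normc u; have := unm_opn u; rewrite u0.
case: u {u0} => a z h1 h2.
have z0 : z = 0 by apply: eq0_normc; apply/eqP; rewrite eq_le h2 normc_ge0.
have := opn_act (a, z) (star a); rewrite /act /= z0 scale0r addr0 => h.
suff sa0 : star a = 0 by rewrite -(starK a) sa0 star0.
have : na (star a) ^+ 2 <= 0.
  rewrite -na_cstar starK; apply: le_trans h _.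
  by rewrite z0 in h1; rewrite mulr_le0_ge0 // na_ge0.
by rewrite exprn_even_le0 //= => /eqP/na_eq0.
Qed.

Lemma unmD u v : unm (u + v) <= unm u + unm v.
Proof.
rewrite ge_max; apply/andP; split.
  by apply: le_trans (le_normcD _ _) _; rewrite lerD ?unm_normc.
apply: opn_ub => [|x x1].
  by rewrite addr_ge0 // (le_trans (opn_ge0 _) (unm_opn _)).
have -> : act (u + v) x = act u x + act v x by rewrite /act /= cmulDl scalerDl addrACA.
apply: le_trans (naD _ _) _; rewrite lerD //; apply: le_trans (opn_le _ x1) (unm_opn _).
Qed.

Lemma opnZ (a : R[i]) u : opn (a *: u) <= normc a * opn u.
Proof.
apply: opn_ub => [|x x1]; first by rewrite mulr_ge0 ?normc_ge0 ?opn_ge0.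
have -> : act (a *: u) x = a *: act u x by rewrite /act /= cmulZl scalerDr scalerA.
by rewrite naZ ler_wpM2l ?normc_ge0 // opn_le.
Qed.

Lemma unmZ (a : R[i]) u : unm (a *: u) = normc a * unm u.
Proof.
rewrite /unm maxr_pMr ?normc_ge0 //= normcM; congr Num.max.
apply/eqP; rewrite eq_le opnZ /=.
have [->|a0] := eqVneq a 0; first by rewrite normc0 mul0r opn_ge0.
have na0 : 0 < normc a.
  by rewrite lt_def normc_ge0 andbT; apply: contra a0 => /eqP/eq0_normc ->.
rewrite mulrC -ler_pdivlMr // mulrC -normcV; apply: le_trans (opnZ _ _).
by rewrite scalerA mulVf // scale1r.
Qed.

Lemma opnM u v : opn (u * v) <= opn u * opn v.
Proof.
apply: opn_ub => [|x x1]; first by rewrite mulr_ge0 ?opn_ge0.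
rewrite actM; apply: le_trans (opn_act _ _) _.
by rewrite ler_wpM2l ?opn_ge0 ?opn_le.
Qed.

Lemma unmM u v : unm (u * v) <= unm u * unm v.
Proof.
rewrite ge_max; apply/andP; split.
  by rewrite /= normcM ler_pM ?normc_ge0 ?unm_normc.
by apply: le_trans (opnM _ _) _; rewrite ler_pM ?opn_ge0 ?unm_opn.
Qed.

Definition ust (u : unitz) : unitz := unitization_star u.

Lemma ustK : involutive ust.
Proof.
by case=> a z; rewrite /ust /unitization_star /= starK; congr (_, _); case: z => x y; rewrite /= opprK.
Qed.

(** The square of the norm of u x is the norm of st x times (u^* u) x, at most that of u^* u when x
    has norm at most 1. *)
Lemma opn_sqr u : opn u ^+ 2 <= opn (ust u * u).
Proof.
rewrite -[leRHS]sqr_sqrtr ?opn_ge0 // ler_pXn2r ?nnegrE ?opn_ge0 ?sqrtr_ge0 //.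
apply: opn_ub => [|x x1]; first exact: sqrtr_ge0.
rewrite -(@ler_pXn2r _ 2) ?nnegrE ?na_ge0 ?sqrtr_ge0 // sqr_sqrtr ?opn_ge0 //.
rewrite -na_cstar act_star -actM; apply: le_trans (naM _ _) _; rewrite na_star.
rewrite -[leRHS]mul1r; apply: ler_pM; rewrite ?na_ge0 //; exact: opn_le.
Qed.

Lemma opn_ust u : opn (ust u) = opn u.
Proof.
suff le v : opn v <= opn (ust v) by apply/eqP; rewrite eq_le le andbT -{2}(ustK u) le.
have [->|v0] := eqVneq (opn v) 0; first exact: opn_ge0.
have vp : 0 < opn v by rewrite lt_def v0 opn_ge0.
by rewrite -(ler_pM2r vp) -expr2; apply: le_trans (opn_sqr _) (opnM _ _).
Qed.

Lemma normc_conj (z : R[i]) : normc z^* = normc z.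
Proof. by case: z => a b; rewrite /= sqrrN. Qed.

Lemma unm_cstar u : unm (ust u * u) = unm u ^+ 2.
Proof.
have -> : unm u ^+ 2 = Num.max (normc u.2 ^+ 2) (opn u ^+ 2).
  rewrite /unm; case: (leP (normc u.2) (opn u)) => h; apply/esym.
    by apply/max_idPr; rewrite ler_pXn2r ?nnegrE ?opn_ge0 ?normc_ge0.
  by apply/max_idPl; rewrite ler_pXn2r ?nnegrE ?opn_ge0 ?normc_ge0 // ltW.
rewrite /unm /= normcM normc_conj -expr2; congr Num.max.
apply/eqP; rewrite eq_le opn_sqr andbT expr2 -{1}(opn_ust u); exact: opnM.
Qed.

Lemma ustD : {morph ust : u v / u + v}.
Proof.
move=> [a x] [b y]; congr (_, _); first exact: starD.
by case: x y => x1 x2 [y1 y2]; apply/eqP; rewrite eq_complex /= opprD !eqxx.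
Qed.

Lemma ustZ (a : R[i]) u : ust (a *: u) = a^* *: ust u.
Proof.
case: u => [b x]; congr (_, _); first exact: starZ.
case: a x => a1 a2 [x1 x2]; apply/eqP; rewrite eq_complex /=.
by apply/andP; split; apply/eqP; ring.
Qed.

Lemma ustM u v : ust (u * v) = ust v * ust u.
Proof.
case: u v => [a x] [b y]; congr (_, _).
  by rewrite /= !starD starM !starZ addrAC.
case: x y => x1 x2 [y1 y2]; apply/eqP; rewrite eq_complex /=.
by apply/andP; split; apply/eqP; ring.
Qed.

(** For a = u.1 one has a * star a = act u (star a) - u.2 star a; divide by the norm of a. With
    [unm_le] this makes [unm] equivalent to the sum of the norms of the components, whence
    completeness. *)
Lemma na_unm u : na u.1 <= 2 * unm u.
Proof.
have [->|a0] := eqVneq (na u.1) 0.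
  by rewrite mulr_ge0 // (le_trans (opn_ge0 u) (unm_opn u)).
have ap : 0 < na u.1 by rewrite lt_def a0 na_ge0.
rewrite -(ler_pM2r ap) -expr2 -na_star -na_cstar starK.
have -> : cmul u.1 (star u.1) = act u (star u.1) - u.2 *: star u.1 by rewrite /act addrK.
apply: le_trans (naD _ _) _; rewrite naN naZ.
have := opn_act u (star u.1); rewrite na_star => h.
have := ler_wpM2r (na_ge0 u.1) (unm_opn u); have := ler_wpM2r (na_ge0 u.1) (unm_normc u).
lra.
Qed.

Lemma unm_le u : unm u <= na u.1 + normc u.2.
Proof.
rewrite ge_max lerDr na_ge0 /=; apply: opn_ub => [|x x1].
  by rewrite addr_ge0 ?na_ge0 ?normc_ge0.
apply: le_trans (naD _ _) _; rewrite naZ lerD //.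
  by apply: le_trans (naM _ _) _; rewrite ler_piMr ?na_ge0.
by rewrite ler_piMr ?normc_ge0.
Qed.

Lemma unm_complete (u : nat -> unitz) :
  (forall e : R, 0 < e -> exists N : nat, forall m n : nat,
     (N <= m)%N -> (N <= n)%N -> unm (u m - u n) < e) ->
  exists l : unitz, forall e : R, 0 < e -> exists N : nat, forall n : nat,
    (N <= n)%N -> unm (u n - l) < e.
Proof.
move=> uC.
have [|a ua] := @na_complete R A (fun n => (u n).1).
  move=> e e0; have [|N Nu] := uC (e / 2); first by rewrite divr_gt0.
  exists N => m n Nm Nn; have := Nu m n Nm Nn; have := na_unm (u m - u n) => /=; lra.
have [|z uz] := @complex_complete R (fun n => (u n).2).
  move=> e e0; have [N Nu] := uC e e0.
  exists N => m n Nm Nn; have := Nu m n Nm Nn; apply: le_lt_trans.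
  exact: (unm_normc (u m - u n)).
exists (a, z) => e e0; have e2 : 0 < e / 2 by rewrite divr_gt0.
have [N Na] := ua _ e2; have [M Mz] := uz _ e2.
exists (maxn N M) => n; rewrite geq_max => /andP[Nn Mn].
apply: le_lt_trans (unm_le _) _ => /=.
by have := Na n Nn; have := Mz n Mn; lra.
Qed.

HB.instance Definition _ := isUnitalCStar.Build R unitz unm_eq0 unmD unmZ unmM
  unm_cstar ustD ustZ ustM ustK unm_complete.

Definition emb (x : A) : unitz := (x, 0).

Lemma embD : {morph emb : x y / x + y}.
Proof. by move=> x y; congr (_, _); rewrite addr0. Qed.
Lemma embZ (a : R[i]) : {morph emb : x / a *: x}.
Proof. by move=> x; congr (_, _); rewrite /= scaler0. Qed.
Lemma embM x y : emb (cmul x y) = emb x * emb y.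
Proof. by congr (_, _); rewrite /= ?mulr0 // !scale0r !addr0. Qed.
Lemma emb_star x : emb (star x) = st (emb x).
Proof. by congr (_, _); rewrite /= oppr0. Qed.
Lemma emb0 : emb 0 = 0. Proof. by []. Qed.
Lemma embN : {morph emb : x / - x}.
Proof. by move=> x; congr (_, _); rewrite oppr0. Qed.
Lemma embB : {morph emb : x y / x - y}.
Proof. by move=> x y; rewrite embD embN. Qed.
Lemma emb_inj : injective emb. Proof. by move=> x y []. Qed.

Lemma nm_emb x : nm (emb x) = na x.
Proof.
apply/eqP; rewrite eq_le; apply/andP; split.
  by have := unm_le (emb x); rewrite [normc _]normc0 addr0.
have [->|x0] := eqVneq (na x) 0; first exact: nm_ge0.
have xp : 0 < na x by rewrite lt_def x0 na_ge0.
rewrite -(ler_pM2r xp) -expr2 -na_star -na_cstar starK.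
have -> : cmul x (star x) = act (emb x) (star x) by rewrite /act scale0r addr0.
apply: le_trans (opn_act _ _) _; rewrite na_star ler_wpM2r ?na_ge0 //.
exact: unm_opn.
Qed.

End Unitization.

(** * Projections and ideals *)

Section Projections.
Context (R : realType) (U : ucstarType R).
Implicit Types (x y z h p q : U) (K B J : set U).

Definition isproj p := st p = p /\ p * p = p.

Lemma proj0 : isproj 0. Proof. by split; [exact: st0|rewrite mulr0]. Qed.

Lemma nm_proj p : isproj p -> nm p <= 1.
Proof.
move=> [sp pp]; have := nm_cstar p; rewrite sp pp => /esym h.
have := nm_ge0 p; rewrite leNgt => n0; rewrite leNgt; apply/negP => n1.
by move: h; rewrite expr2; nra.
Qed.

Lemma nm_proj1 p : isproj p -> p != 0 -> nm p = 1.
Proof.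
move=> [sp pp] p0; have := nm_cstar p; rewrite sp pp => /esym/eqP.
rewrite expr2 -{3}(mulr1 (nm p)) (inj_eq (mulfI _)) => [/eqP //|].
by apply: contra p0 => /eqP/nm_eq0 ->.
Qed.

(* [pq = q] says that q lies below p. *)
Lemma proj_leC p q : isproj p -> isproj q -> p * q = q -> q * p = q.
Proof. by move=> [sp _] [sq _] pq; rewrite -{1}sq -{1}sp -stM pq. Qed.

Lemma sa_above p x : sa p -> sa x -> p * x = x -> x * p = x.
Proof. by move=> sp sx px; have := congr1 st px; rewrite stM sp sx. Qed.

Lemma proj_sub p q : isproj p -> isproj q -> p * q = q -> isproj (p - q).
Proof.
move=> pp pq h; have h' := proj_leC pp pq h.
split; first by rewrite stB pp.1 pq.1.
by rewrite mulrBl !mulrBr pp.2 pq.2 h h' subrr subr0.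
Qed.

Lemma proj_orth q f : isproj q -> isproj f -> q * f = 0 -> f * q = 0.
Proof. by move=> [sq _] [sf _] qf; rewrite -sf -sq -stM qf st0. Qed.

Lemma proj_add p q : isproj p -> isproj q -> p * q = 0 -> isproj (p + q).
Proof.
move=> pp pq h; have h' := proj_orth pp pq h.
split; first by rewrite stD pp.1 pq.1.
by rewrite mulrDl !mulrDr pp.2 pq.2 h h' addr0 add0r.
Qed.

Lemma nm_mulproj p x : isproj p -> nm (p * x) <= nm x.
Proof.
by move=> /nm_proj p1; apply: le_trans (nmM _ _) _; rewrite ler_piMl ?nm_ge0.
Qed.

Lemma nm_projmul p x : isproj p -> nm (x * p) <= nm x.
Proof.
by move=> /nm_proj p1; apply: le_trans (nmM _ _) _; rewrite ler_piMr ?nm_ge0.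
Qed.

Definition cstsub K := csub K /\ forall x, K x -> K (st x).

(** Closedness and nonemptiness are left out, so that the union of any chain is again of this kind;
    [max_idl] regains both from maximality. *)
Definition idl B J := [/\ J `<=` B,
  forall (a : R[i]) x y, J x -> J y -> J (a *: x + y),
  forall x b, J x -> B b -> J (x * b) /\ J (b * x) &
  forall x, J x -> J (st x)].

(** The inverse v of 1 - z is 1 plus a convergent series of powers of z. Hence ideals of K absorb
    multiplication by v although v is not in K. *)
Lemma neumann_csub K z v : csub K -> K z -> nm z < 1 -> (1 - z) * v = 1 -> K (v - 1).
Proof.
move=> cK Kz z1 zv.
have vz : v = 1 + z * v by rewrite -zv; nring.
have vE n : v - 1 = \sum_(i < n) z ^+ i.+1 + z ^+ n.+1 * v.
  elim: n => [|n IHn].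
    by rewrite big_ord0 add0r expr1 {1}vz; nring.
  rewrite IHn big_ord_recr /= -addrA; congr (_ + _).
  by rewrite {1}vz mulrDr mulr1 mulrA -exprSr.
have zn n : nm (z ^+ n) <= nm z ^+ n.
  elim: n => [|n IHn]; first by rewrite !expr0 nm1.
  by rewrite !exprS; apply: le_trans (nmM _ _) _; rewrite ler_wpM2l ?nm_ge0.
have Kzn n : K (z ^+ n.+1).
  elim: n => [|n IHn]; first by rewrite expr1.
  by rewrite exprS; apply: (csubM cK).
apply: (csub_clo cK) => e e0.
have /cvgrPdist_lt/(_ e e0)[N _ Nn] : (fun n => nm v * nm z ^+ n : R) @ \oo --> (0 : R).
  rewrite -[X in _ --> X](mulr0 (nm v)).
  by apply: cvgM; [exact: cvg_cst|apply: cvg_expr; rewrite ger0_norm ?nm_ge0].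
exists (\sum_(i < N) z ^+ i.+1); first by apply: (csub_sum cK).
rewrite (vE N) addrAC subrr add0r; apply: le_lt_trans (nmM _ _) _.
have := Nn N.+1 (leqnSn N); rewrite /= sub0r normrN ger0_norm; last first.
  by rewrite mulr_ge0 ?exprn_ge0 ?nm_ge0.
by apply: le_lt_trans; rewrite mulrC ler_wpM2l ?nm_ge0.
Qed.

Section Ideal.
Variables (B J : set U) (cB : cstsub B) (iJ : idl B J).

Lemma idl_sub x : J x -> B x. Proof. by case: iJ => h _ _ _; exact: h. Qed.
Lemma idlZ (a : R[i]) x : J x -> J (a *: x).
Proof.
case: iJ => _ h _ _ Jx; have J0 : J 0 by rewrite -(addNr x) -scaleN1r; exact: h.
by rewrite -(addr0 (a *: x)); exact: h.
Qed.
Lemma idl0 x : J x -> J 0. Proof. by move=> /(idlZ 0); rewrite scale0r. Qed.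
Lemma idlD x y : J x -> J y -> J (x + y).
Proof. by case: iJ => _ h _ _ Jx Jy; rewrite -(scale1r x); exact: h. Qed.
Lemma idlN x : J x -> J (- x).
Proof. by rewrite -scaleN1r; exact: idlZ. Qed.
Lemma idlB x y : J x -> J y -> J (x - y).
Proof. by move=> Jx Jy; apply/idlD/idlN. Qed.
Lemma idlMr x b : J x -> B b -> J (x * b).
Proof. by case: iJ => _ _ h _ Jx Bb; case: (h _ _ Jx Bb). Qed.
Lemma idlMl x b : J x -> B b -> J (b * x).
Proof. by case: iJ => _ _ h _ Jx Bb; case: (h _ _ Jx Bb). Qed.
Lemma idl_st x : J x -> J (st x). Proof. by case: iJ => _ _ _; apply. Qed.

Lemma idl_sum I (r : seq I) (P : pred I) (F : I -> U) : J 0 ->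
  (forall i, P i -> J (F i)) -> J (\sum_(i <- r | P i) F i).
Proof. by move=> J0 JF; apply: big_ind => //; exact: idlD. Qed.

Lemma idl_cst : J 0 -> clo J -> cstsub J.
Proof.
move=> J0 cJ; split; last exact: idl_st.
split=> // [a x y Jx Jy|x y Jx Jy]; first by apply: idlD => //; exact: idlZ.
by apply: idlMr => //; exact: idl_sub.
Qed.

(* A projection at distance less than 1 from an ideal, closed or not, belongs
   to it, because pjp is then invertible in pBp. *)
Lemma proj_near_idl p j : isproj p -> B p -> J j -> nm (p - j) < 1 -> J p.
Proof.
move=> [sp pp] Bp Jj pj; set z := p - p * j * p.
have Jpjp : J (p * j * p) by apply: idlMr => //; exact: idlMl.
have Bz : B z by apply: (csubB cB.1) => //; exact: idl_sub.
have z1 : nm z < 1.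
  have -> : z = p * (p - j) * p by rewrite /z mulrBr mulrBl !pp.
  by apply: le_lt_trans pj; apply: le_trans (nm_projmul _ _) (nm_mulproj _ _).
have [v [v1 v2]] := neumann z1.
have Bv : B (v - 1) := neumann_csub cB.1 Bz z1 v1.
have -> : p = p * j * p + p * j * p * (v - 1).
  have -> : p * j * p + p * j * p * (v - 1) = p * j * p * v by nring.
  have -> : p * j * p = p * (1 - z).
    by rewrite /z mulrBr mulr1 mulrBr !mulrA !pp; nring.
  by rewrite -mulrA v1 mulr1.
by apply: idlD => //; exact: idlMr.
Qed.

(** The approximate unit a of st y is a function of st y * y without constant term, so it lies in J,
    and a * st y tends to st y. *)
Lemma idl_cstar y : clo J -> J (st y * y) -> B y -> J y.
Proof.
move=> cJ Jh By; have J0 := idl0 Jh; have cstJ := idl_cst J0 cJ.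
rewrite -(stK y); apply: idl_st; apply: cJ => e e0.
have [|a [_ _ ay aK]] := @approx_unit1 R U (st y) (e / 2); first by rewrite divr_gt0.
exists (a * st y); last by lra.
by apply: idlMr; [apply: aK cstJ.1 _; rewrite stK|exact: cB.2].
Qed.

End Ideal.

Lemma spec_open h t : ~ spec h t -> exists2 d : R, 0 < d &
  forall s, `|s - t| < d -> ~ spec h s.
Proof.
move=> /contrapT[v [v1 v2]]; pose n := 1 + nm v.
have n0 : 0 < n by rewrite /n; have := nm_ge0 v; lra.
exists n^-1; first by rewrite invr_gt0.
move=> s st hs; apply: hs.
have -> : h - sc U s = (h - sc U t) * (1 - (s - t)%:C *: v).
  rewrite mulrBr mulr1 -scalerAr v1 -/(sc U (s - t)) scB; nring.
apply: invt_mul; first by exists v.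
apply: neumann; rewrite nmZr.
apply: (@le_lt_trans _ _ (`|s - t| * n)); first by rewrite ler_wpM2l // /n; lra.
by rewrite -ltr_pdivlMr // mul1r.
Qed.

Definition scat := forall h, sa h -> forall a b : R, a < b ->
  exists2 t, a < t < b & ~ spec h t.

(** The indicator of ]t, oo[ is continuous on a spectrum with a gap around t. The ramp descends over
    [t - e, t] with e = min (d, t), so it fits into the gap and vanishes at 0; the resulting
    projection stays in every closed subalgebra containing h. *)
Lemma gap_step h t : 0 < t -> ~ spec h t -> exists f : R -> R,
  [/\ continuous f, f 0 = 0 & forall s, spec h s -> f s = if t < s then 1 else 0].
Proof.
move=> t0 /spec_open[d d0 dt].
pose e := Num.min d t; have e0 : 0 < e by rewrite lt_min d0.
exists (fun s => Num.max 0 (Num.min 1 (1 + (s - t) * e^-1))); split.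
- by cont.
- have et : t * e^-1 >= 1 by rewrite ler_pdivlMr // mul1r ge_min lexx orbT.
  by apply/max_idPl; rewrite ge_min sub0r mulNr; apply/orP; right; lra.
- move=> s hs; have st : d <= `|s - t| by rewrite leNgt; apply/negP => /dt.
  have {}st : e <= `|s - t| by apply: le_trans st; rewrite ge_min lexx.
  case: (ltP t s) => ts /=.
    have -> : Num.min 1 (1 + (s - t) * e^-1) = 1.
      by apply/min_idPl; rewrite lerDl mulr_ge0 ?invr_ge0 ?(ltW e0) // subr_ge0 ltW.
    by apply/max_idPr.
  apply/max_idPl; rewrite ge_min; apply/orP; right.
  move: st; rewrite ler0_norm ?subr_le0 // => st.
  have : e * e^-1 <= - (s - t) * e^-1 by rewrite ler_wpM2r ?invr_ge0 ?(ltW e0).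
  by rewrite mulfV ?gt_eqF // mulNr; lra.
Qed.

Lemma step_proj h (t : R) (f : R -> R) : sa h -> continuous f ->
  (forall s, spec h s -> f s = if t < s then 1 else 0) -> isproj (fc h f).
Proof.
move=> sh cf fE; split; first exact: fc_sa.
rewrite -fcM //; apply: fc_ext => //; first by cont.
by move=> s /fE ->; case: (t < s); rewrite ?mulr1 ?mulr0.
Qed.

Lemma proj_below_csub p : csub [set y | p * y = y].
Proof.
split=> [x xK||a x y /= px py|x y /= px py].
- rewrite /=; apply/eqP; rewrite -subr_eq0.
  have c : clo [set y | p * y - y = 0].
    apply: (@clo_cst _ _ (fun y => p * y - y) 0 (nm p + 1)) => [u v|u]; first by nring.
    by have := nmB (p * u) u; have := nmM p u; lra.
  apply/eqP; apply: c => e /xK[y /= py xy]; exists y => //=; by rewrite py subrr.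
- by rewrite /= mulr0.
- by rewrite /= mulrDr -scalerAr px py.
- by rewrite /= mulrA px.
Qed.

Lemma proj_above_csub p : csub [set y | y * p = y].
Proof.
split=> [x xK||a x y /= px py|x y /= px py].
- rewrite /=; apply/eqP; rewrite -subr_eq0.
  have c : clo [set y | y * p - y = 0].
    apply: (@clo_cst _ _ (fun y => y * p - y) 0 (nm p + 1)) => [u v|u]; first by nring.
    by have := nmB (u * p) u; have := nmM u p; lra.
  apply/eqP; apply: c => e /xK[y /= py xy]; exists y => //=; by rewrite py subrr.
- by rewrite /= mul0r.
- by rewrite /= mulrDl -scalerAl px py.
- by rewrite /= -mulrA py.
Qed.

Lemma csubI K1 K2 : csub K1 -> csub K2 -> csub (K1 `&` K2).
Proof.
move=> c1 c2; split.
- move=> x xK; split; [apply: (csub_clo c1)|apply: (csub_clo c2)] => e /xK[y [k1 k2] xy];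
    by exists y.
- by split; [exact: csub0 c1|exact: csub0 c2].
- move=> a x y [x1 x2] [y1 y2]; split.
    by apply: (csubD c1) => //; apply: (csubZ c1).
  by apply: (csubD c2) => //; apply: (csubZ c2).
- by move=> x y [x1 x2] [y1 y2]; split; [apply: (csubM c1)|apply: (csubM c2)].
Qed.

(** The algebra pKp for p in K. It is described by fixed points because corners of an ideal by
    projections outside it also occur. *)
Definition corner p K := K `&` ([set y | p * y = y] `&` [set y | y * p = y]).

Lemma corner_cst p K : sa p -> cstsub K -> cstsub (corner p K).
Proof.
move=> sp [cK sK]; split.
  by apply: csubI => //; apply: csubI; [exact: proj_below_csub|exact: proj_above_csub].
move=> x [Kx [/= px xp]]; split; first exact: sK.
by split => /=; rewrite -{1}sp -stM ?xp ?px.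
Qed.

Lemma left0_csub (f : U) : csub [set y | f * y = 0].
Proof.
split=> [||a x y /= px py|x y /= px py].
- apply: (@clo_cst _ _ (fun y => f * y) 0 (nm f)) => [u v|u]; [by nring|exact: nmM].
- by rewrite /= mulr0.
- by rewrite /= mulrDr -scalerAr px py scaler0 addr0.
- by rewrite /= mulrA px mul0r.
Qed.

Lemma fc_id_sub h (f : R -> R) : sa h -> continuous f ->
  fc h (fun t => t - f t * t) = h - fc h f * h.
Proof.
move=> sh cf; have ci : continuous (fun t : R => t) by cont.
by rewrite (fcB (f := fun t => t)) ?(fcM (g := fun t => t)) ?(fc_id sh) //; cont.
Qed.

(** By induction on the list. For y = w - f w, the spectral projection q of y * st y above a gap in
    ]0, e^2[ is orthogonal to f and leaves nm (y - q y) < e. Passing from f to f + q does not spoil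
    the earlier elements, because 1 - q is a contraction. Only the products w * st w have to lie in
    K. *)
Lemma proj_approx_unit K (s : seq U) (e : R) : scat -> cstsub K ->
  (forall w, w \in s -> K (w * st w)) -> 0 < e ->
  exists f, [/\ isproj f, K f & forall w, w \in s -> nm (w - f * w) < e].
Proof.
move=> sU [cK sK] + e0; elim: s => [_|w s IHs sKw].
  by exists 0; split; [exact: proj0|exact: csub0 cK|].
have [|f [pf Kf fs]] := IHs; first by move=> v vs; apply: sKw; rewrite inE vs orbT.
pose y := w - f * w; pose h := y * st y.
have ph : psd h by have := psd_cstar (st y); rewrite stK.
have sh := ph.1.
have Kw : K (w * st w) by apply: sKw; rewrite inE eqxx.
have Kh : K h.
  have -> : h = w * st w - f * (w * st w) - w * st w * f + f * (w * st w) * f.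
    by rewrite /h /y stB stM pf.1; nring.
  apply: (csubD cK); last by apply: (csubM cK) => //; apply: (csubM cK).
  by apply: (csubB cK); [apply: (csubB cK) => //|]; apply: (csubM cK).
have e2 : 0 < e ^+ 2 by rewrite exprn_gt0.
have [t /andP[t0 te] ht] := sU h sh 0 (e ^+ 2) e2.
have [g [cg g0 gE]] := gap_step t0 ht.
set q := fc h g; have pq : isproj q := step_proj sh cg gE.
have Kq : K q by apply: fc_csub.
have fh : f * h = 0 by rewrite /h /y mulrA mulrBr mulrA pf.2 subrr mul0r.
have fq : f * q = 0 by apply: (@fc_csub _ _ [set y | f * y = 0]) => //; exact: left0_csub.
have qf : q * f = 0 by apply: proj_orth.
have nh : nm (h - q * h) < e ^+ 2.
  apply: le_lt_trans te; rewrite -fc_id_sub //.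
  apply: fc_norm => // [|s' hs]; first by cont.
  have s0 := ph.2 _ hs; rewrite gE //; case: (ltP t s') => ts /=.
    by rewrite mul1r subrr normr0 ltW.
  by rewrite mul0r subr0 ger0_norm.
have ny : nm (y - q * y) < e.
  rewrite -(@ltr_pXn2r _ 2) ?nnegrE ?nm_ge0 ?(ltW e0) // -nm_st -nm_cstar stK.
  have -> : (y - q * y) * st (y - q * y) = (h - q * h) - (h - q * h) * q.
    by rewrite stB stM pq.1 /h; nring.
  apply: le_lt_trans nh; rewrite -[X in nm (X - _)]mulr1 -mulrBr.
  have p1 : isproj (1 - q).
    by apply: proj_sub; rewrite ?mul1r //; split; [exact: st1|rewrite mulr1].
  exact: nm_projmul.
exists (f + q); split; first exact: proj_add.
  exact: (csubD cK).
move=> v; rewrite inE => /orP[/eqP ->|vs].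
  suff -> : w - (f + q) * w = y - q * y by [].
  by rewrite /y mulrBr mulrA qf mul0r subr0 mulrDl opprD addrA.
have -> : v - (f + q) * v = (v - f * v) - q * (v - f * v).
  by rewrite mulrBr mulrA qf mul0r subr0 mulrDl opprD addrA.
apply: le_lt_trans (fs v vs); rewrite -[X in nm (X - _)]mul1r -mulrBl.
apply: nm_mulproj.
by apply: proj_sub; rewrite ?mul1r //; split; [exact: st1|rewrite mulr1].
Qed.

End Projections.

(** * Minimal projections of quotients *)

Section MinimalProjections.
Context (R : realType) (U : ucstarType R) (B J : set U).
Hypotheses (cB : cstsub B) (iJ : idl B J) (cJ : clo J) (J0 : J 0) (sU : scat U).
Implicit Types (x y z h p q : U).

Definition proj_out p := [/\ isproj p, B p & ~ J p].

(* [p] is a minimal projection of the quotient B/J. *)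
Definition min_mod p := proj_out p /\
  forall q, isproj q -> B q -> p * q = q -> J q \/ J (p - q).

(** * Binary trees of projections *)

Section Tree.
Variable split : U -> U.

(** The sum of the chosen halves of all nodes at depth n. These projections act as the binary digits
    of the element constructed below. *)
Fixpoint tree_proj (n : nat) (p : U) : U :=
  if n is m.+1 then tree_proj m (split p) + tree_proj m (p - split p) else split p.

(** The partial sum of 2^-(k+1) [tree_proj k p] over k < n, by [tree_sumS]. The recursion from the
    root suits the induction along a branch in [tree_branch]. *)
Fixpoint tree_sum (n : nat) (p : U) : U :=
  if n is m.+1 then
    (2^-1)%:C *: (split p + (tree_sum m (split p) + tree_sum m (p - split p)))
  else 0.

Lemma tree_sumS n p : tree_sum n.+1 p - tree_sum n p = (2^-1 ^+ n.+1)%:C *: tree_proj n p.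
Proof.
elim: n p => [|n IHn] p; first by rewrite /= expr1 !addr0 subr0.
rewrite exprS rmorphM -scalerA [tree_proj _ _]/= scalerDr -!IHn.
have E m q : tree_sum m.+1 q = (2^-1)%:C *: (split q + (tree_sum m (split q) +
  tree_sum m (q - split q))) by [].
by rewrite (E n.+1 p) (E n p) -scalerBr; congr (_ *: _); nring.
Qed.

Variable P : set U.
Hypothesis splitP : forall p, P p -> [/\ isproj p, isproj (split p),
  p * split p = split p, P (split p) & P (p - split p)].

Lemma tree_projP n p : P p -> isproj (tree_proj n p) /\ p * tree_proj n p = tree_proj n p.
Proof.
elim: n p => [|n IHn] p Pp; first by have [] := splitP Pp.
have [pp pq pqE Pq Pq'] := splitP Pp.
have [g1 h1] := IHn _ Pq; have [g2 h2] := IHn _ Pq'.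
have qp := proj_leC pp pq pqE.
have o : tree_proj n (split p) * tree_proj n (p - split p) = 0.
  rewrite -(proj_leC pq g1 h1) -h2 -mulrA (mulrA (split p)) mulrBr qp pq.2 subrr.
  by rewrite mul0r mulr0.
split; first exact: proj_add.
have e1 : p * tree_proj n (split p) = tree_proj n (split p) by rewrite -h1 mulrA pqE.
have e2 : p * tree_proj n (p - split p) = tree_proj n (p - split p).
  by rewrite -h2 mulrA mulrBr pp.2 pqE.
by rewrite [tree_proj _ _]/= mulrDr e1 e2.
Qed.

Lemma tree_sumP n p : P p ->
  [/\ sa (tree_sum n p), p * tree_sum n p = tree_sum n p & nm (tree_sum n p) <= 1].
Proof.
move=> Pp; have gP k := tree_projP k Pp.
suff [h1 h2 h3] : [/\ sa (tree_sum n p), p * tree_sum n p = tree_sum n p &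
    nm (tree_sum n p) <= 1 - 2^-1 ^+ n].
  by split => //; apply: le_trans h3 _; rewrite gerBl exprn_ge0 ?invr_ge0.
elim: n => [|n [h1 h2 h3]].
  by rewrite /= mulr0 nm0 expr0 subrr; split=> //; exact: sa0.
have -> : tree_sum n.+1 p = tree_sum n p + (2^-1 ^+ n.+1)%:C *: tree_proj n p.
  by rewrite -tree_sumS addrC subrK.
have [gp gl] := gP n; split.
- by apply: saD => //; apply: saZ; exact: gp.1.
- by rewrite mulrDr h2 -scalerAr gl.
- apply: le_trans (nmD _ _) _; rewrite nmZr ger0_norm ?exprn_ge0 ?invr_ge0 //.
  have := nm_proj gp; have r0 : 0 < 2^-1 ^+ n :> R by rewrite exprn_gt0 // invr_gt0.
  by rewrite exprS; move: r0 h3; set r := _ ^+ n => r0 h3 g1; nra.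
Qed.

(* The branch of the tree prescribed by the binary digits of t: on its N-th
   projection the sum agrees with t up to 2^(1-N). *)
Lemma tree_branch N p (t : R) : P p -> 0 <= t <= 1 ->
  exists q, [/\ P q, isproj q, p * q = q &
    forall m, (N <= m)%N -> nm ((tree_sum m p - sc U t) * q) <= 2 * 2^-1 ^+ N].
Proof.
elim: N p t => [|N IHN] p t Pp /andP[t0 t1].
  have [pp _ _ _ _] := splitP Pp; exists p; split; [by []|by []|exact: pp.2|].
  move=> m _; rewrite expr0 mulr1; apply: le_trans (nm_projmul _ pp) _.
  have [_ _ n1] := tree_sumP m Pp; apply: le_trans (nmB _ _) _.
  by rewrite nm_sc ger0_norm; lra.
have [pp pq pqE Pq Pq'] := splitP Pp.
have qp := proj_leC pp pq pqE; have pq' := proj_sub pp pq pqE.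
have tq m : tree_sum m (split p) * (p - split p) = 0.
  have [sa1 h1 _] := tree_sumP m Pq.
  have h1' : tree_sum m (split p) * split p = tree_sum m (split p).
    by apply: sa_above => //; exact: pq.1.
  by rewrite -h1' -mulrA mulrBr qp pq.2 subrr mulr0.
have tq' m : tree_sum m (p - split p) * split p = 0.
  have [sa1 h1 _] := tree_sumP m Pq'.
  have h1' : tree_sum m (p - split p) * (p - split p) = tree_sum m (p - split p).
    by apply: sa_above => //; exact: pq'.1.
  by rewrite -h1' -mulrA mulrBl pqE pq.2 subrr mulr0.
have half (z : U) : (2^-1)%:C *: (z + z) = z.
  by rewrite scalerDr -scalerDl complex_half scale1r.
have r2 : 2 * 2^-1 ^+ N.+1 = 2^-1 * (2 * 2^-1 ^+ N) :> R by rewrite exprS; ring.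
have [th|th] := leP 2^-1 t.
  have [|q [Pq0 pq0 sq mq]] := IHN (split p) (2 * t - 1) Pq.
    by apply/andP; split; lra.
  have qs : split p * q = q by [].
  exists q; split=> //; first by rewrite -sq mulrA pqE.
  case=> // m Nm; rewrite r2; have := mq m Nm.
  have -> : (tree_sum m.+1 p - sc U t) * q =
      (2^-1)%:C *: ((tree_sum m (split p) - sc U (2 * t - 1)) * q).
    rewrite -(half (sc U t)) /= -scalerBr -scalerAl; congr (_ *: _).
    have -> : sc U (2 * t - 1) = sc U t + sc U t - 1.
      by rewrite -sc1 -scD -scB; congr (sc U _); ring.
    have tq0 : tree_sum m (p - split p) * q = 0 by rewrite -sq mulrA tq' mul0r.
    have -> : (split p + (tree_sum m (split p) + tree_sum m (p - split p)) - (sc U t + sc U t)) * q =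
      split p * q + tree_sum m (split p) * q + tree_sum m (p - split p) * q - (sc U t + sc U t) * q.
      by nring.
    by rewrite sq tq0; nring.
  by rewrite nmZr ger0_norm ?invr_ge0 // => h; rewrite ler_wpM2l ?invr_ge0.
have [|q [Pq0 pq0 sq mq]] := IHN (p - split p) (2 * t) Pq'.
  by apply/andP; split; lra.
exists q; split=> //; first by rewrite -sq mulrA mulrBr pp.2 pqE.
case=> // m Nm; rewrite r2; have := mq m Nm.
have -> : (tree_sum m.+1 p - sc U t) * q =
    (2^-1)%:C *: ((tree_sum m (p - split p) - sc U (2 * t)) * q).
  rewrite -(half (sc U t)) /= -scalerBr -scalerAl; congr (_ *: _).
  have -> : sc U (2 * t) = sc U t + sc U t by rewrite -scD; congr (sc U _); ring.
  have sq0 : split p * q = 0 by rewrite -sq mulrA mulrBr qp pq.2 subrr mul0r.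
  have tq0 : tree_sum m (split p) * q = 0 by rewrite -sq mulrA tq mul0r.
  have -> : (split p + (tree_sum m (split p) + tree_sum m (p - split p)) - (sc U t + sc U t)) * q =
    split p * q + tree_sum m (split p) * q + (tree_sum m (p - split p) - (sc U t + sc U t)) * q.
    by nring.
  by rewrite sq0 tq0 !add0r.
by rewrite nmZr ger0_norm ?invr_ge0 // => h; rewrite ler_wpM2l ?invr_ge0.
Qed.

(** Let h be the limit of the tree sums. For t in ]0, 1[ the projections q along the branch of t
    have norm 1 while (h - t) q tends to 0, so h - t has no left inverse. *)
Lemma tree_interval p : P p -> (forall q, P q -> q != 0) ->
  exists2 h : U, sa h & forall t : R, 0 < t < 1 -> spec h t.
Proof.
move=> Pp P0.
have r0 n : 0 < 2^-1 ^+ n :> R by rewrite exprn_gt0 // invr_gt0.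
have [||n|h hl] := @geom_limit _ _ (fun n => tree_sum n p) 1 2^-1.
- by [].
- by rewrite invr_ge0 ler0n /=; lra.
- rewrite tree_sumS nmZr ger0_norm ?(ltW (r0 _)) // mul1r.
  have [gp _] := tree_projP n Pp; have := nm_proj gp => g1.
  apply: (@le_trans _ _ (2^-1 ^+ n.+1)); first by rewrite ler_piMr // ltW.
  by rewrite exprS; have := r0 n; lra.
have {}hl n : nm (tree_sum n p - h) <= 2 * 2^-1 ^+ n.
  apply: le_trans (hl n) _; rewrite (_ : 1 - 2^-1 = 2^-1 :> R); last by field.
  by rewrite invrK mul1r.
have small (e : R) : 0 < e -> exists N, 4 * 2^-1 ^+ N < e.
  move=> e0.
  have /cvgrPdist_lt/(_ e e0)[N _ Nn] : (fun n => 4 * 2^-1 ^+ n : R) @ \oo --> (0 : R).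
    rewrite -[X in _ --> X](mulr0 4).
    by apply: cvgM; [exact: cvg_cst|apply: cvg_expr; rewrite ger0_norm ?invr_ge0 //; lra].
  by exists N; have := Nn N (leqnn N); rewrite /= sub0r normrN ger0_norm.
have sh : sa h.
  apply/eqP; rewrite -subr_eq0; apply/eqP/nm_eps => e e0.
  have [N Ne] := small e e0; have [sN _ _] := tree_sumP N Pp.
  have := nm_tri (tree_sum N p) (st h) h; have := hl N.
  by rewrite -{2}sN -stB nm_st (nmBC h); lra.
exists h => // t /andP[t0 t1] [v [_ vh]].
have n0 : 0 < nm v + 1 by have := nm_ge0 v; lra.
have [|N Ne] := small (nm v + 1)^-1; first by rewrite invr_gt0.
have [|q [Pq pq pqE qN]] := tree_branch N Pp (t := t); first by rewrite !ltW.
have q1 := nm_proj1 pq (P0 _ Pq).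
have hq : nm ((h - sc U t) * q) < (nm v + 1)^-1.
  apply: le_lt_trans Ne.
  have -> : (h - sc U t) * q = (h - tree_sum N p) * q + (tree_sum N p - sc U t) * q.
    by nring.
  have := qN N (leqnn N); have := nm_projmul (h - tree_sum N p) pq.
  have := nmD ((h - tree_sum N p) * q) ((tree_sum N p - sc U t) * q).
  have := hl N; rewrite (nmBC h); lra.
have : 1 <= nm v * nm ((h - sc U t) * q).
  by rewrite -q1 -{1}[q]mul1r -vh -mulrA; exact: nmM.
have := nm_ge0 v; have := nm_ge0 ((h - sc U t) * q).
move: hq; rewrite -[X in _ < X]mul1r ltr_pdivlMr //; nra.
Qed.

End Tree.

Lemma min_mod_exists s : proj_out s -> exists p, min_mod p /\ s * p = p.
Proof.
move=> os; apply: contrapT => nmin.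
(* Without a minimal projection below s, every candidate p has a part q with q and p - q outside J;
   the value 0 is a dummy for elements that are not candidates. *)
have /choice[split splitP] p : exists q, proj_out p /\ s * p = p ->
    [/\ proj_out q, proj_out (p - q) & p * q = q].
  have [h|h] := pselect (proj_out p /\ s * p = p); last by exists 0.
  have [[pp Bp Jp] sp] := h; apply: contrapT => nq; apply: nmin; exists p; split=> //.
  split=> // q pq Bq pqE; apply: contrapT => /not_orP[Jq Jpq]; apply: nq; exists q => _.
  by split=> //; split=> //; [exact: proj_sub|apply: (csubB cB.1)].
pose P := [set p | proj_out p /\ s * p = p].
have [p Pp||q [[_ _ Jq] _]|h sh hs] := @tree_interval split P _ s.
- have [h1 h2 h3] := splitP _ Pp; have [[pp _ _] sp] := Pp; split=> //.
  + by case: h1.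
  + by split=> //; rewrite -h3 mulrA sp.
  + by split=> //; rewrite mulrBr sp -h3 mulrA sp h3.
- by split=> //; case: os => [[]].
- by apply/eqP => q0; apply: Jq; rewrite q0.
- have [t tab []] := sU sh (ltr01 : 0 < 1 :> R); exact: hs.
Qed.

Section Scalars.
Variable p : U.
Hypothesis mp : min_mod p.

Let pp : isproj p. Proof. by case: mp => [[]]. Qed.
Let Bp : B p. Proof. by case: mp => [[]]. Qed.
Let nJp : ~ J p. Proof. by case: mp => [[]]. Qed.

(** The class of p in the quotient has norm at least 1, for otherwise [proj_near_idl] would put p
    into J. Hence scalars modulo J are unique and depend continuously on the element. *)
Lemma min_mod_dist (c : R[i]) j : J j -> normc c <= nm (c *: p - j).
Proof.
move=> Jj; rewrite leNgt; apply/negP => lt.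
have c0 : c != 0.
  by apply/eqP => c0; move: lt; rewrite c0 normc0 ltNge nm_ge0.
have nc : 0 < normc c.
  by rewrite lt_def normc_ge0 andbT; apply: contra c0 => /eqP/eq0_normc ->.
apply: nJp; apply: (@proj_near_idl _ _ _ _ cB iJ p (c^-1 *: j)) => //.
  exact: (idlZ iJ).
have -> : p - c^-1 *: j = c^-1 *: (c *: p - j).
  by rewrite scalerBr scalerA mulVf // scale1r.
by rewrite nmZ normcV mulrC ltr_pdivrMr // mul1r.
Qed.

(** Cut the spectrum, contained in [-C, C], at a gap t in ]0, C/4[. By minimality one of the
    spectral projections q, p - q lies in J, so modulo J the spectrum lies in [-C, C/4] or in
    [0, C]. Recentering by -3C/8 or C/2 leaves radius at most 5C/8. *)
Lemma min_mod_step y (C : R) : 0 < C -> sa y -> B y -> p * y = y -> nm y <= C ->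
  exists y' (m : R), [/\ sa y', B y', p * y' = y', nm y' <= 5 / 8 * C &
    J (y - y' - m%:C *: p)].
Proof.
move=> C0 sy By py yC.
have yp : y * p = y by rewrite -{1}sy -pp.1 -stM py sy.
have C4 : 0 < C / 4 by rewrite divr_gt0.
have [t /andP[t0 tC] yt] := sU sy C4.
have [f [cf f0 fE]] := gap_step t0 yt.
set q := fc y f; have pq : isproj q := step_proj sy cf fE.
have Bq : B q by apply: fc_csub => //; exact: cB.1.
have pqE : p * q = q.
  by apply: (@fc_csub _ _ [set z | p * z = z]) => //; exact: proj_below_csub.
have yq : q * y = y * q by apply: fc_comm.
have corner c (g : R -> R) : continuous g -> (forall s, spec y s -> `|g s + c| <= 5 / 8 * C) ->
    p * fc y g = fc y g -> nm (fc y g + c%:C *: p) <= 5 / 8 * C.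
  move=> cg gC pg; have -> : fc y g + c%:C *: p = p * fc y (fun s => g s + c).
    by rewrite fcD ?fc_cst ?mulrDr ?pg ?scEr //; cont.
  by apply: le_trans (nm_mulproj _ pp) _; apply: fc_norm => //; cont.
have fqy : fc y (fun s => f s * s) = q * y by rewrite fcM ?fc_id //; cont.
have cfs : continuous (fun s => f s * s) by cont.
have [_ /(_ q pq Bq pqE)[Jq|Jpq]] := mp.
- exists (fc y (fun s => s - f s * s) + (3 / 8 * C)%:C *: p), (- (3 / 8 * C)).
  have E : fc y (fun s => s - f s * s) = y - q * y by rewrite fc_id_sub.
  split.
  + by apply: saD; [apply: fc_sa => //; cont|apply/saZ; exact: pp.1].
  + rewrite E; apply: (csubD cB.1); last exact: (csubZ cB.1).
    by apply: (csubB cB.1) => //; apply: (csubM cB.1).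
  + by rewrite mulrDr -scalerAr pp.2 E mulrBr mulrA pqE py.
  + apply: corner; [by cont| |by rewrite E mulrBr mulrA pqE py].
    move=> s ys; have := spec_le sy ys; rewrite ler_norml fE // => /andP[s1 s2].
    by case: (ltP t s) => ts; rewrite ler_norml; lra.
  + rewrite E rmorphN /= scaleNr opprK opprD addrA addrNK opprB addrC subrK.
    by apply: (idlMr iJ) => //.
- exists (fc y (fun s => f s * s) + (- (C / 2))%:C *: p), (C / 2).
  split.
  + by apply: saD; [exact: fc_sa|apply/saZ; exact: pp.1].
  + rewrite fqy; apply: (csubD cB.1); last exact: (csubZ cB.1).
    by apply: (csubM cB.1).
  + by rewrite mulrDr -scalerAr pp.2 fqy mulrA pqE.
  + apply: corner => //; last by rewrite fqy mulrA pqE.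
    move=> s ys; have := spec_le sy ys; rewrite ler_norml fE // => /andP[s1 s2].
    by case: (ltP t s) => ts; rewrite ler_norml; lra.
  + rewrite fqy rmorphN /= scaleNr opprB addrA addrAC addrK.
    have -> : y - q * y = (p - q) * y by rewrite mulrBl py.
    exact: (idlMr iJ).
Qed.

(** Iterating [min_mod_step] makes the remainder decay like (5/8)^n. The accumulated scalars form a
    Cauchy sequence, since [min_mod_dist] bounds their differences by the remainders. *)
Lemma min_mod_scalar_sa x : sa x -> B x -> p * x = x ->
  exists l : R, J (x - l%:C *: p).
Proof.
move=> sx Bx px; pose C := nm x + 1.
have C0 : 0 < C by rewrite /C; have := nm_ge0 x; lra.
have r0 n : 0 < (5 / 8) ^+ n :> R by rewrite exprn_gt0 // divr_gt0.
have /choice[t tP] n : exists t : R, exists y, [/\ sa y, B y, p * y = y,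
    nm y <= (5 / 8) ^+ n * C & J (x - y - t%:C *: p)].
  elim: n => [|n [t [y [sy By py yn Jy]]]].
    exists 0, x; rewrite expr0 mul1r subrr scale0r subrr; split=> //.
    by rewrite /C; lra.
  have [|y' [m [sy' By' py' yn' Jy']]] := @min_mod_step y ((5 / 8) ^+ n * C) _ sy By py yn.
    by rewrite mulr_gt0.
  exists (t + m), y'; split=> //; first by rewrite exprS -mulrA.
  have -> : x - y' - (t + m)%:C *: p = (x - y - t%:C *: p) + (y - y' - m%:C *: p).
    by rewrite -!scE scD; nring.
  exact: (idlD iJ).
have small e : 0 < e -> exists N, forall n, (N <= n)%N -> (5 / 8) ^+ n * C < e.
  move=> e0.
  have /cvgrPdist_lt/(_ e e0)[N _ Nn] : (fun n => (5 / 8) ^+ n * C : R) @ \oo --> (0 : R).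
    rewrite -[X in _ --> X](mul0r C).
    by apply: cvgM; [apply: cvg_expr; rewrite ger0_norm; lra|exact: cvg_cst].
  exists N => n /Nn; rewrite /= sub0r normrN ger0_norm // mulr_ge0 ?ltW //.
have tt n m : `|t n - t m| <= (5 / 8) ^+ n * C + (5 / 8) ^+ m * C.
  have [y [sy By py yn Jy]] := tP n; have [z [sz Bz pz zm Jz]] := tP m.
  rewrite -normc_real.
  apply: le_trans (min_mod_dist (t n - t m)%:C (idlB iJ Jz Jy)) _.
  have -> : (t n - t m)%:C *: p - (x - z - (t m)%:C *: p - (x - y - (t n)%:C *: p)) = z - y.
    by rewrite -!scE scB; nring.
  by apply: le_trans (nmB _ _) _; rewrite addrC lerD.
have [|l tl] := @real_complete _ t.
  move=> e e0; have [|N Ne] := small (e / 2); first by rewrite divr_gt0.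
  exists N => m n Nm Nn; apply: le_lt_trans (tt m n) _.
  by have := Ne m Nm; have := Ne n Nn; lra.
exists l; apply: cJ => e e0; have e2 : 0 < e / 2 by rewrite divr_gt0.
have [N Ne] := small _ e2; have [M Me] := tl _ e2.
have [y [sy By py yn Jy]] := tP (maxn N M).
exists (x - y - (t (maxn N M))%:C *: p) => //.
have -> : x - l%:C *: p - (x - y - (t (maxn N M))%:C *: p) =
    y + (t (maxn N M) - l)%:C *: p by rewrite -!scE scB; nring.
have := nmD y ((t (maxn N M) - l)%:C *: p); rewrite nmZr.
have := Ne _ (leq_maxl N M); have := Me _ (leq_maxr N M).
have := ler_piMr (normr_ge0 (t (maxn N M) - l)) (nm_proj pp); lra.
Qed.

Lemma min_mod_scalar x : B x -> p * x = x -> x * p = x ->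
  exists l : R[i], J (x - l *: p).
Proof.
move=> Bx px xp.
have pstx : p * st x = st x by rewrite -{1}pp.1 -stM xp.
have Bst : B (st x) by exact: cB.2.
have [||a Ja] := @min_mod_scalar_sa (rpart x) (rpart_sa x).
- by apply: (csubZ cB.1); apply: (csubD cB.1).
- by rewrite /rpart -scalerAr mulrDr px pstx.
have [||b Jb] := @min_mod_scalar_sa (ipart x) (ipart_sa x).
- by apply: (csubZ cB.1); apply: (csubZ cB.1); apply: (csubB cB.1).
- by rewrite /ipart -!scalerAr mulrBr px pstx.
exists (a%:C + 'i * b%:C).
have -> : x - (a%:C + 'i * b%:C) *: p = (rpart x - a%:C *: p) + 'i *: (ipart x - b%:C *: p).
  rewrite {1}(ri_partE x); move: (rpart x) (ipart x) => c d.
  by rewrite scalerDl scalerBr scalerA opprD addrACA.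
by apply: (idlD iJ) => //; exact: (idlZ iJ).
Qed.

End Scalars.

End MinimalProjections.

(** * Approximate finite dimension *)

Section Span.
Context (R : realType) (U : ucstarType R).
Implicit Types (x y : U) (l : seq U).

Definition inspan l x := exists c : nat -> R[i], x = \sum_(i < size l) c i *: l`_i.

Lemma inspan0 l : inspan l 0.
Proof. by exists (fun=> 0); rewrite big1 // => i _; rewrite scale0r. Qed.

Lemma inspanD l x y : inspan l x -> inspan l y -> inspan l (x + y).
Proof.
move=> [c ->] [d ->]; exists (fun i => c i + d i).
by rewrite -big_split; apply: eq_bigr => i _; rewrite scalerDl.
Qed.

Lemma inspanZ l (a : R[i]) x : inspan l x -> inspan l (a *: x).
Proof.
move=> [c ->]; exists (fun i => a * c i).
by rewrite scaler_sumr; apply: eq_bigr => i _; rewrite scalerA.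
Qed.

Lemma inspan_mem l x : x \in l -> inspan l x.
Proof.
move=> xl; exists (fun i => if i == index x l then 1 else 0).
have il : (index x l < size l)%N by rewrite index_mem.
rewrite (bigD1 (Ordinal il)) //= eqxx scale1r nth_index // big1 ?addr0 // => i ii.
by rewrite ifN ?scale0r //; apply: contra ii => /eqP ii; apply/eqP/val_inj.
Qed.

Lemma inspan_sum I (r : seq I) (P : pred I) (F : I -> U) l :
  (forall i, P i -> inspan l (F i)) -> inspan l (\sum_(i <- r | P i) F i).
Proof. by move=> h; apply: big_ind => //; [exact: inspan0|exact: inspanD]. Qed.

Lemma inspan_sub l l' x : {subset l <= l'} -> inspan l x -> inspan l' x.
Proof.
move=> ll' [c ->]; apply: inspan_sum => i _; apply/inspanZ/inspan_mem/ll'.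
exact: mem_nth.
Qed.

Definition fdim (D : set U) := exists l : seq U,
  (forall x, x \in l -> D x) /\ forall x, D x -> inspan l x.

Lemma clo_pre (f : U -> U) (M : R) (K : set U) :
  (forall x y, f (x - y) = f x - f y) -> (forall x, nm (f x) <= M * nm x) ->
  clo K -> clo [set x | K (f x)].
Proof.
move=> fB fM cK x xK; apply: cK => e e0.
have M0 : 0 < `|M| + 1 by rewrite ltr_pwDr.
have [y /= Ky xy] := xK (e / (`|M| + 1)) (divr_gt0 e0 M0).
exists (f y) => //; rewrite -fB; apply: le_lt_trans (fM _) _.
apply: (@le_lt_trans _ _ ((`|M| + 1) * nm (x - y))).
  by rewrite ler_wpM2r ?nm_ge0//; have := ler_norm M; lra.
by rewrite mulrC -ltr_pdivlMr.
Qed.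

Lemma nm_mul3 a x b : nm (a * x * b) <= nm a * nm b * nm x.
Proof.
have := nmM (a * x) b; have := ler_wpM2r (nm_ge0 b) (nmM a x); lra.
Qed.

Lemma clo_line (g : U) : isproj g -> clo [set x : U | exists c : R[i], x = c *: g].
Proof.
move=> pg x xK; have [g0|g0] := eqVneq g 0.
  exists 0; rewrite g0 scaler0; apply: nm_eps => e /xK[y [c ->]].
  by rewrite g0 scaler0 subr0 => /ltW.
have g1 := nm_proj1 pg g0.
have /choice[c cP] (n : nat) : exists c : R[i], nm (x - c *: g) < n.+1%:R^-1.
  have [|y [c ->] xy] := xK n.+1%:R^-1; first by rewrite invr_gt0.
  by exists c.
have small (e : R) : 0 < e -> exists N : nat, forall n, (N <= n)%N -> n.+1%:R^-1 < e.
  move=> e0; exists (Num.truncn e^-1) => n Nn; rewrite -ltf_pV2 ?posrE ?invr_gt0// invrK.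
  by apply: lt_le_trans (truncnS_gt _) _; rewrite ler_nat ltnS.
have [|l cl] := @complex_complete _ c.
  move=> e e0; have [|N Ne] := small (e / 2); first by rewrite divr_gt0.
  exists N => m n Nm Nn; rewrite -[normc _]mulr1 -g1 -nmZ scalerBl.
  have := nm_tri x (c m *: g) (c n *: g); rewrite (nmBC (c m *: g) x).
  by have := lt_trans (cP m) (Ne m Nm); have := lt_trans (cP n) (Ne n Nn); lra.
exists l; apply/eqP; rewrite -subr_eq0; apply/eqP/nm_eps => e e0.
have [|N Ne] := small (e / 2); first by rewrite divr_gt0.
have [|M Me] := cl (e / 2); first by rewrite divr_gt0.
pose n := maxn N M; have := nm_tri (c n *: g) x (l *: g).
rewrite -scalerBl nmZ g1 mulr1.
have := lt_trans (cP n) (Ne n (leq_maxl _ _)); have := Me n (leq_maxr _ _); lra.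
Qed.

Definition af_in (K : set U) := forall n (x : 'I_n -> U) (e : R),
  (forall k, K (x k)) -> 0 < e -> exists D, [/\ cstsub D, D `<=` K, fdim D &
    exists y : 'I_n -> U, forall k, D (y k) /\ nm (x k - y k) < e].

End Span.

(** * Matrix algebras added to an orthogonal subalgebra *)

Section MatrixUnits.
Context (R : realType) (U : ucstarType R) (g : U) (m : nat) (w : nat -> U).
Implicit Types (x y d F : U) (D : set U).

(** The w i are partial isometries with common initial projection g and orthogonal ranges; the
    matrix units are the products [w i * st (w j)], with unit [P]. *)
Definition munits := isproj g /\ forall i, (i < m)%N -> w i * g = w i /\
  forall j, (j < m)%N -> st (w i) * w j = if i == j then g else 0.

Hypothesis mu : munits.
Let P := \sum_(i < m) w i * st (w i).

Lemma munits_st i : (i < m)%N -> g * st (w i) = st (w i).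
Proof.
by move=> im; have [wg _] := mu.2 i im; have := congr1 st wg; rewrite stM mu.1.1.
Qed.

Lemma munits_sum j : (j < m)%N -> P * w j = w j.
Proof.
move=> jm; rewrite /P mulr_suml (bigD1 (Ordinal jm)) //= -mulrA.
have [wg ww] := mu.2 j jm; rewrite ww // eqxx wg big1 ?addr0 // => i ij.
have [_ ww'] := mu.2 i (ltn_ord i); rewrite -mulrA ww' // ifN ?mulr0 //.
Qed.

Lemma munits_sum_sa : sa P.
Proof. by rewrite /sa st_sum; apply: eq_bigr => i _; rewrite stM stK. Qed.

Lemma munits_sum_st j : (j < m)%N -> st (w j) * P = st (w j).
Proof. by move=> jm; rewrite -munits_sum_sa -stM munits_sum. Qed.

Lemma munits_proj : isproj P.
Proof.
split; first exact: munits_sum_sa.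
by rewrite {2}/P mulr_sumr; apply: eq_bigr => i _; rewrite mulrA munits_sum.
Qed.

Definition mspan (c : nat -> nat -> R[i]) : U :=
  \sum_(i < m) \sum_(j < m) c i j *: (w i * st (w j)).

Lemma mspan_entry c i j : (i < m)%N -> (j < m)%N -> st (w i) * mspan c * w j = c i j *: g.
Proof.
move=> im jm; rewrite mulr_sumr mulr_suml (bigD1 (Ordinal im)) //= [X in _ + X]big1 ?addr0; last first.
  move=> i' ii; rewrite mulr_sumr mulr_suml big1 // => j' _.
  have [_ ww] := mu.2 i im; rewrite -scalerAr -scalerAl !mulrA ww // ifN ?mul0r ?scaler0 //.
  by rewrite eq_sym.
rewrite mulr_sumr mulr_suml (bigD1 (Ordinal jm)) //= [X in _ + X]big1 ?addr0; last first.
  move=> j' jj; rewrite -scalerAr -scalerAl -!mulrA.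
  have [_ ww] := mu.2 j' (ltn_ord j'); rewrite ww // ifN ?mulr0 ?scaler0 //.
rewrite -scalerAr -scalerAl -!mulrA.
have [_ ww] := mu.2 j jm; rewrite ww // eqxx mulrA.
by have [_ ww'] := mu.2 i im; rewrite ww' // eqxx mu.1.2.
Qed.

Lemma mspan_exp c x : (forall i j, (i < m)%N -> (j < m)%N -> st (w i) * x * w j = c i j *: g) ->
  P * x * P = mspan c.
Proof.
move=> xc; rewrite /P mulr_suml mulr_suml; apply: eq_bigr => i _.
rewrite mulr_sumr; apply: eq_bigr => j _.
have -> : w i * st (w i) * x * (w j * st (w j)) = w i * (st (w i) * x * w j) * st (w j) by nring.
by rewrite xc // -scalerAr -scalerAl -mulrA munits_st.
Qed.

Variables (F : U) (D : set U).
Hypotheses (pF : isproj F) (Fw : forall i, (i < m)%N -> F * w i = 0).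
Hypotheses (cD : cstsub D) (DF : D `<=` [set x | F * x * F = x]).

Definition line (h : U) := [set x : U | exists c : R[i], x = c *: h].

(* The direct sum of D and the matrix algebra spanned by the [w i * st (w j)]. *)
Definition madd := [set x | [/\ x = F * x * F + P * x * P, D (F * x * F) &
  forall i j, (i < m)%N -> (j < m)%N -> line g (st (w i) * x * w j)]].

Let FP : F * P = 0.
Proof. by rewrite /P mulr_sumr big1 // => i _; rewrite mulrA Fw // mul0r. Qed.

Let PF : P * F = 0. Proof. exact: (proj_orth pF munits_proj FP). Qed.

Lemma line_sum I (r : seq I) (Q : pred I) (f : I -> U) :
  (forall i, Q i -> line g (f i)) -> line g (\sum_(i <- r | Q i) f i).
Proof.
move=> h; apply: big_ind => //; first by exists 0; rewrite scale0r.
by move=> _ _ [a ->] [b ->]; exists (a + b); rewrite scalerDl.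
Qed.

Lemma madd_left x : madd x -> F * x = F * x * F /\ P * x = P * x * P.
Proof.
move=> [xE _ _]; split.
  by rewrite {1}xE mulrDr !mulrA pF.2 FP !mul0r addr0.
by rewrite {1}xE mulrDr !mulrA munits_proj.2 PF !mul0r add0r.
Qed.

(** Membership is a condition on the corners of x, so closedness is inherited from D and from the
    line spanned by g. The product formula rests on F and P being orthogonal and commuting with
    x. *)
Lemma madd_csub : csub madd.
Proof.
split.
- move=> x xK; split.
  + have c : clo [set y : U | y - (F * y * F + P * y * P) = 0].
      apply: (@clo_cst _ _ (fun y => y - (F * y * F + P * y * P)) 0
        (1 + (nm F * nm F + nm P * nm P))) => [u v|u]; first by nring.
      rewrite mulrDl mul1r; apply: le_trans (nmB _ _) _; rewrite lerD2l.
      apply: le_trans (nmD _ _) _; rewrite mulrDl; apply: lerD; exact: nm_mul3.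
    apply/eqP; rewrite -subr_eq0; apply/eqP; apply: c => e /xK[y [yE _ _] xy].
    by exists y => //=; rewrite -yE subrr.
  + apply: (@clo_pre _ _ (fun x => F * x * F) (nm F * nm F) D) => [u v|u||e /xK[y [_ Dy _] xy]].
    * by nring.
    * exact: nm_mul3.
    * exact: (csub_clo cD.1).
    * by exists y.
  + move=> i j im jm.
    apply: (@clo_pre _ _ (fun x => st (w i) * x * w j) (nm (st (w i)) * nm (w j)) (line g))
      => [u v|u||e /xK[y [_ _ ly] xy]].
    * by nring.
    * exact: nm_mul3.
    * exact: clo_line mu.1.
    * by exists y => //; exact: ly.
- split; rewrite ?mulr0 ?mul0r ?addr0 //; first exact: (csub0 cD.1).
  by move=> i j _ _; exists 0; rewrite mulr0 mul0r scale0r.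
- move=> a x y [xE Dx lx] [yE Dy ly]; split.
  + rewrite {1}xE {1}yE !mulrDr !mulrDl -!scalerAr -!scalerAl scalerDr.
    by rewrite addrACA.
  + by rewrite mulrDr mulrDl -scalerAr -scalerAl; apply: (csubD cD.1) => //; exact: (csubZ cD.1).
  + move=> i j im jm; have [b xb] := lx i j im jm; have [c yc] := ly i j im jm.
    exists (a * b + c).
    by rewrite mulrDr mulrDl -scalerAr -scalerAl xb yc scalerA scalerDl.
- move=> x y mx my; have [xF xP] := madd_left mx; have [yF yP] := madd_left my.
  have [xE Dx lx] := mx; have [yE Dy ly] := my.
  have FE : F * (x * y) * F = (F * x * F) * (F * y * F).
    by rewrite mulrA {1}xF !mulrA -(mulrA _ F F) pF.2.
  have PE : P * (x * y) * P = (P * x * P) * (P * y * P).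
    by rewrite mulrA {1}xP !mulrA -(mulrA _ P P) munits_proj.2.
  split.
  + rewrite FE PE {1}xE {1}yE mulrDl !mulrDr.
    have -> : F * x * F * (P * y * P) = 0 by rewrite !mulrA -(mulrA _ F P) FP mulr0 !mul0r.
    have -> : P * x * P * (F * y * F) = 0 by rewrite !mulrA -(mulrA _ P F) PF mulr0 !mul0r.
    by rewrite addr0 add0r.
  + by rewrite FE; exact: (csubM cD.1).
  + move=> i j im jm.
    have -> : st (w i) * (x * y) * w j = st (w i) * x * P * (y * w j).
      rewrite -{1}(munits_sum_st im) -(mulrA (st (w i)) P) (mulrA P) xP.
      by rewrite !mulrA (munits_sum_st im).
    rewrite /P mulr_sumr mulr_suml; apply: line_sum => k _.
    have -> : st (w i) * x * (w k * st (w k)) * (y * w j) =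
      (st (w i) * x * w k) * (st (w k) * y * w j) by nring.
    have [b ->] := lx i k im (ltn_ord k); have [c ->] := ly k j (ltn_ord k) jm.
    by exists (b * c); rewrite -scalerAl -scalerAr mu.1.2 scalerA.
Qed.

Lemma madd_cst : cstsub madd.
Proof.
split; first exact: madd_csub.
move=> x [xE Dx lx]; have stF (G : U) : sa G -> st (G * x * G) = G * st x * G.
  by move=> sG; rewrite !stM sG mulrA.
split.
- by rewrite {1}xE stD !stF //; [exact: munits_sum_sa|exact: pF.1].
- by rewrite -stF; [exact: cD.2|exact: pF.1].
- move=> i j im jm; have [c xc] := lx j i jm im; exists c^*.
  have -> : st (w i) * st x * w j = st (st (w j) * x * w i) by rewrite !stM stK mulrA.
  by rewrite xc stZ mu.1.1.
Qed.

Lemma madd_mem c d : D d -> madd (d + mspan c).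
Proof.
move=> Dd; have Fd := DF Dd; have dF : F * d = d.
  by rewrite -Fd !mulrA pF.2.
have FM : F * mspan c = 0.
  by rewrite mulr_sumr big1 // => i _; rewrite mulr_sumr big1 // => j _;
    rewrite -scalerAr mulrA Fw // mul0r scaler0.
have wF i : (i < m)%N -> st (w i) * F = 0.
  by move=> im; rewrite -pF.1 -stM Fw // st0.
have wd i : (i < m)%N -> st (w i) * d = 0.
  by move=> im; rewrite -dF mulrA wF // mul0r.
have E i j : (i < m)%N -> (j < m)%N -> st (w i) * (d + mspan c) * w j = c i j *: g.
  by move=> im jm; rewrite mulrDr wd // add0r mspan_entry.
split.
- by rewrite (mspan_exp E) mulrDr FM addr0 Fd.
- by rewrite mulrDr FM addr0 Fd.
- by move=> i j im jm; exists (c i j); exact: E.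
Qed.

Lemma madd_dec x : madd x -> exists c, x = F * x * F + mspan c.
Proof.
move=> [xE Dx lx].
have /choice[c cP] (t : nat * nat) : exists c : R[i], (t.1 < m)%N -> (t.2 < m)%N ->
    st (w t.1) * x * w t.2 = c *: g.
  have [i0|i0] := boolP (t.1 < m)%N; last by exists 0.
  have [j0|j0] := boolP (t.2 < m)%N; last by exists 0.
  by have [c h] := lx _ _ i0 j0; exists c.
exists (fun i j => c (i, j)); rewrite {1}xE; congr (_ + _).
by apply: mspan_exp => i j im jm; exact: (cP (i, j)).
Qed.

Lemma madd_fdim : fdim D -> fdim madd.
Proof.
move=> [l [lD Dl]].
pose l2 := [seq w i * st (w j) | i <- iota 0 m, j <- iota 0 m].
have l2P i j : (i < m)%N -> (j < m)%N -> w i * st (w j) \in l2.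
  by move=> im jm; apply/allpairsP; exists (i, j); rewrite !mem_iota.
have mD d : D d -> madd d.
  move=> Dd; have := @madd_mem (fun _ _ => 0) d Dd.
  rewrite /mspan big1 ?addr0 // => i _; rewrite big1 // => j _.
  by rewrite scale0r.
exists (l ++ l2); split.
  move=> x; rewrite mem_cat => /orP[/lD/mD //|/allpairsP[[i j] /= []]].
  rewrite !mem_iota /= add0n => im jm ->.
  have := @madd_mem (fun i' j' => ((i' == i) && (j' == j))%:R) 0 (csub0 cD.1).
  rewrite add0r /mspan (bigD1 (Ordinal im)) //= (bigD1 (Ordinal jm)) //=.
  rewrite !eqxx scale1r big1 ?addr0 => [|j' jj]; last first.
    by have := jj; rewrite -val_eqE /= => /negbTE ->; rewrite scale0r.
  rewrite big1 ?addr0 // => i' ii; rewrite big1 // => j' _.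
  by have := ii; rewrite -val_eqE /= => /negbTE ->; rewrite scale0r.
move=> x mx; have [c ->] := madd_dec mx; have [_ Dx _] := mx.
apply: inspanD.
  by apply: inspan_sub (Dl _ Dx) => y yl; rewrite mem_cat yl.
apply: inspan_sum => i _; apply: inspan_sum => j _; apply/inspanZ/inspan_mem.
by rewrite mem_cat l2P ?orbT.
Qed.

End MatrixUnits.

(** * Extending approximate finiteness by a minimal projection of the quotient *)

Section Extension.
Context (R : realType) (U : ucstarType R) (B J : set U).
Hypotheses (cB : cstsub B) (iJ : idl B J) (cJ : clo J) (J0 : J 0) (sU : scat U).
Variables (p s : U).
Hypotheses (mp : min_mod B J p) (ps : isproj s) (Bs : B s).
Implicit Types (x y z h q : U) (v : nat -> U).

Let JD := idlD iJ.
Let JB := idlB iJ.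
Let JMr := idlMr iJ.
Let JMl := idlMl iJ.
Let BM := csubM cB.1.
Let BD := csubD cB.1.
Let BB := csubB cB.1.
Let pp : isproj p. Proof. by case: mp => [[]]. Qed.
Let Bp : B p. Proof. by case: mp => [[]]. Qed.
Let nJp : ~ J p. Proof. by case: mp => [[]]. Qed.

(** Lifting a partial isometry from the quotient forces p to be cut down; the class modulo J stays
    the same. *)
Definition equiv_below q := [/\ isproj q, B q, p * q = q & J (p - q)].

Lemma equiv_below_min q : equiv_below q -> min_mod B J q.
Proof.
move=> [pq Bq pqE Jpq]; split.
  by split=> // Jq; apply: nJp; rewrite -(subrK q p); exact: JD.
move=> q' pq' Bq' qq'.
have qp := proj_leC pp pq pqE.
have [|Jq'|Jpq'] := mp.2 q' pq' Bq'; [by rewrite -qq' mulrA pqE|by left|right].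
have -> : q - q' = q * (p - q') by rewrite mulrBr qp qq'.
exact: JMl.
Qed.

(* Matrix units: the [v i] are partial isometries from [q] to orthogonal
   subprojections of [s], so that the [v i * st (v j)] span a matrix algebra. *)
Definition matrix_system q m v := equiv_below q /\ forall i, (i < m)%N ->
  [/\ B (v i), s * v i = v i, v i * q = v i &
      forall j, (j < m)%N -> st (v i) * v j = if i == j then q else 0].

Definition mrest m v := s - \sum_(i < m) v i * st (v i).

Section Rest.
Variables (q : U) (m : nat) (v : nat -> U).
Hypothesis sys : matrix_system q m v.

Lemma sys_st i : (i < m)%N -> B (st (v i)) /\ q * st (v i) = st (v i) /\ st (v i) * s = st (v i).
Proof.
move=> im; have [Bv sv vq _] := sys.2 i im; have [pq _ _ _] := sys.1.
split; first exact: cB.2.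
split; first by have := congr1 st vq; rewrite stM pq.1.
by have := congr1 st sv; rewrite stM ps.1.
Qed.

Let mu : munits q m v.
Proof.
split=> [|i im]; first by case: sys.1.
by have [_ _ vq vv] := sys.2 i im.
Qed.

Lemma sys_sum_below : s * (\sum_(i < m) v i * st (v i)) = \sum_(i < m) v i * st (v i).
Proof.
rewrite mulr_sumr; apply: eq_bigr => i _.
by have [_ sv _ _] := sys.2 i (ltn_ord i); rewrite mulrA sv.
Qed.

Lemma mrest_proj : isproj (mrest m v).
Proof. exact: proj_sub ps (munits_proj mu) sys_sum_below. Qed.

Lemma mrest_below : s * mrest m v = mrest m v.
Proof. by rewrite mulrBr ps.2 sys_sum_below. Qed.

Lemma mrest_below' : mrest m v * s = mrest m v.
Proof. exact: (proj_leC ps mrest_proj mrest_below). Qed.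

Lemma mrest_B : B (mrest m v).
Proof.
apply: BB => //; apply: (csub_sum cB.1) => i _; apply: BM.
  by have [] := sys.2 i (ltn_ord i).
exact: (sys_st (ltn_ord i)).1.
Qed.

Lemma mrest_mul j : (j < m)%N -> mrest m v * v j = 0.
Proof.
by move=> jm; have [_ sv _ _] := sys.2 j jm; rewrite mulrBl sv (munits_sum mu) // subrr.
Qed.

Lemma st_mul_mrest j : (j < m)%N -> st (v j) * mrest m v = 0.
Proof. by move=> jm; rewrite -mrest_proj.1 -stM mrest_mul // st0. Qed.

(** If the column y = r a q is not in J, the partial isometry w in its polar decomposition, cut off
    at a spectral gap of st y * y, is a new matrix unit orthogonal to the others. All v i are cut
    down to its initial projection q'. Since w * st w * y = y q' and q - q' lies in J, the new rest
    annihilates a p modulo J. *)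
Lemma matrix_system_step a : B a -> s * a = a ->
  exists q' m' v', [/\ matrix_system q' m' v', J (mrest m' v' * a * p) &
    forall b, B b -> J (mrest m v * b * p) -> J (mrest m' v' * b * p)].
Proof.
move=> Ba sa'; set r := mrest m v.
have [pq Bq pqE Jpq] := sys.1; have mq := equiv_below_min sys.1.
have Br : B r := mrest_B.
pose y := r * a * q.
have By : B y by apply: BM => //; apply: BM.
have rap : r * a * p = y + r * a * (p - q) by rewrite /y -mulrDr addrC subrK.
have Jrapq : J (r * a * (p - q)) by apply: JMl => //; apply: BM.
have [Jy|nJy] := pselect (J y).
  by exists q, m, v; split=> //; rewrite -/r rap; apply: JD.
pose h := st y * y; have ph : psd h := psd_cstar y; have sh := ph.1.
have Bh : B h by apply: BM => //; apply: cB.2.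
have yq : y * q = y by rewrite /y -mulrA pq.2.
have qy : q * st y = st y by rewrite -{1}pq.1 -stM yq.
have nJh : ~ J h by move=> Jh; apply: nJy; exact: (idl_cstar cB iJ cJ Jh By).
(* d is a lower bound for the distance from h to J. A gap t below d keeps q' outside J, as q' h is
   at distance at most t from h. *)
have [d d0 dP] : exists2 d : R, 0 < d & forall z, J z -> d <= nm (h - z).
  apply: contrapT => nd; apply: nJh; apply: cJ => e e0; apply: contrapT => nz.
  apply: nd; exists e => // z Jz; rewrite leNgt; apply/negP => lt; apply: nz.
  by exists z.
have [t /andP[t0 td] ht] := sU sh d0.
have [f [cf f0 fE]] := gap_step t0 ht.
set q' := fc h f; have pq' : isproj q' := step_proj sh cf fE.
have Bq' : B q' by apply: fc_csub => //; exact: cB.1.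
have qh : q * h = h by rewrite mulrA qy.
have qq' : q * q' = q'.
  by apply: (@fc_csub _ _ [set z | q * z = z]) => //; exact: proj_below_csub.
have q'q := proj_leC pq pq' qq'.
have nJq' : ~ J q'.
  move=> Jq'; have : d <= nm (h - q' * h) by apply: dP; apply: JMr.
  rewrite leNgt => /negP; apply; apply: le_lt_trans td.
  rewrite -fc_id_sub //; apply: fc_norm => // [|x hx]; first by cont.
  have x0 := ph.2 _ hx; rewrite fE //; case: (ltP t x) => tx.
    by rewrite mul1r subrr normr0 ltW.
  by rewrite mul0r subr0 ger0_norm.
have Jqq' : J (q - q') by case: (mq.2 q' pq' Bq' qq').
(* g is x^(-1/2) above the gap and 0 below it; the maximum with t keeps it continuous where f
   vanishes. *)
pose g (x : R) := f x * (Num.sqrt (Num.max x t))^-1.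
have cg : continuous g.
  have c1 : continuous (fun x : R => (Num.sqrt (Num.max x t))^-1).
    apply: contV => [x|]; last by cont.
    by rewrite gt_eqF // sqrtr_gt0 lt_max t0 orbT.
  by rewrite /g; cont.
set z := fc h g; have sz : sa z by exact: fc_sa.
have Bz : B z by apply: fc_csub => //; [exact: cB.1|rewrite /g f0 mul0r].
have qz : q * z = z.
  apply: (@fc_csub _ _ [set z | q * z = z]) => //; first exact: proj_below_csub.
  by rewrite /g f0 mul0r.
have cfx : continuous (fun x : R => x) by cont.
have zhz : z * h * z = q'.
  have cgx : continuous (fun x : R => g x * x) by cont.
  rewrite /z -{2}(fc_id sh) -(fcM (g := fun x : R => x)) // -(fcM (f := fun x : R => g x * x)) //.
  apply: fc_ext => //; first by cont.
  move=> x hx; rewrite /g fE //; case: (ltP t x) => tx; last by rewrite !mul0r.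
  have x0 : 0 < x by exact: lt_trans tx.
  rewrite !mul1r mulrAC -expr2 exprVn sqr_sqrtr ?ltW //.
  by rewrite mulVf // gt_eqF.
have hz : h * z = z * h by symmetry; exact: fc_comm.
have zq' : z * q' = z.
  rewrite /z /q' -fcM //; apply: fc_ext => //; first by cont.
  by move=> x hx; rewrite /g fE //; case: (t < x); rewrite ?mulr1 ?mulr0 ?mul0r.
pose w := y * z.
have Bw : B w by apply: BM.
have rw : r * w = w by rewrite /w /y !mulrA mrest_proj.2.
have sw : s * w = w by rewrite -rw mulrA mrest_below.
have ww : st w * w = q' by rewrite /w stM sz -zhz /h !mulrA.
have wq' : w * q' = w by rewrite /w -mulrA zq'.
have vw i : (i < m)%N -> st (v i) * w = 0.
  by move=> im; rewrite -rw mulrA st_mul_mrest // mul0r.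
have wv i : (i < m)%N -> st w * v i = 0.
  by move=> im; rewrite -(stK (v i)) -stM vw // st0.
pose v' i := if (i < m)%N then v i * q' else w.
have vm : v' m = w by rewrite /v' ltnn.
(* Cutting the v i down to q' changes the rest only by the middle sum, which lies in J because q -
   q' does. *)
have r'E : mrest m.+1 v' = r + \sum_(i < m) v i * (q - q') * st (v i) - w * st w.
  rewrite /mrest big_ord_recr /= vm opprD addrA; congr (_ - _).
  rewrite /r /mrest -addrA -sumrN -sumrN -big_split /=; congr (_ + _); apply: eq_bigr => i _.
  have [_ _ vq _] := sys.2 i (ltn_ord i).
  rewrite /v' ltn_ord stM pq'.1 mulrBr vq mulrBl mulrA.
  by rewrite -(mulrA (v i) q' q') pq'.2; nring.
have r'M b : mrest m.+1 v' * b * p = r * b * p +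
    (\sum_(i < m) v i * (q - q') * st (v i)) * b * p - w * st w * b * p.
  by rewrite r'E; clearbody r; nring.
have Jsum b : B b -> J ((\sum_(i < m) v i * (q - q') * st (v i)) * b * p).
  move=> Bb; apply: JMr => //; apply: JMr => //; apply: (idl_sum iJ) => // i _.
  apply: JMr; last exact: (sys_st (ltn_ord i)).1.
  by apply: JMl => //; have [] := sys.2 i (ltn_ord i).
exists q', m.+1, v'; split.
- split.
    split=> //; first by rewrite -qq' mulrA pqE.
    have -> : p - q' = (p - q) + (q - q') by nring.
    exact: JD.
  move=> i; rewrite ltnS leq_eqVlt => /orP[/eqP ->|im].
    rewrite /v' ltnn; split=> // j; rewrite ltnS leq_eqVlt => /orP[/eqP ->|jm].
      by rewrite ltnn eqxx.
    by rewrite jm mulrA wv // mul0r ifN // neq_ltn jm orbT.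
  have [Bv sv vq vv] := sys.2 i im.
  rewrite /v' im; split; [exact: BM|by rewrite mulrA sv|by rewrite -mulrA pq'.2|].
  move=> j; rewrite ltnS leq_eqVlt => /orP[/eqP ->|jm].
    by rewrite ltnn stM -mulrA vw // mulr0 ifN // neq_ltn im.
  rewrite jm stM pq'.1 -mulrA (mulrA (st (v i))) vv //; case: eqP => _.
    by rewrite mulrA q'q pq'.2.
  by rewrite mul0r mulr0.
- rewrite r'M rap.
  have -> : w * st w * a * p = w * st w * (r * a * p).
    by rewrite -{2}rw stM mrest_proj.1 !mulrA.
  rewrite rap (mulrDr (w * st w)).
  have -> : w * st w * y = y * q'.
    have -> : w * st w * y = y * (z * (z * h)) by rewrite /w /h stM sz !mulrA.
    by rewrite -hz (mulrA z h z) zhz.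
  have -> : y + r * a * (p - q) + (\sum_(i < m) v i * (q - q') * st (v i)) * a * p -
      (y * q' + w * st w * (r * a * (p - q))) =
      (r * a * (p - q) - w * st w * (r * a * (p - q))) + y * (q - q') +
      (\sum_(i < m) v i * (q - q') * st (v i)) * a * p.
    by rewrite (mulrBr y) yq; nring.
  apply: JD; last exact: Jsum.
  apply: JD; last exact: JMl.
  by apply: JB => //; apply: JMl => //; apply: BM => //; exact: cB.2.
- move=> b Bb Jb; rewrite r'M; apply: JB.
    by apply: JD => //; exact: Jsum.
  have -> : w * st w * b * p = w * st w * (r * b * p).
    by rewrite -{2}rw stM mrest_proj.1 !mulrA.
  by apply: JMl => //; apply: BM => //; exact: cB.2.
Qed.

End Rest.

Lemma matrix_system_list (l : seq U) : (forall a, a \in l -> B a /\ s * a = a) ->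
  exists q m v, matrix_system q m v /\ forall a, a \in l -> J (mrest m v * a * p).
Proof.
elim: l => [_|a l IHl al].
  exists p, 0%N, (fun=> 0); split=> //; split=> //; split=> //; first exact: pp.2.
  by rewrite subrr.
have [|q [m [v [sys lJ]]]] := IHl; first by move=> b bl; apply: al; rewrite inE bl orbT.
have [|Ba sa'] := al a; first by rewrite inE eqxx.
have [q' [m' [v' [sys' Ja' Jb']]]] := matrix_system_step sys Ba sa'.
exists q', m', v'; split=> // b; rewrite inE => /orP[/eqP -> //|bl].
by apply: Jb'; [apply: (al b _).1; rewrite inE bl orbT|exact: lJ].
Qed.

(** Here s lies in the ideal generated by J and p. A matrix system absorbing the a k leaves a rest r
    in J. The compressions of x k to the matrix units are scalars modulo J, so x k = y k + z k with
    y k a matrix and z k in J. A projection F in J that commutes with the matrix units and nearly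
    fixes the z k is chosen; the corner of F is handled by hypothesis, its complement by a matrix
    algebra. *)
Lemma corner_matrix_af (n : nat) (a b : nat -> U) jj :
  (forall f, isproj f -> J f -> af_in (corner f B)) ->
  (forall k, (k < n)%N -> B (a k) /\ B (b k)) -> J jj ->
  s = \sum_(k < n) a k * p * b k + jj -> af_in (corner s B).
Proof.
move=> goodJ ab Jjj sE.
have [|q [m [v [sys lJ]]]] := @matrix_system_list [seq s * a k | k <- iota 0 n].
  move=> u /mapP[k]; rewrite mem_iota => kn ->; split; last by rewrite mulrA ps.2.
  by apply: BM => //; exact: (ab k kn).1.
set r := mrest m v in lJ; have pr : isproj r := mrest_proj sys.
have sr : s * r = r := mrest_below sys.
have rs : r * s = r := mrest_below' sys.
have Br : B r := mrest_B sys.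
have [pq Bq _ _] := sys.1.
have mu : munits q m v.
  by split=> // i im; have [_ _ vq vv] := sys.2 i im.
have Bv i : (i < m)%N -> B (v i) by move=> im; have [] := sys.2 i im.
have sv i : (i < m)%N -> s * v i = v i by move=> im; have [] := sys.2 i im.
have Bstv i (im : (i < m)%N) := cB.2 _ (Bv i im).
have stvs i (im : (i < m)%N) : st (v i) * s = st (v i) by have [_ []] := sys_st sys im.
have qv i (im : (i < m)%N) : q * st (v i) = st (v i) by have [_ []] := sys_st sys im.
have nv i : (i < m)%N -> nm (v i) <= 1.
  move=> im; have [_ _ _ /(_ i im)] := sys.2 i im; rewrite eqxx => vv.
  rewrite -(@ler_pXn2r _ 2) ?nnegrE ?nm_ge0 // expr1n -nm_cstar vv.
  exact: nm_proj.
pose P0 := \sum_(i < m) v i * st (v i).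
have sP : s = P0 + r by rewrite /r /mrest addrC subrK.
(* Since r s = r, r is the sum of the terms r (s a k) p b k, each in J by the choice of the matrix
   system, and of r jj. *)
have Jr : J r.
  have -> : r = \sum_(k < n) r * (s * a k) * p * b k + r * jj.
    rewrite -{1}rs {1}sE mulrDr; congr (_ + _); rewrite mulr_sumr.
    by apply: eq_bigr => k _; rewrite (mulrA r s) rs !mulrA.
  apply: JD; last exact: JMl.
  apply: (idl_sum iJ) => // k _; apply: JMr; last exact: (ab k (ltn_ord k)).2.
  by apply: lJ; apply/mapP; exists (val k) => //; rewrite mem_iota /= add0n ltn_ord.
move=> N x e Kx e0.
have Bx k : B (x k) by case: (Kx k).
have sx k : s * x k = x k by case: (Kx k) => _ [].
have xs k : x k * s = x k by case: (Kx k) => _ [].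
have /choice[c cP] (t : 'I_N * nat * nat) : exists c : R[i], (t.1.2 < m)%N -> (t.2 < m)%N ->
    J (st (v t.1.2) * x t.1.1 * v t.2 - c *: q).
  have [i0|i0] := boolP (t.1.2 < m)%N; last by exists 0.
  have [j0|j0] := boolP (t.2 < m)%N; last by exists 0.
  have [|||l Jl] := @min_mod_scalar _ _ B J cB iJ cJ J0 sU q (equiv_below_min sys.1)
    (st (v t.1.2) * x t.1.1 * v t.2).
  - by apply: BM; [apply: BM; [exact: Bstv|exact: Bx]|exact: Bv].
  - by rewrite !mulrA qv.
  - by have [_ _ vq _] := sys.2 _ j0; rewrite -mulrA vq.
  - by exists l.
pose C k i j := c (k, i, j).
pose y k := mspan m v (C k); pose z k := x k - y k.
have Jz k : J (z k).
  have -> : z k = \sum_(i < m) \sum_(j < m)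
      v i * (st (v i) * x k * v j - C k i j *: q) * st (v j) + (r * x k + P0 * x k * r).
    have -> : \sum_(i < m) \sum_(j < m)
        v i * (st (v i) * x k * v j - C k i j *: q) * st (v j) = P0 * x k * P0 - y k.
      rewrite /P0 /y /mspan !mulr_suml -sumrB; apply: eq_bigr => i _.
      rewrite mulr_sumr -sumrB; apply: eq_bigr => j _.
      have [_ _ vq _] := sys.2 i (ltn_ord i).
      by rewrite mulrBr mulrBl -scalerAr -scalerAl vq !mulrA.
    rewrite /z -{1}(xs k) -{1}(sx k) sP.
    have -> : r * x k = r * x k * (P0 + r) by rewrite -sP -mulrA xs.
    by nring.
  apply: JD; first apply: (idl_sum iJ) => // i _.
    apply: (idl_sum iJ) => // j _; apply: JMr => //; last exact: Bstv.
    by apply: JMl; [exact: (cP (k, val i, val j) (ltn_ord i) (ltn_ord j))|exact: Bv].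
  apply: JD; first exact: JMr.
  apply: JMl => //; apply: BM => //.
  by apply: (csub_sum cB.1) => i _; apply: BM; [exact: Bv|exact: Bstv].
have By k : B (y k).
  apply: (csub_sum cB.1) => i _; apply: (csub_sum cB.1) => j _.
  by apply: (csubZ cB.1); apply: BM; [exact: Bv|exact: Bstv].
have sy k : s * y k = y k.
  rewrite mulr_sumr; apply: eq_bigr => i _; rewrite mulr_sumr; apply: eq_bigr => j _.
  by rewrite -scalerAr mulrA sv.
have ys k : y k * s = y k.
  rewrite mulr_suml; apply: eq_bigr => i _; rewrite mulr_suml; apply: eq_bigr => j _.
  by rewrite -scalerAl -mulrA stvs.
have sz k : s * z k = z k by rewrite mulrBr sx sy.
have szt k : s * st (z k) = st (z k).
  have zs : z k * s = z k by rewrite mulrBl xs ys.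
  by rewrite -{1}ps.1 -stM zs.
pose zz := [seq z k | k : 'I_N] ++ [seq st (z k) | k : 'I_N].
have zzP w : w \in zz -> J w /\ s * w = w.
  rewrite mem_cat => /orP[] /mapP[k _ ->]; first by [].
  by split => //; exact: (idl_st iJ).
have M0 : 0 < 4 * (m%:R + 1) :> R by rewrite mulr_gt0 // ltr_pwDr.
(* Each of the m columns and the rest contributes an error of at most d, together e/4. *)
pose d := e / (4 * (m%:R + 1)); have d0 : 0 < d by rewrite divr_gt0.
have cJst := idl_cst iJ J0 cJ.
have [|f0 [pf0 [Jf0 [/= qf0 f0q]] f0P]] := @proj_approx_unit _ _ (corner q J)
    [seq st (v i) * w | i <- iota 0 m, w <- zz] d sU (corner_cst pq.1 cJst) _ d0.
  move=> u /allpairsP[[i w] /= [+ wz ->]]; rewrite mem_iota /= add0n => im.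
  have [Jw _] := zzP w wz; split; last first.
    have qq : q * (st (v i) * w) = st (v i) * w by rewrite mulrA qv.
    split => /=; first by rewrite mulrA qq.
    by rewrite -[X in _ * X]pq.1 -mulrA -stM qq.
  apply: JMr; first by apply: JMl => //; exact: Bstv.
  by apply: cB.2; apply: BM; [exact: Bstv|exact: (idl_sub iJ)].
have [|f1 [pf1 [Jf1 [/= rf1 f1r]] f1P]] := @proj_approx_unit _ _ (corner r J)
    [seq r * w | w <- zz] d sU (corner_cst pr.1 cJst) _ d0.
  move=> u /mapP[w wz ->]; have [Jw _] := zzP w wz; split; last first.
    split => /=; first by rewrite !mulrA pr.2.
    by rewrite stM pr.1 -!mulrA pr.2.
  by apply: JMr; [exact: JMl|apply: cB.2; apply: BM => //; exact: (idl_sub iJ)].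
(* Copying f0 to all m ranges gives F0 v i = v i f0, so that F commutes with the matrix units. *)
pose F0 := \sum_(i < m) v i * f0 * st (v i); pose F := F0 + f1.
have Bf0 := idl_sub iJ Jf0.
have F0v i : (i < m)%N -> F0 * v i = v i * f0.
  move=> im; rewrite /F0 mulr_suml (bigD1 (Ordinal im)) //= big1 ?addr0 => [|j ij].
    by rewrite -mulrA; have [_ ->//] := mu.2 i im; rewrite eqxx -mulrA f0q.
  have [_ vv] := mu.2 j (ltn_ord j).
  by rewrite -mulrA vv // ifN ?mulr0.
have f1v i : (i < m)%N -> f1 * v i = 0.
  by move=> im; rewrite -f1r -mulrA (mrest_mul sys im) mulr0.
have pF0 : isproj F0.
  split.
    by rewrite st_sum; apply: eq_bigr => i _; rewrite !stM stK pf0.1 mulrA.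
  rewrite {2}/F0 mulr_sumr; apply: eq_bigr => i _.
  by rewrite !mulrA F0v // -(mulrA (v i)) pf0.2.
have f1F0 : f1 * F0 = 0.
  by rewrite mulr_sumr big1 // => i _; rewrite !mulrA f1v // !mul0r.
have pF : isproj F by apply: proj_add => //; exact: proj_orth f1F0.
have JF : J F.
  apply: JD => //; apply: (idl_sum iJ) => // i _; apply: JMr; last exact: Bstv.
  by apply: JMl => //; exact: Bv.
have sF : s * F = F.
  rewrite mulrDr; congr (_ + _); last by rewrite -rf1 mulrA sr.
  by rewrite mulr_sumr; apply: eq_bigr => i _; rewrite !mulrA sv.
have Fs : F * s = F := proj_leC ps pF sF.
have Fz w : w \in zz -> nm (w - F * w) <= e / 4.
  move=> wz; have [_ sw] := zzP w wz.
  have -> : w - F * w = \sum_(i < m) v i * (st (v i) * w - f0 * (st (v i) * w)) +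
      (r * w - f1 * (r * w)).
    have -> : \sum_(i < m) v i * (st (v i) * w - f0 * (st (v i) * w)) = P0 * w - F0 * w.
      rewrite /P0 /F0 !mulr_suml -sumrB; apply: eq_bigr => i _.
      by rewrite mulrBr !mulrA.
    rewrite (mulrA f1) f1r -{1}sw sP /F; nring.
  apply: le_trans (nmD _ _) _.
  have h1 : nm (r * w - f1 * (r * w)) <= d.
    by apply/ltW/f1P; apply/mapP; exists w.
  have h0 : nm (\sum_(i < m) v i * (st (v i) * w - f0 * (st (v i) * w))) <= m%:R * d.
    rewrite mulr_natl -[X in d *+ X](card_ord m) -sumr_const.
    elim/big_ind2: _ => [|a1 b1 a2 b2 h1' h2'|i _]; first by rewrite nm0.
      by apply: le_trans (nmD _ _) _; exact: lerD.
    apply: le_trans (nmM _ _) _.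
    have h2 : nm (st (v i) * w - f0 * (st (v i) * w)) < d.
      by apply: f0P; apply/allpairsP; exists (val i, w); rewrite mem_iota /=.
    have := nv i (ltn_ord i); have := nm_ge0 (v i).
    by have := nm_ge0 (st (v i) * w - f0 * (st (v i) * w)); nra.
  have : (m%:R + 1) * d = e / 4.
    by rewrite /d; field; rewrite gt_eqF // ltr_pwDr.
  lra.
have FzF k : nm (z k - F * z k * F) <= e / 2.
  have h1 : nm (z k - F * z k) <= e / 4.
    by apply: Fz; rewrite mem_cat map_f // mem_enum.
  have h2 : nm (st (z k) - F * st (z k)) <= e / 4.
    by apply: Fz; rewrite mem_cat [X in _ || X]map_f ?orbT // mem_enum.
  have -> : z k - F * z k * F = (z k - F * z k) + F * st (st (z k) - F * st (z k)).
    by rewrite stB stM pF.1 stK; nring.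
  apply: le_trans (nmD _ _) _.
  by have := nm_mulproj (st (st (z k) - F * st (z k))) pF; rewrite nm_st; lra.
pose g := q - f0; pose w i := v i * g.
have pg : isproj g := proj_sub pq pf0 qf0.
have gf0 : g * f0 = 0 by rewrite mulrBl qf0 pf0.2 subrr.
have f0g : f0 * g = 0 := proj_orth pg pf0 gf0.
have muw : munits g m w.
  split=> // i im; split=> [|j jm]; first by rewrite /w -mulrA pg.2.
  have [_ /(_ j jm) vv] := mu.2 i im; rewrite /w stM pg.1 -mulrA (mulrA _ (v j)) vv.
  case: eqP => _; last by rewrite mul0r mulr0.
  by rewrite /g mulrBr pq.2 qf0 -/g pg.2.
have Fw i : (i < m)%N -> F * w i = 0.
  by move=> im; rewrite mulrA mulrDl F0v // f1v // addr0 -mulrA f0g mulr0.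
have e2 : 0 < e / 2 by rewrite divr_gt0.
have [|D [cD DB fD [y' y'P]]] := goodJ F pF JF N (fun k => F * x k * F) (e / 2) _ e2.
  move=> k; split; first by apply: BM => //; [apply: BM => //|]; exact: (idl_sub iJ).
  by split=> /=; [rewrite !mulrA pF.2|rewrite -mulrA pF.2].
have DF : D `<=` [set x | F * x * F = x].
  by move=> a1 /DB[_ [/= h1 h2]]; rewrite h1 h2.
exists (madd g m w F D); split.
- exact: madd_cst.
- move=> u mu'; have [cc ->] := madd_dec muw mu'; have [_ Du _] := mu'.
  have [Bu [/= h1 h2]] := DB _ Du; move: Bu h1 h2; move: (F * u * F) => u' Bu h1 h2.
  have Bg : B g by apply: BB.
  have sw i : (i < m)%N -> s * w i = w i by move=> im; rewrite mulrA sv.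
  split.
    apply: BD => //; apply: (csub_sum cB.1) => i _; apply: (csub_sum cB.1) => j _.
    by apply: (csubZ cB.1); apply: BM; [|apply: cB.2]; apply: BM => //; exact: Bv.
  split => /=.
    rewrite mulrDr -{1}h1 mulrA sF h1; congr (_ + _).
    rewrite mulr_sumr; apply: eq_bigr => i _; rewrite mulr_sumr; apply: eq_bigr => j _.
    by rewrite -scalerAr mulrA sw.
  rewrite mulrDl -{1}h2 -mulrA Fs h2; congr (_ + _).
  rewrite mulr_suml; apply: eq_bigr => i _; rewrite mulr_suml; apply: eq_bigr => j _.
  by rewrite -scalerAl -mulrA -{1}ps.1 -stM sw.
- exact: madd_fdim.
- exists (fun k => y' k + mspan m w (C k)) => k; have [Dy xy'] := y'P k.
  split; first exact: madd_mem.
  (* Because q = g + f0, each product v i * st (v j) splits into the matrix unit over g and its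
     compression by F, with the same coefficient. *)
  have yE : y k = mspan m w (C k) + F * y k * F.
    rewrite /y /mspan mulr_sumr mulr_suml -big_split; apply: eq_bigr => i _.
    rewrite mulr_sumr mulr_suml -big_split; apply: eq_bigr => j _ /=.
    rewrite -scalerAr -scalerAl -scalerDr; congr (_ *: _).
    rewrite mulrA (mulrDl F0) f1v // addr0 F0v // -(mulrA _ (st (v j)) F).
    have -> : st (v j) * F = f0 * st (v j).
      rewrite -{1}pF.1 -stM mulrDl f1v // addr0 F0v // stM pf0.1 //.
    have [vq _] := mu.2 i (ltn_ord i).
    rewrite /w stM pg.1 -!mulrA (mulrA g) pg.2 (mulrA f0) pf0.2.
    by rewrite -mulrDr -mulrDl /g subrK qv.
  have -> : x k - (y' k + mspan m w (C k)) = (F * x k * F - y' k) + (z k - F * z k * F).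
    have -> : x k = y k + z k by rewrite /z addrC subrK.
    by rewrite {1}yE; nring.
  apply: le_lt_trans (nmD _ _) _; have := FzF k; lra.
Qed.

End Extension.

(** * Maximal ideals and approximate finiteness of all subalgebras *)

Section ScatteredAF.
Context (R : realType) (U : ucstarType R) (B : set U).
Hypotheses (cB : cstsub B) (sU : scat U).
Implicit Types (x y : U) (I : set U).

Definition cl I := [set x : U | forall e : R, 0 < e -> exists2 y : U, I y & nm (x - y) < e].

Lemma sub_cl I : I `<=` cl I.
Proof. by move=> x Ix e e0; exists x; rewrite ?subrr ?nm0. Qed.

Lemma cl_lip (f : U -> U) (M : R) I : (forall x y, f (x - y) = f x - f y) ->
  (forall x, nm (f x) <= M * nm x) -> (forall x, I x -> I (f x)) ->
  forall x, cl I x -> cl I (f x).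
Proof.
move=> fB fM fI x Ix e e0.
have M0 : 0 < `|M| + 1 by rewrite ltr_pwDr.
have [y Iy xy] := Ix (e / (`|M| + 1)) (divr_gt0 e0 M0).
exists (f y); first exact: fI.
rewrite -fB; apply: le_lt_trans (fM _) _.
apply: (@le_lt_trans _ _ ((`|M| + 1) * nm (x - y))).
  by rewrite ler_wpM2r ?nm_ge0//; have := ler_norm M; lra.
by rewrite mulrC -ltr_pdivlMr.
Qed.

Lemma cl_idl I : idl B I -> idl B (cl I).
Proof.
move=> iI; split.
- move=> x Ix; apply: (csub_clo cB.1) => e /Ix[y /(idl_sub iI) By xy].
  by exists y.
- move=> a x y Ix Iy e e0.
  have Iax : cl I (a *: x).
    apply: (@cl_lip (fun x => a *: x) (normc a)) => // [u v|u|u]; first by rewrite scalerBr.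
      by rewrite nmZ.
    exact: (idlZ iI).
  have e2 : 0 < e / 2 by rewrite divr_gt0.
  have [u Iu xu] := Iax _ e2; have [v Iv yv] := Iy _ e2.
  exists (u + v); first exact: (idlD iI).
  have -> : a *: x + y - (u + v) = (a *: x - u) + (y - v) by nring.
  by apply: le_lt_trans (nmD _ _) _; lra.
- move=> x b Ix Bb; split.
    apply: (@cl_lip (fun x => x * b) (nm b)) => // [u v|u|u Iu]; first by nring.
      by rewrite mulrC; exact: nmM.
    exact: (idlMr iI).
  apply: (@cl_lip (fun x => b * x) (nm b)) => // [u v|u|u Iu]; first by nring.
    exact: nmM.
  exact: (idlMl iI).
- move=> x Ix; apply: (@cl_lip st 1) => // [u v|u|u Iu]; first by rewrite stB.
    by rewrite nm_st mul1r.
  exact: (idl_st iI).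
Qed.

Lemma cl_clo I : clo (cl I).
Proof.
move=> x xI e e0; have e2 : 0 < e / 2 by rewrite divr_gt0.
have [y yI xy] := xI _ e2; have [z Iz yz] := yI _ e2.
by exists z => //; have := nm_tri y x z; lra.
Qed.

Lemma idl_zero : idl B [set 0].
Proof.
split.
- by move=> x ->; exact: (csub0 cB.1).
- by move=> a x y -> ->; rewrite scaler0 addr0.
- by move=> x b -> _; rewrite mul0r mulr0.
- by move=> x ->; rewrite /= st0.
Qed.

(** Zorn is applied to ideals that need not be closed. The closure of a maximal one is again an
    ideal with P, hence no larger. It serves for the property that corners of projections are AF and
    for the vanishing of a functional. *)
Lemma max_idl (P : set U -> Prop) :
  (forall F : set (set U), (forall I, F I -> idl B I /\ P I) ->
     total_on F subset -> P (\bigcup_(I in F) I)) ->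
  (forall I, idl B I -> P I -> P (cl I)) -> P [set 0] ->
  exists J, [/\ idl B J, clo J, J 0, P J &
    forall J', J `<=` J' -> idl B J' -> P J' -> J' `<=` J].
Proof.
move=> Pbig Pcl P0.
have [F FP totF|J [[iJ PJ] maxJ]] := @Zorn_bigcup _ (fun I => idl B I /\ P I).
  split; last exact: Pbig.
  split.
  - by move=> x [I FI Ix]; apply: (idl_sub (FP _ FI).1).
  - move=> a x y [I FI Ix] [I' FI' Iy].
    have [II|II] := totF _ _ FI FI'; [exists I' => //|exists I => //].
      by apply: (idlD (FP _ FI').1); [apply: (idlZ (FP _ FI').1); exact: II|].
    by apply: (idlD (FP _ FI).1); [exact: (idlZ (FP _ FI).1)|exact: II].
  - move=> x b [I FI Ix] Bb; split; exists I => //.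
      exact: (idlMr (FP _ FI).1).
    exact: (idlMl (FP _ FI).1).
  - by move=> x [I FI Ix]; exists I => //; exact: (idl_st (FP _ FI).1).
have maxE J' : J `<=` J' -> idl B J' -> P J' -> J' `<=` J.
  move=> JJ' iJ' PJ'; apply: contrapT => nJ; exact: (maxJ J' (conj JJ' nJ)).
exists J; split=> //.
- by move=> x xJ; apply: (maxE (cl J)) => //; [exact: sub_cl|exact: cl_idl|exact: Pcl].
- have [[x /(idl0 iJ) //]|nJ] := pselect (exists x, J x).
  apply: (maxE [set 0]) => //; last exact: idl_zero.
  by move=> x Jx; case: nJ; exists x.
Qed.

(** The ideal generated by I and p, without closure, so that each member is a finite sum as required
    by [corner_matrix_af]. *)
Definition proj_ideal I p := [set z : U | exists (l : seq (U * U)) (j : U),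
  [/\ forall t, t \in l -> B t.1 /\ B t.2, I j & z = \sum_(t <- l) t.1 * p * t.2 + j]].

Lemma proj_ideal_idl I p : B p -> isproj p -> idl B I -> idl B (proj_ideal I p).
Proof.
move=> Bp pp iI; split.
- move=> _ [l [j [lB Ij ->]]]; apply: (csubD cB.1); last exact: (idl_sub iI).
  rewrite big_seq; apply: (csub_sum cB.1) => t /lB[B1 B2].
  by apply: (csubM cB.1) => //; apply: (csubM cB.1).
- move=> a _ _ [l [j [lB Ij ->]]] [l' [j' [lB' Ij' ->]]].
  exists ([seq (a *: t.1, t.2) | t <- l] ++ l'), (a *: j + j'); split.
  + move=> t; rewrite mem_cat => /orP[/mapP[u /lB[B1 B2] ->]|/lB' //]; split=> //.
    exact: (csubZ cB.1).
  + by apply: (idlD iI) => //; exact: (idlZ iI).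
  + rewrite big_cat big_map scalerDr addrACA; congr (_ + _ + _).
    by rewrite scaler_sumr; apply: eq_bigr => t _; rewrite -!scalerAl.
- move=> _ b [l [j [lB Ij ->]]] Bb; split.
    exists [seq (t.1, t.2 * b) | t <- l], (j * b); split.
    + by move=> t /mapP[u /lB[B1 B2] ->]; split=> //; exact: (csubM cB.1).
    + exact: (idlMr iI).
    + by rewrite mulrDl big_map mulr_suml; congr (_ + _); apply: eq_bigr => t _; rewrite !mulrA.
  exists [seq (b * t.1, t.2) | t <- l], (b * j); split.
  + by move=> t /mapP[u /lB[B1 B2] ->]; split=> //; exact: (csubM cB.1).
  + exact: (idlMl iI).
  + by rewrite mulrDr big_map mulr_sumr; congr (_ + _); apply: eq_bigr => t _; rewrite !mulrA.
- move=> _ [l [j [lB Ij ->]]]; exists [seq (st t.2, st t.1) | t <- l], (st j); split.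
  + by move=> t /mapP[u /lB[B1 B2] ->]; split=> //=; exact: cB.2.
  + exact: (idl_st iI).
  + rewrite stD st_sum big_map; congr (_ + _); apply: eq_bigr => t _.
    by rewrite !stM pp.1 mulrA.
Qed.

Lemma proj_out_exists I x : idl B I -> clo I -> B x -> ~ I x -> exists s, proj_out B I s.
Proof.
move=> iI cI Bx nIx; apply: contrapT => ns; apply: nIx; apply: cI => e e0.
have [|f [pf Bf fP]] := @proj_approx_unit _ _ B [:: x] e sU cB _ e0.
  move=> w; rewrite inE => /eqP ->; apply: (csubM cB.1) => //; exact: cB.2.
exists (f * x); last by apply: fP; rewrite inE.
apply: (idlMr iI) => //; apply: contrapT => nIf; apply: ns; exists f.
by split.
Qed.

Theorem scat_af : af_in B.
Proof.
(* Speaking of projections only, the property passes to closures: a projection in [cl I] lies in I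
   by [proj_near_idl]. *)
pose P I := forall p, isproj p -> I p -> af_in (corner p B).
have [F FP totF p pp [I FI Ip]|I iI PI p pp|p _ ->|I [iI cI I0 PI maxI]] := @max_idl P.
- exact: (FP _ FI).2.
- move=> /[dup] Ip /(_ 1 ltr01)[j Ij pj]; apply: PI => //.
  by apply: (proj_near_idl cB iI pp _ Ij pj); exact: (idl_sub (cl_idl iI) Ip).
- move=> n x e x0 e0; exists [set 0].
  have z0 k : x k = 0 by have [_ [/= <-]] := x0 k; rewrite mul0r.
  split.
  + split; last by move=> u ->; rewrite /= st0.
    split=> // [u uK|a u v -> ->|u v -> ->]; last 2 first.
    * by rewrite scaler0 addr0.
    * by rewrite mul0r.
    by apply: nm_eps => r /uK[y -> h]; rewrite ltW // -(subr0 u).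
  + move=> u ->; split; first exact: (csub0 cB.1).
    by split; rewrite /= mulr0.
  + by exists [::]; split=> // u ->; exact: inspan0.
  + by exists (fun=> 0) => k; split=> //; rewrite z0 subrr nm0.
have BI : B `<=` I.
  (* Otherwise B/I has a minimal projection p, and by [corner_matrix_af] the ideal generated by I
     and p still has the property, against maximality. *)
  move=> x Bx; apply: contrapT => nIx; have [s os] := proj_out_exists iI cI Bx nIx.
  have [p [mp sp]] := min_mod_exists cB I0 sU os.
  have [[pp Bp nIp] _] := mp.
  apply: nIp; apply: (maxI (proj_ideal I p)).
  - by move=> j Ij; exists [::], j; rewrite big_nil add0r.
  - exact: proj_ideal_idl.
  - move=> s' ps' /[dup] Is' [l [j [lB Ij sE]]].
    have Bs' := idl_sub (proj_ideal_idl Bp pp iI) Is'.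
    apply: (@corner_matrix_af _ _ B I cB iI cI I0 sU p s' mp ps' Bs' (size l)
      (fun k => (nth 0 l k).1) (fun k => (nth 0 l k).2) j) => //.
      by move=> k kl; apply: lB; exact: mem_nth.
    by rewrite sE (big_nth 0) big_mkord.
  - exists [:: (p, p)], 0; split=> //.
      by move=> t; rewrite inE => /eqP ->.
    by rewrite big_seq1 addr0 /= !pp.2.
move=> n x e Bx e0; have e4 : 0 < e / 4 by rewrite divr_gt0.
have e2 : 0 < e / 2 by rewrite divr_gt0.
(* A projection that nearly fixes all x k and their adjoints reduces the claim to its corner, which
   is AF because I = B. *)
pose l := [seq x k | k : 'I_n] ++ [seq st (x k) | k : 'I_n].
have [|q [pq Bq qP]] := @proj_approx_unit _ _ B l _ sU cB _ e4.
  move=> w; rewrite mem_cat => /orP[] /mapP[k _ ->]; apply: (csubM cB.1) => //; rewrite ?stK //;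
    exact: cB.2.
have [|D [cD DB fD [y yP]]] := PI q pq (BI _ Bq) n (fun k => q * x k * q) _ _ e2.
  move=> k; split; first by apply: (csubM cB.1) => //; apply: (csubM cB.1).
  by split=> /=; [rewrite !mulrA pq.2|rewrite -mulrA pq.2].
exists D; split=> //; first by move=> u /DB[].
exists y => k; have [Dy xy] := yP k; split=> //.
have h1 : nm (x k - q * x k) < e / 4 by apply: qP; rewrite mem_cat map_f // mem_enum.
have h2 : nm (st (x k) - q * st (x k)) < e / 4.
  by apply: qP; rewrite mem_cat [X in _ || X]map_f ?orbT // mem_enum.
have -> : x k - y k = (q * x k * q - y k) + (x k - q * x k) + q * st (st (x k) - q * st (x k)).
  by rewrite stB stM pq.1 stK; nring.
apply: le_lt_trans (nmD _ _) _.
have := nmD (q * x k * q - y k) (x k - q * x k).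
by have := nm_mulproj (st (st (x k) - q * st (x k))) pq; rewrite nm_st; lra.
Qed.

End ScatteredAF.

(** * Decomposition of positive functionals into pure ones *)

Section Limits.
Context (R : realType).
Implicit Types (u v : nat -> R[i]) (l m : R[i]).

Definition clim u l := forall e : R, 0 < e -> exists N, forall n, (N <= n)%N -> normc (u n - l) < e.

Lemma normcB_tri (z x y : R[i]) : normc (x - y) <= normc (x - z) + normc (z - y).
Proof. by rewrite -{1}(subrK z x) -addrA; exact: le_normcD. Qed.

Lemma normcBC (x y : R[i]) : normc (x - y) = normc (y - x).
Proof. by rewrite -normcN opprB. Qed.

Lemma normc_eps (z : R[i]) : (forall e : R, 0 < e -> normc z <= e) -> z = 0.
Proof.
move=> h; apply: eq0_normc; apply/eqP; rewrite eq_le normc_ge0 andbT.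
by apply/ler_addgt0Pr => e e0; rewrite add0r h.
Qed.

Lemma clim_uniq u l m : clim u l -> clim u m -> l = m.
Proof.
move=> ul um; apply/eqP; rewrite -subr_eq0; apply/eqP/normc_eps => e e0.
have e2 : 0 < e / 2 by rewrite divr_gt0.
have [N Ne] := ul _ e2; have [M Me] := um _ e2.
have := normcB_tri (u (maxn N M)) l m; rewrite (normcBC l (u _)).
have := Ne _ (leq_maxl N M); have := Me _ (leq_maxr N M); lra.
Qed.

Lemma clim_cst l : clim (fun=> l) l.
Proof. by move=> e e0; exists 0%N => n _; rewrite subrr normc0. Qed.

Lemma clim_lin (a : R[i]) u v l m : clim u l -> clim v m ->
  clim (fun n => a * u n + v n) (a * l + m).
Proof.
move=> ul vm e e0; have a0 : 0 < normc a + 1 by rewrite ltr_wpDl ?normc_ge0.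
have [N Ne] := ul (e / 2 / (normc a + 1)) (divr_gt0 (divr_gt0 e0 (ltr0n _ 2)) a0).
have [M Me] := vm (e / 2) (divr_gt0 e0 (ltr0n _ 2)).
exists (maxn N M) => n; rewrite geq_max => /andP[/Ne h1 /Me h2].
have -> : a * u n + v n - (a * l + m) = a * (u n - l) + (v n - m) by ring.
apply: le_lt_trans (le_normcD _ _) _; rewrite normcM.
move: h1; rewrite ltr_pdivlMr // => h1.
have := normc_ge0 (u n - l); nra.
Qed.

Lemma clim_sub u v l m : clim u l -> clim v m -> clim (fun n => u n - v n) (l - m).
Proof.
move=> ul vm; rewrite addrC -mulN1r.
by under eq_fun do rewrite addrC -mulN1r; exact: clim_lin.
Qed.

Lemma clim_ge0 u l : (forall n, 0 <= u n) -> clim u l -> 0 <= l.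
Proof.
move=> u0 ul; rewrite lecE; apply/andP; split.
  rewrite -normr_eq0 eq_le normr_ge0 andbT; apply/ler_addgt0Pr => e e0; rewrite add0r.
  have [N Ne] := ul e e0; apply: le_trans (ltW (Ne N (leqnn N))).
  have [-> _] := ge0_complex (u0 N); rewrite normcBC; apply: le_trans (normc_Im _).
  by case: (l) => a b /=; rewrite subr0.
apply/ler_addgt0Pr => e e0; have [N Ne] := ul e e0.
have [_ h] := ge0_complex (u0 N).
have := normc_Re (u N - l); rewrite ReD ReN; have := Ne N (leqnn N).
have := ler_norm (complex.Re (u N) - complex.Re l); rewrite /=; lra.
Qed.

Lemma clim_Re u l : clim u l -> clim (fun n => (complex.Re (u n))%:C) (complex.Re l)%:C.
Proof.
move=> ul e /ul[N Ne]; exists N => n /Ne; apply: le_lt_trans.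
have -> : (complex.Re (u n))%:C - (complex.Re l)%:C = (complex.Re (u n - l))%:C.
  by rewrite ReD ReN rmorphB.
by rewrite normc_real normc_Re.
Qed.

Lemma clim_le u l (r : R) : (forall n, complex.Re (u n) <= r) -> clim u l -> complex.Re l <= r.
Proof.
move=> ur /clim_Re ul; rewrite -subr_ge0 -ler0c rmorphB /=.
apply: clim_ge0 (clim_sub (clim_cst r%:C) ul) => n.
by rewrite -rmorphB /= ler0c subr_ge0.
Qed.

Lemma clim_sqr u l (C r : R) : 0 <= r < 1 ->
  (forall n, normc (u n - l) ^+ 2 <= C * r ^+ n) -> clim u l.
Proof.
move=> /andP[r0 r1] h e e0; have e2 : 0 < e ^+ 2 by rewrite exprn_gt0.
have /cvgrPdist_lt/(_ _ e2)[N _ Nn] : (fun n => C * r ^+ n : R) @ \oo --> (0 : R).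
  rewrite -[X in _ --> X](mulr0 C).
  by apply: cvgM; [exact: cvg_cst|apply: cvg_expr; rewrite ger0_norm].
exists N => n /Nn; rewrite /= sub0r normrN => lt.
rewrite -(@ltr_pXn2r _ 2) ?nnegrE ?normc_ge0 ?(ltW e0) //.
by apply: le_lt_trans (h n) (le_lt_trans (ler_norm _) lt).
Qed.

End Limits.

(** * Pure minorants and sums of pure functionals *)

Section Functionals.
Context (R : realType) (U : ucstarType R) (K : set U).
Hypothesis (cK : cstsub K).
Implicit Types (x y z p q : U) (F G L : {scalar U}).

Let KM := csubM cK.1.
Let KD := csubD cK.1.
Let KB := csubB cK.1.
Let KZ := csubZ cK.1.
Let Kst := cK.2.

Definition lin_on (S : set U) (g : U -> R[i]) :=
  forall (a : R[i]) x y, S x -> S y -> g (a *: x + y) = a * g x + g y.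

Definition fle G F := forall x, K x -> qf G x <= qf F x.

Definition pure_on G := [/\ pos_on K G, exists2 x, K x & G x != 0 &
  forall G', pos_on K G' -> fle G' G ->
    exists2 t : R, 0 <= t <= 1 & forall x, K x -> G' x = t%:C * G x].

Lemma qfZ F (t : R) x : qf F (t%:C *: x) = t ^+ 2 * qf F x.
Proof.
by rewrite /qf stZr -scalerAl -scalerAr scalerA -rmorphM /= scalarZ Re_scale expr2.
Qed.

Lemma qf_parallelogram F x y : qf F (x - y) = 2 * qf F x + 2 * qf F y - qf F (x + y).
Proof.
have e : st (x - y) * (x - y) =
    (st x * x + st x * x + (st y * y + st y * y)) - st (x + y) * (x + y).
  by rewrite stB stD; nring.
rewrite {1}/qf e linearB ReD ReN.
by rewrite !(linearD F) !ReD -/(qf F x) -/(qf F y) -/(qf F (x + y)); lra.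
Qed.

Lemma square_bound (C q r n : R) : 0 <= C -> 0 <= q -> r ^+ 2 <= n ^+ 2 ->
  n ^+ 2 <= C * q -> - C <= q - 2 * r.
Proof.
move=> C0 q0 h1 h2; have h3 := sqr_ge0 (C - q); rewrite leNgt; apply/negP => h4.
have h5 : C + q < 2 * r by lra.
by move: h1 h2 h3; rewrite !expr2; nra.
Qed.

Section Riesz.
Variables (F : {scalar U}) (S : set U) (L : U -> R[i]) (C : R) (e : nat -> R).
Hypotheses (pF : pos_on K F) (SK : S `<=` K) (S0 : S 0)
  (Slin : forall (a : R[i]) x y, S x -> S y -> S (a *: x + y)).
Hypotheses (linL : lin_on S L) (C0 : 0 <= C)
  (LC : forall x, S x -> normc (L x) ^+ 2 <= C * qf F x) (e0 : forall n, 0 < e n).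

Let phi x := qf F x - 2 * complex.Re (L x).

Let phi_ge x : S x -> - C <= phi x.
Proof.
move=> Sx; have := LC Sx; have := qf_ge0 pF (SK Sx); rewrite /phi.
have : complex.Re (L x) ^+ 2 <= normc (L x) ^+ 2.
  by rewrite -real_normK ?num_real // ler_pXn2r ?nnegrE ?normc_ge0 ?normr_ge0 ?normc_Re.
by move=> h1 h2 h3; exact: (square_bound C0 h2 h1 h3).
Qed.

(* The minimizing sequence of [qf F x - 2 Re (L x)] on [S]. *)
Lemma riesz : exists a : nat -> U, [/\ forall n, S (a n),
  forall m n, qf F (a m - a n) <= 2 * (e m + e n) &
  forall n x, S x -> normc (F (st (a n) * x) - L x) ^+ 2 <= e n * qf F x].
Proof.
pose m := inf (phi @` S).
have hi : has_inf (phi @` S).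
  split; first by exists (phi 0); exists 0.
  by exists (- C) => _ [x Sx <-]; exact: phi_ge.
have mle x : S x -> m <= phi x.
  by move=> Sx; apply: ge_inf; [exact: hi.2|exists x].
have /choice[a aP] n : exists a, S a /\ phi a < m + e n.
  by have [_ [x Sx <-] lt] := inf_adherent (e0 n) hi; exists x.
exists a; split=> [n|k n|n x Sx]; first by case: (aP n).
- have [Sk lk] := aP k; have [Sn ln] := aP n.
  have Smid : S ((2^-1)%:C *: (a k) + ((2^-1)%:C *: (a n) + 0)).
    by apply: Slin => //; exact: Slin.
  (* The midpoint of two near-minimizers cannot be lower than the infimum; the parallelogram law
     then bounds their distance. *)
  have := mle _ Smid; rewrite /phi addr0 -scalerDr qfZ qf_parallelogram.
  have -> : L ((2^-1)%:C *: (a k + a n)) = (2^-1)%:C * L (a k) + (2^-1)%:C * L (a n).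
    have L0 : L 0 = 0.
      by have := linL (- 1) S0 S0; rewrite scaler0 addr0 mulN1r addNr.
    rewrite scalerDr linL //; last by rewrite -(addr0 (_ *: _)); exact: Slin.
    by rewrite -[_ *: a n]addr0 linL // L0 addr0.
  rewrite ReD !Re_scale; move: lk ln; rewrite /phi; lra.
- have [Sa la] := aP n; apply: disc_le => [|||s]; [exact: ltW|exact: sqr_ge0|exact: qf_ge0 pF (SK Sx)|].
  set b := F (st (a n) * x) - L x.
  (* Near-minimality of a n tested in the direction of x, with the phase of b, is a quadratic
     inequality in s. *)
  have := mle _ (Slin (- s%:C * b^*) Sx Sa); rewrite /phi linL // {1}/qf (addrC _ (a n)).
  rewrite qf_polar (qfE pF (SK Sa)) (qfE pF (SK Sx)).
  rewrite (F_herm cK.1 pF (SK Sa) (SK Sx)).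
  move: la; rewrite /phi /b; case: (F (st (a n) * x)) => b1 b2; case: (L x) => l1 l2.
  case: (L (a n)) => k1 k2; move: (qf F x) (qf F (a n)) => qx qa /= la.
  rewrite sqr_sqrtr; last by rewrite addr_ge0 ?sqr_ge0.
  move: la; move: (e n) (m : R) => en mm la; lra.
Qed.

End Riesz.

(** Functionals are defined on all of U, but only their values on K matter. Pointwise limits and
    scalars modulo J are linear on K alone, and this hypothesis turns them into functionals. *)
Hypothesis Kext : forall g : U -> R[i], lin_on K g ->
  exists G : {scalar U}, forall x, K x -> G x = g x.
Hypothesis sU : scat U.

Section Minorant.
Variable F : {scalar U}.
Hypotheses (pF : pos_on K F) (nzF : exists2 x, K x & F x != 0).

Lemma vanishing_ideal : exists J p a, [/\ idl K J /\ clo J /\ J 0, min_mod K J p,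
  forall x, J x -> F x = 0, K a & 0 < qf F (p * a)].
Proof.
have [M M0 FM] := pos_cont cK.1 Kst pF.
pose P (I : set U) := forall x, I x -> F x = 0.
have [I FI totI x [X IX Xx]|I iI PI x xI|x ->|J [iJ cJ J0 PJ maxJ]] := @max_idl _ _ K cK P.
- exact: (FI X IX).2.
- apply: normc_eps => e e0; have M1 : 0 < M + 1 by lra.
  have [y Iy xy] := xI _ (divr_gt0 e0 M1).
  have Kx := idl_sub (cl_idl cK iI) xI; have Ky := idl_sub iI Iy.
  rewrite -[F x]subr0 -(PI y Iy) -linearB.
  have [_ h _] := FM _ (KB Kx Ky); apply: le_trans h _.
  move: xy; rewrite ltr_pdivlMr // mulrDr mulr1 mulrC => xy.
  by have := nm_ge0 (x - y); lra.
- by rewrite linear0.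
have [x0 Kx0 Fx0] := nzF.
have nJx0 : ~ J x0 by move=> /PJ/eqP; rewrite (negbTE Fx0).
have [s os] := proj_out_exists cK sU iJ cJ Kx0 nJx0.
have [p [mp _]] := min_mod_exists cK J0 sU os.
have [[pp Kp nJp] _] := mp.
(* If the p a were all null for F, Cauchy-Schwarz would make F vanish on the ideal generated by J
   and p, against maximality of J. *)
have [a Ka pa] : exists2 a, K a & qf F (p * a) != 0.
  apply: contrapT => na.
  have z a : K a -> qf F (p * a) = 0.
    by move=> Ka; apply: contrapT => /eqP h; apply: na; exists a.
  apply: nJp; apply: (maxJ (proj_ideal K J p)).
  - by move=> j Jj; exists [::], j; rewrite big_nil add0r.
  - exact: proj_ideal_idl.
  - move=> _ [l [j [lK Jj ->]]]; rewrite linearD (PJ j) // addr0 linear_sum big_seq.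
    rewrite big1 // => t /lK[K1 K2].
    have -> : t.1 * p * t.2 = st (p * st t.1) * (p * t.2).
      by rewrite stM stK pp.1 !mulrA -(mulrA t.1 p p) pp.2.
    apply: (qf_null cK.1 pF); [exact: KM|by apply: KM => //; exact: Kst|].
    by apply: z; exact: Kst.
  - exists [:: (p, p)], 0; split=> //.
      by move=> t; rewrite inE => /eqP ->.
    by rewrite big_seq1 addr0 /= !pp.2.
exists J, p, a; split=> //.
by rewrite lt_def pa (qf_ge0 pF) //; exact: KM.
Qed.

Variables (J : set U) (p a : U).
Hypotheses (iJ : idl K J) (cJ : clo J) (J0 : J 0) (mp : min_mod K J p)
  (FJ : forall x, J x -> F x = 0) (Ka : K a) (N0 : 0 < qf F (p * a)).

Let JD := idlD iJ.
Let JB := idlB iJ.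
Let JZ := idlZ iJ.
Let JMr := idlMr iJ.
Let JMl := idlMl iJ.
Let pp : isproj p. Proof. by case: mp => [[]]. Qed.
Let Kp : K p. Proof. by case: mp => [[]]. Qed.
Let nJp : ~ J p. Proof. by case: mp => [[]]. Qed.

Lemma corner_scalar_uniq (l m : R[i]) z : J (z - l *: p) -> J (z - m *: p) -> l = m.
Proof.
move=> h1 h2; apply/eqP; rewrite -subr_eq0; apply/eqP/eq0_normc/eqP.
rewrite eq_le normc_ge0 andbT -[leRHS](@nm0 R U) -(subrr ((l - m) *: p)).
apply: (min_mod_dist cK iJ mp).
have -> : (l - m) *: p = (z - m *: p) - (z - l *: p).
  by rewrite scalerBl opprB [RHS]addrC addrA subrK.
exact: JB.
Qed.

Lemma corner_functional : exists G : {scalar U}, forall x, K x -> J (p * x * p - G x *: p).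
Proof.
have /choice[l lP] x : exists l : R[i], K x -> J (p * x * p - l *: p).
  have [Kx|nKx] := pselect (K x); last by exists 0.
  have [|||l Jl] := min_mod_scalar cK iJ cJ J0 sU mp (x := p * x * p).
  - by apply: KM => //; exact: KM.
  - by rewrite !mulrA pp.2.
  - by rewrite -mulrA pp.2.
  - by exists l.
have [c x y Kx Ky|G GP] := @Kext l; last by exists G => x Kx; rewrite GP //; exact: lP.
apply: (corner_scalar_uniq (lP _ (KD (KZ c Kx) Ky))).
have -> : p * (c *: x + y) * p - (c * l x + l y) *: p =
    c *: (p * x * p - l x *: p) + (p * y * p - l y *: p).
  by rewrite mulrDr mulrDl -scalerAr -scalerAl scalerDl scalerBr scalerA opprD addrACA.
by apply: JD; [apply/JZ; exact: lP|exact: lP].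
Qed.

Variable G : {scalar U}.
Hypothesis GP : forall x, K x -> J (p * x * p - G x *: p).

Lemma corner_value x l : K x -> J (p * x * p - l *: p) -> G x = l.
Proof. by move=> Kx; apply: corner_scalar_uniq; exact: GP. Qed.

Lemma corner_null x : J x -> G x = 0.
Proof.
move=> Jx; have Kx := idl_sub iJ Jx; apply: corner_value => //; rewrite scale0r subr0.
by apply: JMr => //; exact: JMl.
Qed.

Lemma G_st x : K x -> G (st x) = (G x)^*.
Proof.
move=> Kx; apply: corner_value; first exact: Kst.
have := idl_st iJ (GP Kx); rewrite stB !stM stZ pp.1 mulrA.
by [].
Qed.

(** Write p * st x * x * p = z z with z self-adjoint in the corner of p. Modulo J, z is a real
    multiple of p, and z z is the square of that scalar times p. *)
Lemma G_pos : pos_on K G.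
Proof.
move=> x Kx; pose y := p * (st x * x) * p.
have yE : y = st (x * p) * (x * p) by rewrite /y stM pp.1 !mulrA.
have [z [sz yz _ zK]] := psd_sqrt (psd_cstar (x * p)).
have Ky : K (st (x * p) * (x * p)) by apply: KM; [apply: Kst|]; exact: KM.
have Kz : K z := zK _ cK.1 Ky.
have pz : p * z = z.
  apply: (zK [set z | p * z = z]); first exact: proj_below_csub.
  by rewrite /= -yE /y !mulrA pp.2.
have zp : z * p = z := sa_above pp.1 sz pz.
have Gz : J (z - G z *: p) by have := GP Kz; rewrite pz zp.
have Gzr : G z = (G z)^* by rewrite -{1}sz; exact: G_st.
have -> : G (st x * x) = G z * G z.
  apply: corner_value; first by apply: KM => //; exact: Kst.
  rewrite -/y yE yz.
  have -> : z * z - (G z * G z) *: p = z * (z - G z *: p) + G z *: (z - G z *: p).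
    by rewrite mulrBr scalerBr -scalerAr zp scalerA addrA subrK.
  by apply: JD; [exact: JMl|exact: JZ].
by rewrite {1}Gzr -normc2E ler0c sqr_ge0.
Qed.

Lemma G_bound x : K x -> normc (G x) <= nm x.
Proof.
move=> Kx.
have := min_mod_dist cK iJ mp (G x) (idlN iJ (GP Kx)); rewrite opprK addrC subrK => h.
apply: le_trans h _.
by apply: le_trans (nm_projmul _ pp) (nm_mulproj _ pp).
Qed.

Let S := [set y | K y /\ y * p = y].

Let S_scal x y : S x -> S y -> J (st x * y - G (st x * y) *: p).
Proof.
move=> [Kx xp] [Ky yp]; have := GP (KM (Kst Kx) Ky).
by rewrite -[p * _ * p]mulrA -(mulrA (st x)) yp mulrA -{1}pp.1 -stM xp.
Qed.

(* [qf G y] is the squared norm of [y] modulo [J]. *)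
Lemma quotient_norm y e : S y -> 0 < e ->
  exists f, [/\ isproj f, J f, p * f = f & nm (y * (p - f)) ^+ 2 <= qf G y + e].
Proof.
move=> Sy e0; have [Ky yp] := Sy.
pose w := st y * y - (qf G y)%:C *: p.
have Jw : J w by have := S_scal Sy Sy; rewrite (qfE G_pos Ky).
have psty : p * st y = st y by rewrite -{1}pp.1 -stM yp.
have pw : p * w = w by rewrite mulrBr mulrA psty -scalerAr pp.2.
have wp : w * p = w by rewrite mulrBl -mulrA yp -scalerAl pp.2.
have sw : sa w by apply: saB; [exact: sa_cstar|apply: saZ; exact: pp.1].
have [|f [pf [Jf [/= pfE fpE]] fP]] := @proj_approx_unit _ _ (corner p J) [:: w] e sU
    (corner_cst pp.1 (idl_cst iJ J0 cJ)) _ e0.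
  move=> u; rewrite inE => /eqP ->; rewrite sw; split.
    by apply: JMr => //; exact: (idl_sub iJ).
  by split=> /=; [rewrite mulrA pw|rewrite -mulrA wp].
exists f; split=> //; set q := p - f; have pq : isproj q := proj_sub pp pf pfE.
have qp : p * q = q by rewrite mulrBr pp.2 pfE.
rewrite -nm_cstar.
have -> : st (y * q) * (y * q) = (w - f * w) * q + (qf G y)%:C *: q.
  have -> : w - f * w = q * w by rewrite /q mulrBl pw.
  rewrite /w (mulrBr q) (mulrBl q) -scalerAr -scalerAl (proj_leC pp pq qp) pq.2 subrK.
  by rewrite stM pq.1 !mulrA.
have fw : nm (w - f * w) < e by apply: fP; rewrite inE.
apply: le_trans (nmD _ _) _; rewrite addrC nmZr ger0_norm; last exact: qf_ge0 G_pos Ky.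
apply: lerD; last by apply: le_trans (nm_projmul _ pq) (ltW fw).
by rewrite ler_piMr ?(nm_proj pq) //; exact: qf_ge0 G_pos Ky.
Qed.

(** As F vanishes on J, the map y |-> F (y a) is bounded for the quotient norm on S, whose square is
    qf G. Riesz gives vectors b n that are Cauchy only modulo J; correcting the increments by
    projections of J makes them Cauchy in norm, without changing their classes. *)
Lemma riesz_vector : exists c, S c /\ forall y, S y -> G (st c * y) = F (y * a).
Proof.
have [M M0 FM] := pos_cont cK.1 Kst pF.
pose C := (M * nm a) ^+ 2; have C0 : 0 <= C by rewrite sqr_ge0.
have LC y : S y -> normc (F (y * a)) ^+ 2 <= C * qf G y.
  move=> Sy; have [Ky yp] := Sy; apply/ler_addgt0Pr => e e0; have C1 : 0 < C + 1 by lra.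
  have [f [pf Jf pfE fP]] := quotient_norm Sy (divr_gt0 e0 C1).
  have Kf := idl_sub iJ Jf.
  have -> : F (y * a) = F (y * (p - f) * a).
    rewrite mulrBr yp mulrBl linearB (FJ (x := y * f * a)) ?subr0 //.
    by apply: JMr => //; exact: JMl.
  have [_ h _] := FM (y * (p - f) * a) (KM (KM Ky (KB Kp Kf)) Ka).
  have h2 : normc (F (y * (p - f) * a)) <= M * nm a * nm (y * (p - f)).
    by apply: le_trans h _; rewrite -[leRHS]mulrA ler_wpM2l // [leRHS]mulrC; exact: nmM.
  apply: (@le_trans _ _ ((M * nm a * nm (y * (p - f))) ^+ 2)).
    by rewrite ler_pXn2r ?nnegrE ?normc_ge0 // ?mulr_ge0 ?nm_ge0.
  rewrite exprMn -/C; apply: le_trans (ler_wpM2l C0 fP) _; rewrite mulrDr lerD2l.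
  by rewrite mulrCA ler_piMr ?(ltW e0) // ler_pdivrMr // mul1r; lra.
(* Chosen so that 2 (e n.+1 + e n) + 4 e n <= 4^-n, the square of the required size of the n-th
   increment. *)
pose e (n : nat) := 8^-1 * 4^-1 ^+ n : R.
have e0 n : 0 < e n by rewrite mulr_gt0 ?invr_gt0 ?exprn_gt0 ?invr_gt0.
have linL : lin_on S (fun y => F (y * a)).
  by move=> k x y _ _; rewrite mulrDl -scalerAl linearD scalarZ.
have Slin (k : R[i]) x y : S x -> S y -> S (k *: x + y).
  move=> [Kx xp] [Ky yp]; split; first by apply: KD => //; exact: KZ.
  by rewrite mulrDl -scalerAl xp yp.
have S0 : S 0 by split; [exact: (csub0 cK.1)|rewrite mul0r].
have [|b [Sb bb bL]] := @riesz G S _ C e G_pos _ S0 Slin linL C0 LC e0; first by move=> x [].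
pose d n := b n.+1 - b n.
have Sd n : S (d n) by rewrite /d -scaleN1r addrC; exact: Slin.
have /choice[f fP] n := quotient_norm (Sd n) (mulr_gt0 (ltr0n R 4) (e0 n)).
(* Multiplying d k by p - f k removes d k * f k, an element of J, and brings the norm down to
   2^-k. *)
pose c n := b 0%N + \sum_(k < n) d k * (p - f k).
have cS n : c n.+1 = c n + d n * (p - f n).
  by rewrite /c big_ord_recr /= addrA.
have Jc n : J (c n - b n).
  elim: n => [|n IHn]; first by rewrite /c big_ord0 addr0 subrr.
  have -> : c n.+1 - b n.+1 = (c n - b n) - d n * f n.
    have [_ dp] := Sd n; have -> : b n.+1 = b n + d n by rewrite addrC subrK.
    by rewrite cS mulrBr dp; clearbody c d; nring.
  have [_ Jf _ _] := fP n; apply: JB => //; apply: JMl => //; by case: (Sd n).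
have r2 (n : nat) : (2^-1 ^+ n) ^+ 2 = 4^-1 ^+ n :> R.
  by rewrite -exprM mulnC exprM; congr (_ ^+ n); field.
have [||n|cc cl] := @geom_limit _ _ c 1 2^-1.
- by [].
- by rewrite invr_ge0 ler0n /=; lra.
- rewrite cS [X in nm (X - _)]addrC addrK mul1r.
  have [_ _ _ h] := fP n.
  rewrite -(@ler_pXn2r _ 2) ?nnegrE ?nm_ge0 ?exprn_ge0 ?invr_ge0 // r2.
  apply: le_trans h _; have := bb n.+1 n; rewrite -/(d n) /e exprS.
  have : 0 < 4^-1 ^+ n :> R by rewrite exprn_gt0 // invr_gt0.
  move: (4^-1 ^+ n) (qf G (d n)) => r q; lra.
have Sc n : S (c n).
  elim: n => [|n IHn]; first by rewrite /c big_ord0 addr0.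
  have -> : c n.+1 = 1 *: c n + d n * (p - f n).
    by rewrite cS scale1r.
  apply: Slin => //; have [Kd _] := Sd n; have [pf Jf pfE _] := fP n.
  have Kf := idl_sub iJ Jf; split; first by apply: KM => //; exact: KB.
  by rewrite -mulrA (mulrBl p) pp.2 (proj_leC pp pf pfE).
have small (e1 : R) : 0 < e1 -> exists N, nm (c N - cc) < e1.
  move=> e10.
  have /cvgrPdist_lt/(_ e1 e10)[N _ Nn] : (fun n => 2 * 2^-1 ^+ n : R) @ \oo --> (0 : R).
    rewrite -[X in _ --> X](mulr0 2).
    by apply: cvgM; [exact: cvg_cst|apply: cvg_expr; rewrite ger0_norm ?invr_ge0 //; lra].
  exists N; have := Nn N (leqnn N); rewrite /= sub0r normrN ger0_norm //; apply: le_lt_trans.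
  apply: le_trans (cl N) _; rewrite (_ : 1 / (1 - 2^-1) = 2 :> R) //.
  by rewrite (_ : 1 - 2^-1 = 2^-1 :> R); [rewrite invrK mul1r|field].
have Kcc : K cc.
  apply: (csub_clo cK.1) => e1 /small[N Ne]; exists (c N); first by case: (Sc N).
  by rewrite nmBC.
exists cc; split.
  split=> //; apply: (csub_clo (proj_above_csub p)) => e1 /small[N Ne].
  by exists (c N); [case: (Sc N)|rewrite nmBC].
move=> y Sy; have [Ky yp] := Sy.
apply: (@clim_uniq _ (fun n => G (st (b n) * y))).
  apply: (@clim_sqr _ _ _ (4 * nm y ^+ 2) 4^-1).
    by rewrite invr_ge0 ler0n /=; lra.
  move=> n; have -> : G (st (b n) * y) - G (st cc * y) = G (st (c n - cc) * y).
    have Kb : K (b n) by case: (Sb n).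
    have Kc : K (c n) by case: (Sc n).
    rewrite -linearB -mulrBl -stB (_ : b n - cc = (c n - cc) - (c n - b n)); last by nring.
    rewrite stB mulrBl linearB (corner_null (x := st (c n - b n) * y)) ?subr0 //.
    by apply: JMr => //; exact: (idl_st iJ).
  have Kc : K (c n) by case: (Sc n).
  have h : normc (G (st (c n - cc) * y)) <= 2 * 2^-1 ^+ n * nm y.
    apply: le_trans (G_bound (KM (Kst (KB Kc Kcc)) Ky)) _.
    apply: le_trans (nmM _ _) _; rewrite nm_st ler_wpM2r ?nm_ge0 //.
    apply: le_trans (cl n) _; rewrite (_ : 1 / (1 - 2^-1) = 2 :> R) //.
    by rewrite (_ : 1 - 2^-1 = 2^-1 :> R); [rewrite invrK mul1r|field].
  rewrite (_ : 4 * _ * _ = (2 * 2^-1 ^+ n * nm y) ^+ 2); last by rewrite -r2; ring.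
  by rewrite ler_pXn2r ?nnegrE ?normc_ge0 // ?mulr_ge0 ?nm_ge0 ?exprn_ge0 ?invr_ge0.
apply: (@clim_sqr _ _ _ (8^-1 * qf G y) 4^-1).
  by rewrite invr_ge0 ler0n /=; lra.
by move=> n; apply: le_trans (bL n y Sy) _; rewrite /e mulrAC.
Qed.

Lemma pos_null H z : pos_on K H -> K z -> qf H z = 0 -> H z = 0.
Proof.
move=> pH Kz z0; have [M _ /(_ z Kz)[_ _]] := pos_cont cK.1 Kst pH.
rewrite z0 mulr0 => h; apply/eq0_normc/eqP.
by rewrite -sqrf_eq0 eq_le h sqr_ge0.
Qed.

(** The functional is H x = G (st c * x * c) / N with N = qf F (p a). It is the vector functional of
    c for the representation of K/J in which p has rank one: modulo J, st c * x * c is the multiple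
    G (st c * x * c) of p, which yields both domination and purity. *)
Lemma pure_minorant_vector c : K c -> c * p = c ->
  (forall y, S y -> G (st c * y) = F (y * a)) -> exists2 H, pure_on H & fle H F.
Proof.
move=> Kc cp cP; pose N := qf F (p * a).
have Nn : N != 0 by rewrite gt_eqF.
have pc : p * st c = st c by rewrite -{1}pp.1 -stM cp.
have KM3 x y z : K x -> K y -> K z -> K (x * y * z) by move=> *; apply: KM => //; exact: KM.
have GapE : G (st c * (st a * p)) = N%:C.
  rewrite cP; last by split; [apply: KM => //; exact: Kst|rewrite -mulrA pp.2].
  have -> : st a * p * a = st (p * a) * (p * a).
    by rewrite stM pp.1 !mulrA -(mulrA (st a) p p) pp.2.
  by rewrite (qfE pF) //; exact: KM.
have GC x : K x -> J (st c * x * c - G (st c * x * c) *: p).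
  move=> Kx; have := GP (KM3 _ _ _ (Kst Kc) Kx Kc).
  by rewrite !mulrA pc -(mulrA _ c) cp.
have [H HE] : exists H : {scalar U}, forall x, K x -> H x = (N^-1)%:C * G (st c * x * c).
  apply: (Kext (g := fun x => (N^-1)%:C * G (st c * x * c))) => l x y _ _.
  by rewrite mulrDr mulrDl -scalerAr -scalerAl linearD scalarZ; ring.
have stxc x : st c * (st x * x) * c = st (x * c) * (x * c) by rewrite stM !mulrA.
have Kxx x : K x -> K (st x * x) by move=> Kx; apply: KM => //; exact: Kst.
have qH x : K x -> qf H x = N^-1 * qf G (x * c).
  by move=> Kx; rewrite /qf (HE _ (Kxx _ Kx)) stxc Re_scale.
have pH : pos_on K H.
  move=> x Kx; rewrite (HE _ (Kxx _ Kx)) stxc (qfE G_pos); last exact: KM.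
  rewrite -rmorphM /= ler0c mulr_ge0 ?invr_ge0 ?(ltW N0) //.
  by apply: qf_ge0 G_pos _; exact: KM.
have HF : fle H F.
  move=> x Kx; rewrite qH //; set mu := qf G (x * c).
  have Kxc : K (x * c) by exact: KM.
  have mu0 : 0 <= mu := qf_ge0 G_pos Kxc.
  have GmuE : G (st c * (st x * x) * c) = mu%:C by rewrite stxc (qfE G_pos).
  (* With e2, Cauchy-Schwarz reads mu^2 <= mu N qf F x, that is qf H x <= qf F x. *)
  have e1 : F (st x * (x * c * a)) = mu%:C.
    rewrite -GmuE !mulrA -cP; first by rewrite !mulrA.
    by split; [apply: KM3 => //; exact: Kst|rewrite -mulrA cp].
  have e2 : qf F (x * c * a) = mu * N.
    pose z := st c * (st x * x) * c.
    have Kz : K z by apply: KM3; [exact: Kst|exact: Kxx|].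
    have -> : qf F (x * c * a) = complex.Re (F (st a * z * a)).
      by rewrite /qf /z !stM !mulrA.
    rewrite -cP; last first.
      split; first by apply: KM => //; exact: Kst.
      by rewrite -mulrA /z -(mulrA _ c p) cp.
    have -> : st c * (st a * z) = st c * st a * (z - mu%:C *: p) + mu%:C *: (st c * (st a * p)).
      by rewrite mulrBr -scalerAr !mulrA subrK.
    rewrite linearD scalarZ GapE corner_null ?add0r -?rmorphM //.
    apply: JMl; last by apply: KM; exact: Kst.
    by rewrite -GmuE; apply: GC; exact: Kxx.
  have := cauchy_schwarz cK.1 pF (KM Kxc Ka) Kx.
  rewrite e1 e2 normc_real ger0_norm // => h.
  have [->|mun] := eqVneq mu 0; first by rewrite mulr0 (qf_ge0 pF).
  have mup : 0 < mu by rewrite lt_def mun.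
  rewrite mulrC ler_pdivrMr // mulrC.
  by rewrite expr2 -mulrA ler_pM2l // in h.
have qHa : qf H a != 0.
  rewrite qH //; apply/eqP => h; have h0 : qf G (a * c) = 0.
    by apply: (mulfI (invr_neq0 Nn)); rewrite mulr0.
  have := qf_null cK.1 G_pos Kp (KM Ka Kc) h0.
  rewrite stM -mulrA GapE => /(congr1 (@complex.Re R)) /= N00.
  by move: Nn; rewrite N00 eqxx.
have qHa0 : 0 < qf H a by rewrite lt_def qHa (qf_ge0 pH).
exists H => //; split=> //.
  by exists (st a * a); [exact: Kxx|rewrite (qfE pH Ka) (inj_eq (@complexI R))].
move=> k pk kH; pose nu := qf G c.
have GnuE : G (st c * c) = nu%:C by rewrite (qfE G_pos Kc).
have nun : nu != 0.
  apply/eqP => h; have := qf_null cK.1 G_pos (KM (Kst Ka) Kp) Kc h.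
  rewrite GapE => /(congr1 (@complex.Re R)) /= N00.
  by move: Nn; rewrite N00 eqxx.
have Jnu : J (st c * c - nu%:C *: p).
  by have := GP (Kxx _ Kc); rewrite GnuE !mulrA pc -(mulrA _ c) cp.
have knull z : K z -> J (z * c) -> qf k z = 0.
  move=> Kz Jzc; apply/eqP; rewrite eq_le (qf_ge0 pk) // andbT.
  apply: le_trans (kH z Kz) _; rewrite qH // {1}/qf corner_null ?mulr0 //.
  by apply: JMl => //; apply: Kst; exact: KM.
have kJ x : J x -> k x = 0.
  move=> Jx; have Kx := idl_sub iJ Jx; apply: pos_null => //; apply: knull => //.
  exact: JMr.
(* Modulo J, e fixes c, and k is null at every z with z c in J. So e can be inserted on both sides
   of x, which leaves only the scalar G (st c * x * c). *)
pose e := (nu^-1)%:C *: (c * st c).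
have Ke : K e by apply/KZ/KM => //; exact: Kst.
have se : st e = e by rewrite /e stZr stM stK.
have Jxe x : K x -> J ((x - x * e) * c).
  move=> Kx; have -> : (x - x * e) * c = (nu^-1)%:C *: (x * c * (nu%:C *: p - st c * c)).
    rewrite [in RHS]mulrBr scalerBr -[_ * (nu%:C *: p)]scalerAr scalerA -rmorphM mulVf // scale1r.
    rewrite -(mulrA x c p) cp mulrBl /e; congr (_ - _).
    by rewrite -scalerAr -scalerAl !mulrA.
  by apply: JZ; apply: JMl; [rewrite -opprB; exact: (idlN iJ)|exact: KM].
have kxe x : K x -> k x = k (x * e).
  move=> Kx; have Kxe := KM Kx Ke; apply/eqP; rewrite -subr_eq0 -linearB; apply/eqP.
  by apply: pos_null => //; [exact: KB|apply: knull; [exact: KB|exact: Jxe]].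
have kex x u : K x -> K u -> k (x * u) = k (e * x * u).
  move=> Kx Ku; apply/eqP; rewrite -subr_eq0 -linearB -mulrBl; apply/eqP.
  have -> : x - e * x = st (st x - st x * e) by rewrite stB stM stK se.
  have Kz : K (st x - st x * e) by apply: KB; [exact: Kst|apply: KM => //; exact: Kst].
  by apply: (qf_null cK.1 pk) => //; apply: knull => //; apply: Jxe; exact: Kst.
pose q := qf k (st c); have q0 : 0 <= q := qf_ge0 pk (Kst Kc).
pose t := N * nu^-1 ^+ 2 * q.
have kE x : K x -> k x = t%:C * H x.
  move=> Kx; rewrite kxe // /e -scalerAr scalarZ mulrA (kex _ _ (KM Kx Kc) (Kst Kc)).
  have -> : e * (x * c) * st c = (nu^-1)%:C *: (c * (st c * x * c) * st c).
    by rewrite /e -!scalerAl !mulrA.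
  set z := st c * x * c; rewrite scalarZ.
  have -> : k (c * z * st c) = G z * q%:C.
    have -> : c * z * st c = c * (z - G z *: p) * st c + G z *: (c * st c).
      by rewrite mulrBr mulrBl -scalerAr cp -scalerAl subrK.
    rewrite linearD scalarZ kJ ?add0r; last first.
      by apply: JMr; [apply: JMl => //; exact: GC|exact: Kst].
    by congr (_ * _); rewrite -{1}(stK c) (qfE pk (Kst Kc)).
  have tN : t * N^-1 = nu^-1 * nu^-1 * q by rewrite /t expr2 mulrC !mulrA mulVf // mul1r.
  by rewrite HE // [RHS]mulrA -rmorphM tN !rmorphM /= -/z; ring.
exists t => //; apply/andP; split.
  by apply: mulr_ge0 => //; apply: mulr_ge0; [exact: ltW|exact: sqr_ge0].
have := kH a Ka; rewrite {1}/qf (kE _ (Kxx _ Ka)) Re_scale -/(qf H a).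
by rewrite -[leRHS]mul1r ler_pM2r.
Qed.

End Minorant.

Theorem pure_minorant F : pos_on K F -> (exists2 x, K x & F x != 0) ->
  exists2 H, pure_on H & fle H F.
Proof.
move=> pF nzF; have [J [p [a [[iJ [cJ J0]] mp FJ Ka N0]]]] := vanishing_ideal pF nzF.
have [G GP] := corner_functional iJ cJ J0 mp.
have [c [[Kc cp] cP]] := riesz_vector pF iJ cJ J0 mp FJ Ka GP.
exact: (pure_minorant_vector pF iJ mp Ka N0 GP Kc cp cP).
Qed.

Lemma clim_shift (u : nat -> R[i]) l N : clim u l -> clim (fun n => u (n + N)%N) l.
Proof.
move=> ul e /ul[M Me]; exists M => n Mn; apply: Me.
by apply: leq_trans Mn (leq_addr _ _).
Qed.

(** A projection f that nearly fixes x from the left makes H x close to H (f x), which vanishes if f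
    is null. Sizes of minorants can thus be compared at projections, whose norm is at most 1. *)
Lemma proj_detect H : pos_on K H -> (exists2 x, K x & H x != 0) ->
  exists f, [/\ isproj f, K f & 0 < qf H f].
Proof.
move=> pH [x Kx Hx]; apply: contrapT => nf; move/eqP: Hx; apply.
have [M M0 HM] := pos_cont cK.1 Kst pH.
apply: normc_eps => e e0; have M1 : 0 < M + 1 by lra.
have [|f [pf Kf fP]] := @proj_approx_unit _ _ K [:: x] _ sU cK _ (divr_gt0 e0 M1).
  by move=> w; rewrite inE => /eqP ->; apply: KM => //; exact: Kst.
have f0 : qf H f = 0.
  apply/eqP; rewrite eq_le (qf_ge0 pH) // andbT leNgt; apply/negP => h.
  by apply: nf; exists f.
have Kfx : K (f * x) by exact: KM.
have -> : H x = H (x - f * x).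
  by rewrite linearB -{1}pf.1 (qf_null cK.1 pH Kx Kf f0) subr0.
have [_ h _] := HM _ (KB Kx Kfx); apply: le_trans h _.
have := fP x; rewrite inE eqxx => /(_ isT); rewrite ltr_pdivlMr // mulrDr mulr1 mulrC => h.
by have := nm_ge0 (x - f * x); lra.
Qed.

Section Exhaustion.
Variable F : {scalar U}.
Hypothesis pF : pos_on K F.

Definition has_pure (D : {scalar U}) := exists2 H, pure_on H & fle H D.

(* The value at the projection [Hf.2] measures the size of [Hf.1]. *)
Definition half_maximal (D : {scalar U}) (Hf : {scalar U} * U) :=
  [/\ pure_on Hf.1, fle Hf.1 D, isproj Hf.2, K Hf.2 &
   forall H f, pure_on H -> fle H D -> isproj f -> K f -> qf H f <= 2 * qf Hf.1 Hf.2].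

Lemma half_maximal_exists D : pos_on K D -> has_pure D -> exists Hf, half_maximal D Hf.
Proof.
move=> pD [H0 pH0 H0D]; have [M M0 DM] := pos_cont cK.1 Kst pD.
pose S := [set r | exists H f, [/\ pure_on H, fle H D, isproj f, K f & r = qf H f]].
have [f0 [pf0 Kf0 f0p]] : exists f, [/\ isproj f, K f & 0 < qf H0 f].
  by case: pH0 => p0 n0 _; exact: proj_detect.
have S0 : S (qf H0 f0) by exists H0, f0.
have hS : has_sup S.
  split; first by exists (qf H0 f0).
  exists M => _ [H [f [pH HD pf Kf ->]]]; apply: le_trans (HD f Kf) _.
  have [h _ _] := DM f Kf; apply: le_trans h _.
  by rewrite ler_piMr // -[leRHS](expr1n _ 2) ler_pXn2r ?nnegrE ?nm_ge0 // nm_proj.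
have s0 : 0 < sup S by apply: lt_le_trans f0p _; apply: ub_le_sup => //; exact: hS.2.
have [_ [H [f [pH HD pf Kf ->]]] lt] := sup_adherent (divr_gt0 s0 (ltr0n _ 2)) hS.
exists (H, f); split=> // H' f' pH' H'D pf' Kf'.
have : qf H' f' <= sup S by apply: ub_le_sup; [exact: hS.2|exists H', f'].
by move: lt; rewrite /=; lra.
Qed.

Lemma sub_pos D H : pos_on K H -> fle H D -> pos_on K D -> pos_on K (D \- H : {scalar U}).
Proof.
move=> pH HD pD x Kx /=; rewrite (qfE pH Kx) (qfE pD Kx) -rmorphB /= ler0c subr_ge0.
exact: HD.
Qed.

Lemma qf_sub (D H : {scalar U}) x : qf (D \- H : {scalar U}) x = qf D x - qf H x.
Proof. by rewrite /qf /= ReD ReN. Qed.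

Theorem pure_sum : exists (D : set nat) (g : nat -> {scalar U}),
  (forall n, D n -> pure_on (g n)) /\
  forall x, K x -> clim (fun N => \sum_(0 <= n < N | n \in D) g n x) (F x).
Proof.
have [M M0 FM] := pos_bounded cK.1 Kst pF.
have /choice[pick pickP] (D : {scalar U}) : exists Hf : {scalar U} * U,
    pos_on K D -> has_pure D -> half_maximal D Hf.
  have [h|h] := pselect (pos_on K D /\ has_pure D).
    by have [Hf HfP] := half_maximal_exists h.1 h.2; exists Hf.
  by exists (D, 0) => h1 h2; case: h.
(* D n is what remains after n stages; without a pure minorant it stays constant, and the index n is
   left out of the sum. *)
pose D := fix D n : {scalar U} := if n is m.+1 then
  (if `[< has_pure (D m) >] then (D m \- (pick (D m)).1 : {scalar U}) else D m) else F.
pose S := [set n | has_pure (D n)]; pose g n := (pick (D n)).1.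
have DS n : D n.+1 = if `[< has_pure (D n) >] then (D n \- g n : {scalar U}) else D n by [].
have pD n : pos_on K (D n).
  elim: n => [//|n IHn]; rewrite DS; case: asboolP => [h|//].
  have [[pH _ _] HD _ _ _] := pickP _ IHn h.
  exact: sub_pos.
have gP n : S n -> half_maximal (D n) (pick (D n)) by move=> h; apply: pickP.
have Dle n : fle (D n.+1) (D n).
  move=> x Kx; rewrite DS; case: asboolP => [h|//].
  have [[pH _ _] _ _ _ _] := gP n h.
  by rewrite qf_sub gerBl (qf_ge0 pH).
have Dmono n m : (n <= m)%N -> fle (D m) (D n).
  move=> /subnK <-; elim: (m - n)%N => [//|k IHk] x Kx; rewrite addSn.
  by apply: le_trans (Dle _ x Kx) (IHk x Kx).
have sumE N x : \sum_(0 <= n < N | n \in S) g n x = F x - D N x.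
  elim: N => [|N IHN]; first by rewrite big_geq // subrr.
  rewrite big_mkcond big_nat_recr //= -big_mkcond IHN.
  case: asboolP => h; first by rewrite mem_set //= opprB [RHS]addrA [RHS]addrAC.
  by rewrite memNset // addr0.
have cauchy x : K x -> exists l, clim (fun n => D n x) l.
  move=> Kx; apply: complex_complete => e e0.
  (* The values q n decrease, so a near-minimal q N controls all later differences D N - D m, which
     are positive functionals with bound M. *)
  pose q n := qf (D n) x; have M1 : 0 < M + 1 by lra.
  have hi : has_inf (range q).
    split; first by exists (q 0%N), 0%N.
    by exists 0 => _ [n _ <-]; exact: qf_ge0 (pD n) Kx.
  have d0 : 0 < (e / 2) ^+ 2 / (M + 1) by rewrite divr_gt0 // exprn_gt0 // divr_gt0.
  have [_ [N _ <-] qN] := inf_adherent d0 hi.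
  exists N; suff H m : (N <= m)%N -> normc (D N x - D m x) < e / 2.
    move=> m n Nm Nn; have := normcB_tri (D N x) (D m x) (D n x).
    by rewrite (normcBC (D m x) (D N x)); have := H m Nm; have := H n Nn; lra.
  move=> Nm; pose E : {scalar U} := D N \- D m.
  have pE : pos_on K E by apply: sub_pos => //; exact: Dmono.
  have qE y : K y -> qf E y <= M * nm y ^+ 2.
    move=> Ky; rewrite qf_sub; apply: le_trans (FM y Ky).
    by have := Dmono 0%N N (leq0n N) y Ky; have := qf_ge0 (pD m) Ky; rewrite /=; lra.
  have [_ h] := pos_cont_bound cK.1 Kst pE M0 qE Kx.
  rewrite -(@ltr_pXn2r _ 2) ?nnegrE ?normc_ge0 ?divr_ge0 ?(ltW e0) //.
  apply: le_lt_trans h _; rewrite qf_sub -/(q N) -/(q m).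
  have qm : inf (range q) <= q m by apply: ge_inf; [exact: hi.2|exists m].
  have q0 : 0 <= q N - q m by rewrite subr_ge0; exact: Dmono.
  have : q N - q m < (e / 2) ^+ 2 / (M + 1) by lra.
  by rewrite ltr_pdivlMr //; nra.
have /choice[l lP] x : exists l, K x -> clim (fun n => D n x) l.
  have [Kx|nKx] := pselect (K x); last by exists 0.
  by have [l h] := cauchy x Kx; exists l.
have [c x y Kx Ky|H HE] := @Kext l.
  apply: clim_uniq (lP _ (KD (KZ c Kx) Ky)) _.
  under eq_fun do rewrite linearD scalarZ.
  by apply: clim_lin; exact: lP.
have HP x : K x -> clim (fun n => D n x) (H x) by move=> Kx; rewrite HE //; exact: lP.
have Kxx x : K x -> K (st x * x) by move=> Kx; apply: KM => //; exact: Kst.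
have pH : pos_on K H.
  by move=> x Kx; apply: clim_ge0 (HP _ (Kxx _ Kx)) => n; exact: pD.
have HD n : fle H (D n).
  move=> x Kx; apply: clim_le (@clim_shift _ _ n (HP _ (Kxx _ Kx))) => m.
  by apply: (Dmono n (m + n)%N _ x Kx); exact: leq_addl.
have [nzH|zH] := pselect (exists2 x, K x & H x != 0); last first.
  exists S, g; split=> [n /gP[]//|x Kx].
  have H0 : H x = 0 by apply: contrapT => /eqP h; apply: zH; exists x.
  have := clim_sub (clim_cst (F x)) (HP x Kx); rewrite H0 subr0 => h e /h[N Nh].
  by exists N => n /Nh; rewrite sumE.
exfalso; have [G pG GH] := pure_minorant pH nzH.
have hasS n : S n by exists G => // x Kx; apply: le_trans (GH x Kx) (HD n x Kx).
have [f0 [pf0 Kf0]] : exists f, [/\ isproj f, K f & 0 < qf G f].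
  by case: pG => p0 n0 _; exact: proj_detect.
set d := qf G f0 => d0; pose f n := (pick (D n)).2.
have fd n : d <= 2 * qf (g n) (f n).
  have [_ _ _ _ h] := gP n (hasS n); apply: h => // x Kx.
  exact: le_trans (GH x Kx) (HD n x Kx).
have [m mM] : exists m : nat, M < m%:R * (d / 4).
  exists (Num.truncn (M / (d / 4))).+1; rewrite -ltr_pdivrMr ?divr_gt0 //.
  exact: truncnS_gt.
(* Each g i is bounded by 4 M, so this accuracy changes its values by at most d/8. *)
have M8 : 0 < 8 * (4 * M + 1) by lra.
have [|q [pq Kq qP]] := @proj_approx_unit _ _ K [seq f i | i <- iota 0 m] _ sU cK _
    (divr_gt0 d0 M8).
  move=> w /mapP[i _ ->]; have [_ _ _ Kf _] := gP i (hasS i).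
  by apply: KM => //; exact: Kst.
have gq i : (i < m)%N -> d / 4 <= qf (g i) q.
  move=> im; have [[pg _ _] gD pf Kf _] := gP i (hasS i).
  rewrite -/(f i) -/(g i) in pg gD pf Kf.
  have gM y : K y -> qf (g i) y <= M * nm y ^+ 2.
    move=> Ky; apply: le_trans (gD y Ky) _; apply: le_trans (FM y Ky).
    exact: (Dmono 0%N i (leq0n i) y Ky).
  have Kqf := KM Kq Kf.
  have [h _] := pos_cont_bound cK.1 Kst pg M0 gM (KB Kf Kqf).
  have fq : nm (f i - q * f i) < d / (8 * (4 * M + 1)) by apply: qP; rewrite map_f // mem_iota.
  have h1 : normc (g i (f i - q * f i)) <= d / 8.
    apply: le_trans h _; apply: (@le_trans _ _ (4 * M * (d / (8 * (4 * M + 1))))).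
      by apply: ler_wpM2l; [lra|exact: ltW].
    rewrite mulrA ler_pdivrMr //; have : d / 8 * (8 * (4 * M + 1)) = d * (4 * M + 1) by field.
    by move=> ->; rewrite mulrC; apply: ler_wpM2l; [exact: ltW|lra].
  have gf : g i (f i) = (qf (g i) (f i))%:C by rewrite -(qfE pg Kf) pf.1 pf.2.
  have cs := cauchy_schwarz cK.1 pg Kf Kq; rewrite pq.1 in cs.
  have a0 := qf_ge0 pg Kf; have b0 := qf_ge0 pg Kq.
  have tri : qf (g i) (f i) <= normc (g i (q * f i)) + d / 8.
    have e1 : g i (f i) = g i (q * f i) + g i (f i - q * f i) by rewrite -linearD addrC subrK.
    have := le_normcD (g i (q * f i)) (g i (f i - q * f i)).
    by rewrite -e1 gf normc_real ger0_norm //; lra.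
  have := fd i; move: cs a0 b0 tri (normc_ge0 (g i (q * f i))).
  move: (normc _) (qf _ (f i)) (qf _ q) => u a b cs a0 b0 tri u0 ad.
  (* From (a - d/8)^2 <= a b and a >= d/2 it follows that b >= a - d/4 >= d/4. *)
  rewrite leNgt; apply/negP => bd.
  have h2 : a - d / 8 <= u by lra.
  have h3 : (a - d / 8) ^+ 2 <= a * b.
    by apply: le_trans cs; rewrite ler_pXn2r // nnegrE; lra.
  by move: h3; rewrite expr2; nra.
have : \sum_(0 <= i < m | i \in S) qf (g i) q <= M.
  have e1 : \sum_(0 <= i < m | i \in S) qf (g i) q = complex.Re (F (st q * q) - D m (st q * q)).
    rewrite -sumE; elim/big_ind2: _ => [//|a1 b1 a2 b2 -> ->|//]; first by rewrite ReD.
  rewrite e1 ReD ReN -/(qf F q) -/(qf (D m) q).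
  have h1 : M * nm q ^+ 2 <= M.
    by rewrite ler_piMr // -[leRHS](expr1n _ 2) ler_pXn2r ?nnegrE ?nm_ge0 // nm_proj.
  by have := qf_ge0 (pD m) Kq; have := le_trans (FM q Kq) h1; lra.
apply/negP; rewrite -ltNge; apply: lt_le_trans mM _.
rewrite big_mkord big_mkcond /= mulr_natl -[X in _ *+ X](card_ord m) -sumr_const.
by apply: ler_sum => i _; rewrite mem_set //; exact: gq.
Qed.

End Exhaustion.

End Functionals.

(** * Diffuse functionals on a spectral interval *)

Section HahnBanach.
Context (R : realType) (U : ucstarType R).
Implicit Types (x y z : U) (p q : U -> R).

Definition sublin p := (forall x y, p (x + y) <= p x + p y) /\
  forall (t : R) x, 0 <= t -> p (t%:C *: x) <= t * p x.

Lemma sublin0 p : sublin p -> p 0 = 0.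
Proof.
move=> [pD pZ]; apply/eqP; rewrite eq_le; apply/andP; split.
  by have := pZ 0 0 (lexx 0); rewrite scale0r mul0r.
by have := pD 0 0; rewrite addr0; lra.
Qed.

Lemma sublinN p x : sublin p -> - p (- x) <= p x.
Proof. by move=> sp; have := sp.1 x (- x); rewrite subrr sublin0 //; lra. Qed.

Lemma sublinZ p (t : R) x : sublin p -> 0 <= t -> p (t%:C *: x) = t * p x.
Proof.
move=> sp t0; apply/eqP; rewrite eq_le sp.2 //=; have [->|tn] := eqVneq t 0.
  by rewrite scale0r mul0r sublin0.
have tp : 0 < t by rewrite lt_def tn.
have := sp.2 t^-1 (t%:C *: x); rewrite invr_ge0 => /(_ t0).
rewrite scalerA -rmorphM mulVf // scale1r => h.
by rewrite mulrC -ler_pdivlMr // mulrC.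
Qed.

(** A sublinear functional below p whose value at - z is at most - p z, so that it is linear along
    z. *)
Definition tilt p z x := inf [set p (x + t%:C *: z) - t * p z | t in [set t : R | 0 <= t]].

Section Tilt.
Variables (p : U -> R) (z : U).
Hypothesis sp : sublin p.

Lemma tilt_bound x : has_inf [set p (x + t%:C *: z) - t * p z | t in [set t : R | 0 <= t]].
Proof.
split; first by exists (p (x + 0%:C *: z) - 0 * p z), 0 => /=.
exists (- p (- x)) => _ [t /= t0 <-].
have := sp.1 (x + t%:C *: z) (- x); rewrite addrAC subrr add0r sublinZ //; lra.
Qed.

Lemma tilt_le x (t : R) : 0 <= t -> tilt p z x <= p (x + t%:C *: z) - t * p z.
Proof. by move=> t0; apply: ge_inf; [exact: (tilt_bound x).2|exists t]. Qed.

Lemma tilt_le0 x : tilt p z x <= p x.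
Proof. by have := tilt_le x (lexx 0); rewrite scale0r addr0 mul0r subr0. Qed.

Lemma tilt_adherent x (e : R) : 0 < e ->
  exists2 t : R, 0 <= t & p (x + t%:C *: z) - t * p z < tilt p z x + e.
Proof. by move=> e0; have [_ [t t0 <-] lt] := inf_adherent e0 (tilt_bound x); exists t. Qed.

Lemma tilt_sublin : sublin (tilt p z).
Proof.
split=> [x y|t x t0]; apply/ler_addgt0Pr => e e0.
- have e2 : 0 < e / 2 by rewrite divr_gt0.
  have [s s0 hs] := tilt_adherent x e2; have [t t0 ht] := tilt_adherent y e2.
  apply: le_trans (tilt_le _ (addr_ge0 s0 t0)) _.
  have := sp.1 (x + s%:C *: z) (y + t%:C *: z).
  by rewrite addrACA -scalerDl -rmorphD /=; lra.
- have t1 : 0 < t + 1 by lra.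
  have [s s0 hs] := tilt_adherent x (divr_gt0 e0 t1).
  apply: le_trans (tilt_le _ (mulr_ge0 t0 s0)) _.
  rewrite rmorphM -scalerA -scalerDr sublinZ // -mulrA -mulrBr.
  apply: le_trans (ler_wpM2l t0 (ltW hs)) _; rewrite mulrDr lerD2l.
  by rewrite mulrCA ler_piMr ?(ltW e0) // ler_pdivrMr // mul1r; lra.
Qed.

End Tilt.

Lemma sublin_minimal p : sublin p -> exists q, [/\ sublin q, forall x, q x <= p x &
  forall q', sublin q' -> (forall x, q' x <= q x) -> q' = q].
Proof.
move=> sp; pose T := {q : U -> R | sublin q /\ forall x, q x <= p x}.
(* The order is reversed: a maximal element is a minimal sublinear functional, and a chain is
   bounded by its pointwise infimum. *)
pose le : rel T := fun a b => `[< forall x, sval b x <= sval a x >].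
have [q|q r s /asboolP h1 /asboolP h2|q q' /asboolP h1 /asboolP h2|C totC|q qmin] := @Zorn T le.
- exact/asboolP.
- by apply/asboolP => x; exact: le_trans (h2 x) (h1 x).
- case: q q' h1 h2 => [a ap] [b bp] /= h1 h2; apply: eq_exist; apply/funext => x; apply/eqP; rewrite eq_le; apply/andP; split.
    exact: h2.
  exact: h1.
- have [[q0 Cq0]|nC] := pselect (exists a, C a); last first.
    have pp : sublin p /\ forall x, p x <= p x by [].
    by exists (exist _ p pp) => q Cq; case: nC; exists q.
  pose S x := [set sval a x | a in C].
  have hS x : has_inf (S x).
    split; first by exists (sval q0 x), q0.
    exists (- p (- x)) => _ [q _ <-]; have [sq qp] := svalP q.
    by have := sublinN x sq; have := qp (- x); lra.
  have Sle a x : C a -> inf (S x) <= sval a x.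
    by move=> Ca; apply: ge_inf; [exact: (hS x).2|exists a].
  have Sadh x (e : R) : 0 < e -> exists2 a, C a & sval a x < inf (S x) + e.
    by move=> e0; have [_ [q Cq <-] lt] := inf_adherent e0 (hS x); exists q.
  have sS : sublin (fun x => inf (S x)) /\ forall x, inf (S x) <= p x.
    split; last by move=> x; apply: le_trans (Sle _ _ Cq0) _; exact: (svalP q0).2.
    split=> [x y|t x t0]; apply/ler_addgt0Pr => e e0.
    + have e2 : 0 < e / 2 by rewrite divr_gt0.
      have [q1 C1 h1] := Sadh x _ e2; have [q2 C2 h2] := Sadh y _ e2.
      have [q [Cq hq1 hq2]] : exists a, [/\ C a, sval a x <= sval q1 x & sval a y <= sval q2 y].
        by have [/asboolP h|/asboolP h] := totC _ _ C1 C2; [exists q2|exists q1].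
      by have := Sle q (x + y) Cq; have := (svalP q).1.1 x y; lra.
    + have t1 : 0 < t + 1 by lra.
      have [q Cq hq] := Sadh x _ (divr_gt0 e0 t1).
      apply: le_trans (Sle q _ Cq) _; apply: le_trans ((svalP q).1.2 t x t0) _.
      apply: le_trans (ler_wpM2l t0 (ltW hq)) _; rewrite mulrDr lerD2l.
      by rewrite mulrCA ler_piMr ?(ltW e0) // ler_pdivrMr // mul1r; lra.
  exists (exist (fun g : U -> R => sublin g /\ forall x, g x <= p x) _ sS) => q Cq; apply/asboolP => x /=; exact: Sle.
exists (sval q); have [sq qp] := svalP q; split=> // q' sq' q'q.
have q'p : sublin q' /\ forall x, q' x <= p x by split=> // x; exact: le_trans (q'q x) (qp x).
by have := qmin (exist _ q' q'p) (introT (asboolP _) q'q) => /(congr1 sval) /=.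
Qed.

(** A minimal f equals its own [tilt f y] for every y, which gives f x <= f (x + y) - f y and hence
    additivity. Minimizing below [tilt p z] instead of p forces f z = p z. *)
Theorem hahn_banach p z : sublin p -> exists f : U -> R,
  [/\ forall x y, f (x + y) = f x + f y, forall (t : R) x, f (t%:C *: x) = t * f x,
      forall x, f x <= p x & f z = p z].
Proof.
move=> sp; have [f [sf fp fmin]] := sublin_minimal (tilt_sublin z sp).
have fD x y : f (x + y) = f x + f y.
  apply/eqP; rewrite eq_le sf.1 /=.
  have := fmin _ (tilt_sublin y sf) (tilt_le0 y sf) => fE.
  have := tilt_le y sf x ler01; rewrite fE mul1r scale1r; lra.
have fN x : f (- x) = - f x.
  by apply/eqP; rewrite -addr_eq0 -fD addNr sublin0.
exists f; split=> // [t x|x|].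
- have [t0|t0] := leP 0 t; first exact: sublinZ.
  rewrite -[t]opprK rmorphN scaleNr fN sublinZ ?mulNr // oppr_ge0; exact: ltW.
- exact: le_trans (fp x) (tilt_le0 z sp x).
- apply/eqP; rewrite eq_le; apply/andP; split.
    exact: le_trans (fp z) (tilt_le0 z sp z).
  have := fp (- z); have := tilt_le z sp (- z) ler01.
  by rewrite scale1r addNr sublin0 // mul1r fN; lra.
Qed.

Lemma scalar_exists (f : U -> R[i]) : (forall (a : R[i]) x y, f (a *: x + y) = a * f x + f y) ->
  exists G : {scalar U}, forall x, G x = f x.
Proof.
move=> lf.
pose m := GRing.isLinear.Build R[i] U R[i] *%R f lf.
pose G : {scalar U} := HB.pack f m.
by exists G.
Qed.

End HahnBanach.

(** * Averages over dyadic cells and the diffuse state *)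

Section Averages.
Context (R : realType) (U : ucstarType R).
Variables (h : U) (al be : R).
Hypotheses (sh : sa h) (ab : al < be) (hab : forall t, al <= t <= be -> spec h t).
Implicit Types (x y : U) (n j : nat) (t u : R).

Definition clamp t : R := Num.max 0 (Num.min 1 t).

Lemma clamp_ge0 t : 0 <= clamp t. Proof. by rewrite le_max lexx. Qed.
Lemma clamp_le1 t : clamp t <= 1.
Proof. by rewrite ge_max ler01 ge_min lexx. Qed.
Lemma clamp1 t : 1 <= t -> clamp t = 1.
Proof. by move=> t1; rewrite /clamp (min_idPl t1); apply/max_idPr. Qed.
Lemma clamp0 t : t <= 0 -> clamp t = 0.
Proof. by move=> t0; apply/max_idPl; rewrite ge_min t0 orbT. Qed.

(** It is 1 for |u| <= 2 and 0 for |u| >= 3. With these radii the support of a cell lies in the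
    plateau of its parent, as [cell_child] requires. *)
Definition tent u : R := clamp (3 - `|u|).

Definition coord t : R := (t - al) / (be - al).

Definition cell n j := fc h (fun t : R => tent (2 ^+ n * coord t - j%:R)).

Lemma cont_cell n j : continuous (fun t : R => tent (2 ^+ n * coord t - j%:R)).
Proof. by rewrite /tent /clamp /coord; cont. Qed.

Lemma sa_cell n j : sa (cell n j).
Proof. by apply: fc_sa => //; exact: cont_cell. Qed.

Lemma nm_cell n j : nm (cell n j) <= 1.
Proof.
apply: fc_norm => // [|t _]; first exact: cont_cell.
by rewrite ger0_norm ?clamp_ge0 // clamp_le1.
Qed.

Lemma cell_child n j : cell n.+1 j * cell n j./2 = cell n.+1 j.
Proof.
have c1 := @cont_cell n.+1 j; have c2 := @cont_cell n j./2.
rewrite /cell -fcM //; apply: fc_ext => //; first by cont.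
move=> t _; rewrite /tent exprS; set v := 2 ^+ n * coord t.
have -> : 2 * 2 ^+ n * coord t = 2 * v by rewrite -mulrA.
have [h1|h1] := leP 3 `|2 * v - j%:R|; first by rewrite clamp0 ?mul0r //; lra.
have hj : j%:R = (odd j)%:R + 2 * (j./2)%:R :> R.
  by rewrite -{1}(odd_double_half j) natrD -mul2n natrM.
have o1 : (odd j)%:R <= 1 :> R by case: (odd j).
have o0 : 0 <= (odd j)%:R :> R by [].
rewrite [X in _ * X]clamp1 ?mulr1 //.
move: h1; rewrite ltr_norml => /andP[h1 h2].
have : `|v - (j./2)%:R| <= 2 by rewrite ler_norml; apply/andP; split; lra.
lra.
Qed.

Definition average n x : R := 2^-1 ^+ n * \sum_(j < 2 ^ n) nm (cell n j * x * cell n j).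

Lemma average_bound n x (C : R) : (forall j, (j < 2 ^ n)%N -> nm (cell n j * x * cell n j) <= C) ->
  average n x <= C.
Proof.
move=> xC; have r0 : 0 < 2 ^+ n :> R by rewrite exprn_gt0.
rewrite /average exprVn mulrC ler_pdivrMr //.
apply: (@le_trans _ _ (\sum_(j < 2 ^ n) C)); first by apply: ler_sum => j _; exact: xC.
by rewrite sumr_const card_ord -[C *+ _]mulr_natr natrX.
Qed.

Lemma nm_cell_mul n j x : nm (cell n j * x * cell n j) <= nm x.
Proof.
apply: le_trans (nm_mul3 _ _ _) _; rewrite ler_piMl ?nm_ge0 //.
by rewrite mulr_ile1 ?nm_ge0 ?nm_cell.
Qed.

Lemma average_ge0 n x : 0 <= average n x.
Proof.
rewrite mulr_ge0 ?exprn_ge0 ?invr_ge0 //; apply: sumr_ge0 => j _; exact: nm_ge0.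
Qed.

Lemma averageD n x y : average n (x + y) <= average n x + average n y.
Proof.
rewrite /average -mulrDr; apply: ler_wpM2l; first by rewrite exprn_ge0 ?invr_ge0.
rewrite -big_split; apply: ler_sum => j _ /=.
by rewrite mulrDr mulrDl; exact: nmD.
Qed.

Lemma averageZ n (a : R[i]) x : average n (a *: x) = normc a * average n x.
Proof.
rewrite /average mulrCA; congr (_ * _); rewrite mulr_sumr; apply: eq_bigr => j _.
by rewrite -scalerAr -scalerAl nmZ.
Qed.

Lemma sum_half (f : nat -> R) n :
  \sum_(j < 2 * n) f j./2 = 2 * \sum_(j < n) f j.
Proof.
elim: n => [|n IHn]; first by rewrite muln0 !big_ord0 mulr0.
rewrite mulnS add2n !big_ord_recr /= IHn.
have -> : (2 * n)./2 = n by rewrite mul2n doubleK.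
have -> : uphalf (2 * n) = n by rewrite mul2n uphalf_double.
by rewrite mulrDr; lra.
Qed.

(** A cell absorbs its parent, so compressing by it can only decrease the norm of the compression by
    the parent. Each parent has two children, which the factor 1/2 compensates. *)
Lemma averageS n x : average n.+1 x <= average n x.
Proof.
rewrite /average exprSr -mulrA; apply: ler_wpM2l; first by rewrite exprn_ge0 ?invr_ge0.
rewrite mulrC ler_pdivrMr // mulrC -(sum_half (fun j => nm (cell n j * x * cell n j))) -expnS.
apply: ler_sum => j _.
have e1 : cell n j./2 * cell n.+1 j = cell n.+1 j.
  by have := congr1 st (cell_child n j); rewrite stM !sa_cell.
have -> : cell n.+1 j * x * cell n.+1 j =
    cell n.+1 j * (cell n j./2 * x * cell n j./2) * cell n.+1 j.
  by rewrite -{1}(cell_child n j) -{2}e1 !mulrA.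
exact: nm_cell_mul.
Qed.

Lemma average_mono m n x : (m <= n)%N -> average n x <= average m x.
Proof.
move=> /subnK <-; elim: (n - m)%N => [//|k IHk].
by apply: le_trans (averageS _ x) IHk.
Qed.

Definition grid n j : R := al + (be - al) * (2^-1 ^+ n * j%:R).

Lemma grid_spec n j : (j < 2 ^ n)%N -> al <= grid n j <= be.
Proof.
move=> jn; have d0 : 0 < be - al by rewrite subr_gt0.
have r0 : 0 < 2 ^+ n :> R by rewrite exprn_gt0.
have s0 : 0 <= 2^-1 ^+ n * j%:R :> R by rewrite mulr_ge0 ?exprn_ge0 ?invr_ge0.
have s1 : 2^-1 ^+ n * j%:R <= 1 :> R.
  by rewrite exprVn mulrC ler_pdivrMr // mul1r -natrX ler_nat ltnW.
by rewrite /grid; move: s0 s1; set s := _ * _ => s0 s1; apply/andP; split; nra.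
Qed.

Lemma coord_grid n j t :
  2 ^+ n * coord t - j%:R = 2 ^+ n / (be - al) * (t - grid n j).
Proof.
rewrite /coord /grid exprVn; field.
by rewrite expf_neq0 //= subr_eq0 gt_eqF.
Qed.

(** Every grid point belongs to the spectrum and its bump takes the value 1 there, so each cell has
    norm 1. *)
Lemma average1 n : average n 1 = 1.
Proof.
apply/eqP; rewrite eq_le; apply/andP; split.
  by apply: average_bound => j _; apply: le_trans (nm_cell_mul _ _ _) _; rewrite nm1.
have r0 : 0 < 2 ^+ n :> R by rewrite exprn_gt0.
rewrite /average exprVn mulrC ler_pdivlMr // mul1r.
apply: (@le_trans _ _ (\sum_(j < 2 ^ n) 1)).
  by rewrite sumr_const card_ord -natrX.
apply: ler_sum => j _; have cc := @cont_cell n j.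
rewrite mulr1 /cell -fcM //.
have := @fc_ge _ _ h (fun t => tent (2 ^+ n * coord t - j%:R) * tent (2 ^+ n * coord t - j%:R))
  (grid n j) sh _ (hab (grid_spec (ltn_ord j))).
rewrite coord_grid subrr mulr0 /tent normr0 subr0 clamp1 ?mulr1; last by lra.
by rewrite normr1; apply; cont.
Qed.

(* On the j-th cell the functional calculus of [h] is nearly evaluation at the
   grid point. *)
Lemma cell_eigen (u : R -> R) (e : R) : continuous u -> 0 < e -> exists n, forall j,
  (j < 2 ^ n)%N -> nm (fc h u * cell n j - (u (grid n j))%:C *: cell n j) <= e.
Proof.
move=> cu e0; have e2 : 0 < e / 2 by rewrite divr_gt0.
have [C C0 uC] := uniform_modulus (nm h) cu e2.
have d0 : 0 < be - al by rewrite subr_gt0.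
(* The support of a bump has radius 3 (be - al) 2^-n, whose square enters the quadratic modulus of
   continuity of u; this is the origin of 9. *)
have C1 : 0 < 9 * C * (be - al) ^+ 2 + 1.
  by rewrite ltr_pwDr //; exact: mulr_ge0 (mulr_ge0 (ler0n _ 9) C0) (sqr_ge0 _).
have /cvgrPdist_lt/(_ _ (divr_gt0 e2 C1))[n _ Nn] : (fun n => 2^-1 ^+ n : R) @ \oo --> (0 : R).
  by apply: cvg_expr; rewrite ger0_norm ?invr_ge0 //; lra.
have r0 : 0 < 2^-1 ^+ n :> R by rewrite exprn_gt0 // invr_gt0.
have r1 : 2^-1 ^+ n <= 1 :> R by rewrite exprn_ile1 ?invr_ge0 //; lra.
have := Nn n (leqnn n); rewrite /= sub0r normrN ger0_norm ?(ltW r0) // ltr_pdivlMr // => rn.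
exists n => j jn; have cc := @cont_cell n j; have cuc := contM cu cc.
have cg : continuous (fun t => u (grid n j) * tent (2 ^+ n * coord t - j%:R)) by cont.
rewrite /cell -fcM // -fcZ // -fcB //; apply: fc_norm => // [|t ht]; first by cont.
rewrite -mulrBl normrM [X in _ * X]ger0_norm ?clamp_ge0 //.
have gs := hab (grid_spec jn).
rewrite coord_grid /tent; set w := 2 ^+ n / (be - al) * (t - grid n j).
have [h1|h1] := leP 3 `|w|; first by rewrite clamp0 ?mulr0 ?(ltW e0) //; lra.
have ug := uC _ _ (spec_le sh ht) (spec_le sh gs).
apply: (@le_trans _ _ `|u t - u (grid n j)|).
  by rewrite ler_piMr ?clamp_le1.
apply: le_trans ug _.
have -> : t - grid n j = (be - al) * 2^-1 ^+ n * w.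
  by rewrite /w exprVn; field; rewrite expf_neq0 //= subr_eq0 gt_eqF.
clearbody w; rewrite !exprMn; have w2 : w ^+ 2 <= 9.
  have -> : 9 = 3 ^+ 2 :> R by ring.
  by rewrite -real_normK ?num_real // ler_pXn2r ?nnegrE // ltW.
have : C * ((be - al) ^+ 2 * (2^-1 ^+ n) ^+ 2 * w ^+ 2) <= e / 2; last by lra.
apply: le_trans (_ : 2^-1 ^+ n * (9 * C * (be - al) ^+ 2 + 1) <= _); last exact: ltW.
have d2 : 0 <= (be - al) ^+ 2 by exact: sqr_ge0.
move: (2^-1 ^+ n) (w ^+ 2) ((be - al) ^+ 2) r0 r1 w2 (sqr_ge0 w) d2 => r w' d r0 r1 w2 w0 d2.
have h2 : r ^+ 2 <= r by rewrite expr2 ler_piMr // ltW.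
have h3 : d * r ^+ 2 * w' <= d * r * 9.
  apply: ler_pM => //; first by rewrite mulr_ge0 ?sqr_ge0.
  by rewrite ler_wpM2l.
have := ler_wpM2l C0 h3; nra.
Qed.

Definition limit_average x := inf [set average n x | n in setT].

Lemma limit_average_le n x : limit_average x <= average n x.
Proof.
apply: ge_inf; last by exists n.
by exists 0 => _ [m _ <-]; exact: average_ge0.
Qed.

Lemma limit_average_adherent x (e : R) : 0 < e -> exists n, average n x < limit_average x + e.
Proof.
move=> e0; have hi : has_inf [set average n x | n in setT].
  split; first by exists (average 0 x), 0%N.
  by exists 0 => _ [m _ <-]; exact: average_ge0.
by have [_ [n _ <-] lt] := inf_adherent e0 hi; exists n.
Qed.

Lemma limit_averageZ_le (a : R[i]) x : limit_average (a *: x) <= normc a * limit_average x.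
Proof.
apply/ler_addgt0Pr => e e0; have a1 : 0 < normc a + 1 by have := normc_ge0 a; lra.
have [n hn] := limit_average_adherent x (divr_gt0 e0 a1).
apply: le_trans (limit_average_le n _) _; rewrite averageZ.
apply: le_trans (ler_wpM2l (normc_ge0 a) (ltW hn)) _; rewrite mulrDr lerD2l.
by rewrite mulrCA ler_piMr ?(ltW e0) // ler_pdivrMr // mul1r; lra.
Qed.

Lemma limit_average_sublin : sublin limit_average.
Proof.
split=> [x y|t x t0]; last first.
  by apply: le_trans (limit_averageZ_le _ _) _; rewrite normc_real ger0_norm.
apply/ler_addgt0Pr => e e0; have e2 : 0 < e / 2 by rewrite divr_gt0.
have [n hn] := limit_average_adherent x e2; have [m hm] := limit_average_adherent y e2.
apply: le_trans (limit_average_le (maxn n m) _) _; apply: le_trans (averageD _ _ _) _.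
have := average_mono x (leq_maxl n m); have := average_mono y (leq_maxr n m); lra.
Qed.

Lemma limit_average_nm x : limit_average x <= nm x.
Proof.
apply: le_trans (limit_average_le 0 _) _; apply: average_bound => j _.
exact: nm_cell_mul.
Qed.

Lemma limit_average1 : limit_average 1 = 1.
Proof.
apply/eqP; rewrite eq_le; apply/andP; split.
  by rewrite -[leRHS](average1 0) limit_average_le.
by apply/ler_addgt0Pr => e e0; have [n] := limit_average_adherent 1 e0; rewrite average1 => /ltW.
Qed.

(** Compressed to a small cell, u(h) is nearly a scalar and commutes with everything up to a small
    error. *)
Lemma limit_average_comm (u : R -> R) x : continuous u ->
  limit_average (fc h u * x - x * fc h u) <= 0.
Proof.
move=> cu; apply/ler_addgt0Pr => e e0; rewrite add0r.
have x1 : 0 < 2 * nm x + 1 by have := nm_ge0 x; lra.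
have [n nj] := cell_eigen cu (divr_gt0 e0 x1).
apply: le_trans (limit_average_le n _) _; apply: average_bound => j jn.
have := nj j jn; set c := cell n j; set d := _ - _ => dn.
have cd : c * fc h u - (u (grid n j))%:C *: c = st d.
  by rewrite /d stB stM stZr !sa_cell (fc_sa sh cu).
have -> : c * (fc h u * x - x * fc h u) * c = st d * x * c - c * x * d.
  rewrite -cd /d 2!mulrBl (mulrBr (c * x)) -!scalerAl -!scalerAr opprB addrA subrK.
  by clear; clearbody c; nring.
apply: le_trans (nmB _ _) _.
have h1 : nm (st d * x * c) <= e / (2 * nm x + 1) * nm x.
  apply: le_trans (nm_mul3 _ _ _) _; rewrite nm_st ler_wpM2r ?nm_ge0 //.
  by apply: le_trans dn; rewrite ler_piMr ?nm_ge0 // nm_cell.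
have h2 : nm (c * x * d) <= e / (2 * nm x + 1) * nm x.
  apply: le_trans (nm_mul3 _ _ _) _; rewrite ler_wpM2r ?nm_ge0 //.
  by apply: le_trans dn; rewrite ler_piMl ?nm_ge0 // nm_cell.
apply: le_trans (lerD h1 h2) _.
have -> : e / (2 * nm x + 1) * nm x + e / (2 * nm x + 1) * nm x = e * (2 * nm x) / (2 * nm x + 1).
  by field; rewrite gt_eqF.
by rewrite ler_pdivrMr // ler_wpM2l ?(ltW e0) //; lra.
Qed.

Lemma limit_average_null (u : R -> R) x : continuous u -> (forall t, al <= t <= be -> u t = 0) ->
  limit_average (x * fc h u) <= 0.
Proof.
move=> cu u0; apply/ler_addgt0Pr => e e0; rewrite add0r.
have x1 : 0 < nm x + 1 by have := nm_ge0 x; lra.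
have [n nj] := cell_eigen cu (divr_gt0 e0 x1).
apply: le_trans (limit_average_le n _) _; apply: average_bound => j jn.
have := nj j jn; rewrite (u0 _ (grid_spec jn)) scale0r subr0 => dn.
rewrite mulrA -mulrA; apply: le_trans (nmM _ _) _.
apply: (@le_trans _ _ (nm x * (e / (nm x + 1)))).
  apply: ler_pM; rewrite ?nm_ge0 //; apply: le_trans (nmM _ _) _.
  by rewrite ler_piMl ?nm_ge0 // nm_cell.
by rewrite mulrCA ler_piMr ?(ltW e0) // ler_pdivrMr // mul1r; lra.
Qed.

(** Two bumps of radius 3 meet only if their indices differ by less than 6, which leaves 11 indices.
    The other bound in the minimum carries the induction on N. *)
Lemma count_near (J N : nat) : (\sum_(j < N) ((J < j + 6) && (j < J + 6)) <= minn (N + 5 - J) 11)%N.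
Proof.
elim: N => [|N IHN]; first by rewrite big_ord0.
rewrite big_ord_recr /=; move: IHN; move: (\sum_(j < N) _)%N => S.
by case: (boolP ((J < N + 6)%N && (N < J + 6)%N)) => [/andP[h1 h2]|/nandP[]]; lia.
Qed.

Lemma clamp_dist (N v a d : R) : 0 <= a <= N -> `|v - a| < d ->
  `|Num.max 0 (Num.min N v) - a| < d.
Proof.
move=> /andP[a0 aN]; rewrite !ltr_norml => /andP[a1 a2].
by case: (leP N v) => c1; [case: (leP 0 N)|case: (leP 0 v)] => c2; apply/andP; split; lra.
Qed.

(** Only the 11 cells near J see u, each with weight 2^-n. This is the diffuseness of the states
    dominated by [limit_average]. *)
Lemma limit_average_local n J (u : R -> R) : continuous u -> (forall t, 0 <= u t <= 1) ->
  (forall t, 3 <= `|Num.max 0 (Num.min (2 ^+ n) (2 ^+ n * coord t)) - J%:R| -> u t = 0) ->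
  limit_average (fc h u) <= 11 * 2^-1 ^+ n.
Proof.
move=> cu u01 u0; apply: le_trans (limit_average_le n _) _.
rewrite /average mulrC; apply: ler_wpM2r; first by rewrite exprn_ge0 ?invr_ge0.
apply: (@le_trans _ _ (\sum_(j < 2 ^ n) ((J < j + 6)%N && (j < J + 6)%N)%:R)); last first.
  rewrite -natr_sum ler_nat; apply: leq_trans (count_near J (2 ^ n)) _.
  exact: geq_minr.
apply: ler_sum => j _; have cc := @cont_cell n j.
case: (boolP ((J < j + 6)%N && (j < J + 6)%N)) => [_|far].
  apply: le_trans (nm_cell_mul _ _ _) _.
  by apply: fc_norm => // t _; have /andP[a1 a2] := u01 t; rewrite ger0_norm.
apply: (@le_trans _ _ (nm (fc h u * cell n j))).
  by rewrite -mulrA; apply: le_trans (nmM _ _) _; rewrite ler_piMl ?nm_ge0 // nm_cell.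
rewrite /cell -fcM //; apply: fc_norm => // [|t _]; first by cont.
move: (u0 t); set v := 2 ^+ n * coord t; set w := Num.max _ _ => u0t.
have [h1|h1] := leP 3 `|v - j%:R|; first by rewrite /tent clamp0 ?mulr0 ?normr0 //; lra.
rewrite u0t ?mul0r ?normr0 //; rewrite leNgt; apply/negP => h2.
have j0 : 0 <= j%:R :> R by [].
have jn : j%:R <= 2 ^+ n :> R by rewrite -natrX ler_nat ltnW.
have h3 : `|w - j%:R| < 3.
  by apply: clamp_dist => //; rewrite j0.
move: h2 h3; rewrite !ltr_norml => /andP[a1 a2] /andP[a3 a4].
case/nandP: far; rewrite -leqNgt -(ler_nat R) natrD; lra.
Qed.

Lemma nm_sc_i (t : R) x : sa x -> nm (sc U t + 'i *: x) ^+ 2 <= t ^+ 2 + nm x ^+ 2.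
Proof.
move=> sx; rewrite -nm_cstar stD st_sc stZ sx.
have -> : ('i : R[i])^* *: x = - ('i *: x).
  rewrite -scaleNr; congr (_ *: _).
  by apply/eqP; rewrite eq_complex /= oppr0 !eqxx.
have -> : (sc U t - 'i *: x) * (sc U t + 'i *: x) = sc U (t ^+ 2) + x * x.
  rewrite mulrBl !mulrDr -scM -expr2 sqr_i opprD opprK addrA -addrA.
  by rewrite scC addrA addrK.
apply: le_trans (nmD _ _) _; rewrite nm_sc ger0_norm ?sqr_ge0 // lerD2l expr2.
exact: nmM.
Qed.

(** Hahn-Banach at 1 gives a real-linear f. It vanishes at i x for self-adjoint x, because t + f (i
    x) <= nm (t + i x), whose square is at most t^2 + nm x ^ 2, for all t > 0. So F x = f x - i f (i
    x) is real on self-adjoint elements, and positive because the norm of nm x ^ 2 - st x * x is at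
    most nm x ^ 2. *)
Theorem average_functional : exists F : {scalar U},
  [/\ pos_on setT F, F 1 = 1, forall x, limit_average x <= 0 -> F x = 0 &
      forall x, complex.Re (F x) <= limit_average x].
Proof.
have [f [fD fZ fp f1]] := hahn_banach 1 limit_average_sublin.
rewrite limit_average1 in f1.
have f0 : f 0 = 0 by rewrite -(scale0r 0) fZ mul0r.
have fN x : f (- x) = - f x by apply/eqP; rewrite -addr_eq0 -fD addNr f0.
have ii : 'i * 'i = -1 :> R[i].
  by apply/eqP; rewrite eq_complex /= !mulr0 !mul0r !mulr1 sub0r addr0 oppr0 !eqxx.
have fsa x : sa x -> f ('i *: x) = 0.
  have le0 y : sa y -> f ('i *: y) <= 0.
    move=> sy; rewrite leNgt; apply/negP => fy.
    set g := f _ in fy; set m := nm y ^+ 2; have m0 : 0 <= m by rewrite sqr_ge0.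
    (* For this t one has 2 t g = 2 m + 2, incompatible with (t + g)^2 <= t^2 + m. *)
    pose t := (m + 1) / g; have t0 : 0 < t by rewrite divr_gt0 //; lra.
    have h1 : t + g <= nm (sc U t + 'i *: y).
      apply: le_trans _ (limit_average_nm _); apply: le_trans (fp _).
      by rewrite fD /sc fZ f1 mulr1.
    have h2 : (t + g) ^+ 2 <= t ^+ 2 + m.
      apply: le_trans (nm_sc_i t sy); rewrite ler_pXn2r ?nnegrE ?nm_ge0 //; lra.
    have h3 : t * g = m + 1 by rewrite /t divfK // gt_eqF.
    have : (t + g) ^+ 2 = t ^+ 2 + 2 * (t * g) + g ^+ 2 by ring.
    by have := sqr_ge0 g; rewrite h3; lra.
  move=> sx; apply/eqP; rewrite eq_le le0 //=.
  by have := le0 _ (saN sx); rewrite scalerN fN; lra.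
pose F0 x : R[i] := f x +i* (- f ('i *: x)).
have [F FE] : exists G : {scalar U}, forall x, G x = F0 x.
  apply: scalar_exists => -[a b] x y.
  have fab (z : U) : f ((a +i* b) *: z) = a * f z + b * f ('i *: z).
    have -> : a +i* b = a%:C + b%:C * 'i.
      by apply/eqP; rewrite eq_complex /=; apply/andP; split; apply/eqP; ring.
    by rewrite scalerDl fD -scalerA !fZ.
  have fii (z : U) : f ('i *: ('i *: z)) = - f z by rewrite scalerA ii scaleN1r fN.
  rewrite /F0 scalerDr !fD scalerA (mulrC 'i) -scalerA !fab fii.
  by apply/eqP; rewrite eq_complex /=; apply/andP; split; apply/eqP; ring.
have Fnull x : limit_average x <= 0 -> F x = 0.
  move=> px; have z y : limit_average y <= 0 -> f y = 0.
    move=> py; apply/eqP; rewrite eq_le (le_trans (fp y)) //=.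
    have : limit_average (- y) <= 0.
      rewrite -scaleN1r; apply: le_trans (limit_averageZ_le _ _) _.
      by rewrite mulr_ge0_le0 ?normc_ge0.
    by move=> /(le_trans (fp _)); rewrite fN; lra.
  rewrite FE /F0 !z ?oppr0 //; apply: le_trans (limit_averageZ_le _ _) _.
  by rewrite mulr_ge0_le0 ?normc_ge0.
exists F; split=> // [x _||x].
- have sx := sa_cstar x; rewrite FE lecE /= fsa // oppr0 eqxx /=.
  have nx : nm (st x * x) <= nm x ^+ 2 by rewrite nm_cstar.
  have := le_trans (fp _) (le_trans (limit_average_nm _) (psd_bound (psd_cstar x) nx)).
  by rewrite fD fN /sc fZ f1 mulr1; lra.
- rewrite FE /F0 f1 fsa ?oppr0 //; exact: st1.
- by rewrite FE; exact: fp.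
Qed.

End Averages.

Section MoreLimits.
Context (R : realType).
Implicit Types (u v : nat -> R[i]) (l m : R[i]).

Lemma clim_Re_le u v l m : (forall n, complex.Re (u n) <= complex.Re (v n)) ->
  clim u l -> clim v m -> complex.Re l <= complex.Re m.
Proof.
move=> uv ul vm; rewrite -subr_ge0 -ReN -ReD.
have := clim_ge0 _ (clim_sub (clim_Re vm) (clim_Re ul)).
rewrite -rmorphB /= -ReN -ReD ler0c; apply => n.
by rewrite -rmorphB /= ler0c subr_ge0.
Qed.

Lemma limit_square_bound (A C r d e : R) : 0 <= A -> 0 <= C -> 0 < d -> d <= 1 ->
  d * (2 * A + C + 1) <= e -> 0 <= C * (r + d) ->
  (d <= A -> (A - d) ^+ 2 <= C * (r + d)) -> A ^+ 2 <= C * r + e.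
Proof.
move=> A0 C0 d0 d1 de h; have [Ad /(_ isT)|Ad _] := leP d A; last by rewrite expr2; nra.
by have := sqr_ge0 d; rewrite !expr2; nra.
Qed.

Lemma clim_sqr_le u v l m (C : R) : clim u l -> clim v m -> 0 <= C ->
  (forall n, normc (u n) ^+ 2 <= C * complex.Re (v n)) -> normc l ^+ 2 <= C * complex.Re m.
Proof.
move=> ul vm C0 uv; apply/ler_addgt0Pr => e e0; set A := normc l.
have A0 : 0 <= A := normc_ge0 l; have D0 : 0 < 2 * A + C + 1 by lra.
pose d := Num.min 1 (e / (2 * A + C + 1)).
have d0 : 0 < d by rewrite lt_min ltr01 divr_gt0.
have d1 : d <= 1 by rewrite ge_min lexx.
have de : d * (2 * A + C + 1) <= e by rewrite -ler_pdivlMr // ge_min lexx orbT.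
have [N Nd] := ul d d0; have [M Md] := vm d d0; pose n := maxn N M.
have h1 : A - d <= normc (u n).
  have := normcB_tri (u n) l 0; rewrite !subr0 (normcBC l).
  by have := Nd n (leq_maxl _ _); rewrite /A; lra.
have h2 : complex.Re (v n) <= complex.Re m + d.
  have := normc_Re (v n - m); rewrite ReD ReN; have := Md n (leq_maxr _ _).
  by have := ler_norm (complex.Re (v n) - complex.Re m); lra.
have h3 := uv n; have u0 := normc_ge0 (u n).
have h4 : normc (u n) ^+ 2 <= C * (complex.Re m + d).
  by apply: le_trans h3 _; rewrite ler_wpM2l.
apply: (limit_square_bound A0 C0 d0 d1 de (le_trans (sqr_ge0 _) h4)) => Ad.
by apply: le_trans h4; rewrite ler_pXn2r ?nnegrE // subr_ge0.
Qed.

Lemma clim_sum (N : nat) (u : nat -> nat -> R[i]) (l : nat -> R[i]) :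
  (forall j, (j < N)%N -> clim (u j) (l j)) ->
  clim (fun n => \sum_(j < N) u j n) (\sum_(j < N) l j).
Proof.
elim: N => [_|N IHN ul].
  by rewrite big_ord0; under eq_fun do rewrite big_ord0; exact: clim_cst.
rewrite big_ord_recr /= addrC -[l N]mul1r; under eq_fun do rewrite big_ord_recr /= addrC -[u N _]mul1r.
apply: clim_lin; first exact: ul.
by apply: IHN => j jN; apply: ul; exact: ltnW.
Qed.

End MoreLimits.

(** * Pure minorants compressed by elements centralizing the functional *)

Section Compressions.
Context (R : realType) (U : ucstarType R) (K : set U).
Hypotheses (cK : cstsub K) (iK : idl setT K).
Hypothesis Kext : forall g : U -> R[i], lin_on K g ->
  exists G : {scalar U}, forall x, K x -> G x = g x.
Variables (F G : {scalar U}).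
Hypotheses (pF : pos_on setT F) (pG : pure_on K G) (GF : fle K G F).
Implicit Types (x y z e : U).

Let KMl x y : K x -> K (y * x). Proof. by move=> Kx; apply: (idlMl iK). Qed.
Let KMr x y : K x -> K (x * y). Proof. by move=> Kx; apply: (idlMr iK). Qed.
Let pFK : pos_on K F. Proof. by move=> x _; exact: pF. Qed.
Let pGK : pos_on K G. Proof. by case: pG. Qed.
Let cT := @csubT R U.
Let qF0 x : 0 <= qf F x. Proof. exact: qf_ge0 pF I. Qed.

Lemma qf_mul_le x y : qf F (x * y) <= nm x ^+ 2 * qf F y.
Proof.
have [z [sz zE _ _]] := psd_sqrt (psd_nm_sub x).
have E : st (x * y) * (x * y) = (nm x ^+ 2)%:C *: (st y * y) - st (z * y) * (z * y).
  rewrite !stM sz; have -> : st y * z * (z * y) = st y * (z * z) * y by rewrite !mulrA.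
  by rewrite -zE mulrBr mulrBl scEr -scalerAl opprB addrC subrK !mulrA.
rewrite /qf E linearB scalarZ ReD ReN Re_scale gerDl oppr_le0.
exact: qF0.
Qed.

Lemma riesz_sequence : exists a : nat -> U, [/\ forall n, K (a n),
  forall m n, qf F (a m - a n) <= 2 * (2^-1 ^+ m + 2^-1 ^+ n) &
  forall n x, K x -> normc (F (st (a n) * x) - G x) ^+ 2 <= 2^-1 ^+ n * qf F x].
Proof.
have [M M0 GM] := pos_cont cK.1 cK.2 pGK.
apply: (@riesz _ _ K cK F K G M (fun n => 2^-1 ^+ n)) => //.
- exact: csub0 cK.1.
- by case: cK.1.
- by move=> a x y _ _; rewrite linearD scalarZ.
- move=> x Kx; have [_ _ h] := GM x Kx; apply: le_trans h _.
  by rewrite ler_wpM2l //; exact: GF.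
Qed.

Variable a : nat -> U.
Hypotheses (Ka : forall n, K (a n))
  (aC : forall m n, qf F (a m - a n) <= 2 * (2^-1 ^+ m + 2^-1 ^+ n))
  (aG : forall n x, K x -> normc (F (st (a n) * x) - G x) ^+ 2 <= 2^-1 ^+ n * qf F x).

Lemma riesz_bounded : exists2 B : R, 0 <= B & forall n, qf F (a n) <= B.
Proof.
exists (2 * qf F (a 0%N) + 8); first by have := qF0 (a 0%N); lra.
move=> n; have := qf_parallelogram F (a n - a 0%N) (a 0%N); rewrite subrK.
have := qF0 (a n - a 0%N - a 0%N); have := aC n 0; rewrite expr0.
have : 2^-1 ^+ n <= 1 :> R by rewrite exprn_ile1 ?invr_ge0 //; lra.
lra.
Qed.

(** Membership in the centralizer of F, not in the center of the algebra. *)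
Definition central e := forall x, F (e * x) = F (x * e).

(** Right multiplication by e then induces a contraction of the GNS space of F that commutes with
    the left action. *)
Definition contraction e := [/\ sa e, central e & forall y, qf F (y * e) <= qf F y].

Lemma contraction1 : contraction 1.
Proof. by split=> [|x|x]; [exact: sa1|rewrite mulr1 mul1r|rewrite mulr1]. Qed.

Lemma central_move e n x : contraction e ->
  F (st (a n) * x * a n * (e * e)) = F (st (a n * e) * x * (a n * e)).
Proof. by move=> [se ce _]; rewrite mulrA -ce stM se !mulrA. Qed.

(** The a n converge to a vector of the GNS space; the a n * e are again Cauchy, hence so are the
    values of the vector functionals they define. *)
Lemma compression_limit e x : contraction e ->
  exists l, clim (fun n => F (st (a n) * x * a n * (e * e))) l.
Proof.
move=> ce; have [se _ he] := ce; have [B B0 aB] := riesz_bounded.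
pose b n := a n * e; have bB n : qf F (b n) <= B by apply: le_trans (he _) (aB n).
have bC m n : qf F (b m - b n) <= 2 * (2^-1 ^+ m + 2^-1 ^+ n).
  by rewrite /b -mulrBl; apply: le_trans (he _) (aC m n).
have T y : setT y by [].
have d1 m n y : normc (F (st (b m - b n) * (y * b m))) ^+ 2 <=
    nm y ^+ 2 * B * (2 * (2^-1 ^+ m + 2^-1 ^+ n)).
  apply: le_trans (cauchy_schwarz cT pF (T _) (T _)) _.
  apply: ler_pM => //; apply: le_trans (qf_mul_le _ _) _.
  by rewrite ler_wpM2l ?sqr_ge0.
have d2 m n y : normc (F (st (st y * b n) * (b m - b n))) ^+ 2 <=
    nm y ^+ 2 * B * (2 * (2^-1 ^+ m + 2^-1 ^+ n)).
  apply: le_trans (cauchy_schwarz cT pF (T _) (T _)) _; rewrite mulrC.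
  apply: ler_pM => //; apply: le_trans (qf_mul_le _ _) _; rewrite nm_st.
  by rewrite ler_wpM2l ?sqr_ge0.
apply: complex_complete => eps eps0.
have e2 : 0 < (eps / 2) ^+ 2 by rewrite exprn_gt0 // divr_gt0.
have /cvgrPdist_lt/(_ _ e2)[N _ Nn] :
    (fun n => nm x ^+ 2 * B * 4 * 2^-1 ^+ n : R) @ \oo --> (0 : R).
  rewrite -[X in _ --> X](mulr0 (nm x ^+ 2 * B * 4)).
  by apply: cvgM; [exact: cvg_cst|apply: cvg_expr; rewrite ger0_norm ?invr_ge0 //; lra].
have := Nn N (leqnn N); rewrite /= sub0r normrN => lt.
exists N => m n Nm Nn'; rewrite !central_move // -/(b m) -/(b n).
have C0 : 0 <= nm x ^+ 2 * B by rewrite mulr_ge0 ?sqr_ge0.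
have rN k : (N <= k)%N -> 2^-1 ^+ k <= 2^-1 ^+ N :> R.
  by move=> Nk; rewrite ler_wiXn2l ?invr_ge0 //; lra.
have bnd (z : R[i]) : normc z ^+ 2 <= nm x ^+ 2 * B * (2 * (2^-1 ^+ m + 2^-1 ^+ n)) ->
    normc z < eps / 2.
  move=> h; rewrite -(@ltr_pXn2r _ 2) ?nnegrE ?normc_ge0 ?divr_ge0 ?(ltW eps0) //.
  apply: le_lt_trans h _; apply: le_lt_trans lt; apply: le_trans (ler_norm _).
  rewrite -(mulrA _ 4); apply: ler_wpM2l => //; have := rN m Nm; have := rN n Nn'; lra.
have -> : F (st (b m) * x * b m) - F (st (b n) * x * b n) =
    F (st (b m - b n) * (x * b m)) + F (st (st x * b n) * (b m - b n)).
  by rewrite -linearB -linearD stB (stM (st x)) stK; congr (F _); clearbody b; nring.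
apply: le_lt_trans (le_normcD _ _) _.
by have := bnd _ (d1 m n x); have := bnd _ (d2 m n x); lra.
Qed.

(** The limit k is at most its analogue nu for e = 1. There F (st (a n) * z) is close to G z, so
    Cauchy-Schwarz for G <= F gives nu^2 <= G (st y * y) nu. Thus k <= G, and purity of G supplies
    the factor s. *)
Lemma compression e : contraction e -> exists2 s : R, 0 <= s <= 1 &
  forall x, K x -> clim (fun n => F (st (a n) * x * a n * (e * e))) (s%:C * G x).
Proof.
move=> ce; have [se _ he] := ce; have [B B0 aB] := riesz_bounded.
have /choice[l lP] x := compression_limit x ce.
have [c x y _ _|k kE] := @Kext l.
  apply: clim_uniq (lP _) _.
  have := clim_lin c (lP x) (lP y) => h ep /h[N Nh]; exists N => n /Nh.
  congr (normc (_ - _) < _).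
  by rewrite mulrDr !mulrDl -!scalerAr -!scalerAl linearD scalarZ.
have Kxx x : K x -> K (st x * x) by move=> Kx; exact: KMl.
have E n (ee : U) x : contraction ee ->
    F (st (a n) * (st x * x) * a n * (ee * ee)) = (qf F (x * (a n * ee)))%:C.
  by move=> cee; rewrite central_move // -(qfE pF I) !stM !mulrA.
have pk : pos_on K k.
  move=> x Kx; rewrite (kE _ (Kxx _ Kx)); apply: clim_ge0 (lP _) => n.
  by rewrite E // ler0c.
have kG : fle K k G.
  move=> y Ky; have [nu nuP] := compression_limit (st y * y) contraction1.
  have knu : qf k y <= complex.Re nu.
    rewrite /qf (kE _ (Kxx _ Ky)); apply: clim_Re_le (lP _) nuP => n.
    by rewrite !E //; [rewrite /= !mulrA mulr1; exact: he|exact: contraction1].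
  apply: le_trans knu _.
  (* [aG] is applied to z = st y * y * a n, whose seminorm stays bounded in n. *)
  have Gnu : clim (fun n => G (st y * y * a n)) nu.
    have diff : clim (fun n => F (st (a n) * (st y * y) * a n * (1 * 1)) - G (st y * y * a n)) 0.
      apply: (@clim_sqr _ _ _ (nm (st y * y) ^+ 2 * B) 2^-1).
        by rewrite invr_ge0 ler0n /=; lra.
      move=> n; rewrite subr0 !mulr1 -(mulrA (st (a n))).
      apply: le_trans (aG n (KMr _ (Kxx _ Ky))) _; rewrite mulrC.
      rewrite ler_wpM2r ?exprn_ge0 ?invr_ge0 //; apply: le_trans (qf_mul_le _ _) _.
      by rewrite ler_wpM2l ?sqr_ge0.
    have := clim_sub nuP diff; rewrite subr0 => h ep /h[N Nh]; exists N => n /Nh.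
    by rewrite subKr.
  have h : normc nu ^+ 2 <= qf G y * complex.Re nu.
    apply: clim_sqr_le Gnu nuP (qf_ge0 pGK Ky) _ => n.
    rewrite -mulrA; apply: le_trans (cauchy_schwarz cK.1 pGK (KMr (a n) Ky) Ky) _.
    rewrite mulrC ler_wpM2l ?(qf_ge0 pGK) // E; last exact: contraction1.
    by rewrite /= mulr1; exact: GF (KMr _ Ky).
  have r0 := normc_Re nu.
  have [r|r] := leP (complex.Re nu) 0; first by apply: le_trans r (qf_ge0 pGK Ky).
  have : complex.Re nu ^+ 2 <= qf G y * complex.Re nu.
    apply: le_trans h; rewrite ler_pXn2r ?nnegrE ?normc_ge0 ?(ltW r) //.
    exact: le_trans (ler_norm _) r0.
  by rewrite expr2 ler_pM2r.
have [_ _ /(_ k pk kG)[s s01 sE]] := pG.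
by exists s => // x Kx; rewrite -sE // kE.
Qed.

(** With b = c e, G (st b * b) is the limit of F (st (a n) * st b * b). Moving e to the left factor
    and applying Cauchy-Schwarz bounds the square of this limit by qf F c * s * G (st b * b). *)
Lemma compression_le e s c : contraction e -> 0 <= s -> K c ->
  (forall x, K x -> clim (fun n => F (st (a n) * x * a n * (e * e))) (s%:C * G x)) ->
  qf G (c * e) <= s * qf F c.
Proof.
move=> ce s0 Kc sP; have [se cc he] := ce; have [B B0 aB] := riesz_bounded.
pose b := c * e; have Kb : K b := KMr _ Kc.
have Kbb : K (st b * b) by exact: KMl.
have u1 : clim (fun n => F (st (a n) * (st b * b))) (G (st b * b)).
  apply: (@clim_sqr _ _ _ (qf F (st b * b)) 2^-1).
    by rewrite invr_ge0 ler0n /=; lra.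
  by move=> n; rewrite mulrC; exact: aG.
have : normc (G (st b * b)) ^+ 2 <= qf F c * complex.Re (s%:C * G (st b * b)).
  apply: clim_sqr_le u1 (sP _ Kbb) (qF0 c) _ => n.
  have -> : F (st (a n) * (st b * b)) = F (st (b * (a n * e)) * c).
    by rewrite {2}/b !mulrA -cc !stM se !mulrA.
  apply: le_trans (cauchy_schwarz cT pF I I) _; rewrite ler_wpM2l //.
  by rewrite central_move // /qf !stM !mulrA.
rewrite (qfE pGK Kb) normc_real ger0_norm ?(qf_ge0 pGK) // Re_scale /=.
move=> h; have g0 := qf_ge0 pGK Kb.
have [->|g1] := eqVneq (qf G b) 0; first by rewrite mulr_ge0.
have gp : 0 < qf G b by rewrite lt_def g1.
by rewrite expr2 mulrA [qf F c * s]mulrC ler_pM2r in h.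
Qed.

End Compressions.

(** * A diffuse state has no pure minorant *)

Section NoInterval.
Context (R : realType) (U : ucstarType R) (K : set U).
Hypotheses (cK : cstsub K) (iK : idl setT K).
Hypothesis Kext : forall g : U -> R[i], lin_on K g ->
  exists G : {scalar U}, forall x, K x -> G x = g x.
Hypothesis Kpure : forall F, pos_on K F -> (exists2 x, K x & F x != 0) ->
  exists2 G, pure_on K G & fle K G F.
Variables (h : U) (al be : R).
Hypotheses (sh : sa h) (Kh : K h) (ab : al < be) (albe0 : 0 < al * be).
Implicit Types (x y : U) (u : R -> R) (n J : nat) (t : R).

Let KMl x y : K x -> K (y * x). Proof. by move=> Kx; apply: (idlMl iK). Qed.
Let KMr x y : K x -> K (x * y). Proof. by move=> Kx; apply: (idlMr iK). Qed.
Let cT := @csubT R U.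

Definition ramp n t : R := Num.max 0 (Num.min (2 ^+ n) (2 ^+ n * coord al be t)).
(** The piecewise linear hat centred at J, written as a difference of clamps so that the sum over J
    telescopes. *)
Definition hat n J t : R := clamp (ramp n t + 1 - J%:R) - clamp (ramp n t - J%:R).
Definition window n J t : R := tent (ramp n t - J%:R).

Lemma cont_ramp n : continuous (ramp n).
Proof. by rewrite /ramp /coord; cont. Qed.

Lemma cont_hat n J : continuous (hat n J).
Proof. by have cr := @cont_ramp n; rewrite /hat /clamp; cont. Qed.

Lemma cont_window n J : continuous (window n J).
Proof. by have cr := @cont_ramp n; rewrite /window /tent /clamp; cont. Qed.

Lemma clamp_mono (s t : R) : s <= t -> clamp s <= clamp t.
Proof.
move=> st; rewrite ge_max clamp_ge0 /= le_max; apply/orP; right.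
by rewrite le_min !ge_min lexx st orbT.
Qed.

Lemma hat_ge0 n J t : 0 <= hat n J t.
Proof. by rewrite subr_ge0; apply: clamp_mono; lra. Qed.

Lemma hat_le1 n J t : hat n J t <= 1.
Proof. by rewrite /hat; have := clamp_le1 (ramp n t + 1 - J%:R); have := clamp_ge0 (ramp n t - J%:R); lra. Qed.

Lemma hat_window n J t : window n J t * hat n J t = hat n J t.
Proof.
rewrite /hat /window; set v := ramp n t; have [h1|h1] := leP 1 `|v - J%:R|.
  suff -> : clamp (v + 1 - J%:R) - clamp (v - J%:R) = 0 by rewrite mulr0.
  have [h2|h2] := leP 0 (v - J%:R).
    by rewrite !clamp1 ?subrr //; move: h1; rewrite ger0_norm //; lra.
  by rewrite !clamp0 ?subrr //; move: h1; rewrite ltr0_norm //; lra.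
by rewrite /tent clamp1 ?mul1r //; lra.
Qed.

Lemma hat_sum n t : \sum_(J < (2 ^ n).+1) hat n J t = 1.
Proof.
pose rho J := clamp (ramp n t + 1 - J%:R).
have v0 : 0 <= ramp n t by rewrite le_max lexx.
have v1 : ramp n t <= 2 ^+ n by rewrite ge_max ge_min lexx exprn_ge0.
rewrite -(big_mkord xpredT (fun J => hat n J t)).
rewrite (eq_bigr (fun J => - (rho J.+1 - rho J))) => [|J _]; last first.
  have -> : rho J.+1 = clamp (ramp n t - J%:R) by rewrite /rho -natr1; congr clamp; ring.
  by rewrite opprB.
have r0 : rho 0%N = 1 by rewrite /rho clamp1 // subr0 lerDr.
have rN : rho (2 ^ n).+1 = 0 by rewrite /rho clamp0 // -natr1 natrX opprD addrACA subrr addr0 subr_le0.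
by rewrite sumrN telescope_sumr // r0 rN opprB subr0.
Qed.

(** For a pure G <= F, compression by e J = sqrt (hat J) yields factors s J with sum at most 1. As F
    is at most 11 * 2^-n on functions supported near J, qf G (w e J) <= s J * 11 * 2^-n. Summation
    over J gives qf G w <= 11 * 2^-n for every n. *)
Theorem no_spectral_interval : exists2 t, al <= t <= be & ~ spec h t.
Proof.
apply: contrapT => nt.
have hab t : al <= t <= be -> spec h t by move=> tab; apply: contrapT => ht; apply: nt; exists t.
have [F [pF F1 Fnull FRe]] := average_functional sh ab hab.
have pFK : pos_on K F by move=> x _; exact: pF.
have Fcentral u : continuous u -> central F (fc h u).
  move=> cu x; apply/eqP; rewrite -subr_eq0 -linearB; apply/eqP/Fnull.
  exact: limit_average_comm.
have F0 u x : continuous u -> (forall t, al <= t <= be -> u t = 0) -> F (x * fc h u) = 0.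
  by move=> cu u0; apply: Fnull; exact: limit_average_null.
(* A lower bound for |t| on [al, be], positive since al and be have the same sign. It gives a
   function w0 equal to 1 on the interval and to 0 at 0; w = w0(h) lies in K and acts as a unit for
   F. *)
pose c0 := Num.min `|al| `|be|.
have aln : al != 0 by apply/eqP => z; move: albe0; rewrite z mul0r ltxx.
have ben : be != 0 by apply/eqP => z; move: albe0; rewrite z mulr0 ltxx.
have c00 : 0 < c0 by rewrite lt_min !normr_gt0 aln.
have c0t t : al <= t <= be -> c0 <= `|t|.
  move=> /andP[at1 tb]; rewrite ge_min; have [a0|a0] := leP 0 al.
    by rewrite (ger0_norm a0) (ger0_norm (le_trans a0 at1)) at1.
  have b0 : be < 0 by move: albe0; rewrite nmulr_rgt0.
  by rewrite (ltr0_norm b0) (ltr0_norm (le_lt_trans tb b0)) lerN2 tb orbT.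
pose w0 t := clamp (`|t| * c0^-1); have cw0 : continuous w0 by rewrite /w0 /clamp; cont.
have w00 : w0 0 = 0 by rewrite /w0 normr0 mul0r clamp0.
have w01 t : al <= t <= be -> w0 t = 1.
  by move=> tab; rewrite /w0 clamp1 // ler_pdivlMr // mul1r c0t.
pose w := fc h w0; have sw : sa w by exact: fc_sa.
have Kw : K w by apply: fc_csub => //; exact: cK.1.
have cw1 : continuous (fun t => 1 - w0 t) by cont.
have w1E : fc h (fun t => 1 - w0 t) = 1 - w by rewrite fcB ?fc_cst ?sc1 //; cont.
have F1w x : F (x * (1 - w)) = 0.
  by rewrite -w1E; apply: F0 => // t /w01 ->; rewrite subrr.
have [G pG GF] : exists2 G, pure_on K G & fle K G F.
  apply: Kpure => //; exists w => //; apply/eqP => Fw.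
  have := F1w 1; rewrite mul1r linearB F1 Fw subr0 => /eqP; by rewrite oner_eq0.
have [pGK [x1 Kx1 Gx1] _] := pG.
have Gw x : K x -> G x = G (x * w).
  move=> Kx; apply/eqP; rewrite -subr_eq0 -linearB; apply/eqP.
  have Kz : K (x - x * w) by apply: (csubB cK.1) => //; exact: KMr.
  apply: (pos_null cK pGK Kz); apply/eqP; rewrite eq_le (qf_ge0 pGK Kz) andbT.
  apply: le_trans (GF _ Kz) _.
  have -> : qf F (x - x * w) = complex.Re (F (st (x - x * w) * x * (1 - w))).
    by rewrite -mulrA mulrBr mulr1.
  by rewrite F1w.
(* Since G x = G (x w) on K, Cauchy-Schwarz makes G vanish as soon as qf G w does. *)
suff w_null : qf G w = 0.
  move/eqP: Gx1; apply; rewrite Gw // -{1}(stK x1) (F_herm cK.1 pGK Kw (cK.2 _ Kx1)).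
  rewrite (qf_null cK.1 pGK (cK.2 _ Kx1) Kw w_null).
  by apply/eqP; rewrite eq_complex /= oppr0 !eqxx.
have [a [Ka aC aG]] := riesz_sequence cK pF pG GF.
(* With e and d the square roots of u(h) and 1 - u(h), centrality splits qf F y into qf F (y e) + qf
   F (y d). *)
have contr u : continuous u -> (forall t, 0 <= u t <= 1) ->
    contraction F (fc h (fun t => Num.sqrt (u t))).
  move=> cu u01; have ce : continuous (fun t => Num.sqrt (u t)) by cont.
  have cd : continuous (fun t => Num.sqrt (1 - u t)) by cont.
  split=> [||y]; [exact: fc_sa|exact: Fcentral|].
  set e := fc h _; pose d := fc h (fun t => Num.sqrt (1 - u t)).
  have sq (g : R -> R) : continuous g -> F (st (y * fc h g) * (y * fc h g)) = F (st y * y * (fc h g * fc h g)).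
    move=> cg; rewrite stM (fc_sa sh cg).
    rewrite -[X in F X]mulrA.
    rewrite (Fcentral g cg (st y * (y * fc h g))); congr (F _).
    by rewrite !mulrA.
  have ed : e * e + d * d = 1.
    rewrite -!fcM // -fcD //; [|by cont..].
    rewrite -(sc1 U) -(fc_cst 1 sh); apply: fc_ext => //; [by cont..|move=> t _].
    by have /andP[u0 u1] := u01 t; rewrite -!expr2 !sqr_sqrtr ?subr_ge0 //; lra.
  have : qf F y = qf F (y * e) + qf F (y * d).
    by rewrite /qf !sq // -ReD -linearD -mulrDr -/e -/d ed mulr1.
  by have := qf_ge0 pF (I : setT (y * d)); lra.
have contr1 := contraction1 F.
have [s1 s1P s1E] := compression cK iK Kext pF pG GF aC aG contr1.
apply/eqP; rewrite eq_le (qf_ge0 pGK Kw) andbT; apply/ler_addgt0Pr => eps eps0; rewrite add0r.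
have /cvgrPdist_lt/(_ eps eps0)[n _ Nn] : (fun n => 11 * 2^-1 ^+ n : R) @ \oo --> (0 : R).
  rewrite -[X in _ --> X](mulr0 11).
  by apply: cvgM; [exact: cvg_cst|apply: cvg_expr; rewrite ger0_norm ?invr_ge0 //; lra].
have := Nn n (leqnn n); rewrite /= sub0r normrN ger0_norm; last first.
  by rewrite mulr_ge0 // exprn_ge0 // invr_ge0.
move=> /ltW; apply: le_trans.
have hat01 J t : 0 <= hat n J t <= 1 by rewrite hat_ge0 hat_le1.
have ch J := @cont_hat n J; have cw J := @cont_window n J.
pose e J := fc h (fun t => Num.sqrt (hat n J t)).
have ce J : continuous (fun t => Num.sqrt (hat n J t)) by have := ch J => c; cont.
have ee J : e J * e J = fc h (hat n J).
  rewrite -fcM //; apply: fc_ext => //; first by have := ce J => c; cont.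
  by move=> t _; rewrite -expr2 sqr_sqrtr ?hat_ge0.
have /choice[s sP] J : exists s : R, 0 <= s <= 1 /\ forall x, K x ->
    clim (fun n => F (st (a n) * x * a n * (e J * e J))) (s%:C * G x).
  by have [s] := compression cK iK Kext pF pG GF aC aG (contr _ (ch J) (hat01 J)); exists s.
have sum_e N : \sum_(J < N) e J * e J = fc h (fun t => \sum_(J < N) hat n J t).
  have csum M : continuous (fun t => \sum_(J < M) hat n J t).
    elim: M => [|M IHM].
      by under eq_fun do rewrite big_ord0; exact: cont_cst.
    by under eq_fun do rewrite big_ord_recr /=; apply: contD.
  elim: N => [|N IHN].
    by rewrite big_ord0; under eq_fun do rewrite big_ord0; rewrite fc_cst ?sc0.
  rewrite big_ord_recr /= IHN ee -fcD //; congr fc.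
  by apply/funext => t; rewrite big_ord_recr.
have e1 : \sum_(J < (2 ^ n).+1) e J * e J = 1.
  rewrite sum_e -(sc1 U) -(fc_cst 1 sh); congr fc; apply/funext => t; exact: hat_sum.
(* At x1, where G x1 != 0, uniqueness of limits identifies the sum of the s J with s1, because the
   squares of the e J add up to 1. *)
have sums : \sum_(J < (2 ^ n).+1) s J <= 1.
  have h1 := s1E x1 Kx1.
  have h2 := @clim_sum _ (2 ^ n).+1 (fun J n => F (st (a n) * x1 * a n * (e J * e J)))
    (fun J => (s J)%:C * G x1) (fun J _ => (sP J).2 x1 Kx1).
  have h3 : clim (fun n => F (st (a n) * x1 * a n * (1 * 1))) (\sum_(J < (2 ^ n).+1) (s J)%:C * G x1).
    move=> ep /h2[M Mh]; exists M => k /Mh.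
    by rewrite -linear_sum -mulr_sumr e1 mulr1.
  have := clim_uniq h1 h3; rewrite -mulr_suml => /(mulIf Gx1).
  rewrite -rmorph_sum => /(congr1 (@complex.Re R)) /= <-.
  by case/andP: s1P.
have bound J : qf G (w * e J) <= s J * (11 * 2^-1 ^+ n).
  have /andP[sJ0 _] := (sP J).1.
  have cwJ := cw J; have ceJ := ce J.
  (* The window is 1 wherever the hat is nonzero, so D can be inserted for free; it localizes w on
     the side where F is evaluated. *)
  pose D := fc h (window n J).
  have wD : w * e J = w * D * e J.
    rewrite -mulrA /w /D /e -!fcM //; [|by cont..].
    apply: fc_ext => //; [by cont..|move=> t _]; congr (_ * _).
    have := hat_window n J t; rewrite mulrC => hw.
    have [z|z] := eqVneq (hat n J t) 0; first by rewrite z sqrtr0 mulr0.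
    have -> : window n J t = 1 by apply: (mulfI z); rewrite mulr1.
    by rewrite mul1r.
  have KwD : K (w * D) by exact: KMr.
  rewrite wD; apply: le_trans
    (compression_le iK pF pG aC aG (contr _ (ch J) (hat01 J)) sJ0 KwD (sP J).2) _.
  apply: ler_wpM2l => //; apply: le_trans (_ : complex.Re (F (fc h (fun t =>
      w0 t * window n J t * (w0 t * window n J t)))) <= _).
    rewrite /qf fcM //; [|by cont..]; rewrite fcM // -/w -/D.
    have cwD : w * D = D * w by rewrite /w /D -!fcM //; congr fc; apply/funext => t; rewrite mulrC.
    by rewrite stM sw (fc_sa sh cwJ) -/D -cwD.
  apply: le_trans (FRe _) _; apply: (@limit_average_local _ _ _ _ _ sh ab n J).
  + by cont.
  + move=> t; have a1 := clamp_ge0 (`|t| * c0^-1); have a2 := clamp_le1 (`|t| * c0^-1).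
    have b1 := clamp_ge0 (3 - `|ramp n t - J%:R|); have b2 := clamp_le1 (3 - `|ramp n t - J%:R|).
    rewrite -/(w0 t) in a1 a2; rewrite -/(tent _) -/(window n J t) in b1 b2.
    by rewrite !mulr_ge0 //= !mulr_ile1 // mulr_ge0.
  + by move=> t ht; rewrite /window /tent clamp0 ?mulr0 ?mul0r // -/(ramp n t) subr_le0.
have -> : qf G w = \sum_(J < (2 ^ n).+1) qf G (w * e J).
  have E J : qf G (w * e J) = complex.Re (G (w * w * (e J * e J))).
    have we : e J * w = w * e J.
      by rewrite /w /e -!fcM //; congr fc; apply/funext => t; rewrite mulrC.
    by rewrite /qf stM sw (fc_sa sh (ce J)) we; congr (complex.Re (G _)); rewrite -!mulrA (mulrA (e J)) we !mulrA.
  under eq_bigr do rewrite E.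
  by rewrite -raddf_sum -linear_sum -mulr_sumr e1 mulr1 /qf sw.
apply: le_trans (ler_sum _ (fun (J : 'I__) _ => bound J)) _.
by rewrite -mulr_suml ler_piMl // mulr_ge0 // exprn_ge0 // invr_ge0.
Qed.

End NoInterval.

(** * Transfer to the unitization *)

Section Embedding.
Context (R : realType) (A : cstarAlgType R).
Local Notation U := (unitz A).
Implicit Types (x y : A) (u v w : U) (B D : set A).

Lemma closureP B x : closure B x <->
  forall e : R, 0 < e -> exists2 y, B y & na (x - y) < e.
Proof.
split=> [cx e e0|h V /nbhs_ballP[e /= e0 eV]].
  have e0' : 0 < e%:C by rewrite ltcR.
  have [y [By]] := cx _ (nbhsx_ballx x _ e0').
  by rewrite -ball_normE /= naE ltcR => xy; exists y.
have [eE e0'] : e = (complex.Re e)%:C /\ 0 < complex.Re e.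
  by move: e0; case: (e) => r s; rewrite ltcE /= => /andP[/eqP -> ->].
have [y By xy] := h _ e0'; exists y; split=> //; apply: eV.
by rewrite -ball_normE /= naE eE ltcR.
Qed.

Lemma closedP B : closed B <->
  forall x, (forall e : R, 0 < e -> exists2 y, B y & na (x - y) < e) -> B x.
Proof.
split=> [cB x /closureP|h]; first by rewrite -(closure_id B).1.
by apply/closure_id/seteqP; split=> [|x /closureP/h //]; exact: subset_closure.
Qed.

Definition lift B : set U := [set u | u.2 = 0 /\ B u.1].

Lemma lift_emb B x : B x -> lift B (emb x). Proof. by []. Qed.

Lemma liftE B u : lift B u -> u = emb u.1.
Proof. by case: u => x a [/= ->]. Qed.

Lemma lift_cst B : cstar_subalgebra B -> cstsub (lift B).
Proof.
case=> /closedP cB B0 BL BM Bst; split; last first.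
  by move=> u Lu; rewrite (liftE Lu); case: Lu => _ Bu; rewrite -emb_star; apply/lift_emb/Bst.
split=> //.
- move=> u uB.
  have u2 : u.2 = 0.
    apply: normc_eps => e e0; have [v [v2 _] uv] := uB e e0.
    have := unm_normc (u - v); rewrite /= v2 subr0 => /le_trans; apply; exact: ltW.
  split=> //; apply: cB => e e0; have [v Bv uv] := uB e e0.
  exists v.1; first by case: Bv.
  by rewrite -nm_emb embB -(liftE Bv) -(@liftE setT u).
- move=> a u v Lu Lv; rewrite (liftE Lu) (liftE Lv); case: Lu Lv => _ Bx [_ By].
  by rewrite -embZ -embD; apply/lift_emb/BL.
- move=> u v Lu Lv; rewrite (liftE Lu) (liftE Lv); case: Lu Lv => _ Bx [_ By].
  by rewrite -embM; apply/lift_emb/BM.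
Qed.

Lemma unlift_cst (D : set U) : cstsub D -> cstar_subalgebra (emb (A := A) @^-1` D).
Proof.
move=> cD; split.
- apply/closedP => x h; apply: (csub_clo cD.1) => e e0.
  by have [y Dy xy] := h e e0; exists (emb y); rewrite // -embB nm_emb.
- by rewrite /= emb0; exact: csub0 cD.1.
- by move=> a x y Dx Dy /=; rewrite embD embZ; apply/(csubD cD.1)/Dy/(csubZ cD.1).
- by move=> x y Dx Dy /=; rewrite embM; exact: csubM cD.1 _ _ Dx Dy.
- by move=> x Dx /=; rewrite emb_star; exact: cD.2.
Qed.

Local Notation K := (lift setT).

Lemma cst_setT : cstar_subalgebra [set: A].
Proof. by split=> //; exact: closedT. Qed.

Lemma liftT_cst : cstsub K.
Proof. exact/lift_cst/cst_setT. Qed.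

Lemma liftT_idl : idl setT K.
Proof.
split=> //.
- by move=> a [x1 x2] [y1 y2] [/= -> _] [/= -> _]; split=> //=; rewrite addr0; exact: mulr0.
- by move=> [x1 x2] b [/= -> _] _; split; split; rewrite //= ?mulr0 ?mul0r.
- exact: liftT_cst.2.
Qed.

Lemma liftT_ext (g : U -> R[i]) : lin_on K g ->
  exists G : {scalar U}, forall u, K u -> G u = g u.
Proof.
move=> lg; have [|G Gg] := @scalar_exists _ _ (fun u => g (emb u.1)).
  by move=> a x y; rewrite /= embD embZ; apply: lg.
by exists G => x /[dup] /liftE xE Kx; rewrite Gg -xE.
Qed.

Lemma unitzE u : u = emb u.1 + u.2%:A.
Proof.
case: u => x a; congr (_, _) => /=; first by rewrite scaler0 addr0.
by rewrite add0r; apply/esym/mulr1.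
Qed.

Lemma sa_emb x : sa (emb x) <-> star x = x.
Proof. by rewrite /sa -emb_star; split=> [/emb_inj|->]. Qed.

Lemma sa_unitz u : sa u -> exists l : R, sa (emb u.1) /\ u = emb u.1 + sc U l.
Proof.
move=> su; exists (complex.Re u.2); split.
  by apply/sa_emb; have := congr1 fst su.
rewrite {1}(unitzE u) /sc; congr (_ + _%:A).
have := congr1 snd su; case: u {su} => x [a b] /= [] /eqP.
by rewrite -subr_eq0 -opprD oppr_eq0 -mulr2n mulrn_eq0 /= => /eqP ->.
Qed.

(* Functions of an element of [A] stay in [A] only if they vanish at 0. *)
Lemma scat_off_zero :
  (forall h, K h -> sa h -> forall al be : R, al < be -> 0 < al * be ->
    exists2 t, al <= t <= be & ~ spec h t) -> scat U.
Proof.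
move=> H u /sa_unitz[l [sx uE]] a b ab.
(* Middle third of the positive part of ]a - l, b - l[ if there is one, of the whole interval
   otherwise; both avoid 0. *)
have [al [be [abe ab0 lo hi]]] : exists al be : R, [/\ al < be, 0 < al * be, a < al + l & be + l < b].
  have [b0|b0] := ltP 0 (b - l).
    pose m := Num.max 0 (a - l).
    have m0 : 0 <= m by rewrite le_max lexx.
    have ma : a - l <= m by rewrite le_max lexx orbT.
    have mb : m < b - l by rewrite gt_max b0; lra.
    exists ((2 * m + (b - l)) / 3), ((m + 2 * (b - l)) / 3); split; try lra.
    by rewrite mulr_gt0 //; lra.
  exists ((2 * (a - l) + (b - l)) / 3), (((a - l) + 2 * (b - l)) / 3); split; try lra.
  by rewrite nmulr_rgt0; lra.
have [t /andP[t1 t2] nt] := H _ (lift_emb (B := setT) I) sx _ _ abe ab0.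
exists (t + l); first by apply/andP; split; lra.
by rewrite /spec /= uE scD (addrC (sc U t)) opprD addrA addrK.
Qed.

End Embedding.

Section Functionals.
Context (R : realType) (A : cstarAlgType R).
Local Notation U := (unitz A).
Local Notation K := (lift [set: A]).
Implicit Types (x y : A) (f g : {scalar A}) (F G : {scalar U}).

Definition extends f F := forall x, F (emb x) = f x.

Lemma extension_exists f : exists F, extends f F.
Proof.
have [|F FE] := @scalar_exists _ U (fun u => f u.1); last by exists F => x; rewrite FE.
by move=> a u v; rewrite linearP.
Qed.

Lemma restriction_exists F : exists f, extends f F.
Proof.
have lF (a : R[i]) x y : F (emb (a *: x + y)) = a * F (emb x) + F (emb y).
  by rewrite embD embZ linearP.
pose m := GRing.isLinear.Build R[i] A R[i] *%R (fun x => F (emb x)) lF.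
pose f : {scalar A} := HB.pack (fun x => F (emb x)) m.
by exists f.
Qed.

Lemma extends_cstar f F x : extends f F -> F (st (emb x) * emb x) = f (cmul (star x) x).
Proof. by move=> fF; rewrite -emb_star -embM fF. Qed.

Lemma extends_pos f F : extends f F -> positive_functional f <-> pos_on K F.
Proof.
move=> fF; split=> [pf u Ku|pF x]; last by rewrite -(extends_cstar _ fF) pF.
by rewrite (liftE Ku) (extends_cstar _ fF).
Qed.

Lemma extends_fle f g F G : extends f F -> extends g G ->
  positive_functional f -> positive_functional g -> functional_le g f <-> fle K G F.
Proof.
move=> fF gG pf pg; have [pF _] := extends_pos fF; have [pG _] := extends_pos gG.
split=> [gf u Ku|GF x].
  rewrite -lecR -(qfE (pG pg) Ku) -(qfE (pF pf) Ku) (liftE Ku).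
  by rewrite (extends_cstar _ fF) (extends_cstar _ gG).
rewrite -(extends_cstar _ fF) -(extends_cstar _ gG).
have Kx : K (emb x) by [].
by rewrite (qfE (pG pg) Kx) (qfE (pF pf) Kx) lecR GF.
Qed.

Lemma extends_pure f F : extends f F -> pure_functional f <-> pure_on K F.
Proof.
move=> fF; have [pfF pFf] := extends_pos fF; split.
  case=> pf [x fx] max; split; first exact: pfF.
    by exists (emb x); rewrite ?fF.
  move=> G pG GF; have [g gG] := restriction_exists G.
  have pg : positive_functional g by apply/(extends_pos gG).
  have [||t [t01 gE]] := max g; rewrite ?(extends_fle fF gG) //.
  by exists t => // u Ku; rewrite (liftE Ku) fF gG.
case=> pF [u Ku Fu] max; have pf := pFf pF; split=> //.
  by exists u.1; rewrite -fF -(liftE Ku).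
move=> g pg gf; have [G gG] := extension_exists g.
have [||t t01 GE] := max G; first exact/(extends_pos gG).
  exact/(extends_fle fF gG).
by exists t; split=> // x; rewrite -fF -gG GE.
Qed.

Lemma clim_cvg (u : nat -> R[i]) (l : R[i]) :
  clim u l <-> (u : nat -> R[i]^o) @ \oo --> (l : R[i]^o).
Proof.
split=> [ul|/cvgrPdist_lt ul e e0].
  apply/cvgrPdist_lt => e e0.
  have [eE e0'] : e = (complex.Re e)%:C /\ 0 < complex.Re e.
    by move: e0; case: (e) => r s; rewrite ltcE /= => /andP[/eqP -> ->].
  have [N Nu] := ul _ e0'; exists N => // n /= Nn.
  by rewrite distrC eE -[`|_|]/((normc (u n - l))%:C) ltcR; exact: Nu.
have e0C : 0 < e%:C by rewrite ltcR.
have [N _ Nu] := ul _ e0C; exists N => n Nn.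
by have := Nu n Nn; rewrite /= distrC -[`|_|]/((normc (u n - l))%:C) ltcR.
Qed.

(** Partial sums that contain the term n exceed it by a sum of positive terms, and the inequality
    passes to the limit. *)
Lemma pure_term_le f (D : set nat) (g : nat -> {scalar A}) n : D n ->
  (forall n, D n -> positive_functional (g n)) ->
  (forall x, (fun N : nat => \sum_(0 <= n < N | n \in D) g n x : R[i]^o) @ \oo
    --> (f x : R[i]^o)) -> functional_le (g n) f.
Proof.
move=> Dn pg fE x; set z := cmul (star x) x.
rewrite -subr_ge0.
have /clim_cvg/(clim_shift n.+1) h := fE z.
have := clim_sub h (clim_cst (g n z)).
apply: clim_ge0 => m.
rewrite subr_ge0 big_mkcond (bigD1_seq n) ?iota_uniq ?mem_index_iota ?leq_addl //=.
rewrite mem_set // lerDl; apply: sumr_ge0 => k _.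
by case: ifP => //; rewrite inE => Dk; exact: pg.
Qed.

Theorem scattered_scat : scattered A -> scat U.
Proof.
move=> sA; apply: scat_off_zero => h Kh sh al be ab ab0.
apply: (no_spectral_interval (@liftT_cst _ A) (@liftT_idl _ A) (@liftT_ext _ A)) => //.
move=> F pF [u Ku Fu]; have [f fF] := restriction_exists F.
have pf : positive_functional f by apply/(extends_pos fF).
have [D [g [pg fE]]] := sA f pf.
have pg0 n : D n -> positive_functional (g n) by case/pg.
have [n Dn] : exists n, D n.
  apply: contrapT => nD; case/negP: Fu; apply/eqP.
  rewrite (liftE Ku) fF; apply: clim_uniq (clim_cst 0).
  have /clim_cvg := fE u.1; congr clim; apply/funext => N.
  by rewrite big1 // => k; rewrite inE => Dk; case: nD; exists k.
have [G gG] := extension_exists (g n); exists G; first exact/(extends_pure gG)/pg.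
by apply/(extends_fle fF gG) => //; [exact: pg0|exact: pure_term_le Dn pg0 fE].
Qed.

Theorem scat_scattered : scat U -> scattered A.
Proof.
move=> sU f pf; have [F fF] := extension_exists f.
have [D [G [pG FE]]] := pure_sum (@liftT_cst _ A) (@liftT_ext _ A) sU ((extends_pos fF).1 pf).
have /choice[g gG] n : exists g, extends g (G n) by exact: restriction_exists.
exists D, g; split=> [n Dn|x]; first exact/(extends_pure (gG n))/pG.
rewrite -fF; apply/clim_cvg; have := FE (emb x) (lift_emb (B := setT) I).
by congr clim; apply/funext => N; apply: eq_bigr => n _; rewrite gG.
Qed.

End Functionals.

Section ApproximatelyFinite.
Context (R : realType) (A : cstarAlgType R).
Local Notation U := (unitz A).
Implicit Types (x y : A) (B D : set A).

Lemma emb_sum I (r : seq I) (P : pred I) (F : I -> A) :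
  emb (\sum_(i <- r | P i) F i) = \sum_(i <- r | P i) emb (F i).
Proof. by apply: (big_morph (@emb R A)); [exact: embD|exact: emb0]. Qed.

Theorem scat_approximately_finite B : scat U -> cstar_subalgebra B -> approximately_finite B.
Proof.
move=> sU cB n x e Bx e0.
have [|D [cD DB [l [lD Dl]] [y yP]]] :=
  scat_af (lift_cst cB) sU (x := fun k => emb (x k)) (e := e) _ e0.
  by move=> k; exact: lift_emb.
exists (emb (A := A) @^-1` D); split; first exact: unlift_cst.
- by move=> z /DB [].
- exists (size l), (fun i => (l`_i).1); split=> [i|z Dz].
    have Dli : D l`_i by apply: lD; exact: mem_nth.
    by rewrite /= -(liftE (DB _ Dli)).
  have [c cE] := Dl _ Dz; exists (fun i => c i); apply: emb_inj.
  rewrite emb_sum cE; apply: eq_bigr => i _; rewrite embZ.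
  by congr (_ *: _); apply/(@liftE _ _ B)/DB/lD/mem_nth.
- exists (fun k => (y k).1) => k; have [Dy xy] := yP k.
  rewrite /= -(liftE (DB _ Dy)); split=> //.
  by rewrite naE ltcR -nm_emb embB -(liftE (DB _ Dy)).
Qed.

End ApproximatelyFinite.

(** * Inverses in the unitization of a subalgebra and real rank zero *)

Section RealRankZero.
Context (R : realType).

(** On the spectrum 1/(t - s) = t / (s (t - s)) - 1/s, and the first summand vanishes at 0, so the
    inverse is a scalar plus an element of any closed subalgebra containing h. In [den] the square
    (t - s)^2 is cut off at d^2, which keeps the function continuous and changes nothing on the
    spectrum. *)
Lemma resolvent_csub (U : ucstarType R) (h : U) (s : R) : sa h -> s != 0 -> ~ spec h s ->
  exists c, [/\ (forall K, csub K -> K h -> K c),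
    (h - sc U s) * (c - sc U s^-1) = 1 & (c - sc U s^-1) * (h - sc U s) = 1].
Proof.
move=> sh s0 /spec_open[d d0 dP].
pose den (t : R) := Num.max ((t - s) * (t - s)) (d * d).
have den0 t : den t != 0 by rewrite gt_eqF // lt_max orbC mulr_gt0.
have cden : continuous den by rewrite /den; cont.
have cdenV : continuous (fun t => (den t)^-1) by exact: contV.
pose f (t : R) := s^-1 * (t * ((t - s) * (den t)^-1)).
have cf : continuous f by rewrite /f; cont.
have f0 : f 0 = 0 by rewrite /f mul0r mulr0.
have hc : h * fc h f = fc h f * h by rewrite -fc_comm.
have e : (h - sc U s) * (fc h f - sc U s^-1) = 1.
  have c1 : continuous (fun t : R => t - s) by cont.
  have c2 : continuous (fun t : R => f t - s^-1) by cont.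
  rewrite -{1}(fc_id sh) -!(fc_cst _ sh) -!fcB //; try by cont.
  rewrite -fcM // (fc_ext (g := fun=> 1)) ?fc_cst ?sc1 //; try by cont.
  move=> t ht; have td : d <= `|t - s| by rewrite leNgt; apply/negP => /dP.
  have ts : t - s != 0 by rewrite -normr_gt0; apply: lt_le_trans td.
  have denE : den t = (t - s) * (t - s).
    by apply/max_idPl; rewrite -!expr2 -(real_normK (num_real (t - s))) ler_pXn2r ?nnegrE // ltW.
  by rewrite /f denE; clear -ts s0; field; rewrite s0 ts.
exists (fc h f); split=> //; first by move=> K cK Kh; exact: fc_csub.
rewrite -[RHS]e; apply/esym/commrB; last exact: scC.
by apply/commr_sym/commrB; [exact/esym|exact: scC].
Qed.

Context (A : cstarAlgType R).
Local Notation U := (unitz A).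
Implicit Types (x y : A) (B D : set A).

Theorem scat_real_rank_zero B : scat U -> cstar_subalgebra B -> real_rank_zero B.
Proof.
move=> sU cB u e Bu uu e0.
have [l [sb uE]] : exists l : R, sa (emb u.1) /\ u = emb u.1 + sc U l by exact: sa_unitz.
(* The shift l is replaced by - s for a point s of a gap near - l. It must differ from 0, as 1/s
   occurs in the inverse; hence the search on the side where no sign change can occur. *)
have [s [s0 sl hs]] : exists s, [/\ s != 0, `|l + s| < e & ~ spec (emb u.1) s].
  have [l0|l0] := ltP 0 l.
    have [|t /andP[t1 t2] nt] := sU _ sb (- l) (Num.min 0 (e - l)).
      by rewrite lt_min oppr_lt0 l0; lra.
    move: t2; rewrite lt_min => /andP[t2 t3].
    by exists t; rewrite lt_eqF // ltr_norml; split=> //; apply/andP; split; lra.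
  have [|t /andP[t1 t2] nt] := sU _ sb (- l) (e - l); first by lra.
  by exists t; rewrite gt_eqF ?ltr_norml; try (split=> //; apply/andP; split); lra.
have [c [cK c1 c2]] := resolvent_csub sb s0 hs.
have Bc : lift B c by apply: cK; [exact: (lift_cst cB).1|exact: lift_emb].
exists (u.1, (- s)%:C); split=> //.
- by rewrite /unitization_selfadjoint /unitization_star conjc_realE (sa_emb _).1.
- exists (c.1, (- s^-1)%:C).
  have e1 : (u.1, (- s)%:C) = emb u.1 - sc U s.
    by rewrite -scN [LHS]unitzE.
  have e2 : (c.1, (- s^-1)%:C) = c - sc U s^-1.
    by rewrite -scN [LHS]unitzE (liftE Bc).
  by split=> //; [case: Bc|rewrite e1 e2; exact: c1|rewrite e1 e2; exact: c2].
- have -> : unitization_sub u (u.1, (- s)%:C) = (0, (l + s)%:C).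
    have u2 : u.2 = l%:C by have := congr1 snd uE; rewrite /= add0r => ->; exact: mulr1.
    by rewrite /unitization_sub /= subrr u2 rmorphN opprK rmorphD.
  rewrite /unitization_norm gt_max; apply/andP; split.
    by rewrite -[complex.Re _]/(normc (l + s)%:C) normc_real.
  apply: le_lt_trans sl; apply: ge_sup.
    by exists (na (cmul 0 0 + (l + s)%:C *: (0 : A))), 0; split; rewrite ?normr0 ?ler01; case: cB.
  move=> _ [x [_ x1] <-]; rewrite cmul0l add0r -/(na _) naZ normc_real ler_piMr //.
  by move: x1; rewrite naE lecR.
Qed.

End RealRankZero.

(** * Singly generated subalgebras *)

Section Generated.
Context (R : realType) (U : ucstarType R).
Variable h : U.
Hypothesis sh : sa h.
Implicit Types (x y z : U) (p q : {poly R}).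

(** Complex polynomials in h without constant term, encoded by real and imaginary parts because [ev]
    takes real polynomials. *)
Definition gen (pq : {poly R} * {poly R}) : U := ev h ('X * pq.1) + 'i *: ev h ('X * pq.2).

Definition cgen := cl (range gen).

Lemma genZ (a b : R) (pq : {poly R} * {poly R}) :
  (a +i* b) *: gen pq = gen (a%:P * pq.1 - b%:P * pq.2, b%:P * pq.1 + a%:P * pq.2).
Proof.
have E (c : R) p : ev h ('X * (c%:P * p)) = c%:C *: ev h ('X * p).
  by rewrite mulrCA (evM _ c%:P) evC scE.
rewrite /gen /= mulrBr mulrDr evB evD !E.
have -> : (a +i* b) = a%:C + 'i * b%:C by rewrite [LHS]complexE.
rewrite scalerDr !scalerDl !scalerDr !scalerA.
have -> : 'i * b%:C * 'i = - b%:C :> R[i] 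
  by apply/eqP; rewrite eq_complex /=; apply/andP; split; apply/eqP; ring.
by rewrite scaleNr (mulrC a%:C) !addrA [LHS](ACl (1*4*2*3)).
Qed.

Lemma genD pq pq' : gen pq + gen pq' = gen (pq.1 + pq'.1, pq.2 + pq'.2).
Proof. by rewrite /gen /= !mulrDr !evD scalerDr addrACA. Qed.

Lemma gen_mulX p pq : ev h ('X * p) * gen pq = gen ('X * p * pq.1, 'X * p * pq.2).
Proof. by rewrite /gen /= mulrDr -scalerAr -!evM !(mulrCA ('X * p)). Qed.

Lemma genM pq pq' : exists rs, gen pq * gen pq' = gen rs.
Proof.
rewrite {1}/gen mulrDl -scalerAl !gen_mulX.
have := genZ 0 1; rewrite -[0 +i* 1]/('i : R[i]) => ->.
by rewrite genD; eexists.
Qed.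

Lemma gen_st pq : st (gen pq) = gen (pq.1, - pq.2).
Proof.
rewrite /gen stD stZ !ev_sa //= mulrN.
rewrite [X in X *: _](_ : _ = - 'i); last by apply/eqP; rewrite eq_complex /= oppr0 !eqxx.
by rewrite /ev !rmorphN /= scaleNr scalerN.
Qed.

Lemma rpart_gen pq : rpart (gen pq) = ev h ('X * pq.1).
Proof.
by rewrite /rpart gen_st genD /gen /= subrr mulr0 -polyC0 evC sc0 scaler0 addr0 mulrDr evD
  scalerDr -scalerDl complex_half scale1r.
Qed.

Lemma gen_comm pq z : h * z = z * h -> gen pq * z = z * gen pq.
Proof. by move=> hz; rewrite /gen mulrDl mulrDr -scalerAl -scalerAr !(ev_comm _ hz). Qed.

Lemma cl_min (I K : set U) : clo K -> I `<=` K -> cl I `<=` K.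
Proof. by move=> cK IK x Ix; apply: cK => e /Ix[y Iy xy]; exists y; [exact: IK|]. Qed.

Lemma cgen_comm x y : cgen x -> cgen y -> x * y = y * x.
Proof.
have hx z : cgen z -> h * z = z * h.
  move=> gz; apply/esym; apply: (cl_min (csub_clo (csub_comm h))) gz => _ [pq _ <-].
  by rewrite /= gen_comm.
move=> gx gy; apply: (cl_min (csub_clo (csub_comm y))) gx => _ [pq _ <-].
by rewrite /= gen_comm // hx.
Qed.

Lemma cgen_id : cgen h.
Proof.
apply: sub_cl; exists (1, 0) => //.
by rewrite /gen /= mulr1 mulr0 evX -polyC0 evC sc0 scaler0 addr0.
Qed.

Lemma cgen_cst : cstsub cgen.
Proof.
have gM x y : range gen x -> range gen y -> range gen (x * y).
  by move=> [pq _ <-] [pq' _ <-]; have [rs ->] := genM pq pq'; exists rs.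
have lM x y : range gen y -> cgen x -> cgen (x * y).
  move=> gy; apply: (@cl_lip _ _ (fun x => x * y) (nm y)) => [u v|u|u gu]; first by nring.
    by rewrite mulrC; exact: nmM.
  exact: gM.
split; last first.
  move=> x; apply: (@cl_lip _ _ st 1) => [u v|u|_ [pq _ <-]]; first by rewrite stB.
    by rewrite nm_st mul1r.
  by rewrite gen_st; exists (pq.1, - pq.2).
split; first exact: cl_clo.
- apply: sub_cl; exists (0, 0) => //.
  by rewrite /gen /= mulr0 -polyC0 evC sc0 scaler0 addr0.
- move=> a x y gx gy e e0.
  have gax : cgen (a *: x).
    move: gx; apply: (@cl_lip _ _ (fun x => a *: x) (normc a)) => [u v|u|_ [pq _ <-]].
    + by rewrite scalerBr.
    + by rewrite nmZ.
    + by case: a => a b; rewrite genZ; eexists.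
  have e2 : 0 < e / 2 by rewrite divr_gt0.
  have [_ [pq _ <-] xu] := gax _ e2; have [_ [pq' _ <-] yv] := gy _ e2.
  exists (gen pq + gen pq'); first by rewrite genD; eexists.
  have -> : a *: x + y - (gen pq + gen pq') = (a *: x - gen pq) + (y - gen pq').
    by rewrite opprD addrACA.
  by apply: le_lt_trans (nmD _ _) _; lra.
- move=> x y gx gy; apply: cl_clo => e e0.
  have n0 : 0 < nm x + 1 by have := nm_ge0 x; lra.
  have [z gz yz] := gy _ (divr_gt0 e0 n0).
  exists (x * z); first exact: lM.
  rewrite -mulrBr; apply: le_lt_trans (nmM _ _) _.
  move: yz; rewrite ltr_pdivlMr // mulrC; apply: le_lt_trans.
  by rewrite ler_wpM2r ?nm_ge0 // lerDl.
Qed.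

Lemma ev_rat p (e : R) : 0 < e ->
  exists r : {poly rat}, nm (ev h p - ev h (map_poly ratr r)) < e.
Proof.
elim/poly_ind: p e => [|p c IHp] e e0; first by exists 0; rewrite rmorph0 subrr nm0.
have n0 : 0 < 2 * (nm h + 1) by have := nm_ge0 h; lra.
have [r pr] := IHp _ (divr_gt0 e0 n0).
have [c' /andP[c1 c2]] : exists c' : rat, c - e / 2 < ratr c' < c + e / 2.
  have [|c'] := rat_in_itvoo (x := c - e / 2) (y := c + e / 2); first by lra.
  by rewrite in_itv => h'; exists c'.
exists (r * 'X + c'%:P); rewrite rmorphD rmorphM /= map_polyX map_polyC /= !evD !evM evX !evC.
have -> : ev h p * h + sc U c - (ev h (map_poly ratr r) * h + sc U (ratr c')) =
  (ev h p - ev h (map_poly ratr r)) * h + sc U (c - ratr c') by rewrite scB; nring.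
apply: le_lt_trans (nmD _ _) _; rewrite nm_sc.
have h1 : `|c - ratr c'| < e / 2 by rewrite ltr_norml; apply/andP; split; lra.
suff : nm ((ev h p - ev h (map_poly ratr r)) * h) <= e / 2 by lra.
apply: le_trans (nmM _ _) _; move: pr; rewrite ltr_pdivlMr //.
have := nm_ge0 (ev h p - ev h (map_poly ratr r)); have := nm_ge0 h.
move: (nm (_ - _)) (nm h) => a b; nra.
Qed.

Definition rat_gen (rs : {poly rat} * {poly rat}) : U :=
  gen (map_poly ratr rs.1, map_poly ratr rs.2).

Lemma rat_gen_dense x (e : R) : cgen x -> 0 < e -> exists rs, nm (x - rat_gen rs) < e.
Proof.
move=> gx e0; have e2 : 0 < e / 2 by rewrite divr_gt0.
have [_ [pq _ <-] xp] := gx _ e2.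
have n0 : 0 < 4 * (nm h + 1) by have := nm_ge0 h; lra.
have [r pr] := ev_rat pq.1 (divr_gt0 e0 n0).
have [s ps] := ev_rat pq.2 (divr_gt0 e0 n0).
have B (p q : {poly R}) : nm (ev h p - ev h q) < e / (4 * (nm h + 1)) ->
    nm (ev h ('X * p) - ev h ('X * q)) <= e / 4.
  rewrite !evM -mulrBr evX ltr_pdivlMr // => l; apply: le_trans (nmM _ _) _; move: l.
  have := nm_ge0 h; have := nm_ge0 (ev h p - ev h q).
  move: (nm (_ - _)) (nm h) => a b; nra.
exists (r, s); have := nm_tri (gen pq) x (rat_gen (r, s)).
suff : nm (gen pq - rat_gen (r, s)) <= e / 2 by lra.
rewrite /rat_gen /gen /= opprD addrACA -scalerBr.
apply: le_trans (nmD _ _) _; rewrite nmZ normc_i mul1r.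
by have := B _ _ pr; have := B _ _ ps; lra.
Qed.

End Generated.

(** * Spectral intervals obstruct approximation *)

Section Obstruction.
Context (R : realType) (U : ucstarType R).
Implicit Types (x y z h : U) (p q : {poly R}).

Lemma rpartB x y : rpart (x - y) = rpart x - rpart y.
Proof. by rewrite /rpart stB -scalerBr opprD addrACA. Qed.

Lemma rpart_id x : sa x -> rpart x = x.
Proof. by move=> sx; rewrite /rpart sx scalerDr -scalerDl complex_half scale1r. Qed.

Lemma invt_open x : invt x -> exists2 d : R, 0 < d & forall y, nm (y - x) < d -> invt y.
Proof.
move=> [v [v1 v2]]; have n0 : 0 < nm v + 1 by have := nm_ge0 v; lra.
exists (nm v + 1)^-1; first by rewrite invr_gt0.
move=> y yx; have -> : y = x * (1 - v * (x - y)).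
  by rewrite mulrBr mulr1 mulrA v1 mul1r subKr.
apply: invt_mul; first by exists v.
apply: neumann; apply: le_lt_trans (nmM _ _) _; move: yx; rewrite nmBC => yx.
have := nm_ge0 v; have := nm_ge0 (x - y) => a0 v0.
apply: (@le_lt_trans _ _ (nm (x - y) * (nm v + 1))); first by nra.
by rewrite -ltr_pdivlMr // mul1r.
Qed.

Lemma spec_root h q t : root q t -> spec h t -> ~ invt (ev h q).
Proof.
move=> /factor_theorem[r ->] ht iq; apply: ht.
have hr : ev h r * (h - sc U t) = (h - sc U t) * ev h r.
  by apply: ev_comm; rewrite mulrBl mulrBr scC.
by apply: (invt_mulC (y := ev h r)) => //; rewrite -hr; move: iq; rewrite evM evB evX evC.
Qed.

(** Approximate b by a real polynomial p(h). At al and be, p + l is close to t - t0 and so has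
    opposite signs; its root in between is a spectral point of h, and p(h) + l is not invertible,
    although it is close to the invertible b + l. Closeness of b + l to h - t0 is tested only on the
    algebra generated by h, as in the norm of its unitization; a bump equal to 1 at al and be is the
    test element. *)
Lemma interval_obstruction h (al be t0 l e : R) b : sa h -> al < t0 -> t0 < be ->
  0 < al * be -> (forall t, al <= t <= be -> spec h t) ->
  cgen h b -> sa b -> e < t0 - al -> e < be - t0 -> invt (b + sc U l) ->
  (forall x, cgen h x -> nm x <= 1 -> nm ((b - h + sc U (l + t0)) * x) <= e) -> False.
Proof.
move=> sh al0 be0 ab0 hab gb sb ea eb ib nb.
have [d d0 dP] := invt_open ib.
(* Close enough that p(h) + l inherits invertibility from b + l and that the signs at al and be are
   not lost. *)
pose del := Num.min d (Num.min (t0 - al - e) (be - t0 - e)).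
have del0 : 0 < del by rewrite !lt_min d0; lra.
have [_ [pq _ <-] bp] := gb _ del0; set p := 'X * pq.1.
have bp' : nm (b - ev h p) < del.
  have -> : b - ev h p = rpart (b - gen h pq).
    by rewrite rpartB rpart_gen // rpart_id.
  exact: le_lt_trans (nm_rpart _) bp.
have [bd ba bb] : [/\ nm (b - ev h p) < d, nm (b - ev h p) < t0 - al - e & nm (b - ev h p) < be - t0 - e].
  by move: bp'; rewrite !lt_min => /and3P[].
pose m := Num.min `|al| `|be|.
have [al1 be1] : al != 0 /\ be != 0.
  by split; apply/eqP => z; move: ab0; rewrite z ?mulr0 ?mul0r ltxx.
have m0 : 0 < m by rewrite lt_min !normr_gt0 al1.
pose w (t : R) := clamp (`|t| * m^-1).
have cw : continuous w by rewrite /w /clamp; cont.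
have w0 : w 0 = 0 by rewrite /w normr0 mul0r clamp0.
have wal : w al = 1 by apply: clamp1; rewrite ler_pdivlMr // mul1r ge_min lexx.
have wbe : w be = 1 by apply: clamp1; rewrite ler_pdivlMr // mul1r ge_min lexx orbT.
set x := fc h w.
have gx : cgen h x by apply: fc_csub (cgen_id h) w0 => //; exact: (cgen_cst sh).1.
have x1 : nm x <= 1.
  by apply: fc_norm => // t _; rewrite ger0_norm ?clamp_ge0 ?clamp_le1.
pose phi (t : R) := p.[t] + (l + t0 - t).
have cp : continuous (horner p) by move=> t; exact: continuous_horner.
have cphi : continuous phi.
  have c1 : continuous (fun t : R => l + t0 - t) by cont.
  by apply: contD.
have phE : fc h phi = ev h p - h + sc U (l + t0).
  have c1 : continuous (fun t : R => l + t0 - t) by cont.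
  have c2 : continuous (fun _ : R => l + t0) by cont.
  by rewrite /phi fcD // fc_poly // fcB ?fc_cst ?fc_id //; [rewrite addrA addrAC|exact: cont_id].
have phx : nm (fc h phi * x) <= e + nm (b - ev h p).
  have -> : fc h phi * x = (b - h + sc U (l + t0)) * x - (b - ev h p) * x.
    by rewrite phE; nring.
  apply: le_trans (nmB _ _) _; rewrite lerD ?nb //.
  by apply: le_trans (nmM _ _) _; rewrite ler_piMr ?nm_ge0.
have bnd t : spec h t -> w t = 1 -> `|phi t| <= e + nm (b - ev h p).
  move=> ht wt; apply: le_trans phx; rewrite -fcM //.
  have c3 : continuous (fun t => phi t * w t) by cont.
  by have := fc_ge sh c3 ht; rewrite wt mulr1.
have hal := bnd _ (hab al _) wal; have hbe := bnd _ (hab be _) wbe.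
have {}hal : `|phi al| <= e + nm (b - ev h p) by apply: hal; rewrite lexx; lra.
have {}hbe : `|phi be| <= e + nm (b - ev h p) by apply: hbe; rewrite lexx andbT; lra.
have [||t tab rt] := @poly_ivt _ (p + l%:P) al be; rewrite ?hornerD ?hornerC.
- by lra.
- move: hal hbe; rewrite /phi !ler_norml => /andP[_ h1] /andP[h2 _]; apply/andP; split; lra.
apply: (spec_root rt (hab t tab)); rewrite evD evC.
apply: dP; rewrite opprD addrACA subrr addr0 nmBC; exact: bd.
Qed.

End Obstruction.

Section FiniteSpectrum.
Context (R : realType) (U : ucstarType R).
Implicit Types (x y z h : U).

(** The powers of h with exponents 1 to n+1 lie in a space spanned by n elements, so a nonzero
    kernel vector of their coordinate matrix gives q. Only positive powers occur, as 1 need not be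
    in D. *)
Lemma fdim_annihilator (D : set U) h : csub D -> fdim D -> D h ->
  exists2 q : {poly R[i]}, q != 0 & horner_alg h q = 0.
Proof.
move=> cD [l [lD lP]] Dh; pose n := size l.
have Dp k : D (h ^+ k.+1).
  by elim: k => [|k IHk]; rewrite ?expr1 // exprS; apply: (csubM cD).
have /choice[c cP] (k : nat) : exists c : nat -> R[i], h ^+ k.+1 = \sum_(i < size l) c i *: l`_i.
  exact: lP.
pose C := \matrix_(k < n.+1, i < n) c k i.
have kC : kermx C != 0.
  rewrite -mxrank_eq0 mxrank_ker -lt0n subn_gt0 ltnS; exact: rank_leq_col.
have /sub_kermxP vC : (nz_row (kermx C) <= kermx C)%MS by exact: nz_row_sub.
have v0 : nz_row (kermx C) != 0 by rewrite nz_row_eq0.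
move: (nz_row _) v0 vC => v v0 vC.
exists (\sum_(k < n.+1) v 0 k *: 'X^(k.+1)).
  apply: contra v0 => /eqP q0; apply/eqP/rowP => k; rewrite mxE.
  have := congr1 (fun q : {poly R[i]} => q`_k.+1) q0; rewrite coef0 coef_sum => <-.
  rewrite (bigD1 k) //= coefZ coefXn eqxx mulr1 big1 ?addr0 // => j jk.
  by rewrite coefZ coefXn eqSS eq_sym (inj_eq val_inj) (negbTE jk) mulr0.
rewrite linear_sum /=.
transitivity (\sum_(k < n.+1) \sum_(i < n) (v 0 k * c k i) *: l`_i).
  apply: eq_bigr => k _; rewrite linearZ rmorphXn /= horner_algX cP mulr_algl scaler_sumr.
  by apply: eq_bigr => i _; rewrite scalerA.
rewrite exchange_big big1 //= => i _; rewrite -scaler_suml.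
have /rowP/(_ i) := vC; rewrite !mxE => E.
rewrite [X in X *: _](_ : _ = 0) ?scale0r // -[RHS]E.
by apply: eq_bigr => k _; rewrite !mxE.
Qed.

Lemma annihilator_spec h (q : {poly R[i]}) t : horner_alg h q = 0 -> spec h t -> root q t%:C.
Proof.
move=> qh ht; apply: contrapT => /negP nr; apply: ht.
have /factor_theorem[r rE] : root (q - (q.[t%:C])%:P) t%:C by rewrite /root !hornerE subrr.
have E : horner_alg h r * (h - sc U t) = - (q.[t%:C] *: 1).
  have := congr1 (horner_alg h) rE; rewrite !rmorphM !rmorphB /= horner_algX !horner_algC qh sub0r.
  by move=> <-.
have hr : (h - sc U t) * horner_alg h r = horner_alg h r * (h - sc U t).
  have hE : h - sc U t = horner_alg h ('X - (t%:C)%:P).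
    by rewrite rmorphB /= horner_algX horner_algC.
  by rewrite hE -!rmorphM mulrC.
apply: (invt_mulC hr); rewrite hr E -scalerN; apply: invt_scale; first exact: nr.
by exists (- 1); rewrite mulrNN mulr1.
Qed.

Lemma nonroot_between (q : {poly R[i]}) (a b : R) : q != 0 -> a < b ->
  exists2 t, a < t < b & ~~ root q t%:C.
Proof.
move=> q0 ab; pose n := size q.
pose t (k : nat) : R := a + (b - a) * (k.+1%:R / n.+2%:R).
have t_inj : injective t.
  move=> i j /addrI /mulfI; rewrite subr_eq0 gt_eqF // => /(_ isT) /mulIf.
  rewrite invr_eq0 pnatr_eq0 => /(_ isT) /eqP; rewrite eqr_nat eqSS => /eqP //.
have [/allP al|/allPn[k]] := boolP (all (fun k => root q (t k)%:C) (iota 0 n)).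
  have := @max_poly_roots _ q [seq (t k)%:C | k <- iota 0 n] q0.
  rewrite all_map size_map size_iota map_inj_uniq ?iota_uniq; last by move=> i j [] /t_inj.
  by rewrite ltnn => h; have : false by apply: h => //; apply/allP.
rewrite mem_iota add0n => /andP[_ kn] nr; exists (t k) => //.
have k0 : 0 < k.+1%:R / n.+2%:R :> R by rewrite divr_gt0.
have k1 : k.+1%:R / n.+2%:R < 1 :> R by rewrite ltr_pdivrMr // mul1r ltr_nat ltnS ltnW.
rewrite /t; move: (k.+1%:R / _) k0 k1 => r r0 r1; apply/andP; split; nra.
Qed.

End FiniteSpectrum.

Section SingleGenerator.
Context (R : realType) (A : cstarAlgType R).
Local Notation U := (unitz A).
Implicit Types (y z : A) (B D : set A).

Lemma emb_mul_act (u : U) z : u * emb z = emb (act u z).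
Proof. by congr (_, _); rewrite /= ?mulr0 // scale0r addr0. Qed.

Lemma na_act_le B (u : U) z : B z -> na z <= 1 -> na (act u z) <= unitization_norm B u.
Proof.
move=> Bz z1; rewrite le_max; apply/orP; right; apply: ub_le_sup.
  exists (na u.1 + normc u.2) => _ [y [_ y1] <-]; move: y1; rewrite naE lecR => y1.
  apply: le_trans (naD _ _) _; rewrite naZ lerD //.
    by apply: le_trans (naM _ _) _; rewrite ler_piMr ?na_ge0.
  by rewrite ler_piMr ?normc_ge0.
by exists z => //; split; rewrite // naE lecR.
Qed.

Lemma lift_fdim D : finite_dimensional D -> fdim (lift D).
Proof.
move=> [m [v [vD Dv]]]; exists (codom (fun i => emb (v i))); split.
  by move=> _ /codomP[i ->]; exact/lift_emb/vD.
move=> u Lu; have [c uE] := Dv _ Lu.2; rewrite (liftE Lu) uE emb_sum.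
by apply: inspan_sum => i _; rewrite embZ; apply/inspanZ/inspan_mem/codom_f.
Qed.

Variable x : A.
Hypothesis sx : star x = x.

Let h := emb x.
Let sh : sa h. Proof. exact/sa_emb. Qed.

Definition generated := emb (A := A) @^-1` cgen h.

Lemma cgen_lift u : cgen h u -> lift setT u.
Proof.
have cT := (@liftT_cst R A).1.
apply: cl_min; first exact: csub_clo cT.
move=> _ [pq _ <-]; apply: (csubD cT); last apply: (csubZ cT);
  by apply: ev_csub => //; rewrite hornerM hornerX mul0r.
Qed.

Lemma generated_cst : cstar_subalgebra generated.
Proof. exact/unlift_cst/cgen_cst. Qed.

Lemma generated_abelian : abelian_subalgebra generated.
Proof. by move=> y z gy gz; apply: emb_inj; rewrite !embM; exact: cgen_comm gy gz. Qed.

Lemma generated_separable : separable_subalgebra generated.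
Proof.
have gr rs : cgen h (rat_gen h rs).
  by apply: sub_cl; exists (map_poly ratr rs.1, map_poly ratr rs.2).
have ratE rs : rat_gen h rs = emb (rat_gen h rs).1 := liftE (cgen_lift (gr rs)).
exists (range (fun rs => (rat_gen h rs).1)); split.
- by apply: card_le_trans (card_image_le _ _) _; exact: countableP.
- by move=> _ [rs _ <-]; rewrite /generated /= -ratE.
- move=> y gy; apply/closureP => e e0.
  have [rs ys] := rat_gen_dense gy e0; exists (rat_gen h rs).1; first by exists rs.
  by rewrite -nm_emb embB -ratE.
Qed.

(** The real part b of an approximant in a finite-dimensional subalgebra has its spectrum among the
    roots of a polynomial, so b - t0 is invertible for some t0 in the middle third of [al, be]. Its
    distance from the ends exceeds (be - al)/8, the accuracy of the approximation. *)
Lemma af_gap (al be : R) : approximately_finite generated -> al < be -> 0 < al * be ->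
  exists2 t, al <= t <= be & ~ spec h t.
Proof.
move=> af ab ab0; apply: contrapT => nt.
have hab t : al <= t <= be -> spec h t by move=> tab; apply: contrapT => ht; apply: nt; exists t.
have [||D [cD DB fD [y yP]]] := af 1%N (fun=> x) ((be - al) / 8).
- by move=> _; exact: cgen_id.
- by rewrite divr_gt0 // subr_gt0.
have [Dy xy] := yP ord0; pose b := rpart (emb (y ord0)).
have rp (K : set U) u : cstsub K -> K u -> K (rpart u).
  by move=> cK Ku; apply: (csubZ cK.1); apply: (csubD cK.1) => //; exact: cK.2.
have Db : lift D b by apply: rp; [exact: lift_cst|exact: lift_emb].
have gb : cgen h b by apply: (rp _ _ (cgen_cst sh)); exact: DB.
have [q q0 qb] := fdim_annihilator (lift_cst cD).1 (lift_fdim fD) Db.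
have [|t0 /andP[t1 t2] rt] := nonroot_between (a := (2 * al + be) / 3) (b := (al + 2 * be) / 3) q0.
  by lra.
have bh : nm (b - h) <= (be - al) / 8.
  rewrite -(rpart_id sh) -rpartB; apply: le_trans (nm_rpart _) _.
  by rewrite nmBC -embB nm_emb ltW // -ltcR -naE.
apply: (interval_obstruction (b := b) (l := - t0) (e := (be - al) / 8) (t0 := t0) sh _ _ ab0 hab gb);
  rewrite ?scN //; try lra.
- exact: rpart_sa.
- by apply: contrapT => /(annihilator_spec qb); exact/negP.
- move=> z _ z1; rewrite addNr sc0 addr0; apply: le_trans (nmM _ _) _.
  apply: le_trans bh; by rewrite ler_piMr ?nm_ge0.
Qed.

(** An invertible self-adjoint approximant of x - t0, with t0 the midpoint, is b + l with b in the
    generated algebra. The accuracy (be - al)/4 is less than the distance of t0 from the ends. *)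
Lemma rr0_gap (al be : R) : real_rank_zero generated -> al < be -> 0 < al * be ->
  exists2 t, al <= t <= be & ~ spec h t.
Proof.
move=> rr ab ab0; apply: contrapT => nt.
have hab t : al <= t <= be -> spec h t by move=> tab; apply: contrapT => ht; apply: nt; exists t.
pose t0 := (al + be) / 2; pose u : U := emb x + sc U (- t0).
have uE : u = (x, (- t0)%:C) by apply/esym/unitzE.
have [|||v [gv vv [w [_ w1 w2]] uv]] := rr u ((be - al) / 4).
- by rewrite uE; exact: cgen_id.
- by rewrite uE /unitization_selfadjoint /unitization_star /= sx oppr0.
- by rewrite divr_gt0 // subr_gt0.
have [l [sv vE]] : exists l : R, sa (emb v.1) /\ v = emb v.1 + sc U l by exact: sa_unitz.
apply: (interval_obstruction (b := emb v.1) (l := l) (e := (be - al) / 4) (t0 := t0) sh _ _ ab0 hab gv);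
  rewrite /t0 //; try lra.
- by rewrite -vE; exists w.
- move=> z gz z1; rewrite -/t0.
  have -> : emb v.1 - h + sc U (l + t0) = - ((u : U) - v).
    by rewrite [X in - (_ - X)]vE /u scN scD !opprB addrAC !addrA.
  rewrite mulNr nmN (liftE (cgen_lift gz)) emb_mul_act nm_emb.
  apply: le_trans (ltW uv); apply: na_act_le; first by rewrite /generated /= -(liftE (cgen_lift gz)).
  by rewrite -nm_emb -(liftE (cgen_lift gz)).
Qed.

End SingleGenerator.

Section GapImplication.
Context (R : realType) (A : cstarAlgType R).

Lemma abelian_gap_scat (P : set A -> Prop) :
  (forall x al be, star x = x -> P (generated x) -> al < be -> 0 < al * be ->
    exists2 t, al <= t <= be & ~ spec (emb x) t) ->
  (forall B, cstar_subalgebra B -> separable_subalgebra B -> abelian_subalgebra B -> P B) ->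
  scat (unitz A).
Proof.
move=> gap PB; apply: scat_off_zero => h Kh sh al be ab ab0.
have sx : star h.1 = h.1 by apply/sa_emb; rewrite -(liftE Kh).
rewrite (liftE Kh); apply: gap => //; apply: PB.
- exact: generated_cst.
- exact: generated_separable.
- exact: generated_abelian.
Qed.

End GapImplication.

Theorem theorem2p3 (R : realType) (A : cstarAlgType R) :
  [<-> scattered A;
       forall B : set A, cstar_subalgebra B -> approximately_finite B;
       forall B : set A, cstar_subalgebra B -> separable_subalgebra B ->
         abelian_subalgebra B -> approximately_finite B;
       forall B : set A, cstar_subalgebra B -> real_rank_zero B;
       forall B : set A, cstar_subalgebra B -> separable_subalgebra B ->
         abelian_subalgebra B -> real_rank_zero B].
Proof.
tfae.
- by move=> sA B; apply: scat_approximately_finite; exact: scattered_scat.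
- by move=> af B cB _ _; exact: af.
- move=> af B; apply: scat_real_rank_zero; apply: abelian_gap_scat af.
  by move=> x al be sx; exact: af_gap.
- by move=> rr B cB _ _; exact: rr.
- move=> rr; apply: scat_scattered; apply: abelian_gap_scat rr.
  by move=> x al be sx; exact: rr0_gap.
Qed.
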